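(* Let $E\to T^n$, $\gamma$, $c_i$, $U$, $D_{T^n}$, $\mathcal H=L^2(E)$, $L^2_1(E)$, $\mathcal H_a=L^2(E_a)$ and the Wilson Dirac operator $D_{W,a}$ be as in the context. Fix a constant $M>0$ and put $X=[-M,M]$, $A=\{-M,M\}$. For $m\in X$ let $\gamma D^m:=\gamma(D_{T^n}+m)$ and $\gamma D^m_{W,a}:=\gamma(D_{W,a}+m)$. Then there exist $a_1>0$ and, for every lattice spacing $a=1/N$ ($N\in\mathbf Z_{>0}$) with $0<a\le a_1$, a linear map $f_a:\mathcal H_a\to\mathcal H$ (with adjoint $f_a^*:\mathcal H\to\mathcal H_a$) such that the operator $$H_{\rm com}(m,t):=\begin{pmatrix}-\gamma D^m_{W,a} & t f_a^*\\ t f_a & \gamma D^m\end{pmatrix}$$ acting on $\mathcal H_a\oplus L^2_1(E)$ (with values in $\mathcal H_a\oplus\mathcal H$) satisfies, for every such $a$: (i) for every $m\in X$, the kernel of $H_{\rm com}(m,1)$ is trivial; (ii) for every $m\in A$ and every $t\in[0,1]$, the kernel of $H_{\rm com}(m,t)$ is trivial.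
   Context: Continuum data. $T^n=\mathbf R^n/\mathbf Z^n$ ($n\ge1$) with the flat metric; $e_i$ is the $i$-th unit vector. $E\to T^n$ is a smooth complex vector bundle of finite rank with a smooth Hermitian fiber metric. $\gamma$ and $c_1,\dots,c_n$ are smooth self-adjoint bundle endomorphisms of $E$ with $\gamma^2=\mathrm{id}$, $c_i^2=\mathrm{id}$, $\gamma c_i+c_i\gamma=0$, and $c_ic_j+c_jc_i=0$ for $i\ne j$. Generalized link variables. Fix a small constant $a_0>0$ (in particular $a_0<1/2$) and let $V=\{(x,y)\in T^n\times T^n:|x-y|<a_0\}$. $U$ is a smooth assignment $(x,y)\in V\mapsto U(x,y)\in\mathrm{Hom}(E_y,E_x)$ such that each $U(x,y)$ is unitary, $U(x,x)=\mathrm{id}$, $U(y,x)=U(x,y)^{-1}$, and $U(x,y)$ intertwines $\gamma$ and each $c_i$ (i.e. $U(x,y)\gamma_y=\gamma_xU(x,y)$ and likewise for $c_i$). $U$ determines a connection on $E$ with covariant derivatives $(\nabla_i^{\rm cont}v)(x)=\frac{d}{ds}\big|_{s=0}U(x,x+se_i)v(x+se_i)$, which preserves the fiber metric, $\gamma$ and the $c_i$. Continuum operator. $\|v\|_{L^2}^2=\int_{T^n}|v|^2d^nx$, and $\|v\|_{L^2_1}^2=\|v\|_{L^2}^2+m_0^{-2}\sum_i\|\nabla_i^{\rm cont}v\|_{L^2}^2$ with a fixed real $m_0\neq0$; $\mathcal H=L^2(E)$ and $L^2_1(E)$ are the completions of the smooth sections of $E$. $D_{T^n}=\sum_ic_i\nabla_i^{\rm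 cont}:L^2_1(E)\to\mathcal H$. A real number $m$ also denotes $m\cdot\mathrm{id}$. Lattice data. For $a=1/N$ with $a<a_0$: $T^n_a=a\mathbf Z^n/\mathbf Z^n\subset T^n$, $E_a=E|_{T^n_a}$, $\mathcal H_a=L^2(E_a)$ is the (finite-dimensional) space of sections of $E_a$ with norm $\|v\|_{L^2}^2=a^n\sum_{z\in T^n_a}|v(z)|^2$. $\gamma,c_i$ act on $E_a$ by restriction. $(U_i\phi)(z)=U(z,z+ae_i)\phi(z+ae_i)$, $\nabla_i=(U_i-\mathrm{id})/a$, $\nabla_i^*$ is its adjoint. $D_a=\sum_ic_i\frac{\nabla_i-\nabla_i^*}{2}$, the Wilson term is $W=-\sum_i\frac{\nabla_i+\nabla_i^*}{2}$, and the Wilson Dirac operator is $D_{W,a}=D_a+W$. *)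

(* Defs.v *)
From HB Require Import structures.
From mathcomp Require Import all_boot all_order all_algebra sesquilinear.
From mathcomp Require Import generic_quotient ring_quotient complex.
From mathcomp Require Import all_classical all_reals all_analysis.

Set Implicit Arguments.
Unset Strict Implicit.
Unset Printing Implicit Defensive.

Import Order.TTheory GRing.Theory Num.Theory.
Import numFieldNormedType.Exports.

Local Open Scope classical_set_scope.
Local Open Scope quotient_scope.
Local Open Scope complex_scope.
Local Open Scope ring_scope.

(* Families of vectors F i, with pointwise operations. *)
Definition dfun (K : pzRingType) (I : Type) (F : I -> lmodType K) : Type :=
  forall i, F i.

Section DfunLmodule.
Variables (K : pzRingType) (I : Type) (F : I -> lmodType K).

HB.instance Definition _ := gen_eqMixin (dfun F).
HB.instance Definition _ := gen_choiceMixin (dfun F).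

Let add (u v : dfun F) : dfun F := fun i => u i + v i.
Let opp (u : dfun F) : dfun F := fun i => - u i.
Let zero : dfun F := fun i => 0.
Let scale (k : K) (u : dfun F) : dfun F := fun i => k *: u i.

Let addA : associative add.
Proof. by move=> u v w; apply: functional_extensionality_dep => i; exact: addrA. Qed.
Let addC : commutative add.
Proof. by move=> u v; apply: functional_extensionality_dep => i; exact: addrC. Qed.
Let add0 : left_id zero add.
Proof. by move=> u; apply: functional_extensionality_dep => i; exact: add0r. Qed.
Let addN : left_inverse zero opp add.
Proof. by move=> u; apply: functional_extensionality_dep => i; exact: addNr. Qed.

HB.instance Definition _ := GRing.isZmodule.Build (dfun F) addA addC add0 addN.

Let scaleA k l u : scale k (scale l u) = scale (k * l) u.
Proof. by apply: functional_extensionality_dep => i; exact: scalerA. Qed.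
Let scale1 : left_id 1 scale.
Proof. by move=> u; apply: functional_extensionality_dep => i; exact: scale1r. Qed.
Let scaleDr : right_distributive scale +%R.
Proof. by move=> k u v; apply: functional_extensionality_dep => i; exact: scalerDr. Qed.
Let scaleDl u : {morph scale^~ u : k l / k + l}.
Proof. by move=> k l; apply: functional_extensionality_dep => i; exact: scalerDl. Qed.

HB.instance Definition _ :=
  GRing.Zmodule_isLmodule.Build K (dfun F) scaleA scale1 scaleDr scaleDl.

End DfunLmodule.

Section Smooth.
Variables (R : realType) (V : normedModType R).

(* On a finite-dimensional V and an open set O, this is the usual C^k. *)
Fixpoint Ck (k : nat) (O : set V) (f : V -> R^o) : Prop :=
  match k with
  | 0 => forall x, O x -> {for x, continuous f}
  | k'.+1 => (forall x, O x -> differentiable f x) /\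
             (forall v : V, Ck k' O (fun x => 'D_v f x))
  end.

Definition smooth (O : set V) (f : V -> R) : Prop := forall k, Ck k O f.

Definition csmooth (O : set V) (f : V -> R[i]) : Prop :=
  smooth O (fun x => complex.Re (f x)) /\ smooth O (fun x => complex.Im (f x)).

End Smooth.

Definition int_vector (R : realType) (n : nat) : {pred 'rV[R]_n} :=
  fun v => v \is a mxOver Num.int.

Fact int_vector_closed (R : realType) (n : nat) :
  zmod_closed (@int_vector R n).
Proof.
split=> [|u v /mxOverP uZ /mxOverP vZ]; apply/mxOverP => i j; rewrite !mxE.
  exact: rpred0.
by apply: rpredB; [exact: uZ | exact: vZ].
Qed.
HB.instance Definition _ (R : realType) (n : nat) :=
  GRing.isZmodClosed.Build 'rV[R]_n (@int_vector R n)
    (@int_vector_closed R n).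

Definition torus (R : realType) (n : nat) : Type :=
  {ideal_quot (@int_vector R n)}.

HB.instance Definition _ (R : realType) (n : nat) :=
  ZmodQuotient.on (torus R n).

Section Torus.
Variables (R : realType) (n : nat).

Definition tpt (v : 'rV[R]_n) : torus R n := \pi_(torus R n) v.

Definition enorm (v : 'rV[R]_n) : R := Num.sqrt (\sum_(i < n) v 0 i ^+ 2).

Definition tdist (x y : torus R n) : R :=
  inf [set enorm v | v in [set v | tpt v = x - y]].

Definition tstep (s : R) (i : 'I_n) : torus R n := tpt (s *: delta_mx 0 i).

Definition smoothT (W : set (torus R n)) (f : torus R n -> R[i]) : Prop :=
  csmooth (tpt @^-1` W) (f \o tpt).

End Torus.

(* Iterated integral; it is only used for continuous integrands, for which it
   is the n-dimensional Lebesgue integral over the unit cube. *)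
Fixpoint cube_integral (R : realType) (n : nat) : ('rV[R]_n -> R) -> R :=
  match n with
  | 0 => fun f => f 0
  | n'.+1 => fun f => Rintegral (@lebesgue_measure R) `[0, 1]
      (fun s : R => cube_integral (fun y : 'rV[R]_n' =>
         f (row_mx (s%:M : 'rV[R]_1) y)))
  end.

Definition torus_integral (R : realType) (n : nat) (f : torus R n -> R) : R :=
  cube_integral (f \o @tpt R n).

(* A bundle is given by its fibers and a cover by local trivializations (with
   inverses) whose transition matrices are smooth. The values of the
   trivializations outside their domains are irrelevant. *)
Record vbundle (R : realType) (n r : nat) := VBundle {
  fiber :> torus R n -> lmodType R[i];
  chart : Type;
  cdom : chart -> set (torus R n);
  triv : forall (c : chart) (x : torus R n), {linear fiber x -> 'rV[R[i]]_r};
  trivV : forall (c : chart) (x : torus R n), {linear 'rV[R[i]]_r -> fiber x};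
  cdom_open : forall c, open (@tpt R n @^-1` cdom c);
  cdom_cover : forall x, exists c, cdom c x;
  trivK : forall c x, cdom c x -> cancel (triv c x) (trivV c x);
  trivVK : forall c x, cdom c x -> cancel (trivV c x) (triv c x);
  transition_smooth : forall c d j k, smoothT (cdom c `&` cdom d)
    (fun x => lin1_mx (triv d x \o trivV c x) j k)
}.

Section Bundle.
Variables (R : realType) (n r : nat) (E : vbundle R n r).

Definition section : Type := dfun (fun x : torus R n => E x).
HB.instance Definition _ := GRing.Lmodule.on section.

Definition smooth_section : set section :=
  [set v | forall c k, smoothT (cdom c) (fun x => triv (v := E) c x (v x) 0 k)].

Definition smooth_endo (T : forall x, E x -> E x) : Prop :=
  forall c j k, smoothT (cdom c)
    (fun x => lin1_mx (triv (v := E) c x \o T x \o trivV c x) j k).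

Definition smooth_form (h : forall x, E x -> E x -> R[i]) : Prop :=
  forall c j k, smoothT (cdom c)
    (fun x => h x (trivV c x (delta_mx 0 j)) (trivV c x (delta_mx 0 k))).

Definition smooth_kernel (W : set (torus R n * torus R n))
    (U : forall x y, E y -> E x) : Prop :=
  forall c d j k, csmooth
    [set p : 'rV[R]_n * 'rV[R]_n | [/\ cdom (v := E) c (tpt p.1),
       cdom (v := E) d (tpt p.2) & W (tpt p.1, tpt p.2)]]
    (fun p => lin1_mx (triv c (tpt p.1) \o U (tpt p.1) (tpt p.2)
                       \o trivV d (tpt p.2)) j k).

End Bundle.

(* The forms are linear in the first and antilinear in the second variable. *)
Record clifford_bundle (R : realType) (n r : nat) := CliffordBundle {
  bundle :> vbundle R n r;
  herm : forall x, {dot bundle x for @Num.conj R[i]};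
  herm_smooth : smooth_form (fun x => herm x : _ -> _ -> _);
  gam : forall x, {linear bundle x -> bundle x};
  gam_smooth : smooth_endo (fun x => gam x : _ -> _);
  gam_selfadj : forall x u v, herm x (gam x u) v = herm x u (gam x v);
  gam_sqr : forall x u, gam x (gam x u) = u;
  cl : 'I_n -> forall x, {linear bundle x -> bundle x};
  cl_smooth : forall i, smooth_endo (fun x => cl i x : _ -> _);
  cl_selfadj : forall i x u v, herm x (cl i x u) v = herm x u (cl i x v);
  cl_sqr : forall i x u, cl i x (cl i x u) = u;
  gam_cl : forall i x u, gam x (cl i x u) + cl i x (gam x u) = 0;
  cl_cl : forall i j x u, i != j ->
    cl i x (cl j x u) + cl j x (cl i x u) = 0
}.

(* U x y is constrained only on the pairs at distance < a0. *)
Record link_variables (R : realType) (n r : nat) (E : clifford_bundle R n r)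
    (a0 : R) := LinkVariables {
  link :> forall x y, {linear E y -> E x};
  link_smooth : smooth_kernel [set p | tdist p.1 p.2 < a0]
    (fun x y => link x y : _ -> _);
  link_unitary : forall x y, tdist x y < a0 -> forall u v,
    herm E x (link x y u) (link x y v) = herm E y u v;
  link_id : forall x u, link x x u = u;
  linkV : forall x y, tdist x y < a0 -> forall u, link y x (link x y u) = u;
  link_gam : forall x y, tdist x y < a0 -> forall u,
    link x y (gam E y u) = gam E x (link x y u);
  link_cl : forall i x y, tdist x y < a0 -> forall u,
    link x y (cl E i y u) = cl E i x (link x y u)
}.

Section Continuum.
Variables (R : realType) (n r : nat) (E : clifford_bundle R n r) (a0 : R).
Variable (U : link_variables E a0).

Definition hnorm (x : torus R n) (u : E x) : R :=
  Num.sqrt (complex.Re (herm E x u u)).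

(* Derivative at 0 of a curve in the finite-dimensional space E x, normed by
   the fiber metric (0 when the derivative does not exist). *)
Definition fiber_derive0 (x : torus R n) (g : R -> E x) : E x :=
  xget 0 [set w : E x |
    (fun s : R => hnorm ((s^-1)%:C *: (g s - g 0) - w)) @ (0 : R)^' --> (0 : R)].

Definition nabla_cont (i : 'I_n) (v : section E) : section E :=
  fun x => fiber_derive0
    (fun s : R => U x (x + tstep s i) (v (x + tstep s i))).

Definition gam_sec (v : section E) : section E := fun x => gam E x (v x).

Definition dirac_cont (v : section E) : section E :=
  fun x => \sum_(i < n) cl E i x (nabla_cont i v x).

Definition L2norm (v : section E) : R :=
  Num.sqrt (torus_integral (fun x => hnorm (v x) ^+ 2)).

Definition L21norm (m0 : R) (v : section E) : R :=
  Num.sqrt (L2norm v ^+ 2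
            + m0 ^- 2 * \sum_(i < n) L2norm (nabla_cont i v) ^+ 2).

End Continuum.

(* A Banach space containing S isometrically (for the seminorm nrm) and
   densely; it is unique up to a unique isometric isomorphism. *)
Record completion (C : numFieldType) (V : lmodType C) (S : set V)
    (nrm : V -> C) := Completion {
  space :> completeNormedModType C;
  embed : V -> space;
  embed_linear : forall k u v, S u -> S v ->
    embed (k *: u + v) = k *: embed u + embed v;
  embed_norm : forall u, S u -> `|embed u| = nrm u;
  embed_dense : dense (embed @` S)
}.

Section Completions.
Variables (R : realType) (n r : nat) (E : clifford_bundle R n r) (a0 : R).
Variable (U : link_variables E a0).

Definition L2_completion : Type :=
  completion (@smooth_section R n r E) (fun v => (L2norm v)%:C).

Definition L21_completion (m0 : R) : Type :=
  completion (@smooth_section R n r E) (fun v => (L21norm U m0 v)%:C).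

End Completions.

(* L is the continuous extension of the operator T on smooth sections. *)
Definition is_extension (C : numFieldType) (V : lmodType C) (S : set V)
    (p q : V -> C) (X : completion S p) (Y : completion S q)
    (T : V -> V) (L : X -> Y) : Prop :=
  continuous L /\ forall v, S v -> L (embed X v) = embed Y (T v).

Definition adjoint (C : numClosedFieldType) (X Y : lmodType C)
    (ipX : X -> X -> C) (ipY : Y -> Y -> C) (f : X -> Y) (y : Y) : X :=
  xget 0 [set w | forall x, ipY (f x) y = ipX x w].

Section Lattice.
Variables (R : realType) (n N : nat).

Local Notation a := (N%:R^-1 : R).

Definition lattice_pts : set (torus R n) :=
  [set tpt (a *: map_mx intr k) | k in [set: 'rV[int]_n]].

Definition lattice : Type := set_type lattice_pts.
HB.instance Definition _ := Choice.on lattice.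

Lemma lattice_stepP (i : 'I_n) (z : lattice) :
  val z + tstep a i \in lattice_pts.
Proof.
have /set_mem [k _ kz] := valP z; apply/mem_set.
exists (k + delta_mx 0 i) => //.
rewrite -kz /tstep /tpt -pi_addr; congr (\pi _).
rewrite map_mxD scalerDr; congr (_ + _ *: _).
by apply/matrixP => p q; rewrite !mxE; case: (_ && _).
Qed.

Definition lstep (i : 'I_n) (z : lattice) : lattice :=
  SigSub (lattice_stepP i z).

End Lattice.

Section WilsonDirac.
Variables (R : realType) (n r : nat) (E : clifford_bundle R n r) (a0 : R).
Variables (U : link_variables E a0) (N : nat).

Local Notation a := (N%:R^-1 : R).

Definition lsection : Type := dfun (fun z : lattice R n N => E (val z)).
HB.instance Definition _ := GRing.Lmodule.on lsection.

Definition lip (phi psi : lsection) : R[i] :=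
  (a ^+ n)%:C * \sum_(z \in [set: lattice R n N]) herm E (val z) (phi z) (psi z).

Definition Ulat (i : 'I_n) (phi : lsection) : lsection :=
  fun z => U (val z) (val (lstep i z)) (phi (lstep i z)).

Definition nabla_lat (i : 'I_n) (phi : lsection) : lsection :=
  (a^-1)%:C *: (Ulat i phi - phi).

Definition nabla_lat_adj (i : 'I_n) : lsection -> lsection :=
  adjoint lip lip (nabla_lat i).

Definition gam_lat (phi : lsection) : lsection :=
  fun z => gam E (val z) (phi z).

Definition cl_lat (i : 'I_n) (phi : lsection) : lsection :=
  fun z => cl E i (val z) (phi z).

Definition dirac_lat (phi : lsection) : lsection :=
  \sum_(i < n) cl_lat i (2^-1 *: (nabla_lat i phi - nabla_lat_adj i phi)).

Definition wilson_term (phi : lsection) : lsection :=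
  - \sum_(i < n) 2^-1 *: (nabla_lat i phi + nabla_lat_adj i phi).

Definition wilson_dirac (phi : lsection) : lsection :=
  dirac_lat phi + wilson_term phi.

End WilsonDirac.

(* H and H1 stand for L^2(E) and L^2_1(E), gH and D for gamma on H and the
   Dirac operator, J for the inclusion of H1 in H, and ip for the inner product
   of H. *)
Section Combined.
Variables (R : realType) (n r : nat) (E : clifford_bundle R n r) (a0 : R).
Variables (U : link_variables E a0) (N : nat).
Variables (H H1 : lmodType R[i]) (ip : H -> H -> R[i]).
Variables (gH : H -> H) (D J : H1 -> H).
Variable (f : lsection E N -> H).

Definition Hcom (m t : R) (p : lsection E N * H1) : lsection E N * H :=
  (- gam_lat (wilson_dirac U p.1 + m%:C *: p.1)
     + t%:C *: adjoint (@lip R n r E N) ip f (J p.2),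
   t%:C *: f p.1 + gH (D p.2 + m%:C *: J p.2)).

End Combined.

Definition trivial_kernel (X Y : zmodType) (F : X -> Y) : Prop :=
  forall p, F p = 0 -> p = 0.

(* Main.v *)
Require Import Defs.
From HB Require Import structures.
From mathcomp Require Import all_boot all_order all_algebra sesquilinear.
From mathcomp Require Import complex ring lra zify.
From mathcomp Require Import all_classical all_reals all_analysis.

Set Implicit Arguments.
Unset Strict Implicit.
Unset Printing Implicit Defensive.

Import Order.TTheory GRing.Theory Num.Theory.
Import numFieldNormedType.Exports.

Local Open Scope classical_set_scope.
Local Open Scope complex_scope.
Local Open Scope ring_scope.

(** The map [f] carries a lattice section over each cell of the lattice by the
    transport [U] from the corner of the cell, and multiplies it by a smooth bump
    that vanishes near the walls of the cell and is close to 1 on most of it. Then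
    [f] is almost isometric and [f^*] is almost the mean over the cells, which is
    bounded below by a Poincare inequality. Summing difference quotients over a
    cell shows that [f] intertwines the two Dirac operators up to [O(a)] in the
    graph norms; these control all first derivatives, on the lattice because the
    Wilson term removes the doublers. If [(phi, v)] is in the kernel, pairing the
    two equations with [f^* v] and [f phi] and adding gives
    [t (|f phi|^2 + |f^* v|^2) <= C a (|D v| + |v|) (|phi| + |D_W phi|)],
    and the equations bound the right hand side by [C a] times the left one: by
    coercivity of [f] and [f^*] if [t = 1], by the mass gap if [m = M] or [m = - M].
    The estimates in the continuum are limits of estimates on the lattices of
    spacing [1 / (N L)], [L -> oo]. *)

(** The opposite signs of the diagonal blocks make the two Dirac terms cancel up to the intertwining
    error when the paired equations are added, and the mass terms cancel exactly because [f]
    commutes with [gamma]. The values of [f] must be smooth, since the abstract completion knows no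
    other sections, but transport from the corners jumps across the walls of the cells: hence the
    bump. Its derivative is large but is never taken: the derivative stays on [v] or is a difference
    quotient of [phi], and only the L2 distance of the bump to 1 enters. A plateau parameter [q] of
    order [N^2] makes it at most [a]. Likewise a derivative of [v] cannot be differentiated again,
    so displacements within a cell are charged to [phi]. An average over the fine lattice is an
    average over cell positions of averages over the coarse one, which turns the comparison into
    algebra on finite sums. The final estimates involve only the graph norm of [D], in which both
    sides are continuous, so density extends them from smooth sections to the completion. *)

Section AbelianIdentities.
Variable V : zmodType.

(* Reflexive decision of identities in abelian groups, for which [ring] is not available. *)
Inductive zexp := ZVar of nat | ZZero | ZAdd of zexp & zexp | ZOpp of zexp
  | ZMuln of zexp & nat.

Fixpoint zeval (s : seq V) (e : zexp) : V :=
  match e with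
  | ZVar i => s`_i
  | ZZero => 0
  | ZAdd e1 e2 => zeval s e1 + zeval s e2
  | ZOpp e1 => - zeval s e1
  | ZMuln e1 k => zeval s e1 *+ k
  end.

Fixpoint zcoef (e : zexp) (i : nat) : int :=
  match e with
  | ZVar j => (i == j)%:R
  | ZZero => 0
  | ZAdd e1 e2 => zcoef e1 i + zcoef e2 i
  | ZOpp e1 => - zcoef e1 i
  | ZMuln e1 k => zcoef e1 i *+ k
  end.

Lemma zevalE s e : zeval s e = \sum_(i < size s) s`_i *~ zcoef e i.
Proof.
elim: e => [j||e1 IH1 e2 IH2|e1 IH1|e1 IH1 k] /=.
- case: (ltnP j (size s)) => js.
    rewrite (bigD1 (Ordinal js)) //= eqxx mulr1z big1 ?addr0 // => i ij.
    by rewrite (_ : (i == j :> nat) = false) ?mulr0z //; exact: negbTE.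
  rewrite nth_default // big1 // => i _.
  by rewrite ltn_eqF ?mulr0z // (leq_trans (ltn_ord i)).
- by rewrite big1 // => i _; rewrite mulr0z.
- by rewrite IH1 IH2 -big_split; apply: eq_bigr => i _; rewrite mulrzDr.
- by rewrite IH1 -sumrN; apply: eq_bigr => i _; rewrite mulrNz.
- rewrite IH1 -sumrMnl; apply: eq_bigr => i _.
  by elim: k => [|k IHk]; rewrite ?mulr0z // !mulrS mulrzDr IHk.
Qed.

Lemma zeval_eq s e1 e2 :
  all (fun i => zcoef e1 i == zcoef e2 i) (iota 0 (size s)) ->
  zeval s e1 = zeval s e2.
Proof.
move=> /allP ee; rewrite !zevalE; apply: eq_bigr => i _.
by rewrite (eqP (ee i _)) // mem_iota ltn_ord.
Qed.

End AbelianIdentities.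

Ltac zmod_mem x s :=
  lazymatch s with
  | nil => constr:(false)
  | cons x _ => constr:(true)
  | cons _ ?s' => zmod_mem x s'
  end.

Ltac zmod_atoms t s :=
  lazymatch t with
  | @GRing.add _ ?x ?y => let s1 := zmod_atoms x s in zmod_atoms y s1
  | @GRing.opp _ ?x => zmod_atoms x s
  | @GRing.natmul _ ?x ?k => zmod_atoms x s
  | @GRing.zero _ => s
  | ?x => match zmod_mem x s with
          | true => s
          | false => constr:(cons x s)
          end
  end.

Ltac zmod_index x s :=
  lazymatch s with
  | cons x _ => constr:(O)
  | cons _ ?s' => let k := zmod_index x s' in constr:(S k)
  end.

Ltac zmod_reify t s :=
  lazymatch t with
  | @GRing.add _ ?x ?y =>
    let e1 := zmod_reify x s in let e2 := zmod_reify y s in constr:(ZAdd e1 e2)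
  | @GRing.opp _ ?x => let e := zmod_reify x s in constr:(ZOpp e)
  | @GRing.natmul _ ?x ?k => let e := zmod_reify x s in constr:(ZMuln e k)
  | @GRing.zero _ => constr:(ZZero)
  | ?x => let k := zmod_index x s in constr:(ZVar k)
  end.

Ltac zmod :=
  lazymatch goal with
  | |- @eq ?T ?l ?r =>
    let s1 := zmod_atoms l (@nil T) in let s := zmod_atoms r s1 in
    let e1 := zmod_reify l s in let e2 := zmod_reify r s in
    refine (@zeval_eq _ s e1 e2 _); vm_compute; reflexivity
  end.

(** * Ellipticity of the Wilson operator *)

Section PsdForms.
Variables (R : realType) (V : lmodType R[i]).

(** Real parts of Hermitian forms. Degenerate forms must be allowed, because a lattice average of a
    section of the torus does not see its values off the lattice. *)
Record psd (b : V -> V -> R) : Prop := Psd {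
  psdDl : forall u v w, b (u + v) w = b u w + b v w;
  psdC : forall u v, b u v = b v u;
  psdZl : forall (k : R) u v, b (k%:C *: u) v = k * b u v;
  psd_ge0 : forall u, 0 <= b u u
}.

Definition nb (b : V -> V -> R) (u : V) : R := Num.sqrt (b u u).

Variable b : V -> V -> R.
Hypothesis pb : psd b.

Lemma psdDr u v w : b u (v + w) = b u v + b u w.
Proof. by rewrite psdC // psdDl // !(psdC pb u). Qed.

Lemma psd0l u : b 0 u = 0.
Proof. by have := psdDl pb 0 0 u; rewrite addr0; lra. Qed.

Lemma psdNl u v : b (- u) v = - b u v.
Proof. by have := psdDl pb u (- u) v; rewrite subrr psd0l; lra. Qed.

Lemma psdNr u v : b u (- v) = - b u v.
Proof. by rewrite psdC // psdNl psdC. Qed.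

Lemma psdBl u v w : b (u - v) w = b u w - b v w.
Proof. by rewrite psdDl // psdNl. Qed.

Lemma psdBr u v w : b u (v - w) = b u v - b u w.
Proof. by rewrite psdDr // psdNr. Qed.

Lemma psdZr k u v : b u (k%:C *: v) = k * b u v.
Proof. by rewrite psdC // psdZl // psdC. Qed.

Lemma psd_suml I (s : seq I) (P : pred I) F v :
  b (\sum_(i <- s | P i) F i) v = \sum_(i <- s | P i) b (F i) v.
Proof.
apply: (big_morph (fun u => b u v)) => [u w|]; first exact: psdDl.
exact: psd0l.
Qed.

Lemma psd_sumr I (s : seq I) (P : pred I) F v :
  b v (\sum_(i <- s | P i) F i) = \sum_(i <- s | P i) b v (F i).
Proof. by rewrite psdC // psd_suml; apply: eq_bigr => i _; rewrite psdC. Qed.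

Lemma nb_ge0 u : 0 <= nb b u.
Proof. exact: sqrtr_ge0. Qed.

Lemma sqr_nb u : nb b u ^+ 2 = b u u.
Proof. by rewrite sqr_sqrtr // psd_ge0. Qed.

Lemma psd_le u v : b u v <= nb b u * nb b v.
Proof.
have [vv0|vv] := eqVneq (b v v) 0.
  have [-> | uv] := eqVneq (b u v) 0; first by rewrite mulr_ge0 ?nb_ge0.
  (* When [b v v = 0], this multiple of [v] would give the form the value [- b u u - 2], so [b u v]
     has to vanish. *)
  have := psd_ge0 pb (u - ((b u u + 1) / b u v)%:C *: v).
  rewrite psdBl !psdBr !(psdZl pb) !psdZr vv0 (psdC pb v u) !mulr0.
  have -> : (b u u + 1) / b u v * b u v = b u u + 1 by field.
  by have := psd_ge0 pb u; lra.
have v0 : 0 < b v v by rewrite lt_neqAle eq_sym vv psd_ge0.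
have := psd_ge0 pb (u - (b u v / b v v)%:C *: v).
rewrite psdBl !psdBr !(psdZl pb) !psdZr (psdC pb v u).
have -> : b u v / b v v * (b u v / b v v * b v v) = b u v / b v v * b u v.
  by field.
move=> le0; rewrite (le_trans (ler_norm _)) // -sqrtr_sqr -sqrtrM ?psd_ge0 //.
rewrite ler_wsqrtr //.
have : b u v / b v v * b u v <= b u u by lra.
by rewrite mulrAC ler_pdivrMr // -expr2.
Qed.

Lemma nbN u : nb b (- u) = nb b u.
Proof. by rewrite /nb psdNl psdNr opprK. Qed.

Lemma psd_abs u v : `|b u v| <= nb b u * nb b v.
Proof. by rewrite ler_norml psd_le andbT lerNl -psdNl -(nbN u) psd_le. Qed.

Lemma nbD u v : nb b (u + v) <= nb b u + nb b v.
Proof.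
rewrite -(@ler_pXn2r _ 2) ?nnegrE ?addr_ge0 ?nb_ge0 //.
rewrite sqrrD !sqr_nb psdDl // !psdDr (psdC pb v u).
by have := psd_le u v; lra.
Qed.

Lemma nbB u v : nb b (u - v) <= nb b u + nb b v.
Proof. by rewrite (le_trans (nbD _ _)) ?nbN. Qed.

Lemma nbBC u v : nb b (u - v) = nb b (v - u).
Proof. by rewrite -nbN opprB. Qed.

Lemma nbZ k u : nb b (k%:C *: u) = `|k| * nb b u.
Proof.
by rewrite /nb psdZl // psdZr mulrA -expr2 sqrtrM ?sqr_ge0 // sqrtr_sqr.
Qed.

Lemma nb0 : nb b 0 = 0.
Proof. by rewrite /nb psd0l sqrtr0. Qed.

Lemma nb_le_sub u v : nb b u <= nb b v + nb b (u - v).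
Proof. by rewrite -{1}(subrK v u) addrC nbD. Qed.

Lemma sqr_nbD u v : b (u + v) (u + v) <= 2 * b u u + 2 * b v v.
Proof.
have := psd_ge0 pb (u - v); rewrite psdBl !psdBr psdDl // !psdDr (psdC pb v u).
lra.
Qed.

End PsdForms.

Section Elliptic.
Variables (R : realType) (V : lmodType R[i]) (b : V -> V -> R) (n : nat).
Hypothesis pb : psd b.
Variables (T : bool -> 'I_n -> {linear V -> V}) (c : 'I_n -> {linear V -> V}).
Variable kap : R.
Hypothesis T_adj : forall s i u v, b (T s i u) v = b u (T (~~ s) i v).
Hypothesis TK : forall s i u, T s i (T (~~ s) i u) = u.
Hypothesis c_adj : forall i u v, b (c i u) v = b u (c i v).
Hypothesis cK : forall i u, c i (c i u) = u.
Hypothesis cc : forall i j u, i != j -> c i (c j u) + c j (c i u) = 0.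
Hypothesis cT : forall s i j u, c i (T s j u) = T s j (c i u).
Hypothesis T_comm : forall s s' i j u, i != j ->
  nb b (T s i (T s' j u) - T s' j (T s i u)) <= kap * nb b u.

Local Notation N := (nb b).

(** Names with equations instead of definitions, so that rewriting does not unfold them; reflexivity
    supplies the equations at the end. [A] is antisymmetric, [B] symmetric, and [G false i] is
    adjoint to [G true i]. *)
Variables (A B : 'I_n -> V -> V) (G : bool -> 'I_n -> V -> V).
Hypothesis AE : forall i u, A i u = T true i u - T false i u.
Hypothesis BE : forall i u, B i u = (u - T true i u) + (u - T false i u).
Hypothesis GE : forall s i u, G s i u = T s i u - u.

Definition wilson_part i u : V := c i (T true i u - T false i u) +
  ((u - T true i u) + (u - T false i u)).

Let wilsonE i u : wilson_part i u = c i (A i u) + B i u.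
Proof. by rewrite AE BE. Qed.

Let TB s i u v : T s i (u - v) = T s i u - T s i v.
Proof. exact: linearB. Qed.

Let TD s i u v : T s i (u + v) = T s i u + T s i v.
Proof. exact: linearD. Qed.

Let cB' i u v : c i (u - v) = c i u - c i v.
Proof. exact: linearB. Qed.

Let cD' i u v : c i (u + v) = c i u + c i v.
Proof. exact: linearD. Qed.

Let A_adj i u v : b (A i u) v = - b u (A i v).
Proof. by rewrite !AE !(psdDl pb, psdDr pb, psdNl pb, psdNr pb) !T_adj /=; lra. Qed.

Let B_adj i u v : b (B i u) v = b u (B i v).
Proof.
by rewrite !BE !(psdDl pb, psdDr pb, psdNl pb, psdNr pb) !T_adj /=; lra.
Qed.

Let NT s i u : N (T s i u) = N u.
Proof. by rewrite /nb T_adj -{2}(negbK s) TK. Qed.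

Let Nc i u : N (c i u) = N u.
Proof. by rewrite /nb c_adj cK. Qed.

Let cA i j u : c i (A j u) = A j (c i u).
Proof. by rewrite !AE cB' !cT. Qed.

Let cB i j u : c i (B j u) = B j (c i u).
Proof. by rewrite !BE !(cB', cD') !cT. Qed.

Let AB i u : A i (B i u) = B i (A i u).
Proof.
rewrite !(AE, BE) !(TB, TD) (TK true) (TK false).
move: (T true i u) (T false i u) (T true i (T true i u)) (T false i (T false i u)).
by move=> *; zmod.
Qed.

(** [c i] commutes with the shifts, so [c i] after [A i] is antisymmetric and commutes with the
    symmetric [B i]: the mixed term is zero. What remains is [|A|^2 + |B|^2], on symbols [4 sin^2 x
    + 4 (1 - cos x)^2 = 4 |e^(ix) - 1|^2]; the Wilson term removes the second zero of the sine. *)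
Let diag i u : b (wilson_part i u) (wilson_part i u) =
  4 * b (T true i u - u) (T true i u - u).
Proof.
have -> : b (wilson_part i u) (wilson_part i u) = b (A i u) (A i u)
    + 2 * b (c i (A i u)) (B i u) + b (B i u) (B i u).
  rewrite wilsonE !(psdDl pb) !(psdDr pb) (psdC pb (B i u)) (c_adj i (A i u)).
  by rewrite cK; lra.
have cAB0 : b (c i (A i u)) (B i u) = 0.
  have h : b (c i (A i u)) (B i u) = - b (B i u) (c i (A i u)).
    by rewrite -{1}B_adj -cB -AB c_adj A_adj -cA.
  by move: h; rewrite (psdC pb (B i u)); lra.
rewrite cAB0.
have e1 : b (T true i u) (T true i u) = b u u by rewrite T_adj (TK false).
have e2 : b (T false i u) (T false i u) = b u u by rewrite T_adj (TK true).
have e3 : b (T true i u) u = b u (T false i u) by rewrite T_adj.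
rewrite !(AE, BE) !(psdDl pb, psdDr pb, psdNl pb, psdNr pb).
move: e3; rewrite !(psdC pb _ u) (psdC pb (T false i u) (T true i u)) => e3.
by lra.
Qed.

Let AA i j u : i != j -> N (A i (A j u) - A j (A i u)) <= 4 * kap * N u.
Proof.
move=> ij.
have -> : A i (A j u) - A j (A i u) =
    (T true i (T true j u) - T true j (T true i u))
  - (T true i (T false j u) - T false j (T true i u))
  - (T false i (T true j u) - T true j (T false i u))
  + (T false i (T false j u) - T false j (T false i u)).
  rewrite !AE !(TB, TD).
  move: (T true i (T true j u)) (T true j (T true i u)) (T true i (T false j u))
    (T false j (T true i u)) (T false i (T true j u)) (T true j (T false i u))
    (T false i (T false j u)) (T false j (T false i u)).
  by move=> *; zmod.
rewrite (le_trans (nbD pb _ _)) //.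
rewrite (le_trans (lerD (nbB pb _ _) (T_comm false false u ij))) //.
rewrite (le_trans (lerD (lerD (nbB pb _ _) (T_comm false true u ij)) (lexx _))) //.
have := T_comm true true u ij; have := T_comm true false u ij; lra.
Qed.

Let BA i j u : i != j -> N (B j (A i u) - A i (B j u)) <= 4 * kap * N u.
Proof.
move=> ij.
have -> : B j (A i u) - A i (B j u) =
    (T true i (T true j u) - T true j (T true i u))
  + (T true i (T false j u) - T false j (T true i u))
  - (T false i (T true j u) - T true j (T false i u))
  - (T false i (T false j u) - T false j (T false i u)).
  rewrite !(AE, BE) !(TB, TD).
  move: (T true i u) (T false i u) (T true i (T true j u)) (T true j (T true i u)) (T true i (T false j u))
    (T false j (T true i u)) (T false i (T true j u)) (T true j (T false i u))
    (T false i (T false j u)) (T false j (T false i u)).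
  by move=> *; zmod.
rewrite (le_trans (nbB pb _ _)) //.
rewrite (le_trans (lerD (nbB pb _ _) (T_comm false false u ij))) //.
rewrite (le_trans (lerD (lerD (nbD pb _ _) (T_comm false true u ij)) (lexx _))) //.
have := T_comm true true u ij; have := T_comm true false u ij; lra.
Qed.

Let GG s s' i j u : i != j -> N (G s i (G s' j u) - G s' j (G s i u)) <= kap * N u.
Proof.
move=> ij; rewrite (_ : _ - _ = T s i (T s' j u) - T s' j (T s i u)) ?T_comm //.
rewrite !GE !(TB, TD).
by move: (T s i u) (T s' j u) (T s i (T s' j u)) (T s' j (T s i u)) => *; zmod.
Qed.

Let G_adj s i u v : b (G s i u) v = b u (G (~~ s) i v).
Proof. by rewrite !GE psdBl // psdBr // T_adj. Qed.

Let BGE i u : B i u = G false i (G true i u).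
Proof.
by rewrite !BE !GE !(TB, TD) (TK false); move: (T true i u) (T false i u) => *; zmod.
Qed.

Let NG s i u : N (G s i u) <= 2 * N u.
Proof. by rewrite GE (le_trans (nbB pb _ _)) // NT; lra. Qed.

Hypothesis kap_ge0 : 0 <= kap.

(** [B i] is [G true i] followed by its adjoint, and commuting nonnegative operators have a
    nonnegative product: the pairing is the square of [G true j (G true i u)] up to two commutators,
    each at most [4 * kap * b u u]. *)
Let BB i j u : i != j -> - (8 * kap * b u u) <= b (B i u) (B j u).
Proof.
move=> ij; have ji : j != i by rewrite eq_sym.
rewrite !BGE [X in _ <= X]psdC // G_adj psdC //=.
set w := G true i u; set w' := G true j u.
have -> : b (G true j (G false i w)) w' = b (G true j w) (G true j w)
   + b (G true j w) (G true i w' - G true j w)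
   + b (G true j (G false i w) - G false i (G true j w)) w'.
  by rewrite psdBl // psdBr // (G_adj false); lra.
have h1 : `|b (G true j w) (G true i w' - G true j w)|
    <= (4 * N u) * (kap * N u).
  rewrite (le_trans (psd_abs pb _ _)) // ler_pM ?nb_ge0 ?GG //.
  by rewrite (le_trans (NG _ _ _)) //; have := NG true i u; rewrite -/w; lra.
have h2 : `|b (G true j (G false i w) - G false i (G true j w)) w'|
    <= (kap * (2 * N u)) * (2 * N u).
  rewrite (le_trans (psd_abs pb _ _)) // ler_pM ?nb_ge0 ?NG //.
  by rewrite (le_trans (GG _ _ _ _)) // ler_wpM2l // NG.
have := psd_ge0 pb (G true j w); have := lerNnormlW h1; have := lerNnormlW h2.
rewrite -(sqr_nb pb u).
have -> : kap * (2 * N u) * (2 * N u) = 4 * (kap * N u ^+ 2) by ring.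
have -> : 4 * N u * (kap * N u) = 4 * (kap * N u ^+ 2) by ring.
have -> : 8 * kap * N u ^+ 2 = 8 * (kap * N u ^+ 2) by ring.
have : 0 <= kap * N u ^+ 2 by rewrite mulr_ge0 ?sqr_ge0.
move: (b _ _) (b _ _) (b _ _) (kap * _) => x1 x2 x3 x4; lra.
Qed.

(** Without curvature the sum would be twice the pairing of [B i u] with [B j u]: the Clifford
    relations cancel the terms with two [A], and the antisymmetry of [c i] after [A i] cancels each
    pairing of an [A] with a [B]. The commutators cost 16 from [BB], 4 from the two [A], and 4 from
    each of the two mixed pairs. *)
Let cross i j u : i != j ->
  - (28 * kap * b u u) <= b (wilson_part i u) (wilson_part j u)
                          + b (wilson_part j u) (wilson_part i u).
Proof.
move=> ij; have ji : j != i by rewrite eq_sym.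
rewrite !wilsonE !(psdDl pb) !(psdDr pb).
have cAB k l : k != l -> `|b (c k (A k u)) (B l u)| * 2 <= 4 * kap * b u u.
  move=> kl.
  have e : b (c k (A k u)) (B l u) * 2 = b (B l (A k u) - A k (B l u)) (c k u).
    rewrite (psdBl pb) A_adj B_adj -cA -cB (psdC pb (B l u)) -c_adj.
    by lra.
  rewrite -(ger0_norm (ler0n R 2)) -normrM e.
  rewrite (le_trans (psd_abs pb _ _)) // Nc -(sqr_nb pb) expr2 mulrA.
  by rewrite ler_wpM2r ?nb_ge0 ?BA.
have ccE : c j (c i u) = - c i (c j u).
  by apply/eqP; rewrite -subr_eq0 opprK cc // eq_sym.
have cAcA k l : b (c k (A k u)) (c l (A l u)) = - b (A l (A k u)) (c k (c l u)).
  by rewrite c_adj cA cA [in RHS]A_adj opprK.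
have cc2 : `|b (c i (A i u)) (c j (A j u)) + b (c j (A j u)) (c i (A i u))|
    <= 4 * kap * b u u.
  rewrite !cAcA ccE (psdNr pb) opprK addrC -(psdBl pb).
  rewrite (le_trans (psd_abs pb _ _)) // !Nc -(sqr_nb pb) expr2 mulrA.
  by rewrite ler_wpM2r ?nb_ge0 ?AA.
have := lerNnormlW cc2; have := BB u ij.
have := cAB _ _ ij; have := cAB _ _ ji.
rewrite (psdC pb (B i u) (c _ _)) (psdC pb (B j u) (c _ _)).
have h (x : R) : - x <= `|x| by rewrite -normrN ler_norm.
have := h (b (c i (A i u)) (B j u)); have := h (b (c j (A j u)) (B i u)).
rewrite (psdC pb (B j u) (B i u)).
lra.
Qed.

(** The diagonal terms are exactly the forward differences and the off-diagonal pairs are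
    nonnegative up to curvature, so the operator controls the difference in every direction. *)
Lemma wilson_part_bound_subproof u :
  4 * \sum_(i < n) b (T true i u - u) (T true i u - u)
    - 15 * n%:R ^+ 2 * kap * b u u
  <= b (\sum_(i < n) wilson_part i u) (\sum_(i < n) wilson_part i u).
Proof.
rewrite (psd_suml pb).
under [X in _ <= X]eq_bigr => i _ do rewrite (psd_sumr pb).
set S := \sum_(i < n) \sum_(j < n) b (wilson_part i u) (wilson_part j u).
(* Doubling puts the off-diagonal terms into the pairs that [cross] bounds; its 28 is rounded up to
   30. *)
have S2 : 2 * S = \sum_(i < n) \sum_(j < n)
    (b (wilson_part i u) (wilson_part j u) + b (wilson_part j u) (wilson_part i u)).
  have -> : 2 * S = S + S by ring.
  rewrite {2}/S [X in _ + X]exchange_big -big_split /=.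
  by apply: eq_bigr => i _; rewrite -big_split.
suff : 2 * (4 * (\sum_(i < n) b (T true i u - u) (T true i u - u))
   - 15 * n%:R ^+ 2 * kap * b u u) <= 2 * S by lra.
rewrite S2.
have -> : 2 * (4 * (\sum_(i < n) b (T true i u - u) (T true i u - u))
   - 15 * n%:R ^+ 2 * kap * b u u) = \sum_(i < n) \sum_(j < n)
  ((if i == j then 8 * b (T true i u - u) (T true i u - u) else 0)
    - 30 * kap * b u u).
  under [RHS]eq_bigr => i _.
    rewrite big_split /= -big_mkcond /= (big_pred1 i); last by move=> j; rewrite eq_sym.
    rewrite sumr_const card_ord.
  over.
  rewrite big_split /= sumr_const card_ord -mulr_sumr.
  rewrite -(mulr_natl (_ *+ n)) -(mulr_natl (- (30 * kap * b u u)) n); ring.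
apply: ler_sum => i _; apply: ler_sum => j _.
have ku : 0 <= kap * b u u by rewrite mulr_ge0 ?psd_ge0.
case: eqVneq => [<-|ij]; first by rewrite diag; lra.
by have := cross u ij; lra.
Qed.

End Elliptic.

Lemma wilson_part_bound (R : realType) (V : lmodType R[i]) (b : V -> V -> R)
    (n : nat) (T : bool -> 'I_n -> {linear V -> V}) (c : 'I_n -> {linear V -> V})
    (kap : R) :
  psd b ->
  (forall s i u v, b (T s i u) v = b u (T (~~ s) i v)) ->
  (forall s i u, T s i (T (~~ s) i u) = u) ->
  (forall i u v, b (c i u) v = b u (c i v)) ->
  (forall i u, c i (c i u) = u) ->
  (forall i j u, i != j -> c i (c j u) + c j (c i u) = 0) ->
  (forall s i j u, c i (T s j u) = T s j (c i u)) ->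
  (forall s s' i j u, i != j ->
    nb b (T s i (T s' j u) - T s' j (T s i u)) <= kap * nb b u) ->
  0 <= kap -> forall u,
  4 * \sum_(i < n) b (T true i u - u) (T true i u - u)
    - 15 * n%:R ^+ 2 * kap * b u u
  <= b (\sum_(i < n) wilson_part T c i u) (\sum_(i < n) wilson_part T c i u).
Proof.
move=> pb h1 h2 h3 h4 h5 h6 h7 k0 u.
exact: (wilson_part_bound_subproof pb h1 h2 h3 h4 h5 h6 h7
  (fun i u => erefl) (fun i u => erefl) (fun s i u => erefl)).
Qed.

(** * Calculus on Euclidean space *)

Section Small.
Variable R : realType.
Implicit Types P Q : R -> Prop.

(** One parameter serves as the radius of a neighbourhood and, through its inverse, as a bound on
    it, so that local estimates are combined by shrinking [e] alone. *)
Definition small P := exists2 e0 : R, 0 < e0 & forall e, 0 < e -> e <= e0 -> P e.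

Lemma small_imp P Q : (forall e, 0 < e -> P e -> Q e) -> small P -> small Q.
Proof. by move=> PQ [e0 e00 Pe]; exists e0 => // e e_gt0 /(Pe _ e_gt0); exact: PQ. Qed.

Lemma smallI P Q : small P -> small Q -> small (fun e => P e /\ Q e).
Proof.
move=> [e0 e00 Pe] [e1 e10 Qe]; exists (Num.min e0 e1); first by rewrite lt_min e00.
by move=> e e_gt0; rewrite le_min => /andP[l0 l1]; split; [exact: Pe | exact: Qe].
Qed.

Lemma small_lt c : 0 < c -> small (fun e => e < c).
Proof. by move=> c0; exists (c / 2) => [|e _ ec]; lra. Qed.

Lemma small_scale k P : 0 < k -> small P -> small (fun e => P (k * e)).
Proof.
move=> k0 [e0 e00 Pe]; exists (e0 / k) => [|e e_gt0 ee]; first by rewrite divr_gt0.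
by apply: Pe; rewrite ?mulr_gt0 // mulrC -ler_pdivlMr.
Qed.

Lemma small_fin (T : finType) (P : T -> R -> Prop) :
  (forall i, small (P i)) -> small (fun e => forall i, P i e).
Proof.
move=> sP; have [s sE] : exists s : seq T, forall i, i \in s.
  by exists (enum T) => i; rewrite mem_enum.
suff : small (fun e => forall i, i \in s -> P i e).
  by apply: small_imp => e _ h i; exact: h.
elim: s {sE} => [|i s IH]; first by exists 1.
apply: small_imp (smallI (sP i) IH) => e _ [h1 h2] j.
by rewrite inE => /orP[/eqP ->|]; [|exact: h2].
Qed.

Lemma small_inv C : small (fun e => C <= e^-1).
Proof.
have C1 : 0 < `|C| + 1 by rewrite ltr_wpDl.
apply: small_imp (small_lt (_ : 0 < (`|C| + 1)^-1)) => [e e0|]; last by rewrite invr_gt0.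
rewrite -[e in e < _]invrK ltf_pV2 ?posrE ?invr_gt0 // => /ltW; apply: le_trans.
by rewrite (le_trans (ler_norm C)) // lerDl.
Qed.

Lemma small_nbhs (V : normedModType R) (x0 : V) (A : set V) :
  nbhs x0 A -> small (fun e => forall x, `|x - x0| < e -> A x).
Proof.
move=> /nbhs_ballP[e0 /= e00 sub]; exists e0 => // e e_gt0 le x xe.
by apply: sub; rewrite -ball_normE /= distrC (lt_le_trans xe).
Qed.

End Small.

Section CkTheory.
Variables (R : realType) (V : normedModType R).
Implicit Types (O : set V) (f g : V -> R^o).

Lemma differentiable_near_eq f g x :
  (\near x, f x = g x) -> differentiable f x -> differentiable g x.
Proof.
move=> fg /diffP[dfc dfx]; apply/diffP.
(* The differential is defined by choice; the differential of [f] is exhibited as a witness for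
   [g]. *)
apply: (@getPex _ (fun (df : {linear V -> R^o}) => continuous df /\
  forall y, g y = g (lim (nbhs x)) + df (y - lim (nbhs x))
                  +o_(y \near x) (y - lim (nbhs x)))).
exists ('d f x); split=> // y.
have gx : g (lim (nbhs x)) = f (lim (nbhs x)).
  by rewrite lim_id // -(nbhs_singleton fg).
have hf : f = (fun y => f (lim (nbhs x)) + 'd f x (y - lim (nbhs x)))
   +o_ (nbhs x) (fun y => y - lim (nbhs x)) by apply/funext => z; exact: dfx.
suff e : g = (fun y => g (lim (nbhs x)) + 'd f x (y - lim (nbhs x)))
   +o_ (nbhs x) (fun y => y - lim (nbhs x)) by rewrite {1}e.
apply/eqaddoP => e e0; move/eqaddoP: hf => /(_ e e0) hf.
rewrite gx; near=> z.
have -> : (g - (fun y => f (lim (nbhs x)) + 'd f x (y - lim (nbhs x)))) z =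
  (f - (fun y => f (lim (nbhs x)) + 'd f x (y - lim (nbhs x)))) z.
  by rewrite /= !fctE (near fg z).
by near: z.
Unshelve. all: by end_near. Qed.

Lemma Ck_S k O f : Ck k.+1 O f -> Ck k O f.
Proof.
elim: k f => [|k IH] f [df Df] /=.
  by move=> x Ox; exact/differentiable_continuous/df.
by split=> // v; apply: IH; exact: Df.
Qed.

Lemma Ck_sub k O O' f : O' `<=` O -> Ck k O f -> Ck k O' f.
Proof.
move=> OO; elim: k f => [|k IH] f /=; first by move=> h x /OO; exact: h.
by move=> [h1 h2]; split=> [x /OO|v]; [exact: h1 | exact: IH].
Qed.

Lemma Ck_eq k O f g : open O -> (forall x, O x -> f x = g x) -> Ck k O f -> Ck k O g.
Proof.
move=> oO; have nO x : O x -> nbhs x O by move=> Ox; exact: open_nbhs_nbhs.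
elim: k f g => [|k IH] f g fg /=.
  move=> cf x Ox; have := cf x Ox; rewrite /prop_for /continuous_at /= -(fg x Ox).
  apply: cvg_trans; apply: near_eq_cvg.
  by near=> y; rewrite fg //; near: y; exact: nO.
move=> [df Df].
have fgn x : O x -> \near x, f x = g x.
  by move=> Ox; near=> y; rewrite fg //; near: y; exact: nO.
split=> [x Ox|v]; first exact: differentiable_near_eq (fgn _ Ox) (df _ Ox).
by apply: IH (Df v) => x Ox; apply: near_eq_derive; exact: fgn.
Unshelve. all: by end_near. Qed.

Lemma Ck_cst k O c : Ck k O (fun=> c).
Proof.
elim: k c => [|k IH] c /=; first by move=> x _; exact: cvg_cst.
split=> [x _|v]; first exact: differentiable_cst.
apply: (eq_ind _ (Ck k O) (IH 0)); apply/funext => x.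
by rewrite -[RHS]/('D_v (cst c) x) derive_cst.
Qed.

Lemma CkD k O f g : open O -> Ck k O f -> Ck k O g -> Ck k O (fun x => f x + g x).
Proof.
move=> oO; elim: k f g => [|k IH] f g /=.
  by move=> cf cg x Ox; apply: cvgD; [exact: cf | exact: cg].
move=> [df Df] [dg Dg]; split=> [x Ox|v].
  by apply: (@differentiableD _ _ _ f g x); [exact: df | exact: dg].
apply: (Ck_eq oO _ (IH _ _ (Df v) (Dg v))) => x Ox.
by rewrite -[RHS]/('D_v (f + g) x) deriveD //; apply: diff_derivable; [exact: df|exact: dg].
Qed.

Lemma CkM k O f g : open O -> Ck k O f -> Ck k O g -> Ck k O (fun x => f x * g x).
Proof.
move=> oO; elim: k f g => [|k IH] f g.
  by move=> cf cg x Ox; apply: cvgM; [exact: cf | exact: cg].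
move=> Cf Cg; have Cf' := Ck_S Cf; have Cg' := Ck_S Cg.
case: Cf Cg => [df Df] [dg Dg]; split=> [x Ox|v].
  by apply: (@differentiableM _ _ f g x); [exact: df | exact: dg].
apply: (Ck_eq oO _ (CkD oO (IH _ _ Cf' (Dg v)) (IH _ _ Cg' (Df v)))) => x Ox.
by rewrite -[RHS]/('D_v (f * g) x) deriveM //; apply: diff_derivable; [exact: df|exact: dg].
Qed.

Lemma CkN k O f : open O -> Ck k O f -> Ck k O (fun x => - f x).
Proof.
move=> oO Cf; apply: Ck_eq oO _ (CkM oO (Ck_cst k O (-1)) Cf) => x _.
by rewrite mulN1r.
Qed.

Lemma deriv_expand O f (m : nat) (L : {linear 'rV[R]_m -> V}) q z :
  differentiable f q ->
  'D_(L z) f q = \sum_(i < m) z 0 i * 'D_(L (delta_mx 0 i)) f q.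
Proof.
move=> df; rewrite deriveE // {1}(row_sum_delta z) !linear_sum /=.
by apply: eq_bigr => i _; rewrite deriveE // !linearZ.
Qed.

Lemma directional_MVT f p v :
  (forall t : R, 0 <= t <= 1 -> differentiable f (p + t *: v)) ->
  exists2 t : R, 0 <= t <= 1 & f (p + v) - f p = 'D_v f (p + t *: v).
Proof.
move=> df; pose g (t : R) : R^o := f (p + t *: v).
have dg (t : R) : 0 <= t <= 1 -> is_derive t 1 g ('D_v f (p + t *: v)).
  move=> t01; have /diff_derivable dv := df _ t01.
  have e : (fun h : R => h^-1 *: ((g \o shift t) (h *: (1 : R^o)) - g t)) =
     (fun h : R => h^-1 *: ((f \o shift (p + t *: v)) (h *: v) - f (p + t *: v))).
    apply/funext => h; rewrite /g /=; congr (_ *: (f _ - _)).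
    by rewrite [h *: _]mulr1 scalerDl addrCA.
  by split; [rewrite /derivable e; exact: dv | rewrite /derive e].
have cg : {within `[0, 1], continuous g}.
  apply: derivable_within_continuous => t; rewrite in_itv /= => t01.
  by have [] := dg t t01.
have [t|t] := @MVT R g (fun t => 'D_v f (p + t *: v)) 0 1 ltr01 _ cg.
  by rewrite in_itv /= => /andP[t0 t1]; apply: dg; rewrite !ltW.
rewrite in_itv /= => /andP[t0 t1] e; exists t; first by rewrite !ltW.
by move: e; rewrite /g scale1r scale0r addr0 subr0 mulr1.
Qed.

End CkTheory.

Lemma coord_norm_le (R : realType) m (z : 'rV[R]_m) i : `|z 0 i| <= `|z|.
Proof. by rewrite [leRHS]mx_normrE; apply: (le_bigmax _ (fun ij => `|z ij.1 ij.2|) (0, i)). Qed.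

Lemma norm_row_le (R : realType) m (z : 'rV[R]_m) (c : R) :
  0 <= c -> (forall i, `|z 0 i| <= c) -> `|z| <= c.
Proof.
move=> c0 h; rewrite [leLHS]mx_normrE; apply/bigmax_leP; split=> // [[i j]] _ /=.
by rewrite ord1.
Qed.

(** For an affine inner map, a directional derivative of the composite is the composite with a
    directional derivative of [f] along the image direction, so the induction on [k] closes without
    a chain rule of higher order. *)
Lemma Ck_comp_affine (R : realType) (V W : normedModType R) k (O : set V)
    (f : V -> R^o) (L : {linear W -> V}) (c : V) :
  continuous L -> Ck k O f -> Ck k ((fun x => L x + c) @^-1` O) (fun x => f (L x + c)).
Proof.
move=> cL; elim: k f => [|k IH] f.
  move=> /= cf x Ox; apply: (@continuous_comp _ _ _ (fun x => L x + c) f); last exact: cf.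
  by apply: cvgD; [exact: cL | exact: cvg_cst].
move=> [df Df]; split=> [x Ox|v].
  apply: (@differentiable_comp _ _ _ _ (fun x => L x + c) f); last exact: df.
  apply: (@differentiableD _ _ _ L (cst c) x); first exact: linear_differentiable.
  exact: differentiable_cst.
apply: (eq_ind _ (Ck k _) (IH _ (Df (L v)))); apply/funext => x; rewrite /derive.
by congr (lim (_ @ 0^')); apply/funext => h /=; rewrite linearP addrA.
Qed.

Section LineMap.
Variables (R : realType) (V : normedModType R) (v : V).

(** Parametrizing a line by rows of length 1 makes the estimates stated for linear maps from row
    vectors apply to a single direction. *)
Definition line_map (z : 'rV[R]_1) : V := z 0 0 *: v.

Lemma line_map_is_linear : linear line_map.
Proof. by move=> k x y; rewrite /line_map !mxE scalerDl scalerA. Qed.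

HB.instance Definition _ := @GRing.isLinear.Build R 'rV[R]_1 V *:%R line_map
  line_map_is_linear.

End LineMap.

Section LocalEstimates.
Variables (R : realType) (V : normedModType R) (O : set V) (p0 : V).
Hypotheses (oO : open O) (Op0 : O p0).

Let small_O : small (fun e : R => forall p, `|p - p0| < e -> O p).
Proof. by apply: small_nbhs; exact: open_nbhs_nbhs. Qed.

Lemma linear_bound m (L : {linear 'rV[R]_m -> V}) :
  exists2 B : R, 0 < B & forall z, `|L z| <= B * `|z|.
Proof.
exists (\sum_i `|L (delta_mx 0 i)| + 1) => [|z].
  by rewrite ltr_wpDl // sumr_ge0.
rewrite {1}(row_sum_delta z) linear_sum (le_trans (ler_norm_sum _ _ _)) //.
rewrite mulrDl mul1r -[leLHS]addr0 lerD //.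
rewrite mulr_suml; apply: ler_sum => i _; rewrite linearZ /= normrZ mulrC.
by rewrite ler_wpM2l // coord_norm_le.
Qed.

Lemma linear_continuous_row m (L : {linear 'rV[R]_m -> V}) : continuous L.
Proof.
have [B B0 hB] := linear_bound L; apply: bounded_linear_continuous.
apply/linear_boundedP; exists B; split; first exact: gtr0_real.
by move=> C BC z; rewrite (le_trans (hB z)) // ler_wpM2r // ltW.
Qed.

Lemma small_in_O m (L : {linear 'rV[R]_m -> V}) :
  small (fun e => forall p z (t : R), `|p - p0| < e -> `|z| < e -> 0 <= t <= 1 ->
    O (p + t *: L z)).
Proof.
have [B B0 hB] := linear_bound L.
have B1 : 0 < 1 + B by rewrite ltr_wpDl.
apply: small_imp (small_scale B1 small_O) => e e0 h p z t pe ze /andP[t0 t1].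
apply: h; rewrite addrAC (le_lt_trans (ler_normD _ _)) // mulrDl mul1r.
rewrite ltr_leD // normrZ ger0_norm // -[leRHS]mul1r ler_pM //.
by rewrite (le_trans (hB z)) // ler_pM2l // ltW.
Qed.

Lemma small_local_bound (f : V -> R^o) : Ck 0 O f ->
  exists C, small (fun e => forall p, `|p - p0| < e -> `|f p| <= C).
Proof.
move=> cf; exists (`|f p0| + 1).
apply: (small_nbhs (A := fun p => `|f p| <= `|f p0| + 1)).
have /cvgrPdist_lt /(_ _ ltr01) := cf _ Op0; apply: filterS => p h.
rewrite -{1}(subKr (f p0) (f p)) (le_trans (ler_normB _ _)) // lerD2l ltW //.
Qed.

Lemma C1_lipschitz m (f : V -> R^o) (L : {linear 'rV[R]_m -> V}) : Ck 1 O f ->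
  small (fun e => forall p z, `|p - p0| < e -> `|z| < e ->
    `|f (p + L z) - f p| <= e^-1 * `|z|).
Proof.
move=> [df Df].
have /choice[C hC] : forall i : 'I_m, exists c, small (fun e =>
    forall p, `|p - p0| < e -> `|'D_(L (delta_mx 0 i)) f p| <= c).
  by move=> i; apply: small_local_bound; exact: Df.
have [B B0 hB] := linear_bound L; have B1 : 0 < 1 + B by rewrite ltr_wpDl.
(* The segment from [p] to [p + L z] stays within [(1 + B) * e] of [p0], hence the rescaling; [e^-1]
   absorbs the bounds on the partial derivatives. *)
have := smallI (small_in_O L) (smallI (small_scale B1 (small_fin hC))
  (small_inv (\sum_i C i))).
apply: small_imp => e e0 [h1 [h2 h3]] p z pe ze.
have [t|t t01 ->] := @directional_MVT _ _ f p (L z).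
  by move=> /(h1 p z _ pe ze); exact: df.
rewrite (deriv_expand O) ?(le_trans (ler_norm_sum _ _ _)) //; last exact/df/h1.
rewrite (le_trans _ (ler_wpM2r (normr_ge0 z) h3)) // mulr_suml ler_sum // => i _.
rewrite normrM mulrC ler_pM ?coord_norm_le //; apply: h2.
rewrite addrAC (le_lt_trans (ler_normD _ _)) // mulrDl mul1r.
rewrite ltr_leD // normrZ; case/andP: t01 => t0 t1; rewrite ger0_norm // -[leRHS]mul1r ler_pM //.
by rewrite (le_trans (hB z)) // ler_pM2l // ltW.
Qed.

(** The mixed difference is the difference along [L1 y] of a map [g] that is itself a difference
    along [L2 z]. The mean value theorem in [y] leaves a derivative of [g], to which the Lipschitz
    bound in [z] applies. *)
Lemma mixed_difference m k (f : V -> R^o) (L1 : {linear 'rV[R]_m -> V})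
    (L2 : {linear 'rV[R]_k -> V}) : Ck 2 O f ->
  small (fun e => forall p y z, `|p - p0| < e -> `|y| < e -> `|z| < e ->
    `|f (p + L1 y + L2 z) - f (p + L1 y) - f (p + L2 z) + f p|
       <= e^-1 * `|y| * `|z|).
Proof.
move=> C2; have [df Df] := C2.
have [B1 B10 hB1] := linear_bound L1; have [B2 B20 hB2] := linear_bound L2.
have K0 : 0 < 1 + B1 + B2 by rewrite addr_gt0 // ltr_wpDl.
pose D i := 'D_(L1 (delta_mx 0 i)) f.
have m0 : (0 : R) < m%:R + 1 by rewrite ltr_wpDl.
have K1 : 1 <= 1 + B1 + B2 by rewrite -addrA lerDl addr_ge0 // ltW.
(* The factor [1 + B1 + B2] keeps all points in the neighbourhood, and [m + 1] absorbs the sum over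
   the [m] coordinates of [y]. *)
have Km : 0 < (1 + B1 + B2) * (m%:R + 1) by rewrite mulr_gt0.
have mm : 1 <= m%:R + 1 :> R by rewrite lerDr.
have := smallI (small_scale K0 small_O)
  (small_scale Km (small_fin (fun i => C1_lipschitz L2 (Df (L1 (delta_mx 0 i)))))).
apply: small_imp => e e0 [hO hD] p y z pe ye ze.
have near_p t : 0 <= t <= 1 -> `|p + t *: L1 y - p0| < (1 + B1) * e.
  move=> /andP[t0 t1]; rewrite addrAC (le_lt_trans (ler_normD _ _)) // mulrDl mul1r.
  rewrite ltr_leD // normrZ ger0_norm // -[leRHS]mul1r ler_pM //.
  by rewrite (le_trans (hB1 y)) // ler_pM2l // ltW.
have L2e : `|L2 z| <= B2 * e by rewrite (le_trans (hB2 z)) // ler_pM2l // ltW.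
have in1 t : 0 <= t <= 1 -> O (p + t *: L1 y).
  move=> t01; apply: hO; rewrite (lt_le_trans (near_p t t01)) // mulrDl [leRHS]mulrDl.
  by rewrite -mulrDl lerDl mulr_ge0 // ltW.
have in2 t : 0 <= t <= 1 -> O (p + t *: L1 y + L2 z).
  move=> t01; apply: hO; rewrite addrAC (le_lt_trans (ler_normD _ _)) // mulrDl.
  by rewrite ltr_leD // near_p.
pose g := fun q => f (q + L2 z) - f q : R^o.
have dg q : O q -> O (q + L2 z) -> differentiable g q.
  move=> Oq Oq2; apply: (@differentiableB _ _ _ (fun q => f (q + L2 z)) f q); last exact: df.
  apply: (@differentiable_comp _ _ _ _ (fun q => q + L2 z) f); last exact: df.
  exact: (@differentiableD _ _ _ id (cst (L2 z)) q).
have Dg q v : O q -> O (q + L2 z) -> 'D_v g q = 'D_v f (q + L2 z) - 'D_v f q.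
  move=> Oq Oq2; rewrite -[LHS]/('D_v ((fun q => f (q + L2 z)) - f) q) deriveB.
  - congr (_ - _); rewrite /derive; congr (lim (_ @ 0^')); apply/funext => h /=.
    by rewrite addrA.
  - apply: diff_derivable.
    apply: (@differentiable_comp _ _ _ _ (fun q => q + L2 z) f); last exact: df.
    exact: (@differentiableD _ _ _ id (cst (L2 z)) q).
  - exact/diff_derivable/df.
have -> : f (p + L1 y + L2 z) - f (p + L1 y) - f (p + L2 z) + f p = g (p + L1 y) - g p.
  rewrite /g; move: (f p) (f (p + L1 y)) (f (p + L2 z)) (f (p + L1 y + L2 z)).
  by move=> *; zmod.
have [t t01|t t01 ->] := @directional_MVT _ _ g p (L1 y).
  by apply: dg; [exact: in1 | exact: in2].
rewrite (deriv_expand O); last by apply: dg; [exact: in1 | exact: in2].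
rewrite (le_trans (ler_norm_sum _ _ _)) //.
have small2 i : `|D i (p + t *: L1 y + L2 z) - D i (p + t *: L1 y)| <=
    ((1 + B1 + B2) * (m%:R + 1) * e)^-1 * `|z|.
  apply: hD; last first.
    by rewrite (lt_le_trans ze) // ler_peMl ?(ltW e0) // -[leLHS]mulr1 ler_pM.
  rewrite (lt_le_trans (near_p t t01)) // ler_pM2r // (le_trans (_ : _ <= 1 + B1 + B2)) //.
    by rewrite lerDl ltW.
  by rewrite ler_peMr // ltW.
rewrite (le_trans (_ : _ <= \sum_(i < m) `|y| * (((1 + B1 + B2) * (m%:R + 1) * e)^-1 * `|z|))) //.
  apply: ler_sum => i _; rewrite normrM ler_pM ?coord_norm_le //.
  by rewrite Dg; [exact: small2 | exact: in1 | exact: in2].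
rewrite sumr_const card_ord -(mulr_natl (`|y| * _)).
set w := (_ * e)^-1.
have -> : m%:R * (`|y| * (w * `|z|)) = m%:R * w * `|y| * `|z| by ring.
rewrite ler_wpM2r // ler_wpM2r // /w invfM mulrA ler_piMl ?invr_ge0 ?(ltW e0) //.
by rewrite ler_pdivrMr // mul1r (le_trans (_ : _ <= m%:R + 1)) ?lerDl // ler_peMl // ltW.
Qed.

(** The mean value theorem gives the derivative at an intermediate point, and the Lipschitz bound of
    the derivative along the line brings it back to [p]. *)
Lemma taylor2 (f : V -> R^o) v : Ck 2 O f ->
  small (fun e => forall p (s : R), `|p - p0| < e -> `|s| < e ->
    `|f (p + s *: v) - f p - s * 'D_v f p| <= e^-1 * s ^+ 2).
Proof.
move=> [df Df].
have D1 : Ck 1 O ('D_v f) by exact: Df.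
have v1 : 0 < 1 + `|v| by rewrite ltr_wpDr.
have := smallI (small_scale v1 small_O) (C1_lipschitz (line_map v) D1).
apply: small_imp => e e0 [hO hD] p s pe se.
have in1 t : 0 <= t <= 1 -> O (p + t *: (s *: v)).
  move=> /andP[t0 t1]; apply: hO; rewrite addrAC (le_lt_trans (ler_normD _ _)) //.
  rewrite mulrDl mul1r ltr_leD // scalerA normrZ [leRHS]mulrC ler_wpM2r //.
  by rewrite normrM ger0_norm // -[leRHS]mul1r ler_pM // ltW.
have [t|t /andP[t0 t1] ->] := @directional_MVT _ _ f p (s *: v).
  by move=> t01; exact/df/in1.
have -> : 'D_(s *: v) f (p + t *: (s *: v)) = s * 'D_v f (p + t *: (s *: v)).
  have /df dd : O (p + t *: (s *: v)) by apply: in1; rewrite t0.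
  by rewrite !deriveE // linearZ.
rewrite -mulrBr normrM -(real_normK (num_real s)) expr2 mulrCA ler_wpM2l //.
have nt : `|const_mx (t * s) : 'rV[R]_1| <= `|s|.
  by apply: norm_row_le => // i; rewrite mxE normrM (ger0_norm t0) ler_piMl.
have := hD p (const_mx (t * s)) pe (le_lt_trans nt se).
rewrite /= (_ : line_map v _ = t *: (s *: v)); last by rewrite /line_map mxE scalerA.
move=> /le_trans; apply.
by rewrite ler_wpM2l // invr_ge0 ltW.
Qed.

End LocalEstimates.

(** * The torus and the bundle *)

Section TorusTheory.
Variables (R : realType) (n : nat).
Implicit Types (u v : 'rV[R]_n) (x y : torus R n).

Lemma tptD u v : tpt (u + v) = tpt u + tpt v.
Proof. by rewrite /tpt pi_addr. Qed.

Lemma tptN u : tpt (- u) = - tpt u.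
Proof. by rewrite /tpt pi_oppr. Qed.

Lemma tptB u v : tpt (u - v) = tpt u - tpt v.
Proof. by rewrite tptD tptN. Qed.

Lemma tpt0 : tpt (0 : 'rV[R]_n) = 0.
Proof. by rewrite -(subrr (0 : 'rV[R]_n)) tptB subrr. Qed.

Lemma tpt_eq u v : tpt u = tpt v <-> int_vector (u - v).
Proof.
rewrite /tpt; split=> [/eqP|h]; first by rewrite -Quotient.idealrBE.
by apply/eqP; rewrite -Quotient.idealrBE.
Qed.

Lemma tpt_surj x : exists v, x = tpt v.
Proof. by exists (repr x); rewrite /tpt reprK. Qed.

Definition frac (v : 'rV[R]_n) : 'rV[R]_n := \row_i (v 0 i - (Num.floor (v 0 i))%:~R).

Lemma tpt_frac v : tpt (frac v) = tpt v.
Proof.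
apply/tpt_eq; rewrite /int_vector; apply/mxOverP => i j; rewrite !mxE ord1.
by rewrite addrAC subrr sub0r rpredN intr_int.
Qed.

Lemma frac_itv v i : 0 <= frac v 0 i < 1.
Proof.
have /andP[h1 h2] := mem_rg1_floor (v 0 i); by rewrite mxE subr_ge0 h1 ltrBlDl.
Qed.

Lemma enorm_le v : enorm v <= n%:R * `|v|.
Proof.
rewrite /enorm -[leRHS]ger0_norm ?mulr_ge0 // -sqrtr_sqr ler_wsqrtr //.
have [n0|n0] := posnP n.
  by subst n; rewrite big_ord0 mul0r expr2 mul0r.
rewrite exprMn (le_trans (_ : _ <= \sum_(i < n) `|v| ^+ 2)) //.
  apply: ler_sum => i _; rewrite -(real_normK (num_real (v 0 i))).
  by rewrite ler_pXn2r ?nnegrE // coord_norm_le.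
rewrite sumr_const card_ord -(mulr_natl (`|v| ^+ 2)) ler_wpM2r ?sqr_ge0 // expr2.
by rewrite ler_peMl // ler1n.
Qed.

Lemma tdist_le x v : tdist x (x + tpt v) <= enorm v.
Proof.
rewrite /tdist; apply: ge_inf.
  by exists 0 => _ [w _ <-]; exact: sqrtr_ge0.
exists (- v); first by rewrite /= tptN opprD addNKr.
by congr Num.sqrt; apply: eq_bigr => i _; rewrite mxE sqrrN.
Qed.

Lemma tdistC x y : tdist x y = tdist y x.
Proof.
rewrite /tdist; congr inf; rewrite eqEsubset; split=> _ [w /= ww <-]; exists (- w).
- by rewrite /= tptN ww opprB.
- by congr Num.sqrt; apply: eq_bigr => i _; rewrite mxE sqrrN.
- by rewrite /= tptN ww opprB.
- by congr Num.sqrt; apply: eq_bigr => i _; rewrite mxE sqrrN.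
Qed.

Lemma compact_cube : compact [set v : 'rV[R]_n | forall i, 0 <= v 0 i <= 1].
Proof.
have := @rV_compact _ n (fun=> `[(0:R), 1]%classic) (fun=> @segment_compact _ 0 1).
congr compact; apply/seteqP; split=> v /= h i; have := h i; by rewrite in_itv.
Qed.

(* Compactness of the torus; a single parameter e serves both as a radius and,
   through e^-1, as a bound. *)
Lemma torus_uniform (P : R -> torus R n -> Prop) :
  (forall e e' x, 0 < e' -> e' <= e -> P e x -> P e' x) ->
  (forall v0 : 'rV[R]_n, small (fun e => forall v, `|v - v0| < e -> P e (tpt v))) ->
  exists2 e, 0 < e & forall x, P e x.
Proof.
move=> anti loc.
have /choice[e he] : forall v0 : 'rV[R]_n, exists e, 0 < e /\
    forall v, `|v - v0| < e -> P e (tpt v).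
  by move=> v0; have [e e0 h] := loc v0; exists e; split=> //; exact: h.
have nc : near_covering [set v : 'rV[R]_n | forall i, 0 <= v 0 i <= 1].
  by rewrite -near_covering_withinP; apply/near_covering_withinP/compact_near_coveringP/compact_cube.
have := nc R (0 : R)^'+ (fun m v => P m (tpt v)) _; case.
  move=> v0 _; exists (ball v0 (e v0), [set m | 0 < m <= e v0]) => /=.
    split; first by apply: nbhsx_ballx; exact: (he v0).1.
    by near=> m => /=; apply/andP; split=> //; near: m; apply: nbhs_right_le; exact: (he v0).1.
  move=> [v m] /= [bv /andP[m0 me]]; apply: (anti (e v0)) => //; apply: (he v0).2.
  by move: bv; rewrite -ball_normE /= distrC.
move=> m0 /= m00 hm; exists (m0 / 2); first by rewrite divr_gt0.
move=> x; have [v ->] := tpt_surj x; rewrite -tpt_frac; apply: (hm (m0 / 2)) => /=.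
- by rewrite sub0r normrN gtr0_norm ?divr_gt0 // ltr_pdivrMr // ltr_pMr // ltr1n.
- by rewrite divr_gt0.
by move=> i; have /andP[-> /ltW ->] := frac_itv v i.
Unshelve. all: by end_near. Qed.

End TorusTheory.

(** * Complex numbers and Hermitian forms on a fiber *)

Section ComplexNumbers.
Variable R : realType.
Implicit Types z w : R[i].

Lemma ReD z w : complex.Re (z + w) = complex.Re z + complex.Re w.
Proof. by case: z w => [a b] [c d]. Qed.
Lemma ImD z w : complex.Im (z + w) = complex.Im z + complex.Im w.
Proof. by case: z w => [a b] [c d]. Qed.
Lemma ReN z : complex.Re (- z) = - complex.Re z. Proof. by case: z. Qed.
Lemma ImN z : complex.Im (- z) = - complex.Im z. Proof. by case: z. Qed.
Lemma ReB z w : complex.Re (z - w) = complex.Re z - complex.Re w.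
Proof. by rewrite ReD ReN. Qed.
Lemma ImB z w : complex.Im (z - w) = complex.Im z - complex.Im w.
Proof. by rewrite ImD ImN. Qed.
Lemma ReM z w : complex.Re (z * w) =
  complex.Re z * complex.Re w - complex.Im z * complex.Im w.
Proof. by case: z w => [a b] [c d]. Qed.
Lemma ImM z w : complex.Im (z * w) =
  complex.Re z * complex.Im w + complex.Im z * complex.Re w.
Proof. by case: z w => [a b] [c d]. Qed.
Lemma ReZ (k : R) z : complex.Re (k%:C * z) = k * complex.Re z.
Proof. by rewrite ReM /= mul0r subr0. Qed.
Lemma ImZ (k : R) z : complex.Im (k%:C * z) = k * complex.Im z.
Proof. by rewrite ImM /= mul0r addr0. Qed.
Lemma ReJ z : complex.Re (Num.conj z) = complex.Re z. Proof. by case: z. Qed.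
Lemma ImJ z : complex.Im (Num.conj z) = - complex.Im z. Proof. by case: z. Qed.

Lemma Re_sum I (s : seq I) (P : pred I) (F : I -> R[i]) :
  complex.Re (\sum_(i <- s | P i) F i) = \sum_(i <- s | P i) complex.Re (F i).
Proof. exact: (big_morph (@complex.Re R) ReD (erefl : complex.Re 0 = 0)). Qed.
Lemma eq_ReIm z w : complex.Re z = complex.Re w -> complex.Im z = complex.Im w -> z = w.
Proof. by case: z w => [a b] [c d] /= -> ->. Qed.

(** The l1 norm fits the definition of smoothness through real and imaginary parts. *)
Definition cabs z : R := `|complex.Re z| + `|complex.Im z|.

Lemma cabs_ge0 z : 0 <= cabs z. Proof. by rewrite addr_ge0. Qed.
Lemma cabs0 : cabs 0 = 0. Proof. by rewrite /cabs /= normr0 addr0. Qed.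
Lemma cabsD z w : cabs (z + w) <= cabs z + cabs w.
Proof. by rewrite /cabs ReD ImD addrACA lerD // ler_normD. Qed.
Lemma cabsM z w : cabs (z * w) <= cabs z * cabs w.
Proof.
rewrite /cabs ReM ImM (le_trans (lerD (ler_normB _ _) (ler_normD _ _))) //.
by rewrite !normrM; lra.
Qed.
Lemma cabs_sum I (s : seq I) (P : pred I) (F : I -> R[i]) :
  cabs (\sum_(i <- s | P i) F i) <= \sum_(i <- s | P i) cabs (F i).
Proof.
elim/big_rec2: _ => [|i x y _ h]; first by rewrite cabs0.
by rewrite (le_trans (cabsD _ _)) // lerD2l.
Qed.
Lemma Re_le_cabs z : `|complex.Re z| <= cabs z. Proof. by rewrite lerDl. Qed.
Lemma cabsJ z : cabs (Num.conj z) = cabs z.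
Proof. by rewrite /cabs ReJ ImJ normrN. Qed.

End ComplexNumbers.

Section DotProducts.
Variables (R : realType) (V : lmodType R[i]) (f : {dot V for @Num.conj R[i]}).

Definition re_dot (u v : V) : R := complex.Re (f u v).

Lemma dotC u v : f u v = Num.conj (f v u).
Proof. by rewrite hermC expr0 mul1r. Qed.

Lemma dotDl u v w : f (u + v) w = f u w + f v w.
Proof. exact: linearDl. Qed.
Lemma dotZl z u v : f (z *: u) v = z * f u v.
Proof. exact: linearZl_LR. Qed.
Lemma dotZr z u v : f u (z *: v) = Num.conj z * f u v.
Proof. exact: linearZr_LR. Qed.
Lemma dot0l u : f 0 u = 0. Proof. exact: linear0l. Qed.
Lemma dot_suml I (s : seq I) (P : pred I) F v :
  f (\sum_(i <- s | P i) F i) v = \sum_(i <- s | P i) f (F i) v.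
Proof. exact: linear_sumlz. Qed.
Lemma dot_sumr I (s : seq I) (P : pred I) F v :
  f v (\sum_(i <- s | P i) F i) = \sum_(i <- s | P i) f v (F i).
Proof. exact: linear_sumr. Qed.

Lemma re_dot_psd : psd re_dot.
Proof.
split=> [u v w|u v|k u v|u]; rewrite /re_dot.
- by rewrite dotDl ReD.
- by rewrite dotC ReJ.
- by rewrite dotZl ReZ.
- have [->|u0] := eqVneq u 0; first by rewrite dot0l.
  have : 0 < f u u by exact: neq0_dnorm_gt0.
  by rewrite ltcE => /andP[_ /ltW].
Qed.

Lemma re_dot_eq0 u : re_dot u u = 0 -> u = 0.
Proof.
move=> h; apply/eqP; apply: contraT => u0.
have : 0 < f u u by exact: neq0_dnorm_gt0.
by rewrite ltcE -/(re_dot u u) h ltxx andbF.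
Qed.

Lemma nb_re_dot_eq0 u : nb re_dot u = 0 -> u = 0.
Proof.
by move=> h; apply: re_dot_eq0; rewrite -(sqr_nb re_dot_psd) h expr0n.
Qed.

Lemma Im_dot u v : complex.Im (f u v) = re_dot u ('i *: v).
Proof. by rewrite /re_dot dotZr ReM ReJ ImJ /=; ring. Qed.

Lemma re_dotii u v : re_dot ('i *: u) ('i *: v) = re_dot u v.
Proof. by rewrite /re_dot dotZl dotZr !(ReM, ImM) ReJ ImJ /=; ring. Qed.

Lemma nbi u : nb re_dot ('i *: u) = nb re_dot u.
Proof. by rewrite /nb re_dotii. Qed.

Lemma cabs_dot u v : cabs (f u v) <= 2 * (nb re_dot u * nb re_dot v).
Proof.
rewrite /cabs Im_dot mulr2n mulrDl mul1r lerD //.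
  exact: (psd_abs re_dot_psd).
by rewrite -(nbi v) (psd_abs re_dot_psd).
Qed.

End DotProducts.

Section FiniteRiesz.
Variables (R : realType) (V : lmodType R[i]) (r : nat).
Variables (f : {dot V for @Num.conj R[i]}).
Variables (co : {linear V -> 'rV[R[i]]_r}) (coV : {linear 'rV[R[i]]_r -> V}).
Hypotheses (coK : cancel co coV) (coVK : cancel coV co).

Local Notation e k := (coV (delta_mx 0 k)).

Lemma coord_sum u : u = \sum_(k < r) co u 0 k *: e k.
Proof.
by rewrite -{1}(coK u) {1}(row_sum_delta (co u)) linear_sum; apply: eq_bigr => k _; rewrite linearZ.
Qed.

(** In coordinates the representing vector solves a linear system with the Gram matrix of the frame,
    which is invertible because the form is definite. The conjugations come from antilinearity in
    the second variable. *)
Lemma finite_riesz (l : {scalar V}) : exists w, forall u, l u = f u w.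
Proof.
pose G : 'M[R[i]]_r := \matrix_(j, k) f (e k) (e j).
have GE (a : 'rV[R[i]]_r) k :
    (a *m G) 0 k = f (e k) (coV (map_mx (@Num.conj R[i]) a)).
  have e := row_sum_delta (map_mx (@Num.conj R[i]) a).
  rewrite mxE {1}e linear_sum dot_sumr.
  by apply: eq_bigr => j _; rewrite linearZ dotZr !mxE conjCK.
have uG : G \in unitmx.
  rewrite -row_free_unit -kermx_eq0; apply/rowV0P => a /sub_kermxP aG0.
  have w0 : coV (map_mx (@Num.conj R[i]) a) = 0.
    set w := coV _; apply: (@re_dot_eq0 _ _ f); rewrite /re_dot {1}(coord_sum w).
    rewrite dot_suml big1 // => k _; rewrite dotZl -GE aG0 mxE mulr0 //.
  have := coVK (map_mx (@Num.conj R[i]) a); rewrite w0 linear0 => a0.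
  apply/rowP => k; have /rowP/(_ k) := a0; rewrite !mxE => /esym/eqP.
  by rewrite conjC_eq0 => /eqP.
pose b := (\row_k l (e k)) *m invmx G.
exists (coV (map_mx (@Num.conj R[i]) b)) => u.
rewrite {1 2}(coord_sum u) linear_sum dot_suml; apply: eq_bigr => k _.
by rewrite dotZl linearZ -GE /b mulmxKV // mxE.
Qed.

(** Each coordinate is a scalar functional, hence the pairing with a fixed vector, and
    Cauchy-Schwarz bounds it. *)
Lemma coord_bound : exists2 C : R, 0 < C & forall u,
  \sum_(k < r) cabs (co u 0 k) <= C * nb (re_dot f) u.
Proof.
have h k : exists w, forall u, co u 0 k = f u w.
  have @l : {scalar V}.
    exists (fun u => co u 0 k); do 2![eexists]; do ?[constructor].
    - by rewrite linear0 mxE.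
    - by move=> u v; rewrite linearD mxE.
    - by move=> a u; rewrite linearZ mxE.
  by have [w hw] := finite_riesz l; exists w.
have /choice[w hw] := h.
exists (\sum_k 2 * nb (re_dot f) (w k) + 1) => [|u].
  by rewrite ltr_wpDl // sumr_ge0 // => k _; rewrite mulr_ge0 // nb_ge0.
rewrite mulrDl mul1r -[leLHS]addr0 lerD ?nb_ge0 // mulr_suml; apply: ler_sum => k _.
by rewrite hw (le_trans (cabs_dot _ _ _)) // -mulrA [nb _ _ * _]mulrC.
Qed.

End FiniteRiesz.

(** * Smooth complex functions, local norms and smooth sections *)

Section CSmooth.
Variables (R : realType) (V : normedModType R).
Implicit Types (O : set V) (f g : V -> R[i]).

Lemma csmooth_eq O f g : open O -> (forall x, O x -> f x = g x) ->
  csmooth O f -> csmooth O g.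
Proof.
move=> oO fg [h1 h2]; split=> k.
  by apply: Ck_eq (h1 k) => // x Ox; rewrite fg.
by apply: Ck_eq (h2 k) => // x Ox; rewrite fg.
Qed.

Lemma csmooth_sub O O' f : O' `<=` O -> csmooth O f -> csmooth O' f.
Proof. by move=> s [h1 h2]; split=> k; apply: Ck_sub s _. Qed.

Lemma csmooth_cst O c : csmooth O (fun=> c).
Proof. by split=> k; exact: Ck_cst. Qed.

Lemma csmoothD O f g : open O -> csmooth O f -> csmooth O g ->
  csmooth O (fun x => f x + g x).
Proof.
move=> oO [f1 f2] [g1 g2]; split=> k.
  by apply: Ck_eq (CkD oO (f1 k) (g1 k)) => // x _; rewrite ReD.
by apply: Ck_eq (CkD oO (f2 k) (g2 k)) => // x _; rewrite ImD.
Qed.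

Lemma csmoothM O f g : open O -> csmooth O f -> csmooth O g ->
  csmooth O (fun x => f x * g x).
Proof.
move=> oO [f1 f2] [g1 g2]; split=> k.
  have := CkD oO (CkM oO (f1 k) (g1 k)) (CkN oO (CkM oO (f2 k) (g2 k))).
  by apply: Ck_eq => // x _; rewrite ReM.
have := CkD oO (CkM oO (f1 k) (g2 k)) (CkM oO (f2 k) (g1 k)).
by apply: Ck_eq => // x _; rewrite ImM.
Qed.

Lemma csmooth_sum O I (s : seq I) (F : I -> V -> R[i]) : open O ->
  (forall i, csmooth O (F i)) -> csmooth O (fun x => \sum_(i <- s) F i x).
Proof.
move=> oO hF; elim: s => [|i s IH].
  by apply: (csmooth_eq oO _ (csmooth_cst O 0)) => x _; rewrite big_nil.
by apply: (csmooth_eq oO _ (csmoothD oO (hF i) IH)) => x _; rewrite big_cons.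
Qed.

Lemma csmooth_mulmx O m n p (A : V -> 'M[R[i]]_(m, n)) (B : V -> 'M[R[i]]_(n, p)) :
  open O -> (forall i j, csmooth O (fun x => A x i j)) ->
  (forall i j, csmooth O (fun x => B x i j)) ->
  forall i j, csmooth O (fun x => (A x *m B x) i j).
Proof.
move=> oO hA hB i j.
apply: (csmooth_eq oO _ (csmooth_sum (index_enum _) oO
  (fun k => csmoothM oO (hA i k) (hB k j)))) => x _.
by rewrite mxE.
Qed.

Lemma csmooth_affine (W : normedModType R) O f (L : {linear W -> V}) c :
  continuous L -> csmooth O f ->
  csmooth ((fun x => L x + c) @^-1` O) (fun x => f (L x + c)).
Proof.
move=> cL [f1 f2]; split=> k.
  exact: (@Ck_comp_affine _ _ _ k O (fun x => complex.Re (f x)) L c cL (f1 k)).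
exact: (@Ck_comp_affine _ _ _ k O (fun x => complex.Im (f x)) L c cL (f2 k)).
Qed.

Lemma csmooth_local O f :
  (forall x, O x -> exists2 Q, Q x & csmooth Q f) -> csmooth O f.
Proof.
have loc (g : V -> R^o) k : (forall x, O x -> exists2 Q, Q x & Ck k Q g) -> Ck k O g.
  elim: k g => [|k IH] g h /=.
    by move=> x /h [Q Qx ck]; exact: (ck x Qx).
  split=> [x /h[Q Qx [dg _]]|v]; first exact: dg.
  by apply: IH => x /h[Q Qx [_ Dg]]; exists Q; [|exact: Dg].
by move=> h; split=> k; apply: loc => x /h[Q Qx [h1 h2]]; exists Q.
Qed.

End CSmooth.

Section CoordinateNorm.
Variables (R : realType) (r : nat).
Implicit Types a b : 'rV[R[i]]_r.

Definition mnorm a : R := \sum_(k < r) cabs (a 0 k).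

Lemma mnorm_ge0 a : 0 <= mnorm a.
Proof. by apply: sumr_ge0 => k _; exact: cabs_ge0. Qed.

Lemma cabs_le_mnorm a k : cabs (a 0 k) <= mnorm a.
Proof. by rewrite /mnorm (bigD1 k) //= lerDl sumr_ge0 // => j _; exact: cabs_ge0. Qed.

Lemma mnorm_le a c : (forall k, cabs (a 0 k) <= c) -> mnorm a <= r%:R * c.
Proof.
move=> h; rewrite (le_trans (ler_sum _ (fun k _ => h k))) //.
by rewrite sumr_const card_ord mulr_natl.
Qed.

Lemma mnorm_mulmx a (M : 'M[R[i]]_r) d : (forall j k, cabs (M j k) <= d) ->
  mnorm (a *m M) <= r%:R * (d * mnorm a).
Proof.
move=> h; apply: mnorm_le => k; rewrite mxE (le_trans (cabs_sum _ _ _)) //.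
rewrite mulr_sumr; apply: ler_sum => j _; rewrite (le_trans (cabsM _ _)) // mulrC.
by rewrite ler_wpM2r // cabs_ge0.
Qed.

Lemma hermitian_form_bound a (g : 'I_r -> 'I_r -> R[i]) B : 0 <= B ->
  (forall j k, cabs (g j k) <= B) ->
  cabs (\sum_j \sum_k a 0 j * (Num.conj (a 0 k) * g j k)) <= B * mnorm a ^+ 2.
Proof.
move=> B0 h; rewrite (le_trans (cabs_sum _ _ _)) //.
have -> : B * mnorm a ^+ 2 = \sum_j \sum_k cabs (a 0 j) * (cabs (a 0 k) * B).
  rewrite expr2 mulrC {1}/mnorm !mulr_suml; apply: eq_bigr => j _.
  by rewrite /mnorm mulr_sumr mulr_suml; apply: eq_bigr => k _; rewrite mulrA.
apply: ler_sum => j _; rewrite (le_trans (cabs_sum _ _ _)) //.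
apply: ler_sum => k _; rewrite (le_trans (cabsM _ _)) // ler_wpM2l ?cabs_ge0 //.
by rewrite (le_trans (cabsM _ _)) // cabsJ ler_wpM2l ?cabs_ge0.
Qed.

End CoordinateNorm.

Lemma csmooth_continuous (R : realType) (V : normedModType R) (O : set V)
    (f : V -> R[i]) x0 d : csmooth O f -> O x0 -> 0 < d ->
  small (fun e => forall x, `|x - x0| < e -> cabs (f x - f x0) <= d).
Proof.
move=> [f1 f2] Ox0 d0.
apply: (small_nbhs (A := fun x => cabs (f x - f x0) <= d)).
have d2 : 0 < d / 2 by rewrite divr_gt0.
have /cvgrPdist_lt /(_ _ d2) h1 := f1 0%N _ Ox0.
have /cvgrPdist_lt /(_ _ d2) h2 := f2 0%N _ Ox0.
near=> x; rewrite /cabs ReB ImB distrC [X in _ + X]distrC.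
have e1 : `|complex.Re (f x0) - complex.Re (f x)| < d / 2 by near: x.
have e2 : `|complex.Im (f x0) - complex.Im (f x)| < d / 2 by near: x.
by rewrite [leRHS](splitr d) lerD // ltW.
Unshelve. all: by end_near. Qed.

Section BundleNorms.
Variables (R : realType) (n r : nat) (E : clifford_bundle R n r).

Definition rd (x : torus R n) : E x -> E x -> R := re_dot (herm E x).
Arguments rd x : clear implicits.

Definition hn (x : torus R n) (u : E x) : R := nb (rd x) u.

Lemma rdP x : psd (rd x). Proof. exact: re_dot_psd. Qed.

Lemma hn_ge0 x (u : E x) : 0 <= hn u. Proof. exact: nb_ge0. Qed.

Lemma hn_eq0 x (u : E x) : hn u = 0 -> u = 0. Proof. exact: nb_re_dot_eq0. Qed.

Lemma hnormE x (u : E x) : hnorm u = hn u. Proof. by []. Qed.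

Lemma chart_nbhd (x0 : 'rV[R]_n) c : cdom (v := E) c (tpt x0) ->
  small (fun e => forall x, `|x - x0| < e -> cdom (v := E) c (tpt x)).
Proof.
move=> cx0; apply: (small_nbhs (A := @tpt R n @^-1` cdom (v := E) c)).
by apply: open_nbhs_nbhs; split=> //; exact: cdom_open.
Qed.

Lemma frame_sum c x (u : E x) : cdom c x ->
  u = \sum_(k < r) triv c x u 0 k *: trivV c x (delta_mx 0 k).
Proof. by move=> cx; apply: coord_sum; exact: trivK. Qed.

(** The comparison of fiber norm and coordinate norm holds at [x0] by finite dimension and persists
    nearby because the Gram matrix of the frame is continuous. *)
Lemma norm_equiv_local (x0 : 'rV[R]_n) c : cdom (v := E) c (tpt x0) ->
  small (fun e => forall x, `|x - x0| < e -> cdom c (tpt x) /\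
    forall u : E (tpt x), hn u <= e^-1 * mnorm (triv c (tpt x) u) /\
      mnorm (triv c (tpt x) u) <= e^-1 * hn u).
Proof.
move=> cx0.
pose G j k (x : 'rV[R]_n) := herm E (tpt x) (trivV c (tpt x) (delta_mx 0 j))
   (trivV c (tpt x) (delta_mx 0 k)).
have GS j k : csmooth (@tpt R n @^-1` cdom c) (G j k) := herm_smooth (c := E) c j k.
pose Q x (a : 'rV[R[i]]_r) := \sum_j \sum_k a 0 j * (Num.conj (a 0 k) * G j k x).
have QE x (u : E (tpt x)) : cdom c (tpt x) -> hn u ^+ 2 = complex.Re (Q x (triv c (tpt x) u)).
  move=> cx; rewrite (sqr_nb (rdP _)) /rd /re_dot {1 2}(frame_sum u cx) dot_suml.
  congr complex.Re; apply: eq_bigr => j _; rewrite dot_sumr; apply: eq_bigr => k _.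
  by rewrite dotZl dotZr.
have [C C0 hC] := coord_bound (herm E (tpt x0)) (trivK cx0) (trivVK cx0).
(* If the entries of the Gram matrix move by at most [d], the squared norm moves by at most
   [d * mnorm a ^+ 2]; multiplied by [C ^+ 2] this is half of [mnorm a ^+ 2] and is absorbed. *)
pose d := (2 * C ^+ 2)^-1.
have d0 : 0 < d by rewrite invr_gt0 mulr_gt0 // exprn_gt0.
pose B := \sum_j \sum_k cabs (G j k x0) + d.
have B0 : 0 <= B by rewrite addr_ge0 ?(ltW d0) // sumr_ge0 // => j _; rewrite sumr_ge0 // => k _; exact: cabs_ge0.
have hB j k : cabs (G j k x0) + d <= B.
  rewrite lerD2r (bigD1 j) //= (bigD1 k) //= -addrA lerDl addr_ge0 //.
    by rewrite sumr_ge0 // => l _; exact: cabs_ge0.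
  by rewrite sumr_ge0 // => l _; rewrite sumr_ge0 // => m _; exact: cabs_ge0.
have := smallI (chart_nbhd cx0) (smallI (small_fin (fun j => small_fin (fun k =>
  csmooth_continuous (GS j k) cx0 d0))) (smallI (small_inv (B + 1)) (small_inv (2 * C)))).
apply: small_imp => e e0 [h1 [h2 [h3 h4]]] x xe; have cx := h1 x xe.
split=> // u; set a := triv c (tpt x) u; have m0 := mnorm_ge0 a; have u0 := hn_ge0 u.
have Gx j k : cabs (G j k x) <= B.
  rewrite (le_trans _ (hB j k)) // -[G j k x](subrK (G j k x0)) addrC.
  by rewrite (le_trans (cabsD _ _)) // lerD2l h2.
split.
  rewrite (le_trans _ (ler_wpM2r m0 h3)) //.
  suff : hn u ^+ 2 <= ((B + 1) * mnorm a) ^+ 2.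
    have Bm : 0 <= (B + 1) * mnorm a by apply: mulr_ge0 => //; apply: addr_ge0.
    by rewrite ler_pXn2r // nnegrE.
  rewrite (QE x u cx) -/a.
  rewrite (le_trans (le_trans (ler_norm _) (Re_le_cabs _))) //.
  rewrite (le_trans (hermitian_form_bound a B0 Gx)) // exprMn ler_wpM2r ?sqr_ge0 //.
  by rewrite expr2; nra.
rewrite (le_trans _ (ler_wpM2r u0 h4)) //.
rewrite -(@ler_pXn2r _ 2) ?nnegrE ?mulr_ge0 ?(ltW C0) // exprMn.
have /(_ (trivV c (tpt x0) a)) := hC; rewrite (trivVK cx0) -/(mnorm a).
set u' := trivV c (tpt x0) a => hm.
have hm2 : mnorm a ^+ 2 <= C ^+ 2 * hn u' ^+ 2.
  by rewrite -exprMn ler_pXn2r ?nnegrE ?mulr_ge0 ?nb_ge0 // ltW.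
have hu' : hn u' ^+ 2 <= hn u ^+ 2 + d * mnorm a ^+ 2.
  rewrite !QE // (trivVK cx0) -/a -lerBlDl -ReB.
  rewrite (le_trans (le_trans (ler_norm _) (Re_le_cabs _))) //.
  have -> : Q x0 a - Q x a = \sum_j \sum_k a 0 j * (Num.conj (a 0 k) * (G j k x0 - G j k x)).
    rewrite -sumrB; apply: eq_bigr => j _; rewrite -sumrB; apply: eq_bigr => k _.
    by rewrite !mulrBr.
  apply: hermitian_form_bound; first exact: ltW.
  move=> j k; have := h2 j k x xe; rewrite /cabs !ReB !ImB.
  by rewrite distrC [X in _ + X <= _]distrC.
have hd : C ^+ 2 * (d * mnorm a ^+ 2) = mnorm a ^+ 2 / 2.
  by rewrite /d; field; rewrite gt_eqF.
have := ler_wpM2l (sqr_ge0 C) hu'; rewrite mulrDr hd; move: hm2.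
have : 0 <= (C * hn u) ^+ 2 by exact: sqr_ge0.
rewrite !exprMn; lra.
Qed.

End BundleNorms.

Arguments rd {R n r E} x.

Section SmoothSections.
Variables (R : realType) (n r : nat) (E : clifford_bundle R n r).
Implicit Types v : section E.

(** One chart around each point suffices: in any other chart the coordinates are multiplied by a
    smooth transition matrix. *)
Lemma smooth_section_local v :
  (forall x0, exists c, exists Q, [/\ open Q, Q x0, Q `<=` @tpt R n @^-1` cdom c &
    forall k, csmooth Q (fun x => triv (v := E) c (tpt x) (v (tpt x)) 0 k)]) ->
  smooth_section v.
Proof.
move=> h d k; apply: csmooth_local => x0 dx0; have [c [Q [oQ Qx0 Qc hQ]]] := h x0.
exists (Q `&` @tpt R n @^-1` cdom d); first by split.
have oQ' : open (Q `&` @tpt R n @^-1` cdom d).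
  by apply: openI => //; exact: cdom_open.
pose M (x : 'rV[R]_n) := lin1_mx (triv (v := E) d (tpt x) \o trivV c (tpt x)).
have MS i j : csmooth (Q `&` @tpt R n @^-1` cdom d) (fun x => M x i j).
  apply: csmooth_sub (transition_smooth (v := E) c d i j) => x [Qx dx].
  by split=> //; exact: Qc.
have := csmooth_mulmx oQ' (A := fun x => \row_k triv c (tpt x) (v (tpt x)) 0 k) (B := M) _ MS 0 k.
move=> /(_ _)/csmooth_eq; apply => //.
  move=> x [Qx dx] /=.
  have -> : \row_k triv c (tpt x) (v (tpt x)) 0 k = triv c (tpt x) (v (tpt x)).
    by apply/rowP => j; rewrite mxE.
  by rewrite /M mul_rV_lin1 /= (trivK (Qc _ Qx)).
move=> i j; apply: (csmooth_eq oQ' _ (csmooth_sub _ (hQ j))) => [x _|x []//].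
by rewrite mxE.
Qed.

Lemma smooth_sectionD v w : smooth_section v -> smooth_section w -> smooth_section (v + w).
Proof.
move=> sv sw c k; apply: csmooth_eq (csmoothD _ (sv c k) (sw c k)); try exact: cdom_open.
by move=> x _ /=; rewrite linearD mxE.
Qed.

Lemma smooth_sectionZ z v : smooth_section v -> smooth_section (z *: v).
Proof.
move=> sv c k.
apply: csmooth_eq (csmoothM _ (csmooth_cst _ z) (sv c k)); try exact: cdom_open.
by move=> x _ /=; rewrite linearZ mxE.
Qed.

Lemma smooth_section0 : smooth_section (0 : section E).
Proof.
move=> c k; apply: csmooth_eq (csmooth_cst _ 0); first exact: cdom_open.
by move=> x _ /=; rewrite linear0 mxE.
Qed.

Lemma smooth_sectionN v : smooth_section v -> smooth_section (- v).
Proof. by rewrite -scaleN1r; exact: smooth_sectionZ. Qed.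

Lemma smooth_sectionB v w : smooth_section v -> smooth_section w -> smooth_section (v - w).
Proof. by move=> sv sw; apply: smooth_sectionD => //; exact: smooth_sectionN. Qed.

Lemma smooth_section_sum I (s : seq I) (F : I -> section E) :
  (forall i, smooth_section (F i)) -> smooth_section (\sum_(i <- s) F i).
Proof.
move=> h; elim/big_rec: _ => [|i w _ sw]; first exact: smooth_section0.
exact: smooth_sectionD.
Qed.

Lemma smooth_section_endo (T : forall x, {linear E x -> E x}) v :
  smooth_endo (fun x => T x : _ -> _) -> smooth_section v ->
  smooth_section ((fun x => T x (v x)) : section E).
Proof.
move=> sT sv c k; have oO : open (@tpt R n @^-1` cdom (v := E) c) by exact: cdom_open.
have := csmooth_mulmx oO (A := fun x => \row_k triv c (tpt x) (v (tpt x)) 0 k) _ (sT c) 0 k.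
move=> /(_ _)/csmooth_eq; apply => //.
  move=> x cx /=.
  have -> : \row_k triv c (tpt x) (v (tpt x)) 0 k = triv c (tpt x) (v (tpt x)).
    by apply/rowP => j; rewrite mxE.
  by rewrite mul_rV_lin1 /= (trivK cx).
by move=> i j; apply: (csmooth_eq oO _ (sv c j)) => x _; rewrite mxE.
Qed.

End SmoothSections.

Lemma eq_le_ring (R : realType) (x y : R) : x = y -> x <= y.
Proof. by move=> ->. Qed.

Section LinearPair.
Variables (R : realType) (V W X : normedModType R).
Variables (f : {linear V -> W}) (g : {linear V -> X}).

Definition lpair (p : V) : W * X := (f p, g p).

Lemma lpair_is_linear : linear lpair.
Proof. by move=> k x y; rewrite /lpair !linearP. Qed.

HB.instance Definition _ := @GRing.isLinear.Build R V (W * X)%type *:%R lpair lpair_is_linear.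

Lemma lpair_continuous : continuous f -> continuous g -> continuous lpair.
Proof. by move=> cf cg x; apply: cvg_pair; [exact: cf | exact: cg]. Qed.

End LinearPair.

Section Combination3.
Variables (R : realType) (V : normedModType R) (a b c : R).

(** With coefficients [1, 1, 0] and [1, 1, 1] this gives the corners [x + y] and [x + y + z] of the
    triangle of a loop. *)
Definition comb3 (p : V * V * V) : V := a *: p.1.1 + b *: p.1.2 + c *: p.2.

Lemma comb3_is_linear : linear comb3.
Proof.
move=> k x y; rewrite /comb3 /= !scalerDr !scalerA.
rewrite ![_ * k]mulrC -!scalerA; zmod.
Qed.

HB.instance Definition _ := @GRing.isLinear.Build R (V * V * V)%type V *:%R comb3 comb3_is_linear.

Lemma comb3_continuous : continuous comb3.
Proof.
move=> p; apply: cvgD; first apply: cvgD.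
- by apply: cvgZr; apply: (@continuous_comp _ _ _ fst fst); exact: cvg_fst.
- by apply: cvgZr; apply: (@continuous_comp _ _ _ fst snd); [exact: cvg_fst | exact: cvg_snd].
- by apply: cvgZr; exact: cvg_snd.
Qed.

End Combination3.

Section FirstProjection.
Variables (R : realType) (V : normedModType R).

Definition proj11 (p : V * V * V) : V := p.1.1.

Lemma proj11_is_linear : linear proj11. Proof. by []. Qed.

HB.instance Definition _ := @GRing.isLinear.Build R (V * V * V)%type V *:%R proj11 proj11_is_linear.

Lemma proj11_continuous : continuous proj11.
Proof. by move=> p; apply: (@continuous_comp _ _ _ fst fst); exact: cvg_fst. Qed.

End FirstProjection.

(** * Parallel transport and covariant derivatives *)

Section Holonomy.
Variables (R : realType) (n r : nat) (E : clifford_bundle R n r) (a0 : R).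
Variables (U : link_variables E a0).
Hypothesis a0_gt0 : 0 < a0.

Lemma small_tdist (x0 : 'rV[R]_n) : small (fun e => forall x y,
  `|x - x0| < e -> `|y - x0| < e -> tdist (tpt x) (tpt y) < a0).
Proof.
have n1 : 0 < 2 * (n%:R + 1) :> R by rewrite mulr_gt0 // ltr_wpDl.
apply: small_imp (small_lt (divr_gt0 a0_gt0 n1)) => e e0.
rewrite ltr_pdivlMr // => ea x y xe ye.
rewrite -(subrK x y) addrC tptD (le_lt_trans (tdist_le _ _)) //.
rewrite (le_lt_trans (enorm_le _)) // (le_lt_trans _ ea) //.
have h : `|y - x| <= e * 2.
  rewrite -(subrK x0 y) -addrA (le_trans (ler_normD _ _)) // mulr2n mulrDr mulr1.
  by rewrite lerD // ltW // distrC.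
rewrite mulrA mulrC ler_pM // lerDl //.
Qed.

(** Matrices act on rows from the right, so products of [lmat] are read in the order in which the
    transports are applied. *)
Definition lmat c d (p : 'rV[R]_n * 'rV[R]_n) : 'M[R[i]]_r :=
  lin1_mx (triv (v := E) c (tpt p.1) \o U (tpt p.1) (tpt p.2) \o trivV d (tpt p.2)).

Lemma lmat_smooth c d (Q : set ('rV[R]_n * 'rV[R]_n)) :
  (forall p, Q p -> [/\ cdom (v := E) c (tpt p.1), cdom (v := E) d (tpt p.2) &
     tdist (tpt p.1) (tpt p.2) < a0]) ->
  forall j k, csmooth Q (fun p => lmat c d p j k).
Proof. by move=> h j k; apply: csmooth_sub (link_smooth U c d j k) => p /h. Qed.

Lemma lmatE c d p a : a *m lmat c d p =
  triv (v := E) c (tpt p.1) (U (tpt p.1) (tpt p.2) (trivV d (tpt p.2) a)).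
Proof. by rewrite /lmat mul_rV_lin1. Qed.

Lemma hn_link x y (u : E y) : tdist x y < a0 -> hn (U x y u) = hn u.
Proof.
move=> xy; rewrite /hn /nb /rd /re_dot; congr (Num.sqrt (complex.Re _)).
exact: link_unitary.
Qed.

Definition loop x1 x2 x3 (u : E x1) : E x1 := U x1 x2 (U x2 x3 (U x3 x1 u)).

Let loop_bound (e : R) (x : torus R n) := forall y z : 'rV[R]_n, `|y| < e -> `|z| < e ->
  forall u : E x, hn (loop (x + tpt y) (x + tpt y + tpt z) u - u) <= e^-1 * `|y| * `|z| * hn u.

(** The matrix [G] of the loop is a smooth function of [(x, y, z)] and is the identity as soon as
    [y] or [z] vanishes. Hence [G - 1] is a mixed second difference, of order [|y| |z|], uniformly
    by compactness of the torus. *)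
Let loop_uniform : exists2 e, 0 < e & forall x, loop_bound e x.
Proof.
apply: torus_uniform => [e e' x e0 le h y z ye ze u|x0].
  rewrite (le_trans (h y z _ _ u)) ?(lt_le_trans ye) ?(lt_le_trans ze) //.
  rewrite -!mulrA ler_wpM2r ?mulr_ge0 ?hn_ge0 // lef_pV2 ?posrE //.
  exact: lt_le_trans le.
have [c cx0] := cdom_cover E (tpt x0).
have [e1 e10 h1] := smallI (chart_nbhd cx0) (small_tdist x0).
have {h1} [hc ht] := h1 e1 e10 (lexx _).
pose V3 := ('rV[R]_n * 'rV[R]_n * 'rV[R]_n)%type.
pose s1 : {linear V3 -> 'rV[R]_n} := @proj11 R _.
pose s2 : {linear V3 -> 'rV[R]_n} := comb3 1 1 0.
pose s3 : {linear V3 -> 'rV[R]_n} := comb3 1 1 1.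
have cs1 : continuous s1 by move=> p; exact: proj11_continuous.
have cs2 : continuous s2 by move=> p; exact: comb3_continuous.
have cs3 : continuous s3 by move=> p; exact: comb3_continuous.
pose B := ball x0 e1.
have oB : open B by exact: ball_open.
pose Q := (s1 @^-1` B `&` s2 @^-1` B) `&` s3 @^-1` B.
have oQ : open Q.
  have o1 : open (s1 @^-1` B) by apply: open_comp => // p _; exact: cs1.
  have o2 : open (s2 @^-1` B) by apply: open_comp => // p _; exact: cs2.
  have o3 : open (s3 @^-1` B) by apply: open_comp => // p _; exact: cs3.
  by apply: openI => //; apply: openI.
pose BB : set ('rV[R]_n * 'rV[R]_n) := [set p | B p.1 /\ B p.2].
have Bn x : B x -> `|x - x0| < e1 by rewrite /B -ball_normE /= distrC.
have MS : forall j k, csmooth BB (fun p => lmat c c p j k).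
  apply: lmat_smooth => p [/Bn b1 /Bn b2]; split; [exact: hc | exact: hc | exact: ht].
have MS' (f g : {linear V3 -> 'rV[R]_n}) : continuous f -> continuous g ->
    Q `<=` f @^-1` B -> Q `<=` g @^-1` B ->
    forall j k, csmooth Q (fun p => lmat c c (f p, g p) j k).
  move=> cf cg Qf Qg j k.
  have := csmooth_affine (L := lpair f g) 0 (lpair_continuous cf cg) (MS j k).
  move=> /(csmooth_sub (O' := Q)) h; have {}h := h _.
  apply: (csmooth_eq oQ _ (h _)) => [p _|p Qp]; rewrite /= addr0 //.
  by split; [exact: Qf | exact: Qg].
pose G p := lmat c c (s3 p, s1 p) *m lmat c c (s2 p, s3 p) *m lmat c c (s1 p, s2 p).
have Q1 : Q `<=` s1 @^-1` B by move=> p [[]].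
have Q2 : Q `<=` s2 @^-1` B by move=> p [[]].
have Q3 : Q `<=` s3 @^-1` B by move=> p [].
have GS : forall j k, csmooth Q (fun p => G p j k).
  apply: csmooth_mulmx => //; first apply: csmooth_mulmx => //; exact: MS'.
have GE p u : Q p -> triv c (tpt (s1 p)) u *m G p =
    triv c (tpt (s1 p)) (loop (tpt (s2 p)) (tpt (s3 p)) u).
  move=> Qp; rewrite /G !mulmxA !lmatE /=.
  have c1 := hc _ (Bn _ (Q1 _ Qp)); have c2 := hc _ (Bn _ (Q2 _ Qp)).
  by have c3 := hc _ (Bn _ (Q3 _ Qp)); rewrite (trivK c1) (trivK c2) (trivK c3).
pose p0 : V3 := (x0, 0, 0).
have Qp y z x : `|x - x0| < e1 / 3 -> `|y| < e1 / 3 -> `|z| < e1 / 3 -> Q (x, y, z).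
  have Bx w : `|w - x0| < e1 -> B w by rewrite /B -ball_normE /= distrC.
  move=> xe ye ze.
  have q2 : B (s2 (x, y, z)).
    rewrite /s2 /= /comb3 /= !scale1r scale0r addr0; apply: Bx.
    by rewrite addrAC (le_lt_trans (ler_normD _ _)) //; lra.
  have q3 : B (s3 (x, y, z)).
    rewrite /s3 /= /comb3 /= !scale1r -addrA; apply: Bx.
    rewrite addrAC (le_lt_trans (ler_normD _ _)) //.
    by have := ler_normD y z; lra.
  have q1 : B (s1 (x, y, z)) by apply: Bx; rewrite /s1 /= /proj11 /=; lra.
  exact: (conj (conj q1 q2) q3).
have e13 : 0 < e1 / 3 by rewrite divr_gt0.
have Qp0 : Q p0 by apply: Qp; rewrite ?subrr ?normr0.
pose L1 : {linear 'rV[R]_n -> V3} := lpair (lpair \0 idfun) \0.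
pose L2 : {linear 'rV[R]_n -> V3} := lpair (lpair \0 \0) idfun.
have mdR := fun j k => mixed_difference oQ Qp0 L1 L2 ((GS j k).1 2%N).
have mdI := fun j k => mixed_difference oQ Qp0 L1 L2 ((GS j k).2 2%N).
have [e2 e20 h2] := smallI (norm_equiv_local cx0) (smallI (small_fin (fun j => small_fin (mdR j)))
  (smallI (small_fin (fun j => small_fin (mdI j))) (small_lt e13))).
have {h2} [hN [hR [hI e23]]] := h2 e2 e20 (lexx _).
(* Two factors [e2^-1] compare norms and one bounds the mixed difference; 2 counts real and
   imaginary parts, and [r] comes from the matrix product. *)
apply: small_imp (smallI (small_lt e20) (small_inv (e2^-1 * (r%:R * (2 * e2^-1 * e2^-1))))).
move=> e e0 [ee2 eC] v ve y z ye ze u.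
have p2 (w : 'rV[R]_n) : `|w| < e -> `|w| < e2 by move=> we; exact: lt_trans we ee2.
have p3 (w : 'rV[R]_n) : `|w| < e -> `|w| < e1 / 3 by move=> we; exact: lt_trans (p2 _ we) e23.
have z3 : `|0 : 'rV[R]_n| < e1 / 3 by rewrite normr0.
have sE (p : V3) : (tpt (s2 p) = tpt p.1.1 + tpt p.1.2) /\
    (tpt (s3 p) = tpt p.1.1 + tpt p.1.2 + tpt p.2).
  by rewrite /s2 /s3 /= /comb3 !scale1r scale0r addr0 !tptD.
have GE' y' z' : `|y'| < e1 / 3 -> `|z'| < e1 / 3 -> triv c (tpt v) u *m G (v, y', z') =
    triv c (tpt v) (loop (tpt v + tpt y') (tpt v + tpt y' + tpt z') u).
  move=> y3 z3'; have := GE (v, y', z') u (Qp y' z' v (p3 _ ve) y3 z3').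
  by have [-> ->] := sE (v, y', z').
have yd (w : 'rV[R]_n) : `|w| < e1 / 3 -> tdist (tpt v) (tpt v + tpt w) < a0.
  move=> w3; rewrite -tptD; apply: ht; first by have := p3 _ ve; lra.
  by rewrite addrAC (le_lt_trans (ler_normD _ _)) //; have := p3 _ ve; lra.
have L0 (w : 'rV[R]_n) : `|w| < e1 / 3 -> loop (tpt v + tpt w) (tpt v + tpt w) u = u.
  move=> w3; rewrite /loop link_id; apply: linkV; rewrite tdistC; exact: yd.
have L00 (w : 'rV[R]_n) : `|w| < e1 / 3 -> loop (tpt v) (tpt v + tpt w) u = u.
  move=> w3; rewrite /loop link_id; apply: linkV; rewrite tdistC; exact: yd.
set a := triv c (tpt v) u.
pose p : V3 := (v, 0, 0).
have pe : `|p - p0| < e2.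
  rewrite /p /p0 -[_ - _]/(v - x0, 0 - 0, 0 - 0 : 'rV[R]_n) !prod_normE /= subrr normr0.
  by rewrite !gt_max e20 !andbT; exact: p2.
pose D := G (p + L1 y + L2 z) - G (p + L1 y) - G (p + L2 z) + G p.
have De j k : cabs (D j k) <= 2 * e2^-1 * (`|y| * `|z|).
  have := hR j k p y z pe (p2 _ ye) (p2 _ ze); have := hI j k p y z pe (p2 _ ye) (p2 _ ze).
  rewrite /D; move: (G (p + L1 y + L2 z)) (G (p + L1 y)) (G (p + L2 z)) (G p).
  move=> A1 A2 A3 A4; rewrite /cabs !mxE !(ReD, ImD, ReN, ImN) => hi hr.
  by rewrite -(mulrA 2) mulr2n mulrDl mul1r mulrA lerD.
have padd (b1 b2 b3 d1 d2 d3 : 'rV[R]_n) :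
    ((b1, b2, b3) : V3) + (d1, d2, d3) = (b1 + d1, b2 + d2, b3 + d3) by [].
have l1 : L1 y = (0, y, 0) by [].
have l2 : L2 z = (0, 0, z) by [].
have py : p + L1 y = (v, y, 0) by rewrite l1 /p padd !addr0 add0r.
have pz : p + L2 z = (v, 0, z) by rewrite l2 /p padd !addr0 add0r.
have pyz : p + L1 y + L2 z = (v, y, z) by rewrite py l2 padd !addr0 add0r.
(* Three of the four corner values of [G] act as the identity, so the mixed difference is the defect
   of the loop. *)
have aD : triv c (tpt v) (loop (tpt v + tpt y) (tpt v + tpt y + tpt z) u - u) = a *m D.
  have g1 := GE' y z (p3 _ ye) (p3 _ ze).
  have g2 := GE' y 0 (p3 _ ye) z3.
  have g3 := GE' 0 z z3 (p3 _ ze).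
  have g4 := GE' 0 0 z3 z3.
  move: g2 g3 g4; rewrite !tpt0 !addr0 => g2 g3 g4.
  rewrite (L0 _ (p3 _ ye)) in g2; rewrite (L00 _ (p3 _ ze)) in g3.
  have := L00 0 z3; rewrite tpt0 addr0 => l00; rewrite l00 in g4.
  rewrite /D pyz py pz mulmxDr !mulmxBr g1 g2 g3 g4.
  by rewrite linearB /= subrK.
have [hN1 hN2] := (hN v (p2 _ ve)).2 (loop (tpt v + tpt y) (tpt v + tpt y + tpt z) u - u).
have [_ hN3] := (hN v (p2 _ ve)).2 u.
rewrite (le_trans hN1) // aD.
have ie : 0 <= e2^-1 by rewrite invr_ge0 ltW.
rewrite (le_trans (ler_wpM2l ie (mnorm_mulmx a De))) //.
have yz0 : 0 <= `|y| * `|z| by rewrite mulr_ge0.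
have -> : e^-1 * `|y| * `|z| * hn u = e^-1 * (`|y| * `|z| * hn u) by rewrite !mulrA.
apply: le_trans (ler_wpM2r (mulr_ge0 yz0 (hn_ge0 u)) eC).
apply: (@le_trans _ _ (e2^-1 * (r%:R * (2 * e2^-1 * (`|y| * `|z|) * (e2^-1 * hn u))))).
  by do 3 apply: ler_wpM2l => //; rewrite !mulr_ge0.
by apply: eq_le_ring; move: (e2^-1) (hn u) => e2i hu; ring.
Qed.

(* The curvature of U is bounded. *)
Lemma holonomy_bound : exists2 h, 0 < h & forall x (y z : 'rV[R]_n),
  `|y| < h -> `|z| < h -> forall u : E (x + tpt y + tpt z),
  hn (U x (x + tpt y) (U (x + tpt y) (x + tpt y + tpt z) u)
      - U x (x + tpt y + tpt z) u) <= h^-1 * `|y| * `|z| * hn u.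
Proof.
have [e e0 he] := loop_uniform.
have n1 : 0 < 2 * (n%:R + 1) :> R by rewrite mulr_gt0 // ltr_wpDl.
pose h := Num.min e (a0 / (2 * (n%:R + 1))).
have h0 : 0 < h by rewrite lt_min e0 divr_gt0.
exists h => // x y z yh zh u.
have yz : `|y + z| < a0 / (n%:R + 1).
  have : h <= a0 / (2 * (n%:R + 1)) by rewrite ge_min lexx orbT.
  have -> : a0 / (2 * (n%:R + 1)) = a0 / (n%:R + 1) / 2 by field; rewrite gt_eqF ?ltr_wpDl.
  by have := ler_normD y z; lra.
have td : tdist (x + tpt y + tpt z) x < a0.
  rewrite tdistC -addrA -tptD (le_lt_trans (tdist_le _ _)) // (le_lt_trans (enorm_le _)) //.
  move: yz; rewrite ltr_pdivlMr ?ltr_wpDl // => yz; rewrite (le_lt_trans _ yz) // mulrC.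
  by rewrite ler_wpM2l // lerDl.
have := he x y z (lt_le_trans yh _) (lt_le_trans zh _) (U x (x + tpt y + tpt z) u).
rewrite /h !ge_min lexx => /(_ erefl erefl); rewrite /loop linkV; last by rewrite tdistC.
rewrite hn_link; last by rewrite tdistC.
move=> /le_trans; apply; rewrite -!mulrA ler_wpM2r ?mulr_ge0 ?hn_ge0 // lef_pV2 ?posrE //.
by rewrite ge_min lexx.
Qed.

End Holonomy.

Section SectionDerivatives.
Variables (R : realType) (n r : nat) (E : clifford_bundle R n r) (a0 : R).
Variables (U : link_variables E a0).
Hypothesis a0_gt0 : 0 < a0.
Variables (i : 'I_n) (v : section E).

Definition transported (x : torus R n) (s : R) : E x :=
  U x (x + tstep s i) (v (x + tstep s i)).

Lemma tstep0 : tstep 0 i = 0 :> torus R n.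
Proof. by rewrite /tstep scale0r tpt0. Qed.

Lemma transported0 x : transported x 0 = v x.
Proof. by rewrite /transported tstep0 addr0 link_id. Qed.

(** The covariant derivative is a choice among the limits of the quotient; a second order expansion
    shows that [w] is such a limit, and limits are unique because the fiber norm is definite. *)
Lemma nabla_contE x (w : E x) (C : R) : 
  small (fun e => forall s : R, `|s| < e ->
     hn (transported x s - v x - s%:C *: w) <= C * s ^+ 2) ->
  nabla_cont U i v x = w.
Proof.
move=> [e e0 /(_ e e0 (lexx _)) he].
have quot (s : R) : s != 0 -> `|s| < e ->
    hnorm ((s^-1)%:C *: (transported x s - transported x 0) - w) <= C * `|s|.
  move=> s0 /he; rewrite transported0 hnormE => h.
  have -> : (s^-1)%:C *: (transported x s - v x) - w =
      (s^-1)%:C *: (transported x s - v x - s%:C *: w).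
    have e1 : (s^-1)%:C * s%:C = 1 :> R[i] by rewrite -rmorphM /= mulVf.
    by rewrite [RHS]scalerBr scalerA e1 scale1r.
  rewrite [X in X <= _](nbZ (rdP E x)) normfV ler_pdivrMl ?normr_gt0 // mulrC.
  by rewrite -mulrA -expr2 (real_normK (num_real s)).
have cv : (fun s : R => hnorm ((s^-1)%:C *: (transported x s - transported x 0) - w))
    @ (0 : R)^' --> (0 : R).
  apply/cvgrPdist_lt => d d0; near=> s; rewrite sub0r normrN ger0_norm ?sqrtr_ge0 //.
  have s0 : s != 0 by near: s; exact: nbhs_dnbhs_neq.
  have se : `|s| < e.
    by near: s; exact: dnbhs0_lt.
  have sd : `|s| < d / (`|C| + 1).
    by near: s; apply: dnbhs0_lt; rewrite divr_gt0 // ltr_wpDl.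
  rewrite (le_lt_trans (quot s s0 se)) //.
  move: sd; rewrite ltr_pdivlMr ?ltr_wpDl // mulrDr mulr1 => sd.
  rewrite (le_lt_trans _ sd) // (le_trans (_ : _ <= `|s| * `|C|)) ?lerDl //.
  by rewrite mulrC ler_wpM2l // ler_norm.
rewrite /nabla_cont /fiber_derive0; apply: xget_unique => // w' cv'.
have cv2 : (fun s : R => hnorm ((s^-1)%:C *: (transported x s - transported x 0) - w'))
    @ (0 : R)^' --> (0 : R) := cv'.
have h0 : hn (w' - w) <= 0.
  apply/ler_addgt0Pr => d d0; rewrite add0r.
  have d2 : 0 < d / 2 by rewrite divr_gt0.
  have n1 : \forall s \near (0 : R)^',
      `|0 - hnorm ((s^-1)%:C *: (transported x s - transported x 0) - w)| < d / 2.
    by move: (d / 2) d2; apply/cvgrPdist_lt.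
  have n2 : \forall s \near (0 : R)^',
      `|0 - hnorm ((s^-1)%:C *: (transported x s - transported x 0) - w')| < d / 2.
    by move: (d / 2) d2; apply/cvgrPdist_lt.
  have [s [hs1 hs2]] := @filter_ex _ (0 : R)^' _ _ (filterI n1 n2).
  have hs : hnorm ((s^-1)%:C *: (transported x s - transported x 0) - w)
      + hnorm ((s^-1)%:C *: (transported x s - transported x 0) - w') < d.
    move: hs1 hs2; rewrite !sub0r !normrN !ger0_norm ?sqrtr_ge0 //; lra.
  apply: le_trans (ltW hs); rewrite !hnormE.
  set q := (s^-1)%:C *: _.
  have -> : w' - w = (q - w) - (q - w') by zmod.
  exact: nbB (rdP E x) _ _.
have /hn_eq0/eqP : hn (w' - w) = 0 by apply/eqP; rewrite eq_le h0 hn_ge0.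
by rewrite subr_eq0 => /eqP.
Unshelve. all: by end_near. Qed.

Hypothesis sv : smooth_section v.

(** In a chart the transported section is a smooth function [W] of a pair of points, and [N] is its
    derivative in the second point, taken on the diagonal. So [N] is smooth and the Taylor remainder
    is uniform near [x0]. *)
Lemma local_taylor (x0 : 'rV[R]_n) : exists c, exists2 e1, 0 < e1 &
  (forall x, `|x - x0| < e1 -> cdom (v := E) c (tpt x)) /\
  exists2 N : 'rV[R]_n -> 'rV[R[i]]_r,
    (forall k, csmooth (ball x0 e1) (fun x => N x 0 k)) &
    small (fun e => forall x s, `|x - x0| < e -> `|s| < e ->
      hn (transported (tpt x) s - v (tpt x) - s%:C *: trivV c (tpt x) (N x))
      <= e^-1 * s ^+ 2).
Proof.
have [c cx0] := cdom_cover E (tpt x0).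
have [e1 e10 h1] := smallI (chart_nbhd cx0) (small_tdist a0_gt0 x0).
have {h1} [hc ht] := h1 e1 e10 (lexx _).
exists c, e1 => //; split=> //.
pose B := ball x0 e1; have oB : open B by exact: ball_open.
have Bn x : B x -> `|x - x0| < e1 by rewrite /B -ball_normE /= distrC.
have Bx x : `|x - x0| < e1 -> B x by rewrite /B -ball_normE /= distrC.
pose V2 := ('rV[R]_n * 'rV[R]_n)%type.
pose p1 : {linear V2 -> 'rV[R]_n} := fst.
pose p2 : {linear V2 -> 'rV[R]_n} := snd.
have cp1 : continuous p1 by move=> p; exact: cvg_fst.
have cp2 : continuous p2 by move=> p; exact: cvg_snd.
pose BB : set V2 := [set p | B p.1 /\ B p.2].
have oBB : open BB.
  have o1 : open (p1 @^-1` B) by apply: open_comp => // p _; exact: cp1.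
  have o2 : open (p2 @^-1` B) by apply: open_comp => // p _; exact: cp2.
  exact: openI.
have MS : forall j k, csmooth BB (fun p => lmat U c c p j k).
  apply: lmat_smooth => p [/Bn b1 /Bn b2]; split; [exact: hc | exact: hc | exact: ht].
have vS j : csmooth BB (fun p => triv (v := E) c (tpt p.2) (v (tpt p.2)) 0 j).
  have := csmooth_affine (L := p2) 0 cp2 (sv c j).
  have sub : BB `<=` (fun x : V2 => p2 x + 0) @^-1` (@tpt R n @^-1` cdom (v := E) c).
    by move=> p [_ /Bn /hc]; rewrite /preimage /= addr0.
  move=> /(csmooth_sub sub); apply: csmooth_eq => // p _ /=.
  by rewrite addr0.
pose W (p : V2) := (\row_j triv (v := E) c (tpt p.2) (v (tpt p.2)) 0 j) *m lmat U c c p.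
have WS k : csmooth BB (fun p => W p 0 k).
  apply: csmooth_mulmx => // l j; apply: csmooth_eq (vS j) => // p _.
  by rewrite mxE.
have WE p : BB p -> W p = triv c (tpt p.1) (U (tpt p.1) (tpt p.2) (v (tpt p.2))).
  move=> [b1 b2]; rewrite /W.
  have -> : \row_j triv c (tpt p.2) (v (tpt p.2)) 0 j = triv c (tpt p.2) (v (tpt p.2)).
    by apply/rowP => j; rewrite mxE.
  by rewrite lmatE (trivK (hc _ (Bn _ b2))).
pose d : V2 := (0, delta_mx 0 i).
pose DR k := 'D_d (fun p => complex.Re (W p 0 k) : R^o).
pose DI k := 'D_d (fun p => complex.Im (W p 0 k) : R^o).
pose N (x : 'rV[R]_n) : 'rV[R[i]]_r := \row_k Complex (DR k (x, x)) (DI k (x, x)).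
exists N => [k|].
  have cl : continuous (lpair idfun idfun : 'rV[R]_n -> V2).
    by apply: lpair_continuous => x; exact: cvg_id.
  have sub : ball x0 e1 `<=` (fun x : 'rV[R]_n => lpair idfun idfun x + 0 : V2) @^-1` BB.
    by move=> x xB; rewrite /preimage /= addr0.
  split=> l.
    have := Ck_comp_affine 0 cl (((WS k).1 l.+1).2 d).
    move=> /(Ck_sub sub); apply: Ck_eq => [|x _]; first exact: ball_open.
    by rewrite addr0 !mxE.
  have := Ck_comp_affine 0 cl (((WS k).2 l.+1).2 d).
  move=> /(Ck_sub sub); apply: Ck_eq => [|x _]; first exact: ball_open.
  by rewrite addr0 !mxE.
have b00 : BB (x0, x0) by split; exact: ballxx.
have tR := small_fin (fun k => taylor2 oBB b00 d ((WS k).1 2%N)).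
have tI := small_fin (fun k => taylor2 oBB b00 d ((WS k).2 2%N)).
have e12 : 0 < e1 / 2 by rewrite divr_gt0.
have [e2 e20 h2] := smallI (norm_equiv_local cx0) (smallI tR (smallI tI (small_lt e12))).
have {h2} [hN [hR [hI e2e]]] := h2 e2 e20 (lexx _).
have := smallI (small_lt e20) (small_inv (e2^-1 * (r%:R * (2 * e2^-1)))).
apply: small_imp => e e0 [ee2 eC] x s xe se.
have nd : `|s *: delta_mx 0 i : 'rV[R]_n| <= `|s|.
  apply: norm_row_le => // j; rewrite !mxE normrM ler_piMr //.
  by case: (_ && _); rewrite ?normr0 ?normr1.
have xB : B x by apply: Bx; lra.
have xsB : B (x + s *: delta_mx 0 i).
  by apply: Bx; rewrite addrAC (le_lt_trans (ler_normD _ _)) //; lra.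
have eqs : (x, x) + s *: d = (x, x + s *: delta_mx 0 i) :> V2.
  by rewrite /d -[s *: _]/(s *: 0, s *: delta_mx 0 i) -[_ + _]/(x + s *: 0, x + s *: delta_mx 0 i) scaler0 addr0.
have Ws : W ((x, x) + s *: d) = triv c (tpt x) (transported (tpt x) s).
  by rewrite eqs WE //= /transported /tstep tptD.
have W0 : W (x, x) = triv c (tpt x) (v (tpt x)) by rewrite WE //= link_id.
have xx : `|((x, x) : V2) - (x0, x0)| < e2.
  rewrite -[_ - _]/(x - x0, x - x0) prod_normE /= gt_max andbb.
  exact: lt_trans xe ee2.
have se2 : `|s| < e2 by exact: lt_trans se ee2.
set D := _ - _ - _.
have [hN1 _] := (hN x (lt_trans xe ee2)).2 D.
have De k : cabs (triv c (tpt x) D 0 k) <= 2 * e2^-1 * s ^+ 2.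
  have := hR k _ s xx se2; have := hI k _ s xx se2.
  have -> : triv c (tpt x) D = W ((x, x) + s *: d) - W (x, x) - s%:C *: N x.
    rewrite Ws W0 -[X in _ *: X](trivVK (hc _ (Bn _ xB))) /D.
    by rewrite 2!(linearB (triv c (tpt x))) linearZ.
  move: (W ((x, x) + s *: d)) (W (x, x)) => W1 W2 hi hr.
  rewrite !mxE /cabs !(ReD, ImD, ReN, ImN) ReZ ImZ /=.
  by rewrite mulr2n !mulrDl !mul1r lerD.
rewrite (le_trans hN1) //.
have ie : 0 <= e2^-1 by rewrite invr_ge0 ltW.
rewrite (le_trans (ler_wpM2l ie (mnorm_le De))) //.
rewrite (le_trans _ (ler_wpM2r (sqr_ge0 s) eC)) //.
by apply: eq_le_ring; move: (e2^-1) => e2i; ring.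
Qed.

Lemma smooth_nabla_cont : smooth_section (nabla_cont U i v).
Proof.
apply: smooth_section_local => x0.
have [c [e1 e10 [hc [N NS hT]]]] := local_taylor x0.
have [e2 e20 h2] := smallI hT (small_lt e10); have [he e21] := h2 e2 e20 (lexx _).
have sb : ball x0 e2 `<=` ball x0 e1 by apply: le_ball; exact: ltW.
exists c, (ball x0 e2); split.
- exact: ball_open.
- exact: ballxx.
- by move=> x; rewrite -ball_normE /= distrC => xe; apply: hc; exact: lt_trans e21.
move=> k; apply: csmooth_eq (csmooth_sub sb (NS k)) => [|x]; first exact: ball_open.
rewrite -ball_normE /= distrC => xe.
rewrite (nabla_contE (w := trivV c (tpt x) (N x)) (C := e2^-1)).
  by rewrite trivVK //; apply: hc; exact: lt_trans e21.
by apply: small_imp (small_lt e20) => e _ ee2 s se; apply: he => //; exact: lt_trans ee2.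
Qed.

Lemma section_taylor : exists2 e, 0 < e & forall x s, `|s| < e ->
  hn (transported x s - v x - s%:C *: nabla_cont U i v x) <= e^-1 * s ^+ 2.
Proof.
apply: (torus_uniform (P := fun e x => forall s, `|s| < e ->
  hn (transported x s - v x - s%:C *: nabla_cont U i v x) <= e^-1 * s ^+ 2)).
  move=> e e' x e'0 le h s se; rewrite (le_trans (h s (lt_le_trans se le))) //.
  by rewrite ler_wpM2r ?sqr_ge0 // lef_pV2 // posrE //; exact: lt_le_trans le.
move=> x0; have [c [e1 e10 [hc [N NS hT]]]] := local_taylor x0.
apply: small_imp hT => e e0 he x xe s se; have := he x s xe se.
rewrite (nabla_contE (w := trivV c (tpt x) (N x)) (C := e^-1)) //.
by apply: small_imp (small_lt e0) => e' _ ee t te; apply: he => //; exact: lt_trans ee.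
Qed.

Lemma section_bounded : exists2 C, 0 < C & forall x, hn (v x) <= C.
Proof.
have [e e0 he] : exists2 e, 0 < e & forall x, hn (v x) <= e^-1.
  apply: (torus_uniform (P := fun e x => hn (v x) <= e^-1)).
    move=> e e' x e'0 le h; rewrite (le_trans h) // lef_pV2 // posrE //.
    exact: lt_le_trans le.
  move=> x0; have [c cx0] := cdom_cover E (tpt x0).
  have [e1 e10 h1] := smallI (norm_equiv_local cx0)
    (small_fin (fun k => csmooth_continuous (sv c k) cx0 ltr01)).
  have [hN hC] := h1 e1 e10 (lexx _).
  apply: small_imp (smallI (small_lt e10) (small_inv (e1^-1 *
    (r%:R * (mnorm (triv c (tpt x0) (v (tpt x0))) + 1))))) => e e0 [ee eC] x xe.
  have xe1 := lt_trans xe ee; have [hN1 _] := (hN x xe1).2 (v (tpt x)).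
  have ie : 0 <= e1^-1 by rewrite invr_ge0 ltW.
  rewrite (le_trans hN1) // (le_trans _ eC) // ler_wpM2l //.
  apply: mnorm_le => k.
  rewrite -[X in cabs X](subrK (triv c (tpt x0) (v (tpt x0)) 0 k)).
  rewrite (le_trans (cabsD _ _)) // addrC lerD //; first exact: cabs_le_mnorm.
  exact: hC.
by exists e^-1; rewrite ?invr_gt0.
Qed.

End SectionDerivatives.

(** * Riemann sums *)

Section RowCons.
Variables (R : realType) (n : nat).
Implicit Types (s t : R) (y z : 'rV[R]_n).

Definition rowc s y : 'rV[R]_n.+1 := row_mx (s%:M : 'rV_1) y.

Lemma rowc0 s y : rowc s y 0 ord0 = s.
Proof.
rewrite mxE; case: splitP => // j _; by rewrite ord1 mxE eqxx mulr1n.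
Qed.

Lemma rowc_lift s y i : rowc s y 0 (lift ord0 i) = y 0 i.
Proof.
rewrite mxE; case: splitP => [j /= e|j /= [e]]; first by move: e; rewrite ord1.
by congr (y 0 _); apply: val_inj.
Qed.

Lemma eq_rowc (v w : 'rV[R]_n.+1) : v 0 ord0 = w 0 ord0 ->
  (forall i, v 0 (lift ord0 i) = w 0 (lift ord0 i)) -> v = w.
Proof.
move=> h0 h; apply/rowP => j; have [i ->|->] := unliftP ord0 j; first exact: h.
exact: h0.
Qed.

Lemma rowcP (v : 'rV[R]_n.+1) : v = rowc (v 0 ord0) (\row_i v 0 (lift ord0 i)).
Proof. by apply: eq_rowc => [|i]; rewrite ?rowc0 ?rowc_lift ?mxE. Qed.

Lemma rowcD s t y z : rowc s y + rowc t z = rowc (s + t) (y + z).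
Proof.
apply: eq_rowc => [|i]; rewrite [LHS]mxE; first by rewrite !rowc0.
by rewrite !rowc_lift mxE.
Qed.

Lemma rowcZ k s y : k *: rowc s y = rowc (k * s) (k *: y).
Proof.
apply: eq_rowc => [|i]; rewrite [LHS]mxE; first by rewrite !rowc0.
by rewrite !rowc_lift mxE.
Qed.

Lemma delta_rowc0 : delta_mx 0 ord0 = rowc 1 0.
Proof. by apply: eq_rowc => [|i]; rewrite ?rowc0 ?rowc_lift !mxE. Qed.

Lemma delta_rowcS i : delta_mx 0 (lift ord0 i) = rowc 0 (delta_mx 0 i).
Proof.
apply: eq_rowc => [|j]; rewrite ?rowc0 ?rowc_lift !mxE //=.
Qed.

Lemma norm_rowc s y : `|rowc s y| <= Num.max `|s| `|y|.
Proof.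
apply: norm_row_le => [|j]; first by rewrite le_max normr_ge0.
have [i ->|->] := unliftP ord0 j; rewrite ?rowc0 ?rowc_lift le_max ?lexx //.
by rewrite coord_norm_le orbT.
Qed.

End RowCons.

(** * Averages over the grids of the unit cube *)

Section Grid.
Variable R : realType.

(** The recursion on the dimension is that of [cube_integral], so that sums and integrals are
    compared one coordinate at a time. *)
Fixpoint grid (n K : nat) : seq 'rV[R]_n :=
  match n with
  | 0 => [:: 0]
  | n'.+1 => [seq rowc (k%:R / K%:R) y | k <- iota 0 K, y <- grid n' K]
  end.

Definition avg n K (g : 'rV[R]_n -> R) : R := (K%:R ^+ n)^-1 * \sum_(x <- grid n K) g x.

Lemma eq_avg n K (f g : 'rV[R]_n -> R) : f =1 g -> avg K f = avg K g.
Proof. by move=> fg; congr (_ * _); apply: eq_bigr => x _. Qed.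

Lemma avgD n K (f g : 'rV[R]_n -> R) : avg K (fun x => f x + g x) = avg K f + avg K g.
Proof. by rewrite /avg big_split mulrDr. Qed.

Lemma avgZ n K c (f : 'rV[R]_n -> R) : avg K (fun x => c * f x) = c * avg K f.
Proof. by rewrite /avg -mulr_sumr mulrCA. Qed.

Lemma avgN n K (f : 'rV[R]_n -> R) : avg K (fun x => - f x) = - avg K f.
Proof. by rewrite /avg sumrN mulrN. Qed.

Lemma avgB n K (f g : 'rV[R]_n -> R) : avg K (fun x => f x - g x) = avg K f - avg K g.
Proof. by rewrite avgD avgN. Qed.

Lemma avg_sum n K I (s : seq I) (F : I -> 'rV[R]_n -> R) :
  avg K (fun x => \sum_(i <- s) F i x) = \sum_(i <- s) avg K (F i).
Proof. by rewrite /avg exchange_big mulr_sumr. Qed.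

Lemma ler_avg_grid n K (f g : 'rV[R]_n -> R) :
  (forall x, x \in grid n K -> f x <= g x) -> avg K f <= avg K g.
Proof.
move=> fg; rewrite /avg ler_wpM2l ?invr_ge0 ?exprn_ge0 // !big_seq.
exact: ler_sum.
Qed.

Lemma ler_avg n K (f g : 'rV[R]_n -> R) : (forall x, f x <= g x) -> avg K f <= avg K g.
Proof. by move=> fg; apply: ler_avg_grid. Qed.

Lemma avg_ge0 n K (f : 'rV[R]_n -> R) : (forall x, 0 <= f x) -> 0 <= avg K f.
Proof. by move=> f0; rewrite mulr_ge0 ?invr_ge0 ?exprn_ge0 // sumr_ge0. Qed.

Lemma ler_norm_avg n K (f : 'rV[R]_n -> R) : `|avg K f| <= avg K (fun x => `|f x|).
Proof.
rewrite /avg normrM ger0_norm ?invr_ge0 ?exprn_ge0 //.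
by rewrite ler_wpM2l ?invr_ge0 ?exprn_ge0 // ler_norm_sum.
Qed.

Lemma avg0 K (g : 'rV[R]_0 -> R) : avg K g = g 0.
Proof. by rewrite /avg expr0 invr1 mul1r big_seq1. Qed.

Lemma avgS n K (g : 'rV[R]_n.+1 -> R) :
  avg K g = K%:R^-1 * \sum_(k < K) avg K (fun y => g (rowc (k%:R / K%:R) y)).
Proof.
rewrite {1}/avg /= big_allpairs_dep exprS invfM -mulrA; congr (_ * _).
rewrite mulr_sumr -{1}(subn0 K) -/(index_iota 0 K) big_mkord.
by apply: eq_bigr.
Qed.

Lemma size_grid n K : size (grid n K) = (K ^ n)%N.
Proof. by elim: n => //= n IH; rewrite size_allpairs IH size_iota expnS. Qed.

Lemma avg_cst n K (c : R) : (0 < K)%N -> avg (n := n) K (fun=> c) = c.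
Proof.
move=> K0; rewrite /avg big_const_seq count_predT size_grid iter_addr_0.
by rewrite -(mulr_natl c) natrX mulrA mulVf ?mul1r // expf_neq0 // pnatr_eq0 -lt0n.
Qed.

Lemma grid_itv n K x i : x \in grid n K -> 0 <= x 0 i < 1.
Proof.
elim: n x i => [|n IH] x i; first by case: i.
case/allpairsP => -[k y] /= [kK yg ->].
have [j ->|->] := unliftP ord0 i; first by rewrite rowc_lift IH.
move: kK; rewrite mem_iota add0n => /andP[_ kK].
have K0 : 0 < K%:R :> R by rewrite ltr0n (leq_ltn_trans _ kK).
by rewrite rowc0 divr_ge0 //= ltr_pdivrMr // mul1r ltr_nat.
Qed.

Lemma sqr_avg_le n K (f : 'rV[R]_n -> R) : (0 < K)%N ->
  avg K f ^+ 2 <= avg K (fun x => f x ^+ 2).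
Proof.
move=> K0; set m := avg K f.
have : 0 <= avg K (fun x => (f x - m) ^+ 2) by apply: avg_ge0 => x; exact: sqr_ge0.
rewrite (eq_avg _ (g := fun x => f x ^+ 2 - (2 * m * f x - m ^+ 2))); last by move=> x; ring.
by rewrite avgB avgB avgZ avg_cst // -/m; lra.
Qed.

Lemma avg_le_norm n K (f : 'rV[R]_n -> R) (A : R) : (0 < K)%N -> 0 <= A ->
  avg K (fun x => f x ^+ 2) <= A ^+ 2 -> avg K f <= A.
Proof.
move=> K0 A0 h; have h2 := le_trans (sqr_avg_le f K0) h.
have := ler_norm (avg K f); move/le_trans; apply.
by rewrite -(ger0_norm A0) -ler_sqr // !real_normK ?num_real.
Qed.

(** A unit shift moves one term from one end of the period to the other; the induction on [m] runs
    in both directions. *)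
Lemma periodic_sum (K : nat) (h : int -> R) (m : int) : (0 < K)%N ->
  (forall j, h (j + K%:Z) = h j) ->
  \sum_(k < K) h (k%:Z + m) = \sum_(k < K) h k%:Z.
Proof.
case: K => // K _ hp; pose S (j : int) := \sum_(k < K.+1) h (k%:Z + j).
have SS j : S (j + 1) = S j.
  rewrite /S big_ord_recr big_ord_recl /= [RHS]addrC; congr (_ + _); last first.
    by rewrite add0r -(hp j); congr h; lia.
  by apply: eq_bigr => k _; congr h; rewrite /bump /=; lia.
have S0 j : S j = S 0.
  elim: j => // [j IHj|j IHj].
    by have := SS j%:Z; rewrite IHj => <-; congr S; lia.
  by rewrite -IHj -(SS (- (j.+1)%:Z)); congr S; lia.
by rewrite -/(S m) S0; apply: eq_bigr => k _; rewrite addr0.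
Qed.

(** In the first coordinate this is a cyclic shift of a periodic sum; the others follow by induction
    on the dimension. *)
Lemma avg_shift n K (g : 'rV[R]_n -> R) (y : 'rV[R]_n) : (0 < K)%N ->
  (forall x w, int_vector w -> g (x + w) = g x) -> int_vector (K%:R *: y) ->
  avg K (fun x => g (x + y)) = avg K g.
Proof.
move=> K0; have K1 : K%:R != 0 :> R by rewrite pnatr_eq0 -lt0n.
elim: n g y => [|n IH] g y pg yK; first by rewrite !avg0 (_ : 0 + y = 0) //; apply/rowP; case.
rewrite !avgS; congr (_ * _); rewrite (rowcP y).
set t := y 0 ord0; set z := \row_i _.
have zK : int_vector (K%:R *: z).
  apply/mxOverP => i j; rewrite !mxE.
  by move/mxOverP: yK => /(_ 0 (lift ord0 j)); rewrite !mxE.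
transitivity (\sum_(k < K) avg K (fun x => g (rowc (k%:R / K%:R + t) x))).
  apply: eq_bigr => k _.
  rewrite -(IH (fun x => g (rowc (k%:R / K%:R + t) x)) z) //.
    by apply: eq_avg => x; rewrite rowcD.
  move=> x w /mxOverP iw; have -> : rowc (k%:R / K%:R + t) (x + w) = rowc (k%:R / K%:R + t) x + rowc 0 w.
    by rewrite rowcD addr0.
  apply: pg; apply/mxOverP => i j; rewrite ord1.
  have [l ->|->] := unliftP ord0 j; first by rewrite rowc_lift iw.
  by rewrite rowc0 rpred0.
have /intrP[m tm] : K%:R * t \is a Num.int.
  by move/mxOverP: yK => /(_ 0 ord0); rewrite !mxE.
have {}tm : t = m%:~R / K%:R by rewrite -tm mulrAC mulfV // mul1r.
pose h (j : int) := avg K (fun x => g (rowc (j%:~R / K%:R) x)).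
have hp j : h (j + K%:Z) = h j.
  apply: eq_avg => x; rewrite -[RHS](pg _ (rowc 1 0)); last first.
    apply/mxOverP => i l; rewrite ord1; have [l' ->|->] := unliftP ord0 l.
      by rewrite rowc_lift mxE rpred0.
    by rewrite rowc0 rpred1.
  by rewrite rowcD addr0 -[LHS]/(g _) intrD mulrDl -pmulrn mulfV.
transitivity (\sum_(k < K) h (k%:Z + m)).
  by apply: eq_bigr => k _; rewrite /h intrD mulrDl -pmulrn -tm.
by rewrite periodic_sum //; apply: eq_bigr => k _; rewrite /h -pmulrn.
Qed.

(** Each fine point is uniquely a coarse point [x] plus [N^-1] times a position [u] in the unit
    cell; in the first coordinate its index is [l + j * L]. *)
Lemma avg_refine n N L (g : 'rV[R]_n -> R) : (0 < N)%N -> (0 < L)%N ->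
  avg (N * L) g = avg L (fun u => avg N (fun x => g (x + N%:R^-1 *: u))).
Proof.
move=> N0 L0; have [N1 L1] : N%:R != 0 :> R /\ L%:R != 0 :> R by rewrite !pnatr_eq0 -!lt0n.
elim: n g => [|n IH] g; first by rewrite !avg0 scaler0 addr0.
pose G k := avg L (fun u => avg N (fun x =>
  g (rowc (k%:R / (N * L)%:R) (x + N%:R^-1 *: u)))).
rewrite !avgS.
have -> : \sum_(k < N * L) avg (N * L) (fun y => g (rowc (k%:R / (N * L)%:R) y))
    = \sum_(j < N) \sum_(l < L) G (l + j * L)%N.
  under eq_bigr => k _ do rewrite IH -/(G k).
  rewrite -(big_mkord xpredT G) big_nat_mul big_mkord; apply: eq_bigr => j _.
  by rewrite -{1}[(j * L)%N]add0n big_addn mulSn addnK big_mkord.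
rewrite exchange_big natrM invfM [N%:R^-1 * _]mulrC -mulrA; congr (_ * _).
rewrite mulr_sumr; apply: eq_bigr => l _.
transitivity (avg L (fun u => N%:R^-1 * \sum_(j < N) avg N (fun x =>
    g (rowc ((l + j * L)%:R / (N * L)%:R) (x + N%:R^-1 *: u))))).
  by rewrite avgZ avg_sum.
apply: eq_avg => u; rewrite avgS; congr (_ * _); apply: eq_bigr => j _.
apply: eq_avg => x; rewrite rowcZ rowcD; congr (g (rowc _ _)).
by rewrite natrD !natrM; field; rewrite N1 L1.
Qed.

(** A pair [s <= t] is [s, s + J] with [J = t - s], and the factor 2 counts both orders. On the
    right [s + J] may exceed [L]: the additional terms are nonnegative and make the range of [s]
    independent of [J]. *)
Lemma pair_sum_le L (V : lmodType R[i]) (b : V -> V -> R) (f : nat -> V) : psd b ->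
  \sum_(s < L) \sum_(t < L) b (f s - f t) (f s - f t) <=
  2 * \sum_(J < L) \sum_(s < L) b (f (s + J)%N - f s) (f (s + J)%N - f s).
Proof.
move=> pb; pose q u := b u u; pose Q s t := q (f s - f t).
have q0 u : 0 <= q u by exact: psd_ge0.
have Qs s t : Q s t = Q t s by rewrite /Q /q -opprB (psdNl pb) (psdNr pb) opprK.
have le1 : \sum_(s < L) \sum_(t < L | (s <= t)%N) Q t s <=
    \sum_(J < L) \sum_(s < L) Q (s + J)%N s.
  rewrite [leRHS]exchange_big; apply: ler_sum => s _.
  rewrite -(big_mkord (fun t => (s <= t)%N) (fun t => Q t s)).
  rewrite -(big_mkord xpredT (fun J => Q (s + J)%N s)).
  rewrite (big_cat_nat (n := s)) //=; last exact: ltnW.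
  rewrite big_nat_cond big_pred0 ?add0r; last first.
    by move=> t; rewrite ltnNge andbC; case: leqP.
  rewrite -{1}[s : nat]add0n big_addn.
  rewrite [leRHS](big_cat_nat (n := (L - s)%N)) ?leq_subr //= -[leLHS]addr0 lerD //.
    rewrite big_mkcond; apply: ler_sum => J _; rewrite leq_addl addnC //.
  by apply: sumr_ge0 => J _; exact: q0.
have -> : \sum_(s < L) \sum_(t < L) b (f s - f t) (f s - f t) = \sum_(s < L) \sum_(t < L) Q s t by [].
have le2 : \sum_(s < L) \sum_(t < L) Q s t <=
   \sum_(s < L) \sum_(t < L | (s <= t)%N) Q t s + \sum_(s < L) \sum_(t < L | (t <= s)%N) Q s t.
  rewrite -big_split; apply: ler_sum => s _; rewrite !(big_mkcond (fun t : 'I_L => _ <= _)%N) -big_split.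
  apply: ler_sum => t _ /=; have := q0 (f s - f t); rewrite -/(Q s t) (Qs t s).
  by case: (leqP s t); case: (leqP t s) => //; [lra | rewrite addr0 | rewrite add0r | lia].
have e : \sum_(s < L) \sum_(t < L | (t <= s)%N) Q s t = \sum_(s < L) \sum_(t < L | (s <= t)%N) Q t s.
  rewrite (exchange_big_dep xpredT) //=.
by move: le2; rewrite e; rewrite -/(\sum_(J < L) \sum_(s < L) Q (s + J)%N s); lra.
Qed.

(** The point [x] is moved to [y] one coordinate at a time. The first coordinate costs a 2 for
    splitting the difference and a 2 from [pair_sum_le], and [4 ^+ n] absorbs the repeated
    splitting. The shifted points may leave the cube, where [F] is not assumed periodic: it will be
    a transported section. *)
Lemma grid_poincare n L (V : lmodType R[i]) (b : V -> V -> R) (F : 'rV[R]_n -> V) :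
  psd b -> (0 < L)%N ->
  avg L (fun x => avg L (fun y => b (F x - F y) (F x - F y))) <=
  4 ^+ n * \sum_(i < n) (L%:R^-1 * \sum_(J < L) avg L (fun x =>
     let d := F (x + (J%:R / L%:R) *: delta_mx 0 i) - F x in b d d)).
Proof.
move=> pb L0; have L1 : 0 < L%:R :> R by rewrite ltr0n.
have iL : 0 <= L%:R^-1 :> R by rewrite invr_ge0 ltW.
elim: n F => [|n IH] F.
  by rewrite !avg0 subrr (psd0l pb) big_ord0 mulr0.
pose q u := b u u.
pose T0 := L%:R^-1 * \sum_(J < L) avg L (fun x : 'rV[R]_n.+1 =>
  q (F (x + (J%:R / L%:R) *: delta_mx 0 ord0) - F x)).
pose T1 (i : 'I_n) := L%:R^-1 * \sum_(J < L) avg L (fun x : 'rV[R]_n.+1 =>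
  q (F (x + (J%:R / L%:R) *: delta_mx 0 (lift ord0 i)) - F x)).
have T00 : 0 <= T0.
  by rewrite mulr_ge0 // sumr_ge0 // => J _; apply: avg_ge0 => x; exact: psd_ge0.
have T10 i : 0 <= T1 i.
  by rewrite mulr_ge0 // sumr_ge0 // => J _; apply: avg_ge0 => x; exact: psd_ge0.
have -> : \sum_(i < n.+1) (L%:R^-1 * \sum_(J < L) avg L (fun x =>
     let d := F (x + (J%:R / L%:R) *: delta_mx 0 i) - F x in b d d)) =
   T0 + \sum_(i < n) T1 i by rewrite big_ord_recl.
pose tl (x : 'rV[R]_n.+1) : 'rV[R]_n := \row_i x 0 (lift ord0 i).
have tlE s y : tl (rowc s y) = y by apply/rowP => i; rewrite mxE rowc_lift.
pose X (x y : 'rV[R]_n.+1) := q (F x - F (rowc (y 0 ord0) (tl x))).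
pose Y (x y : 'rV[R]_n.+1) := q (F (rowc (y 0 ord0) (tl x)) - F y).
have le1 : avg L (fun x => avg L (fun y => q (F x - F y))) <=
    2 * avg L (fun x => avg L (X x)) + 2 * avg L (fun x => avg L (Y x)).
  rewrite -!avgZ -avgD; apply: ler_avg => x; rewrite -!avgZ -avgD; apply: ler_avg => y.
  rewrite /X /Y (_ : F x - F y = (F x - F (rowc (y 0 ord0) (tl x))) +
    (F (rowc (y 0 ord0) (tl x)) - F y)); last by zmod.
  exact: (sqr_nbD pb).
have XT : avg L (fun x => avg L (X x)) <= 2 * T0.
  rewrite avgS.
  have -> : \sum_(s < L) avg L (fun x => avg L (X (rowc (s%:R / L%:R) x))) =
    avg L (fun x => L%:R^-1 * \sum_(s < L) \sum_(t < L)
      q (F (rowc (s%:R / L%:R) x) - F (rowc (t%:R / L%:R) x))).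
    rewrite -avg_sum; apply: eq_avg => x; rewrite mulr_sumr; apply: eq_bigr => s _.
    rewrite avgS; congr (_ * _); apply: eq_bigr => t _.
    rewrite (eq_avg _ (g := fun=> q (F (rowc (s%:R / L%:R) x) - F (rowc (t%:R / L%:R) x)))).
      exact: avg_cst.
    by move=> y; rewrite /X rowc0 tlE.
  rewrite /T0 [leRHS]mulrCA ler_wpM2l //.
  have -> : 2 * \sum_(J < L) avg L (fun x : 'rV[R]_n.+1 =>
      q (F (x + (J%:R / L%:R) *: delta_mx 0 ord0) - F x)) =
    avg L (fun x => L%:R^-1 * (2 * \sum_(J < L) \sum_(s < L)
      q (F (rowc ((s + J)%N%:R / L%:R) x) - F (rowc (s%:R / L%:R) x)))).
    rewrite avgZ avgZ mulrCA; congr (_ * _); rewrite avg_sum mulr_sumr.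
    apply: eq_bigr => J _; rewrite avgS; congr (_ * _); rewrite -avg_sum.
    apply: eq_avg => x; apply: eq_bigr => s _.
    by rewrite delta_rowc0 rowcZ rowcD mulr1 scaler0 addr0 natrD mulrDl.
  apply: ler_avg => x; rewrite ler_wpM2l //.
  exact: (pair_sum_le L (fun s => F (rowc (s%:R / L%:R) x)) pb).
have YT : avg L (fun x => avg L (Y x)) <= 4 ^+ n * \sum_(i < n) T1 i.
  have -> : avg L (fun x => avg L (Y x)) = L%:R^-1 * \sum_(t < L) avg L (fun x => avg L (fun y =>
      q (F (rowc (t%:R / L%:R) x) - F (rowc (t%:R / L%:R) y)))).
    rewrite avgS -avg_sum.
    transitivity (avg L (fun x : 'rV[R]_n => avg L (Y (rowc 0 x)))).
      rewrite avg_sum (eq_bigr (fun=> avg L (fun x : 'rV[R]_n => avg L (Y (rowc 0 x))))).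
        by rewrite sumr_const card_ord -(mulr_natl (avg _ _)) mulrA mulVf ?mul1r // gt_eqF.
      move=> s _; apply: eq_avg => x; apply: eq_avg => y.
      by rewrite /Y !tlE.
    rewrite -avg_sum -avgZ; apply: eq_avg => x; rewrite avgS; congr (_ * _).
    by apply: eq_bigr => t _; apply: eq_avg => y; rewrite /Y !tlE rowc0.
  have -> : 4 ^+ n * \sum_(i < n) T1 i = L%:R^-1 * \sum_(t < L) (4 ^+ n * \sum_(i < n)
     (L%:R^-1 * \sum_(J < L) avg L (fun x =>
       q (F (rowc (t%:R / L%:R) (x + (J%:R / L%:R) *: delta_mx 0 i)) - F (rowc (t%:R / L%:R) x))))).
    transitivity (4 ^+ n * (L%:R^-1 * \sum_(t < L) \sum_(i < n)
     (L%:R^-1 * \sum_(J < L) avg L (fun x =>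
       q (F (rowc (t%:R / L%:R) (x + (J%:R / L%:R) *: delta_mx 0 i)) - F (rowc (t%:R / L%:R) x))))));
      last by rewrite mulrCA mulr_sumr.
    congr (_ * _); rewrite [in RHS]exchange_big mulr_sumr.
    apply: eq_bigr => i _.
    transitivity (L%:R^-1 * (L%:R^-1 * \sum_(t < L) \sum_(J < L) avg L (fun x =>
       q (F (rowc (t%:R / L%:R) (x + (J%:R / L%:R) *: delta_mx 0 i)) - F (rowc (t%:R / L%:R) x)))));
      last by congr (_ * _); rewrite mulr_sumr.
    rewrite /T1; congr (_ * _); rewrite [in RHS]exchange_big mulr_sumr.
    apply: eq_bigr => J _; rewrite avgS; congr (_ * _).
    apply: eq_bigr => t _; apply: eq_avg => x.
    by rewrite delta_rowcS rowcZ rowcD mulr0 addr0.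
  rewrite ler_wpM2l //; apply: ler_sum => t _.
  exact: (IH (fun x => F (rowc (t%:R / L%:R) x))).
rewrite (le_trans le1) //.
have p4 : 1 <= 4 ^+ n :> R by rewrite exprn_ege1 // ler1n.
have S0 : 0 <= \sum_(i < n) T1 i by apply: sumr_ge0.
have h4 := ler_wpM2r T00 p4; have h5 := mulr_ge0 (le_trans ler01 p4) S0.
by rewrite exprS mulrDr -!mulrA; lra.
Qed.

(** Without periodicity, a shift by [J] slices exchanges [J] slices for their translates by a full
    unit; the average over all [L] slices dominates these differences. *)
Lemma avg_shift_defect n L (f : 'rV[R]_n -> R) (i : 'I_n) (J : nat) :
  (0 < L)%N -> (J <= L)%N ->
  `|avg L (fun x => f (x + (J%:R / L%:R) *: delta_mx 0 i)) - avg L f|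
  <= avg L (fun x => `|f (x + delta_mx 0 i) - f x|).
Proof.
move=> L0 JL; have L1 : 0 < L%:R :> R by rewrite ltr0n.
have iL : 0 <= L%:R^-1 :> R by rewrite invr_ge0 ltW.
elim: n f i => [|n IH] f i; first by case: i.
rewrite !avgS -mulrBr normrM ger0_norm // ler_wpM2l //.
have [j ->|->] := unliftP ord0 i.
  rewrite -sumrB (le_trans (ler_norm_sum _ _ _)) //; apply: ler_sum => k _.
  have := IH (fun y => f (rowc (k%:R / L%:R) y)) j; congr (`|_ - _| <= _).
    by apply: eq_avg => x; rewrite delta_rowcS rowcZ rowcD mulr0 addr0.
  by apply: eq_avg => x; rewrite delta_rowcS rowcD addr0.
pose h k := avg L (fun y => f (rowc (k%:R / L%:R) y)).
have e1 : \sum_(k < L) avg L (fun y => f (rowc (k%:R / L%:R) y + (J%:R / L%:R) *: delta_mx 0 ord0))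
   = \sum_(k < L) h (k + J)%N.
  apply: eq_bigr => k _; apply: eq_avg => y.
  by rewrite delta_rowc0 rowcZ rowcD mulr1 scaler0 addr0 natrD mulrDl.
rewrite e1 -/(\sum_(k < L) h k).
have e2 m : \sum_(k < L) h (k + m)%N - \sum_(k < L) h k = \sum_(k < m) (h (k + L)%N - h k).
  elim: m => [|m IHm]; first by rewrite big_ord0; under eq_bigr do rewrite addn0; rewrite subrr.
  rewrite big_ord_recr /= -IHm.
  have -> : \sum_(k < L) h (k + m.+1)%N = \sum_(k < L) h (k + m)%N + h (m + L)%N - h m.
    have := big_ord_recl L (fun k => h (k + m)%N) : \sum_(k < L.+1) _ = _.
    rewrite big_ord_recr /= add0n addnC => /(congr1 (fun z => z - h m)) ->.
    by rewrite addrAC subrr add0r; apply: eq_bigr => k _; rewrite /bump /= add1n addSnnS.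
  by lra.
rewrite e2 (le_trans (ler_norm_sum _ _ _)) //.
have le1 k : `|h (k + L)%N - h k| <= avg L (fun y => `|f (rowc (k%:R / L%:R) y + delta_mx 0 ord0) - f (rowc (k%:R / L%:R) y)|).
  rewrite /h -avgB (le_trans (ler_norm_avg _ _)) //; apply: ler_avg => y.
  by rewrite delta_rowc0 rowcD addr0 natrD mulrDl divff ?gt_eqF.
apply: (@le_trans _ _ (\sum_(k < J) avg L (fun y =>
   `|f (rowc (k%:R / L%:R) y + delta_mx 0 ord0) - f (rowc (k%:R / L%:R) y)|))).
  by apply: ler_sum => k _; exact: le1.
rewrite -!(big_mkord xpredT (fun k => avg L (fun y => `|f (rowc (k%:R / L%:R) y + delta_mx 0 ord0) - f (rowc (k%:R / L%:R) y)|))).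
rewrite [leRHS](big_cat_nat (n := J)) //= lerDl sumr_ge0 // => k _.
by apply: avg_ge0.
Qed.

End Grid.

(** * Riemann sums of uniformly continuous functions *)

Section RiemannSums.
Variable R : realType.

Local Notation mu := (@lebesgue_measure R).

Definition unif_cont n (g : 'rV[R]_n -> R) := forall e, 0 < e ->
  exists2 d, 0 < d & forall x y, `|x - y| <= d -> `|g x - g y| <= e.

Lemma unif_cont_rowc n (g : 'rV[R]_n.+1 -> R) s :
  unif_cont g -> unif_cont (fun y => g (rowc s y)).
Proof.
move=> ug e e0; have [d d0 h] := ug e e0; exists d => // x y xy; apply: h.
have -> : rowc s x - rowc s y = rowc 0 (x - y).
  by rewrite -scaleN1r rowcZ rowcD mulN1r subrr scaleN1r.
by rewrite (le_trans (norm_rowc _ _)) // normr0 ge_max xy ltW.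
Qed.

Lemma riemann_1d (f : R -> R) (K : nat) e : (0 < K)%N -> continuous f ->
  (forall s t, `|s - t| <= K%:R^-1 -> `|f s - f t| <= e) ->
  `|Rintegral mu `[0, 1] f - K%:R^-1 * \sum_(k < K) f (k%:R / K%:R)| <= e.
Proof.
move=> K0 cf h; have K1 : 0 < K%:R :> R by rewrite ltr0n.
have intf a b : mu.-integrable `[a, b] (EFin \o f).
  apply: continuous_compact_integrable; first exact: segment_compact.
  exact: continuous_subspaceT.
have intc a b (c : R) : mu.-integrable `[a, b] (EFin \o cst c).
  apply: continuous_compact_integrable; first exact: segment_compact.
  by apply: continuous_subspaceT => x; exact: cvg_cst.
have cst_int (a b c : R) : a <= b -> Rintegral mu `[a, b] (cst c) = c * (b - a).
  move=> ab; rewrite Rintegral_cst //= lebesgue_measure_itv /= lte_fin.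
  by move: ab; rewrite le_eqVlt => /orP[/eqP ->|->]; rewrite ?ltxx ?subrr.
have piece (a b : R) : 0 <= a -> a <= b -> b - a <= K%:R^-1 ->
   `|Rintegral mu `[0, b] f - Rintegral mu `[0, a] f - f a * (b - a)| <= e * (b - a).
  move=> a0 ab bK.
  have := @Rintegral_itvB R f (BLeft 0) (BRight b) a (intf 0 b).
  rewrite !bnd_simp => /(_ a0 ab) ->.
  rewrite Rintegral_itv_obnd_cbnd; last first.
    apply: integrableS (intf a b) => //; apply: subset_itv; rewrite bnd_simp //.
  have up : Rintegral mu `[a, b] f <= Rintegral mu `[a, b] (cst (f a + e)).
    apply: le_Rintegral; [by [] | exact: intf | exact: intc |].
    move=> x; rewrite /= in_itv /= => /andP[ax xb].
    have : `|f x - f a| <= e by apply: h; rewrite ger0_norm ?subr_ge0 // (le_trans _ bK) // lerB.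
    by rewrite ler_norml => /andP[_]; rewrite lerBlDl.
  have lo : Rintegral mu `[a, b] (cst (f a - e)) <= Rintegral mu `[a, b] f.
    apply: le_Rintegral; [by [] | exact: intc | exact: intf |].
    move=> x; rewrite /= in_itv /= => /andP[ax xb].
    have : `|f x - f a| <= e by apply: h; rewrite ger0_norm ?subr_ge0 // (le_trans _ bK) // lerB.
    by rewrite ler_norml => /andP[+ _]; lra.
  move: up lo; rewrite !cst_int // !mulrDl ler_norml; move: (Rintegral _ _ _) => I h1 h2.
  by apply/andP; split; lra.
have part m : `|Rintegral mu `[0, m%:R / K%:R] f
    - K%:R^-1 * \sum_(k < m) f (k%:R / K%:R)| <= e * (m%:R / K%:R).
  elim: m => [|m IH].
    by rewrite big_ord0 !mul0r !mulr0 set_itv1 Rintegral_set1 subrr normr0.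
  have mK : m.+1%:R / K%:R - m%:R / K%:R = K%:R^-1 :> R.
    by rewrite -mulrBl -natrB // subSnn mul1r.
  have := piece (m%:R / K%:R) (m.+1%:R / K%:R) _ _ _; rewrite mK.
  move=> /(_ _ _ (lexx _)) P; have {P} := P _ _.
  rewrite divr_ge0 // -subr_ge0 mK invr_ge0 ler0n => /(_ erefl erefl) P.
  rewrite big_ord_recr /= mulrDr [K%:R^-1 * f _]mulrC.
  have -> : e * (m.+1%:R / K%:R) = e * K%:R^-1 + e * (m%:R / K%:R).
    by rewrite -(natr1 m) mulrDl mul1r mulrDr addrC.
  move: P IH; set I1 := Rintegral _ _ _; set I0 := Rintegral _ _ _.
  set S := K%:R^-1 * _; set T := f _ * _ => P IH.
  have -> : I1 - (S + T) = (I1 - I0 - T) + (I0 - S) by ring.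
  by rewrite (le_trans (ler_normD _ _)) // lerD.
by have := part K; rewrite divff ?gt_eqF // mulr1.
Qed.

Lemma riemann_error n (g : 'rV[R]_n -> R) : unif_cont g ->
  forall (K : nat) e, (0 < K)%N -> 
  (forall x y, `|x - y| <= K%:R^-1 -> `|g x - g y| <= e) ->
  `|cube_integral g - avg K g| <= n%:R * e.
Proof.
elim: n g => [|n IH] g ug K e K0 he.
  by rewrite avg0 /= subrr normr0 mul0r.
(* Two inner integrals are compared through Riemann sums of a common mesh [m], given by the
   induction hypothesis; applied to slices, this yields the continuity of the outer integrand
   [f]. *)
have close g1 g2 c : unif_cont g1 -> unif_cont g2 -> (forall x, `|g1 x - g2 x| <= c) ->
    `|cube_integral g1 - cube_integral (g2 : 'rV[R]_n -> R)| <= c.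
  move=> u1 u2 hc; apply/ler_addgt0Pr => d d0.
  have d3 : 0 < d / (2 * (n%:R + 1)) by rewrite divr_gt0 // mulr_gt0 // ltr_wpDl.
  have [d1 d10 h1] := u1 _ d3; have [d2 d20 h2] := u2 _ d3.
  have [m [m0 [m1 m2]]] : exists m : nat, (0 < m)%N /\ m%:R^-1 <= d1 /\ m%:R^-1 <= d2.
    have := archi_boundP (_ : 0 <= d1^-1 + d2^-1); rewrite addr_ge0 ?invr_ge0 ?ltW //.
    move=> /(_ isT); set m := Num.bound _ => hm.
    have i1 : 0 < d1^-1 by rewrite invr_gt0. have i2 : 0 < d2^-1 by rewrite invr_gt0.
    have m0 : 0 < m%:R :> R by rewrite (lt_trans _ hm) // addr_gt0.
    exists m; split; first by rewrite -(ltr0n R).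
    split; rewrite -[leRHS]invrK lef_pV2 ?posrE //; lra.
  have := IH _ u1 m _ m0 (fun x y xy => h1 x y (le_trans xy m1)).
  have := IH _ u2 m _ m0 (fun x y xy => h2 x y (le_trans xy m2)).
  have hav : `|avg m g1 - avg m g2| <= c.
    rewrite -avgB (le_trans (ler_norm_avg _ _)) //.
    by rewrite -[leRHS](avg_cst n c m0); apply: ler_avg.
  have nd : n%:R * (d / (2 * (n%:R + 1))) <= d / 2.
    have n1 : n%:R + 1 != 0 :> R by rewrite gt_eqF ?ltr_wpDl.
    have -> : n%:R * (d / (2 * (n%:R + 1))) = d / 2 * (n%:R / (n%:R + 1)) by field.
    rewrite ler_piMr ?divr_ge0 ?(ltW d0) // ler_pdivrMr ?ltr_wpDl // mul1r lerDl //.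
  move=> P2 P1.
  have -> : cube_integral g1 - cube_integral g2 = (cube_integral g1 - avg m g1)
     + (avg m g1 - avg m g2) - (cube_integral g2 - avg m g2) by ring.
  rewrite (le_trans (ler_normB _ _)) // (le_trans (lerD (ler_normD _ _) (lexx _))) //.
  lra.
pose f s := cube_integral (fun y => g (rowc s y)).
have rs s t (y : 'rV[R]_n) : `|rowc s y - rowc t y| <= `|s - t|.
  have -> : rowc s y - rowc t y = rowc (s - t) 0.
    by rewrite -scaleN1r rowcZ rowcD mulN1r scaleN1r subrr.
  by rewrite (le_trans (norm_rowc _ _)) // normr0 ge_max lexx normr_ge0.
have fmod s t c : (forall y, `|g (rowc s y) - g (rowc t y)| <= c) -> `|f s - f t| <= c.
  by move=> h; apply: close => //; exact: unif_cont_rowc.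
have cf : continuous f.
  move=> s; apply/cvgrPdist_le => d d0; have [d1 d10 h1] := ug d d0.
  have nt : \forall t \near s, `|s - t| <= d1.
    by apply/nbhs_normP; exists d1 => // t /= /ltW.
  apply: filterS nt => t st; apply: fmod => y; apply: h1.
  by rewrite (le_trans (rs _ _ _)).
have K1 : 0 < K%:R :> R by rewrite ltr0n.
have R1 := riemann_1d K0 cf (fun s t st => fmod s t e (fun y => he _ _ (le_trans (rs s t y) st))).
rewrite /= -/(Rintegral mu `[0, 1] f) avgS.
have iK : 0 <= K%:R^-1 :> R by rewrite invr_ge0 ltW.
set S := K%:R^-1 * _ in R1; set A := K%:R^-1 * _.
have SA : `|S - A| <= n%:R * e.
  rewrite /S /A -mulrBr -sumrB normrM ger0_norm // ler_pdivrMl //.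
  rewrite (le_trans (ler_norm_sum _ _ _)) // (le_trans (_ : _ <= \sum_(k < K) n%:R * e)) //.
    apply: ler_sum => k _; apply: IH => //; first exact: unif_cont_rowc.
    move=> x y xy; apply: he.
    have -> : rowc (k%:R / K%:R) x - rowc (k%:R / K%:R) y = rowc 0 (x - y).
      by rewrite -scaleN1r rowcZ rowcD mulN1r subrr scaleN1r.
    by rewrite (le_trans (norm_rowc _ _)) // normr0 ge_max xy invr_ge0 ltW.
  by rewrite sumr_const card_ord -(mulr_natl (_ * _)).
rewrite -(subrK S (Rintegral _ _ _)) -addrA (le_trans (ler_normD _ _)) //.
have -> : n.+1%:R * e = e + n%:R * e by rewrite -(natr1 n) mulrDl mul1r addrC.
exact: lerD.
Qed.

Lemma riemann_cvg n (g : 'rV[R]_n -> R) : unif_cont g ->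
  forall e, 0 < e -> exists K0 : nat, forall K, (K0 < K)%N ->
  `|cube_integral g - avg K g| <= e.
Proof.
move=> ug e e0.
have d0 : 0 < e / (n%:R + 1) by rewrite divr_gt0 // ltr_wpDl.
have [d d1 h] := ug _ d0.
exists (Num.bound d^-1) => K hK.
have K0 : (0 < K)%N by exact: leq_trans hK.
have K1 : K%:R^-1 <= d.
  rewrite -[leRHS]invrK lef_pV2 ?posrE ?invr_gt0 ?ltr0n //.
  have := archi_boundP (_ : 0 <= d^-1); rewrite invr_ge0 ltW // => /(_ isT) hb.
  by rewrite (le_trans (ltW hb)) // ler_nat ltnW.
rewrite (le_trans (riemann_error ug K0 (fun x y xy => h x y (le_trans xy K1)))) //.
by rewrite mulrCA ler_piMr ?(ltW e0) // ler_pdivrMr ?ltr_wpDl // mul1r lerDl.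
Qed.

End RiemannSums.

Lemma int_vectorN (R : realType) n (v : 'rV[R]_n) : int_vector v -> int_vector (- v).
Proof. by move=> /mxOverP h; apply/mxOverP => i j; rewrite mxE rpredN. Qed.

Lemma int_vectorD (R : realType) n (v w : 'rV[R]_n) :
  int_vector v -> int_vector w -> int_vector (v + w).
Proof.
by move=> /mxOverP hv /mxOverP hw; apply/mxOverP => i j; rewrite mxE rpredD.
Qed.

(** * Operators on the lattices of the torus *)

Section Transport.
Variables (R : realType) (n r : nat) (E : clifford_bundle R n r) (a0 : R).
Variables (U : link_variables E a0).
Implicit Types (u v w : section E) (x : torus R n) (y z : 'rV[R]_n).

Definition Psh y v : section E := fun x => U x (x + tpt y) (v (x + tpt y)).

Lemma Psh_is_linear y : linear (Psh y).
Proof. by move=> k u v; apply: functional_extensionality_dep => x; rewrite /Psh linearP. Qed.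

HB.instance Definition _ y :=
  @GRing.isLinear.Build R[i] (section E) (section E) *:%R (Psh y) (Psh_is_linear y).

Definition cl_sec i v : section E := fun x => cl E i x (v x).

Lemma cl_sec_is_linear i : linear (cl_sec i).
Proof. by move=> k u v; apply: functional_extensionality_dep => x; rewrite /cl_sec linearP. Qed.

HB.instance Definition _ i :=
  @GRing.isLinear.Build R[i] (section E) (section E) *:%R (cl_sec i) (cl_sec_is_linear i).

Lemma gam_sec_is_linear : linear (@gam_sec R n r E).
Proof. by move=> k u v; apply: functional_extensionality_dep => x; rewrite /gam_sec linearP. Qed.

HB.instance Definition _ :=
  @GRing.isLinear.Build R[i] (section E) (section E) *:%R (@gam_sec R n r E) gam_sec_is_linear.

Definition tavg K (g : torus R n -> R) : R := avg K (g \o @tpt R n).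

(** The forms of all meshes live on one space, the sections over the whole torus, so that different
    lattices can be compared; [bK K] reads only the points of mesh [1/K]. *)
Definition bK K v w : R := tavg K (fun x => rd x (v x) (w x)).

Lemma bK_psd K : psd (bK K).
Proof.
split=> [u v w|u v|k u v|u].
- by rewrite -avgD; apply: eq_avg => x /=; rewrite -(psdDl (rdP E _)).
- by apply: eq_avg => x /=; rewrite (psdC (rdP E _)).
- by rewrite -avgZ; apply: eq_avg => x /=; rewrite -(psdZl (rdP E _)).
- by apply: avg_ge0 => x /=; exact: psd_ge0 (rdP E _) _.
Qed.

Lemma tavg_shift K (g : torus R n -> R) y : (0 < K)%N -> int_vector (K%:R *: y) ->
  tavg K (fun x => g (x + tpt y)) = tavg K g.
Proof.
move=> K0 yK; rewrite /tavg -[RHS](avg_shift (y := y) K0) //.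
  by apply: eq_avg => x /=; rewrite tptD.
move=> x w iw /=; congr (g _); apply/tpt_eq.
by rewrite addrAC subrr add0r.
Qed.

Lemma nbK_dom K c u v : 0 <= c -> (forall x, hn (u x) <= c * hn (v x)) ->
  nb (bK K) u <= c * nb (bK K) v.
Proof.
move=> c0 h; rewrite -(ler_pXn2r (ltn0Sn 1)) ?nnegrE ?mulr_ge0 ?nb_ge0 //.
rewrite exprMn !(sqr_nb (bK_psd _)) -avgZ; apply: ler_avg => x /=.
rewrite -!(sqr_nb (rdP E _)) -exprMn ler_pXn2r ?nnegrE ?mulr_ge0 ?nb_ge0 //.
exact: h.
Qed.

Lemma nbK_le K c u : (0 < K)%N -> 0 <= c -> (forall x, hn (u x) <= c) ->
  nb (bK K) u <= c.
Proof.
move=> K0 c0 h; rewrite -(ler_pXn2r (ltn0Sn 1)) ?nnegrE ?nb_ge0 // (sqr_nb (bK_psd _)).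
rewrite -[leRHS](avg_cst n (c ^+ 2) K0); apply: ler_avg => x /=.
by rewrite -(sqr_nb (rdP E _)) ler_pXn2r ?nnegrE ?nb_ge0 //; exact: h.
Qed.

Lemma cl_secK i u : cl_sec i (cl_sec i u) = u.
Proof. by apply: functional_extensionality_dep => x; exact: cl_sqr. Qed.

Lemma gam_secK u : gam_sec (gam_sec u) = u.
Proof. by apply: functional_extensionality_dep => x; exact: gam_sqr. Qed.

Lemma cl_sec_anti i j u : i != j -> cl_sec i (cl_sec j u) + cl_sec j (cl_sec i u) = 0.
Proof. by move=> ij; apply: functional_extensionality_dep => x; exact: cl_cl. Qed.

Lemma gam_cl_sec i u : gam_sec (cl_sec i u) = - cl_sec i (gam_sec u).
Proof.
apply: functional_extensionality_dep => x; apply/eqP; rewrite -addr_eq0.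
by apply/eqP; exact: gam_cl.
Qed.

Lemma cl_sec_adj K i u v : bK K (cl_sec i u) v = bK K u (cl_sec i v).
Proof. by apply: eq_avg => x /=; rewrite /rd /re_dot cl_selfadj. Qed.

Lemma gam_sec_adj K u v : bK K (gam_sec u) v = bK K u (gam_sec v).
Proof. by apply: eq_avg => x /=; rewrite /rd /re_dot gam_selfadj. Qed.

Lemma nbK_cl K i u : nb (bK K) (cl_sec i u) = nb (bK K) u.
Proof. by rewrite /nb cl_sec_adj cl_secK. Qed.

Lemma nbK_gam K u : nb (bK K) (gam_sec u) = nb (bK K) u.
Proof. by rewrite /nb gam_sec_adj gam_secK. Qed.

(** [h] is at once a length below which the links are constrained and the inverse of a curvature
    bound. *)
Definition transport_scale (h : R) := [/\ 0 < h,
  forall x y, `|y| < h -> tdist x (x + tpt y) < a0 &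
  forall x y z, `|y| < h -> `|z| < h -> forall u : E (x + tpt y + tpt z),
    hn (U x (x + tpt y) (U (x + tpt y) (x + tpt y + tpt z) u)
      - U x (x + tpt y + tpt z) u) <= h^-1 * `|y| * `|z| * hn u].

Lemma transport_scale_exists : 0 < a0 -> exists h, transport_scale h.
Proof.
move=> a00; have [h h0 hol] := holonomy_bound U a00.
have n1 : 0 < n%:R + 1 :> R by rewrite ltr_wpDl.
pose k := Num.min h (a0 / (n%:R + 1)); have k0 : 0 < k by rewrite lt_min h0 divr_gt0.
exists k; split=> // [x y|x y z yk zk u].
  rewrite lt_min => /andP[_]; rewrite ltr_pdivlMr // => yk.
  rewrite (le_lt_trans (tdist_le _ _)) // (le_lt_trans (enorm_le _)) //.
  by rewrite (le_lt_trans _ yk) // mulrC ler_wpM2l // lerDl.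
move: yk zk; rewrite !lt_min => /andP[yh _] /andP[zh _].
rewrite (le_trans (hol x y z yh zh u)) // -!mulrA ler_wpM2r ?mulr_ge0 ?hn_ge0 //.
by rewrite lef_pV2 ?posrE // ge_min lexx.
Qed.

Variable h : R.
Hypothesis hS : transport_scale h.

Lemma scale_gt0 : 0 < h. Proof. by case: hS. Qed.
Let h0 := scale_gt0.

Lemma Psh_isom y u v x : `|y| < h ->
  rd x (Psh y u x) (Psh y v x) = rd (x + tpt y) (u (x + tpt y)) (v (x + tpt y)).
Proof.
move=> yh; case: hS => _ td _; rewrite /rd /re_dot /Psh link_unitary //.
exact: td.
Qed.

Lemma hn_Psh y u x : `|y| < h -> hn (Psh y u x) = hn (u (x + tpt y)).
Proof. by move=> yh; rewrite /hn /nb Psh_isom. Qed.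

Lemma bK_Psh K y u v : (0 < K)%N -> `|y| < h -> int_vector (K%:R *: y) ->
  bK K (Psh y u) (Psh y v) = bK K u v.
Proof.
move=> K0 yh yK; rewrite -[RHS](tavg_shift (fun x => rd x (u x) (v x)) K0 yK).
by apply: eq_avg => x /=; rewrite Psh_isom.
Qed.

Lemma nbK_Psh K y u : (0 < K)%N -> `|y| < h -> int_vector (K%:R *: y) ->
  nb (bK K) (Psh y u) = nb (bK K) u.
Proof. by move=> K0 yh yK; rewrite /nb bK_Psh. Qed.

Lemma Psh0 u : Psh 0 u = u.
Proof.
apply: functional_extensionality_dep => x.
rewrite -[LHS]/((fun q => U x q (u q)) (x + tpt 0)) tpt0 addr0 link_id //.
Qed.

Lemma PshK y u : `|y| < h -> Psh y (Psh (- y) u) = u.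
Proof.
move=> yh; apply: functional_extensionality_dep => x; case: hS => _ td _.
rewrite -[LHS]/((fun q => U x (x + tpt y) (U (x + tpt y) q (u q))) (x + tpt y + tpt (- y))).
by rewrite tptN addrK linkV // tdistC; exact: td.
Qed.

Lemma Psh_adj K y u v : (0 < K)%N -> `|y| < h -> int_vector (K%:R *: y) ->
  bK K (Psh y u) v = bK K u (Psh (- y) v).
Proof. by move=> K0 yh yK; rewrite -{1}(PshK v yh) bK_Psh. Qed.

Lemma Psh_cl y i u : `|y| < h -> cl_sec i (Psh y u) = Psh y (cl_sec i u).
Proof.
move=> yh; apply: functional_extensionality_dep => x; case: hS => _ td _.
by rewrite /cl_sec /Psh link_cl //; exact: td.
Qed.

Lemma Psh_gam y u : `|y| < h -> gam_sec (Psh y u) = Psh y (gam_sec u).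
Proof.
move=> yh; apply: functional_extensionality_dep => x; case: hS => _ td _.
by rewrite /gam_sec /Psh link_gam //; exact: td.
Qed.

Lemma Psh_hol y z u x : `|y| < h -> `|z| < h -> `|y + z| < h ->
  hn ((Psh y (Psh z u) - Psh (y + z) u) x) <= h^-1 * `|y| * `|z| * hn (Psh (y + z) u x).
Proof.
move=> yh zh yzh; rewrite hn_Psh //; case: hS => _ _ hol.
rewrite -[(Psh y (Psh z u) - Psh (y + z) u) x]/(U x (x + tpt y) (U (x + tpt y) (x + tpt y + tpt z)
  (u (x + tpt y + tpt z))) - (fun q => U x q (u q)) (x + tpt (y + z))).
by rewrite tptD addrA; exact: hol.
Qed.

Lemma nbK_hol K y z u : `|y| < h -> `|z| < h -> `|y + z| < h ->
  nb (bK K) (Psh y (Psh z u) - Psh (y + z) u) <= h^-1 * `|y| * `|z| * nb (bK K) (Psh (y + z) u).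
Proof.
move=> yh zh yzh; apply: nbK_dom => [|x]; last exact: Psh_hol.
by rewrite !mulr_ge0 // invr_ge0 ltW.
Qed.

(** Both orders are compared with the direct transport along [y + z]. *)
Lemma nbK_comm K y z u : (0 < K)%N -> `|y| < h -> `|z| < h -> `|y + z| < h ->
  int_vector (K%:R *: (y + z)) ->
  nb (bK K) (Psh y (Psh z u) - Psh z (Psh y u)) <= 2 * h^-1 * `|y| * `|z| * nb (bK K) u.
Proof.
move=> K0 yh zh yzh iyz.
have -> : Psh y (Psh z u) - Psh z (Psh y u) =
    (Psh y (Psh z u) - Psh (y + z) u) - (Psh z (Psh y u) - Psh (z + y) u).
  by rewrite [z + y]addrC; move: (Psh y _) (Psh z _) (Psh (y + z) u) => *; zmod.
rewrite (le_trans (nbB (bK_psd K) _ _)) //.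
have h1 := nbK_hol K u yh zh yzh.
have h2 := @nbK_hol K z y u zh yh _; rewrite [z + y]addrC in h2.
move: h1 (h2 yzh); rewrite nbK_Psh // => h1 {}h2.
have -> : 2 / h * `|y| * `|z| * nb (bK K) u = h^-1 * `|y| * `|z| * nb (bK K) u
  + h^-1 * `|z| * `|y| * nb (bK K) u by ring.
by rewrite [z + y]addrC lerD.
Qed.

End Transport.

Arguments bK_psd {R n r E} K.

(** * The Wilson operator of mesh 1/K *)

Section LatticeDirac.
Variables (R : realType) (n r : nat) (E : clifford_bundle R n r) (a0 : R).
Variables (U : link_variables E a0) (h : R) (hS : transport_scale U h).
Variable K : nat.
Hypotheses (K0 : (0 < K)%N) (Kh : 2 * K%:R^-1 < h).
Implicit Types u v : section E.

Local Notation a := (K%:R^-1 : R).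

Definition unit_step (i : 'I_n) : 'rV[R]_n := a *: delta_mx 0 i.
Definition sgn_step (s : bool) i := if s then unit_step i else - unit_step i.

Let K1 : 0 < K%:R :> R. Proof. by rewrite ltr0n. Qed.
Let ia : 0 < a. Proof. by rewrite invr_gt0. Qed.

Lemma norm_unit_step i : `|unit_step i| <= a.
Proof.
apply: norm_row_le => [|j]; first exact: ltW.
rewrite !mxE normrM gtr0_norm // ler_piMr ?(ltW ia) //.
by case: (_ && _); rewrite ?normr0 ?normr1.
Qed.

Lemma norm_sgn_step s i : `|sgn_step s i| <= a.
Proof. by rewrite /sgn_step; case: s; rewrite ?normrN norm_unit_step. Qed.

Lemma sgn_step_lt s i : `|sgn_step s i| < h.
Proof. by rewrite (le_lt_trans (norm_sgn_step _ _)) //; have := Kh; have := ia; lra. Qed.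

Lemma unit_step_lt i : `|unit_step i| < h.
Proof. exact: (sgn_step_lt true). Qed.

Lemma unit_step_int i : int_vector (K%:R *: unit_step i).
Proof.
rewrite scalerA mulfV ?gt_eqF // scale1r; apply/mxOverP => p q; rewrite !mxE.
by case: (_ && _); rewrite ?rpred0 ?rpred1.
Qed.

Lemma sgn_step_int s i : int_vector (K%:R *: sgn_step s i).
Proof.
case: s; rewrite /sgn_step; first exact: unit_step_int.
by rewrite scalerN; apply: int_vectorN; exact: unit_step_int.
Qed.

Definition nablaK i u : section E := K%:R%:C *: (Psh U (unit_step i) u - u).
(** The adjoint of [nablaK], hence minus the usual backward difference quotient. *)
Definition nablaK' i u : section E := K%:R%:C *: (Psh U (- unit_step i) u - u).

Definition wilsonK u : section E :=
  \sum_(i < n) cl_sec i (2^-1%:C *: (nablaK i u - nablaK' i u))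
   - \sum_(i < n) 2^-1%:C *: (nablaK i u + nablaK' i u).

Lemma nablaK_adj i u v : bK K (nablaK i u) v = bK K u (nablaK' i v).
Proof.
rewrite /nablaK /nablaK' (psdZl (bK_psd K)) (psdZr (bK_psd K)).
rewrite (psdBl (bK_psd K)) (psdBr (bK_psd K)) (Psh_adj hS) //; last exact: unit_step_int.
exact: unit_step_lt.
Qed.

Lemma nablaK_Psh i u : Psh U (unit_step i) u = u + (K%:R^-1)%:C *: nablaK i u.
Proof.
rewrite /nablaK scalerA -rmorphM /= mulVf ?gt_eqF // scale1r.
by rewrite addrC subrK.
Qed.

Lemma nablaK_cl i j u : cl_sec j (nablaK i u) = nablaK i (cl_sec j u).
Proof. by rewrite /nablaK linearZ linearB /= (Psh_cl hS) //; exact: unit_step_lt. Qed.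

Lemma nablaK'_cl i j u : cl_sec j (nablaK' i u) = nablaK' i (cl_sec j u).
Proof. by rewrite /nablaK' linearZ linearB /= (Psh_cl hS) //; exact: (sgn_step_lt false). Qed.

Lemma nbK_nablaK' i u : nb (bK K) (nablaK' i u) = nb (bK K) (nablaK i u).
Proof.
rewrite /nablaK /nablaK' !(nbZ (bK_psd K)); congr (_ * _).
rewrite -(nbK_Psh hS (Psh U _ u - u) K0 (unit_step_lt i) (unit_step_int i)).
by rewrite linearB /= (PshK hS) ?unit_step_lt // (nbBC (bK_psd K)).
Qed.

Lemma wilsonKE u : wilsonK u = (K%:R / 2)%:C *:
  \sum_(i < n) wilson_part (fun s i => Psh U (sgn_step s i) : {linear section E -> section E})
                           (fun i => @cl_sec R n r E i : {linear section E -> section E}) i u.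
Proof.
rewrite /wilsonK -sumrB scaler_sumr; apply: eq_bigr => i _.
have cZ (k : R[i]) (w : section E) : cl_sec i (k *: w) = k *: cl_sec i w by rewrite linearZ.
rewrite /wilson_part /nablaK /nablaK' -scalerBr -scalerDr !scalerA.
have -> : 2^-1%:C * K%:R%:C = (K%:R / 2)%:C :> R[i] by rewrite -rmorphM /= mulrC.
rewrite [in RHS]scalerDr -cZ /=.
move: (Psh U (unit_step i) u) (Psh U (- unit_step i) u) => P P'.
have -> : u - P + (u - P') = - (P - u + (P' - u)) by zmod.
by rewrite scalerN; congr (cl_sec i (_ *: _) - _); zmod.
Qed.

(** Shifts commute up to curvature times the squared mesh, which compensates the factor [K ^+ 2] of
    the squared quotients: the error is of order zero. Its constant is [15 / 2], rounded up to 8. *)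
Lemma wilsonK_elliptic u :
  \sum_(i < n) nb (bK K) (nablaK i u) ^+ 2 <=
  nb (bK K) (wilsonK u) ^+ 2 + 8 * n%:R ^+ 2 * h^-1 * nb (bK K) u ^+ 2.
Proof.
have h0 := scale_gt0 hS.
pose kap := 2 * h^-1 * a * a.
have kap0 : 0 <= kap by rewrite !mulr_ge0 // ?invr_ge0 ltW.
have := @wilson_part_bound R (section E) (bK K) n
  (fun s i => Psh U (sgn_step s i) : {linear section E -> section E})
  (fun i => @cl_sec R n r E i : {linear section E -> section E}) kap (bK_psd K).
move=> W; have {}W := W _ _ _ _ _ _ _ kap0 u.
have {W} : 4 * \sum_(i < n) bK K (Psh U (unit_step i) u - u) (Psh U (unit_step i) u - u) -
    15 * n%:R ^+ 2 * kap * bK K u u <=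
  bK K (\sum_(i < n) wilson_part (fun s i => Psh U (sgn_step s i) : {linear section E -> section E})
         (fun i => @cl_sec R n r E i : {linear section E -> section E}) i u)
       (\sum_(i < n) wilson_part (fun s i => Psh U (sgn_step s i) : {linear section E -> section E})
         (fun i => @cl_sec R n r E i : {linear section E -> section E}) i u).
  apply: W => /=.
  - move=> s i v w; rewrite (Psh_adj hS) ?sgn_step_lt ?sgn_step_int //.
    by case: s; rewrite /= ?opprK.
  - move=> s i v; have -> : sgn_step (~~ s) i = - sgn_step s i by case: s; rewrite /= ?opprK.
    by rewrite (PshK hS) // sgn_step_lt.
  - by move=> i v w; exact: cl_sec_adj.
  - by move=> i v; exact: cl_secK.
  - by move=> i j v; exact: cl_sec_anti.
  - by move=> s i j v; rewrite (Psh_cl hS) ?sgn_step_lt.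
  - move=> s s' i j v _.
    have l2 : `|sgn_step s i + sgn_step s' j| < h.
      rewrite (le_lt_trans (ler_normD _ _)) // (le_lt_trans _ Kh) // mulr2n mulrDl mul1r.
      by rewrite lerD // norm_sgn_step.
    rewrite (le_trans (nbK_comm hS v K0 _ _ l2 _)) ?sgn_step_lt //.
      by rewrite scalerDr; apply: int_vectorD; exact: sgn_step_int.
    rewrite ler_wpM2r ?nb_ge0 // /kap.
    by rewrite ler_pM ?mulr_ge0 ?norm_sgn_step // ?invr_ge0 ?(ltW h0) // ler_wpM2l ?norm_sgn_step // mulr_ge0 // invr_ge0 ltW.
set X := \sum_(i < n) wilson_part _ _ _ _.
have XE : nb (bK K) (wilsonK u) ^+ 2 = (K%:R / 2) ^+ 2 * bK K X X.
  by rewrite wilsonKE -/X (nbZ (bK_psd K)) exprMn real_normK ?num_real // (sqr_nb (bK_psd K)).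
have nE i : nb (bK K) (nablaK i u) ^+ 2 = K%:R ^+ 2 *
    bK K (Psh U (unit_step i) u - u) (Psh U (unit_step i) u - u).
  by rewrite (nbZ (bK_psd K)) exprMn real_normK ?num_real // (sqr_nb (bK_psd K)).
rewrite XE (eq_bigr _ (fun i _ => nE i)) (sqr_nb (bK_psd K)).
have -> : \sum_(i < n) K%:R ^+ 2 * bK K (Psh U (unit_step i) u - u) (Psh U (unit_step i) u - u)
  = K%:R ^+ 2 * \sum_(i < n) bK K (Psh U (unit_step i) u - u) (Psh U (unit_step i) u - u).
  by rewrite mulr_sumr.
have k2 : 0 <= (K%:R / 2) ^+ 2 :> R by exact: sqr_ge0.
move=> /(ler_wpM2l k2); set S := \sum_(i < n) bK _ _ _; set B := bK K X X; set b := bK K u u.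
have b0 : 0 <= b by exact: psd_ge0 (bK_psd K) _.
have -> : (K%:R / 2) ^+ 2 * (4 * S - 15 * n%:R ^+ 2 * kap * b) =
   K%:R ^+ 2 * S - 15 / 2 * (n%:R ^+ 2 * h^-1 * b).
  by rewrite /kap; field; rewrite !gt_eqF.
have hi : 0 <= h^-1 by rewrite invr_ge0 ltW.
have : 0 <= n%:R ^+ 2 * h^-1 * b by rewrite mulr_ge0 // mulr_ge0 // sqr_ge0.
have -> : 8 * n%:R ^+ 2 / h * b = 8 * (n%:R ^+ 2 * h^-1 * b) by ring.
lra.
Qed.

End LatticeDirac.

Lemma eq_avg_grid (R : realType) n K (f g : 'rV[R]_n -> R) :
  (forall x, x \in grid R n K -> f x = g x) -> avg K f = avg K g.
Proof. by move=> fg; rewrite /avg !big_seq; congr (_ * _); apply: eq_bigr. Qed.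

Lemma sqr_sum_le (R : realType) (J : nat) (x : nat -> R) :
  (\sum_(j < J) x j) ^+ 2 <= J%:R * \sum_(j < J) x j ^+ 2.
Proof.
elim: J => [|J IH]; first by rewrite !big_ord0 mulr0 expr0n.
rewrite !big_ord_recr /= -(natr1 J).
set S := \sum_(j < J) x j; set Q := \sum_(j < J) x j ^+ 2; set y := x J.
have SQ : 2 * (S * y) <= Q + J%:R * y ^+ 2.
  have -> : S = \sum_(j < J) x j by []. rewrite mulr_suml mulr_sumr.
  have -> : J%:R * y ^+ 2 = \sum_(j < J) y ^+ 2 by rewrite sumr_const card_ord mulr_natl.
  rewrite -big_split /=; apply: ler_sum => j _.
  by have := sqr_ge0 (x j - y); rewrite sqrrB; lra.
move: IH; rewrite -/S -/Q sqrrD mulrDl mul1r mulrDr => IH.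
by lra.
Qed.

(** * Comparison of two lattices *)

Section GridMean.
Variables (R : realType) (n L : nat) (L0 : (0 < L)%N).
Variables (V : lmodType R[i]) (b : V -> V -> R) (pb : psd b).

Definition gmean (F : 'rV[R]_n -> V) : V :=
  ((L%:R ^+ n)^-1)%:C *: \sum_(g <- grid R n L) F g.

Lemma gmeanE F u : b (gmean F) u = avg L (fun g => b (F g) u).
Proof. by rewrite /gmean (psdZl pb) (psd_suml pb). Qed.

(** The variance is written through differences of pairs because these are what [grid_poincare]
    bounds. *)
Lemma gmean_variance F : avg L (fun g => b (F g) (F g)) = b (gmean F) (gmean F) +
  2^-1 * avg L (fun g => avg L (fun g' => b (F g - F g') (F g - F g'))).
Proof.
set m := gmean F.
have e g : avg L (fun g' => b (F g - F g') (F g - F g')) =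
   b (F g) (F g) - 2 * b m (F g) + avg L (fun g' => b (F g') (F g')).
  rewrite (eq_avg _ (g := fun g' => b (F g) (F g) - 2 * b (F g') (F g) + b (F g') (F g'))).
    by rewrite avgD avgB avgZ (avg_cst _ _ L0) gmeanE.
  by move=> g'; rewrite !(psdDl pb, psdDr pb, psdNl pb, psdNr pb) (psdC pb (F g) (F g')); ring.
rewrite (eq_avg _ e) avgD avgB avgZ (avg_cst _ _ L0).
have -> : avg L (fun g => b m (F g)) = b m m.
  by rewrite [RHS]gmeanE; apply: eq_avg => g; rewrite (psdC pb).
by move: (avg _ _) => A; field.
Qed.

End GridMean.

Section TwoLattices.
Variables (R : realType) (n r : nat) (E : clifford_bundle R n r) (a0 : R).
Variables (U : link_variables E a0) (h : R) (hS : transport_scale U h).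
Variables (N L : nat) (N0 : (0 < N)%N) (L0 : (0 < L)%N).
Hypothesis Nh : 2 * N%:R^-1 < h.
Implicit Types u v w : section E.

Local Notation K := (N * L)%N.
Local Notation a := (N%:R^-1 : R).
Local Notation s := (K%:R^-1 : R).
Local Notation e i := (@unit_step R n K i).
Local Notation b := (bK (E := E) N).
Local Notation Nb := (nb b).
Local Notation NK := (nb (bK (E := E) K)).

Let h0 := scale_gt0 hS.
Let N1 : 0 < N%:R :> R. Proof. by rewrite ltr0n. Qed.
Let L1 : 0 < L%:R :> R. Proof. by rewrite ltr0n. Qed.
Let a_gt0 : 0 < a. Proof. by rewrite invr_gt0. Qed.
Let K0 : (0 < K)%N. Proof. by rewrite muln_gt0 N0. Qed.
Let K1 : 0 < K%:R :> R. Proof. by rewrite ltr0n. Qed.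
Let s_gt0 : 0 < s. Proof. by rewrite invr_gt0. Qed.
Let sE : s = a * L%:R^-1. Proof. by rewrite natrM invfM. Qed.
Let sL : s * L%:R = a. Proof. by rewrite sE -mulrA mulVf ?mulr1 // gt_eqF. Qed.
Let s_le_a : s <= a.
Proof. by rewrite sE ler_piMr ?(ltW a_gt0) // invf_le1 // ler1n. Qed.

Lemma fine_scale : 2 * K%:R^-1 < h.
Proof. by have := Nh; have := s_le_a; lra. Qed.

Let Pb := bK_psd (E := E) N.

Lemma grid_norm g : g \in grid R n L -> `|a *: g| <= a.
Proof.
move=> gL; rewrite normrZ gtr0_norm // ler_piMr ?(ltW a_gt0) //.
apply: norm_row_le => // i; have /andP[g0 g1] := grid_itv i gL.
by rewrite ger0_norm // ltW.
Qed.

(** Cell position [g] moved by [j] fine steps along axis [i]; at [j = L] it is the same position in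
    the neighbouring cell. *)
Definition off i (j : nat) (g : 'rV[R]_n) : 'rV[R]_n := a *: g + j%:R *: e i.

Lemma offE i j g : off i j g = a *: (g + (j%:R / L%:R) *: delta_mx 0 i).
Proof.
rewrite /off /unit_step scalerDr !scalerA; congr (_ + _ *: _).
by rewrite sE; ring.
Qed.

Lemma off0 i g : off i 0 g = a *: g. Proof. by rewrite /off scale0r addr0. Qed.

Lemma offS i j g : off i j.+1 g = off i j g + e i.
Proof. by rewrite /off -(natr1 j) scalerDl scale1r addrA. Qed.

Lemma offL i g : off i L g = a *: g + @unit_step R n N i.
Proof. by rewrite /off /unit_step scalerA mulrC sL. Qed.

Lemma norm_off i j g : g \in grid R n L -> (j <= L)%N -> `|off i j g| <= 2 * a.
Proof.
move=> gL jL; rewrite (le_trans (ler_normD _ _)) // mulr2n mulrDl mul1r lerD ?grid_norm //.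
rewrite normrZ ger0_norm // -[leRHS]sL mulrC ler_pM // ?norm_unit_step //.
by rewrite ler_nat.
Qed.

Lemma off_lt i j g : g \in grid R n L -> (j <= L)%N -> `|off i j g| < h.
Proof. by move=> gL jL; rewrite (le_lt_trans (norm_off i gL jL)). Qed.

(** Transport is isometric and lattice averages are translation invariant, so the coarse form
    averaged over all cell positions is the fine form. *)
Lemma avg_cell_shift z u v : int_vector (K%:R *: z) ->
  (forall g, g \in grid R n L -> `|a *: g + z| < h) ->
  avg L (fun g => b (Psh U (a *: g + z) u) (Psh U (a *: g + z) v)) = bK K u v.
Proof.
move=> iK lt_h; have := tavg_shift (fun x => rd x (u x) (v x)) K0 iK.
rewrite -[X in _ = X -> _]/(bK K u v) => <-.
rewrite /tavg avg_refine //; apply: eq_avg_grid => g gL; apply: eq_avg => x /=.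
rewrite (Psh_isom hS); last exact: lt_h.
by apply: (congr1 (fun q => rd q (u q) (v q))); rewrite -!tptD addrA.
Qed.

Lemma avg_cell u v : avg L (fun g => b (Psh U (a *: g) u) (Psh U (a *: g) v)) = bK K u v.
Proof.
rewrite -(@avg_cell_shift 0) ?scaler0.
- by apply: eq_avg => g; rewrite addr0.
- by apply/mxOverP => p q; rewrite mxE rpred0.
- by move=> g /grid_norm ga; rewrite addr0; have := Nh; have := a_gt0; lra.
Qed.

Lemma avg_off i j u v : (j <= L)%N ->
  avg L (fun g => b (Psh U (off i j g) u) (Psh U (off i j g) v)) = bK K u v.
Proof.
move=> jL; apply: avg_cell_shift => [|g gL]; last exact: off_lt.
rewrite scalerA mulrC -scalerA; apply/mxOverP => p q; rewrite mxE.
by rewrite rpredM ?natr_int //; move/mxOverP: (@unit_step_int R n K K0 i); apply.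
Qed.

Lemma avg_nb_off i j w : (j <= L)%N ->
  avg L (fun g => Nb (Psh U (off i j g) w) ^+ 2) = NK w ^+ 2.
Proof.
move=> jL; rewrite (sqr_nb (bK_psd K)) -(avg_off i w w jL).
by apply: eq_avg => g; rewrite (sqr_nb Pb).
Qed.

Lemma avg_nb_off_le i j w : (j <= L)%N ->
  avg L (fun g => Nb (Psh U (off i j g) w)) <= NK w.
Proof.
by move=> jL; apply: avg_le_norm => //; rewrite ?nb_ge0 // avg_nb_off.
Qed.

(** The defect is the holonomy of a triangle with sides at most [2 * a] and [s]. *)
Lemma one_step i j g w : g \in grid R n L -> (j < L)%N ->
  Nb (Psh U (off i j.+1 g) w - Psh U (off i j g) w
      - s%:C *: Psh U (off i j g) (nablaK U K i w))
  <= h^-1 * (2 * a) * s * Nb (Psh U (off i j.+1 g) w).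
Proof.
move=> gL jL; have lt1 := off_lt i gL (ltnW jL); have lt2 := off_lt i gL jL.
have le1 := norm_off i gL (ltnW jL).
have es : `|e i| < h by apply: unit_step_lt => //; exact: fine_scale.
have := nbK_hol hS N w lt1 es; rewrite -offS => /(_ lt2).
rewrite (nablaK_Psh U K0) linearD linearZ /= (nbBC Pb) => H.
have -> : Psh U (off i j.+1 g) w - Psh U (off i j g) w
      - s%:C *: Psh U (off i j g) (nablaK U K i w) =
  Psh U (off i j.+1 g) w - (Psh U (off i j g) w + s%:C *: Psh U (off i j g) (nablaK U K i w)).
  by move: (Psh _ _ w) (Psh _ _ w) (_ *: _) => *; zmod.
rewrite (le_trans H) // ler_wpM2r ?nb_ge0 // ler_pM ?mulr_ge0 ?invr_ge0 ?(ltW h0) //.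
  by rewrite ler_wpM2l // invr_ge0 ltW.
by apply: norm_unit_step.
Qed.

Lemma telescope i J g w : g \in grid R n L -> (J <= L)%N ->
  Nb (Psh U (off i J g) w - Psh U (off i 0 g) w) <=
  s * \sum_(j < J) (Nb (Psh U (off i j g) (nablaK U K i w)) + Nb (Psh U (off i j.+1 g) w)).
Proof.
move=> gL; elim: J => [|J IH] JL; first by rewrite subrr (nb0 Pb) big_ord0 mulr0.
rewrite big_ord_recr /= mulrDr.
have -> : Psh U (off i J.+1 g) w - Psh U (off i 0 g) w =
  (Psh U (off i J g) w - Psh U (off i 0 g) w) +
  ((Psh U (off i J.+1 g) w - Psh U (off i J g) w
      - s%:C *: Psh U (off i J g) (nablaK U K i w)) +
     s%:C *: Psh U (off i J g) (nablaK U K i w)).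
  by move: (Psh _ (off i J.+1 g) w) (Psh _ (off i J g) w) (Psh _ (off i 0 g) w) (_ *: _) => *; zmod.
rewrite (le_trans (nbD Pb _ _)) // lerD ?IH //; first exact: ltnW.
rewrite (le_trans (nbD Pb _ _)) // (nbZ Pb) gtr0_norm // addrC mulrDr lerD //.
rewrite (le_trans (one_step i w gL JL)) // ler_wpM2r ?nb_ge0 // ler_piMl ?(ltW s_gt0) //.
by rewrite mulrC ler_pdivrMr // mul1r ltW.
Qed.

(** At most [L] steps of length [s = a / L] are summed. Cauchy-Schwarz produces
    [s ^+ 2 * J <= s * a], and by [avg_nb_off] all steps have the same mean square. *)
Lemma avg_telescope i J w : (J <= L)%N ->
  avg L (fun g => Nb (Psh U (off i J g) w - Psh U (off i 0 g) w) ^+ 2) <=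
  2 * a ^+ 2 * (NK (nablaK U K i w) ^+ 2 + NK w ^+ 2).
Proof.
move=> JL; set D := nablaK U K i w.
pose Q g := 2 * s * a * \sum_(j < J) (Nb (Psh U (off i j g) D) ^+ 2 + Nb (Psh U (off i j.+1 g) w) ^+ 2).
apply: (@le_trans _ _ (avg L Q)).
  apply: ler_avg_grid => g gL; have := telescope i w gL JL; rewrite -/D => T.
  have T2 : Nb (Psh U (off i J g) w - Psh U (off i 0 g) w) ^+ 2 <=
     (s * \sum_(j < J) (Nb (Psh U (off i j g) D) + Nb (Psh U (off i j.+1 g) w))) ^+ 2.
    rewrite ler_pXn2r ?nnegrE ?nb_ge0 // mulr_ge0 ?(ltW s_gt0) // sumr_ge0 // => j _.
    by rewrite addr_ge0 ?nb_ge0.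
  apply: (le_trans T2); rewrite exprMn.
  have := sqr_sum_le J (fun j => Nb (Psh U (off i j g) D) + Nb (Psh U (off i j.+1 g) w)).
  move=> /(ler_wpM2l (sqr_ge0 s))/le_trans; apply.
  rewrite /Q mulrA -[leRHS]mulrA.
  have Js : s ^+ 2 * J%:R <= s * a.
    by rewrite expr2 -mulrA ler_wpM2l ?(ltW s_gt0) // -[leRHS]sL ler_wpM2l ?(ltW s_gt0) // ler_nat.
  have S2 : \sum_(j < J) (Nb (Psh U (off i j g) D) + Nb (Psh U (off i j.+1 g) w)) ^+ 2 <=
    2 * \sum_(j < J) (Nb (Psh U (off i j g) D) ^+ 2 + Nb (Psh U (off i j.+1 g) w) ^+ 2).
    rewrite mulr_sumr; apply: ler_sum => j _.
    by have := sqr_ge0 (Nb (Psh U (off i j g) D) - Nb (Psh U (off i j.+1 g) w)); rewrite sqrrB sqrrD; lra.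
  have S0 : 0 <= \sum_(j < J) (Nb (Psh U (off i j g) D) + Nb (Psh U (off i j.+1 g) w)) ^+ 2.
    by apply: sumr_ge0 => j _; exact: sqr_ge0.
  apply: (le_trans (ler_wpM2r S0 Js)).
  have sa : 0 <= s * a by rewrite mulr_ge0 ?ltW.
  apply: (le_trans (ler_wpM2l sa S2)).
  by apply: eq_le_ring; ring.
rewrite /Q avgZ avg_sum.
have le2 : \sum_(j < J) avg L (fun g => Nb (Psh U (off i j g) D) ^+ 2 + Nb (Psh U (off i j.+1 g) w) ^+ 2)
    <= L%:R * (NK D ^+ 2 + NK w ^+ 2).
  apply: (@le_trans _ _ (\sum_(j < J) (NK D ^+ 2 + NK w ^+ 2))).
    apply: ler_sum => j _; have jL := leq_trans (ltn_ord j) JL.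
    by rewrite avgD !avg_nb_off // ltnW.
  rewrite sumr_const card_ord -(mulr_natl (_ + _)) ler_wpM2r ?addr_ge0 ?sqr_ge0 //.
  by rewrite ler_nat.
have sa : 0 <= 2 * s * a by rewrite !mulr_ge0 ?(ltW s_gt0) ?(ltW a_gt0).
apply: (le_trans (ler_wpM2l sa le2)); apply: eq_le_ring.
have -> : 2 * s * a * (L%:R * (NK D ^+ 2 + NK w ^+ 2)) = 2 * (s * L%:R) * a * (NK D ^+ 2 + NK w ^+ 2).
  by ring.
by rewrite sL; ring.
Qed.

Definition cell_mean w := gmean L (fun g => Psh U (a *: g) w).

Lemma cell_meanE w u : b (cell_mean w) u = avg L (fun g => b (Psh U (a *: g) w) u).
Proof. exact: gmeanE. Qed.

(* A Poincare inequality on the cells of the coarse lattice. *)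
Lemma cell_mean_lower_bound w : NK w ^+ 2 <= Nb (cell_mean w) ^+ 2 +
  4 ^+ n * \sum_(i < n) a ^+ 2 * (NK (nablaK U K i w) ^+ 2 + NK w ^+ 2).
Proof.
rewrite {1}(sqr_nb (bK_psd K)) -avg_cell.
rewrite (gmean_variance L0 Pb) -/(cell_mean w) (sqr_nb Pb) lerD2l.
have G := grid_poincare (fun g => Psh U (a *: g) w) Pb L0.
rewrite ler_pdivrMl // (le_trans G) // mulrCA ler_wpM2l ?exprn_ge0 // mulr_sumr.
apply: ler_sum => i _; set C := a ^+ 2 * _.
apply: (@le_trans _ _ (L%:R^-1 * \sum_(J < L) 2 * C)); last first.
  by rewrite sumr_const card_ord -(mulr_natl (2 * C)) mulKf // gt_eqF.
rewrite ler_wpM2l ?invr_ge0 ?ler0n //; apply: ler_sum => J _.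
rewrite /C mulrA; have := avg_telescope i w (ltnW (ltn_ord J)); apply: le_trans.
by apply: eq_le_ring; apply: eq_avg => g; rewrite (sqr_nb Pb) offE off0.
Qed.

Let norm_eN i : `|@unit_step R n N i| < h. Proof. exact: unit_step_lt. Qed.

Let coarse_hol i g v : g \in grid R n L ->
  Nb (Psh U (@unit_step R n N i) (Psh U (a *: g) v) - Psh U (off i L g) v) <=
  h^-1 * a * a * Nb (Psh U (off i L g) v).
Proof.
move=> gL; have ga := grid_norm gL.
have gh : `|a *: g| < h by have := Nh; have := a_gt0; lra.
have := nbK_hol hS N v (norm_eN i) gh; rewrite [_ + a *: g]addrC -offL.
move=> /(_ (off_lt i gL (leqnn L))) /le_trans; apply.
rewrite ler_wpM2r ?nb_ge0 // ler_pM ?mulr_ge0 ?invr_ge0 ?(ltW h0) //.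
by rewrite ler_wpM2l ?invr_ge0 ?(ltW h0) // norm_unit_step.
Qed.

(** Across a cell, [L] fine steps add up to one coarse step, up to [L] thin holonomy triangles and
    one triangle of size [a]: an error of order [a ^+ 2], divided by the spacing. Adjointness puts
    the coarse difference on [u]. *)
Let gradient_sum i g w u : g \in grid R n L ->
  `|b (Psh U (a *: g) w) (nablaK' U N i u)
    - L%:R^-1 * \sum_(j < L) b (Psh U (off i j g) (nablaK U K i w)) u|
  <= h^-1 * a * (Nb (Psh U (off i L g) w)
      + 2 * (L%:R^-1 * \sum_(j < L) Nb (Psh U (off i j.+1 g) w))) * Nb u.
Proof.
move=> gL; set D := nablaK U K i w.
pose Rj j := Psh U (off i j.+1 g) w - Psh U (off i j g) w - s%:C *: Psh U (off i j g) D.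
pose R0 := Psh U (@unit_step R n N i) (Psh U (a *: g) w) - Psh U (off i L g) w.
have tele : forall J : nat, \sum_(j < J) b (Rj j) u =
    b (Psh U (off i J g) w) u - b (Psh U (a *: g) w) u
    - s * \sum_(j < J) b (Psh U (off i j g) D) u.
  elim=> [|J IH]; first by rewrite !big_ord0 off0 mulr0 subrr subr0.
  rewrite !big_ord_recr /= IH /Rj !(psdDl Pb, psdNl Pb) (psdZl Pb).
  by move: (\sum_(j < J) _) => S; ring.
have -> : b (Psh U (a *: g) w) (nablaK' U N i u)
    - L%:R^-1 * \sum_(j < L) b (Psh U (off i j g) D) u =
    N%:R * (b R0 u + \sum_(j < L) b (Rj j) u).
  rewrite -(nablaK_adj hS N0 Nh) /nablaK (psdZl Pb) tele /R0 !(psdDl Pb, psdNl Pb).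
  have -> : L%:R^-1 = N%:R * s by rewrite sE mulrA mulfV ?mul1r // gt_eqF.
  by move: (\sum_(j < L) _) => S; ring.
rewrite normrM gtr0_norm //.
have Ru : `|b R0 u + \sum_(j < L) b (Rj j) u| <=
   h^-1 * a * a * Nb (Psh U (off i L g) w) * Nb u +
   \sum_(j < L) h^-1 * (2 * a) * s * Nb (Psh U (off i j.+1 g) w) * Nb u.
  rewrite (le_trans (ler_normD _ _)) // lerD //.
    by rewrite (le_trans (psd_abs Pb _ _)) // ler_wpM2r ?nb_ge0 // coarse_hol.
  rewrite (le_trans (ler_norm_sum _ _ _)) //; apply: ler_sum => j _.
  by rewrite (le_trans (psd_abs Pb _ _)) // ler_wpM2r ?nb_ge0 // one_step.
apply: (le_trans (ler_wpM2l (ltW N1) Ru)); apply: eq_le_ring.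
rewrite -mulr_suml -mulr_sumr; move: (\sum_(j < L) _) (Nb (Psh U (off i L g) w)) => S A.
by rewrite sE; field; rewrite !gt_eqF.
Qed.

(** A unit translation of [g] is one coarse step, and adjointness moves the difference onto [u]. It
    could not be charged to [v], which will be a derivative of [w] with no further derivative under
    control. *)
Let defect i v u :
  avg L (fun g => `|b (Psh U (a *: (g + delta_mx 0 i)) v) u - b (Psh U (a *: g) v) u|)
  <= a * NK v * (Nb u + Nb (nablaK' U N i u)).
Proof.
have aE g : a *: (g + delta_mx 0 i) = off i L g by rewrite offE divff ?scale1r // gt_eqF.
have ah : h^-1 * a <= 1 by rewrite ler_pdivrMl // mulr1; have := Nh; have := a_gt0; lra.
pose X g := Nb (Psh U (off i L g) v); pose Y g := Nb (Psh U (off i 0 g) v).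
apply: (@le_trans _ _ (avg L (fun g => (a * Nb u) * X g + (a * Nb (nablaK' U N i u)) * Y g))).
  apply: ler_avg_grid => g gL; rewrite aE.
  have -> : b (Psh U (off i L g) v) u - b (Psh U (a *: g) v) u =
     a * b (Psh U (a *: g) v) (nablaK' U N i u)
     - b (Psh U (@unit_step R n N i) (Psh U (a *: g) v) - Psh U (off i L g) v) u.
    rewrite -(nablaK_adj hS N0 Nh) /nablaK (psdZl Pb) mulrA mulVf ?mul1r ?gt_eqF //.
    by rewrite !(psdDl Pb, psdNl Pb); ring.
  rewrite (le_trans (ler_normB _ _)) // addrC lerD //.
    rewrite (le_trans (psd_abs Pb _ _)) // mulrAC ler_wpM2r ?nb_ge0 //.
    rewrite (le_trans (coarse_hol i v gL)) // ler_wpM2r ?nb_ge0 //.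
    by rewrite ler_piMl // ltW.
  rewrite normrM gtr0_norm // -mulrA ler_wpM2l ?(ltW a_gt0) // mulrC /Y off0.
  exact: psd_abs.
rewrite avgD !avgZ.
have h1 := avg_nb_off_le i v (leqnn L); have h2 := avg_nb_off_le i v (leq0n L).
have u0 : 0 <= a * Nb u by rewrite mulr_ge0 ?nb_ge0 // ltW.
have u1 : 0 <= a * Nb (nablaK' U N i u) by rewrite mulr_ge0 ?nb_ge0 // ltW.
apply: (le_trans (lerD (ler_wpM2l u0 h1) (ler_wpM2l u1 h2))).
by apply: eq_le_ring; ring.
Qed.

(* Summing the fine difference quotients over a cell gives the coarse one. *)
Lemma weak_gradient i w u :
  `|avg L (fun g => b (Psh U (a *: g) (nablaK U K i w)) u)
    - avg L (fun g => b (Psh U (a *: g) w) (nablaK' U N i u))|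
  <= a * (1 + 3 * h^-1) * (NK (nablaK U K i w) + NK w) * (Nb u + Nb (nablaK' U N i u)).
Proof.
set D := nablaK U K i w.
(* [S] is the fine derivative averaged along a crossing of the cell. Passing to it from [j = 0]
   shifts the cell position, which [defect] controls; along the crossing the derivatives
   telescope. *)
pose S := L%:R^-1 * \sum_(j < L) avg L (fun g => b (Psh U (off i j g) D) u).
have iL : 0 <= L%:R^-1 :> R by rewrite invr_ge0 ltW.
have hi : 0 <= h^-1 by rewrite invr_ge0 ltW.
have S1 : `|avg L (fun g => b (Psh U (a *: g) D) u) - S| <= a * NK D * (Nb u + Nb (nablaK' U N i u)).
  have -> : avg L (fun g => b (Psh U (a *: g) D) u) - S = L%:R^-1 * \sum_(j < L)
     (avg L (fun g => b (Psh U (a *: g) D) u) - avg L (fun g => b (Psh U (off i j g) D) u)).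
    rewrite sumrB mulrBr sumr_const card_ord -(mulr_natl (avg _ _)) mulKf ?gt_eqF //.
  rewrite normrM (ger0_norm iL) ler_pdivrMl // (le_trans (ler_norm_sum _ _ _)) //.
  set C := a * NK D * _.
  apply: (@le_trans _ _ (\sum_(j < L) C)); last first.
    by rewrite sumr_const card_ord -(mulr_natl C).
  apply: ler_sum => j _.
  have := avg_shift_defect (fun g => b (Psh U (a *: g) D) u) i L0 (ltnW (ltn_ord j)).
  have -> : avg L (fun g => b (Psh U (a *: (g + (j%:R / L%:R) *: delta_mx 0 i)) D) u) =
      avg L (fun g => b (Psh U (off i j g) D) u).
    by apply: eq_avg => g; rewrite offE.
  rewrite distrC.
  by move=> /le_trans; apply; exact: defect.
have S2 : `|S - avg L (fun g => b (Psh U (a *: g) w) (nablaK' U N i u))| <= 3 * h^-1 * a * NK w * Nb u.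
  have -> : S = avg L (fun g => L%:R^-1 * \sum_(j < L) b (Psh U (off i j g) D) u).
    by rewrite avgZ avg_sum.
  rewrite distrC -avgB (le_trans (ler_norm_avg _ _)) //.
  pose Z g := (h^-1 * a * Nb u) * (Nb (Psh U (off i L g) w)
      + 2 * (L%:R^-1 * \sum_(j < L) Nb (Psh U (off i j.+1 g) w))).
  apply: (@le_trans _ _ (avg L Z)).
    apply: ler_avg_grid => g gL; rewrite (le_trans (gradient_sum i w u gL)) //.
    by apply: eq_le_ring; rewrite /Z; ring.
  rewrite /Z avgZ avgD avgZ avgZ avg_sum.
  have Sle : L%:R^-1 * \sum_(j < L) avg L (fun g => Nb (Psh U (off i j.+1 g) w)) <= NK w.
    rewrite ler_pdivrMl //; apply: (@le_trans _ _ (\sum_(j < L) NK w)); last first.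
      by rewrite sumr_const card_ord -(mulr_natl (NK w)).
    by apply: ler_sum => j _; exact: avg_nb_off_le.
  have := avg_nb_off_le i w (leqnn L); move: Sle.
  move: (L%:R^-1 * _) (avg _ _) => A B hA hB.
  have hu : 0 <= h^-1 * a * Nb u by rewrite mulr_ge0 ?nb_ge0 // mulr_ge0 // ltW.
  apply: (@le_trans _ _ (h^-1 * a * Nb u * (3 * NK w))); last by apply: eq_le_ring; ring.
  by rewrite ler_wpM2l //; lra.
set X := avg _ _ in S1 *; set Y := avg _ _ in S2 *.
have -> : X - Y = (X - S) + (S - Y) by ring.
rewrite (le_trans (ler_normD _ _)) // (le_trans (lerD S1 S2)) //.
have p1 : 0 <= NK D := nb_ge0 _ _. have p2 : 0 <= NK w := nb_ge0 _ _.
have p3 : 0 <= Nb u := nb_ge0 _ _. have p4 : 0 <= Nb (nablaK' U N i u) := nb_ge0 _ _.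
move: (NK D) (NK w) (Nb u) (Nb (nablaK' U N i u)) (h^-1) hi p1 p2 p3 p4 => d e1 p q k hk d0 e0 p0 q0.
have -> : a * (1 + 3 * k) * (d + e1) * (p + q) = a * d * (p + q) + 3 * k * a * e1 * p
   + (a * e1 * (p + q) + 3 * (a * k) * d * (p + q) + 3 * (a * k) * e1 * q) by ring.
by rewrite lerDl !addr_ge0 // !mulr_ge0 ?addr_ge0 // ltW.
Qed.

End TwoLattices.

Section CoordLinear.
Variables (R : realType) (n : nat) (i : 'I_n).

Definition coordl (v : 'rV[R]_n) : R^o := v 0 i.

Lemma coordl_is_linear : linear coordl.
Proof. by move=> k u v; rewrite /coordl !mxE. Qed.

HB.instance Definition _ := @GRing.isLinear.Build R 'rV[R]_n R^o *:%R coordl coordl_is_linear.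

End CoordLinear.

(** * The interpolation map *)

Section FlatFunction.
Variables (R : realType) (c : R).
Hypothesis c0 : 0 < c.
Implicit Types u : R.

(** The functions [u^-k exp (- c / u)] form a family closed under differentiation up to linear
    combinations, so one induction over all [k] gives the smoothness of the case [k = 0]. *)
Definition flat (k : nat) u : R := if 0 < u then u^-1 ^+ k * expR (- (c * u^-1)) else 0.

Lemma flat_ge0 k u : 0 <= flat k u.
Proof. by rewrite /flat; case: ifP => // u0; rewrite mulr_ge0 ?expR_ge0 // exprn_ge0 // invr_ge0 ltW. Qed.

Lemma flat0_le1 u : flat 0 u <= 1.
Proof.
rewrite /flat; case: ifP => // u0; rewrite expr0 mul1r -expR0 ler_expR oppr_le0.
by rewrite mulr_ge0 ?invr_ge0 ?ltW.
Qed.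

Lemma flat0_ge u : 0 < u -> 1 - c * u^-1 <= flat 0 u.
Proof. by move=> u0; rewrite /flat u0 expr0 mul1r; exact: expR_ge1Dx. Qed.

(** The term of degree [k + 2] of the exponential series beats [u^-k] with a factor [u ^+ 2] to
    spare, which makes the derivative at 0 vanish. *)
Lemma flat_quadratic k : exists2 C, 0 < C & forall u, `|flat k u| <= C * u ^+ 2.
Proof.
have C0 : 0 < (k.+2)`!%:R / c ^+ k.+2 by rewrite divr_gt0 ?exprn_gt0 // ltr0n fact_gt0.
exists ((k.+2)`!%:R / c ^+ k.+2) => // u; rewrite ger0_norm ?flat_ge0 // /flat.
case: ifP => u0; last by rewrite mulr_ge0 ?sqr_ge0 // ltW.
have cu : 0 < c * u^-1 by rewrite divr_gt0.
rewrite expRN ler_pdivrMr ?expR_gt0 //.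
have := expR_ge1Dxn k.+1 (ltW cu).
set f := (k.+2)`!%:R; have f0 : 0 < f by rewrite ltr0n fact_gt0.
move=> ee.
have -> : u^-1 ^+ k = (f / c ^+ k.+2 * u ^+ 2) * (f^-1 * (c * u^-1) ^+ k.+2).
  rewrite exprMn !exprVn.
  have un : u != 0 by rewrite gt_eqF.
  have cn : c ^+ k.+2 != 0 by rewrite expf_neq0 // gt_eqF.
  have fn : f != 0 by rewrite gt_eqF.
  have -> : u ^+ k.+2 = u ^+ k * u ^+ 2 by rewrite -exprD addn2.
  have := expf_neq0 k un; move: cn; set x := c ^+ _; set y := u ^+ k => x0 y0.
  by field; rewrite un x0 fn y0.
have q0 : 0 <= f / c ^+ k.+2 * u ^+ 2 by rewrite mulr_ge0 ?sqr_ge0 // ltW.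
have : f^-1 * (c * u^-1) ^+ k.+2 <= expR (c * u^-1) by rewrite mulrC; lra.
by move=> /(ler_wpM2l q0); rewrite !mulrA.
Qed.

Lemma flat_deriv k u : is_derive u (1 : R^o) (flat k : R^o -> R^o) (c * flat k.+2 u - k%:R * flat k.+1 u).
Proof.
have [u0|u0|->] := ltgtP u 0.
- have e : flat k.+2 u = 0 /\ flat k.+1 u = 0 by rewrite /flat !ifN // -leNgt ltW.
  rewrite e.1 e.2 !mulr0 subrr.
  apply: (near_eq_is_derive _ (is_derive_cst (0 : R^o) u (1 : R^o))).
  near=> x; rewrite /flat ifN // -leNgt ltW //.
  by near: x; apply: lt_nbhsl.
- have un : u != 0 by rewrite gt_eqF.
  apply: (@near_eq_is_derive _ R^o R^o (fun x => x^-1 ^+ k * expR (- (c * x^-1))) (flat k) u 1).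
    near=> x; rewrite /flat ifT //.
    by near: x; apply: lt_nbhsr.
  rewrite /flat u0.
  have dv : is_derive u (1 : R^o) (fun x : R^o => x^-1 : R^o) (- u ^- 2 *: (1 : R^o)).
    exact: is_deriveV.
  have de : is_derive u (1 : R^o) (fun x : R^o => - (c * x^-1) : R^o) (c * u ^- 2).
    apply: is_derive_eq; rewrite -[in LHS]mulr_algl /= scaler1 /GRing.scale /=; ring.
  have dx : is_derive u (1 : R^o) (fun x : R^o => expR (- (c * x^-1)) : R^o)
     (c * u ^- 2 * expR (- (c * u^-1))).
    have := @is_derive1_comp R expR (fun x => - (c * x^-1)) u _ _ (is_derive_expR _) de.
    by rewrite mulrC.
  have dp : is_derive u (1 : R^o) (fun x : R^o => x^-1 ^+ k : R^o) (- k%:R * u^-1 ^+ k.+1).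
    elim: k => [|k IH].
      by under eq_fun do rewrite expr0; rewrite oppr0 mul0r; exact: (@is_derive_cst R R^o R^o 1 u 1).
    under eq_fun do rewrite exprS.
    apply: (@is_derive_eq _ _ _ _ _ _ _ _ (is_deriveM dv IH)).
    by rewrite /GRing.scale /= mulr1 -exprVn !exprS expr0 -(natr1 k); ring.
  apply: (@is_derive_eq _ _ _ _ _ _ _ _ (is_deriveM dp dx)).
  rewrite /GRing.scale /= -exprVn !exprS expr0; ring.
have e l : flat l 0 = 0 by rewrite /flat ltxx.
rewrite !e !mulr0 subrr; have [C C0 hC] := flat_quadratic k.
suff h : (fun s : R => s^-1 *: ((flat k \o shift 0) (s *: (1 : R^o)) - flat k 0) : R^o)
     @ (0 : R)^' --> (0 : R^o).
  by split; [apply/cvg_ex; exists 0 | apply/cvg_lim].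
apply/cvgrPdist_le => d d0.
have dC : 0 < d / C by rewrite divr_gt0.
near=> s; rewrite e subr0 sub0r normrN /= addr0 /GRing.scale /= mulr1 normrM normfV.
have s0 : 0 < `|s| by rewrite normr_gt0; near: s; exact: nbhs_dnbhs_neq.
rewrite ler_pdivrMl // (le_trans (hC s)) // -real_normK ?num_real // expr2 mulrA.
rewrite (mulrC `|s|) ler_wpM2r // mulrC -ler_pdivlMr //.
near: s; apply: dnbhs0_le; exact: dC.
Unshelve. all: by end_near. Qed.

Lemma Ck_flat m k : Ck m setT (flat k : R^o -> R^o).
Proof.
elim: m k => [|m IH] k.
  move=> u _; apply: differentiable_continuous; apply/derivable1_diffP.
  exact: (@ex_derive _ _ _ _ _ _ _ (flat_deriv k u)).
have df u : differentiable (flat k : R^o -> R^o) u.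
  by apply/derivable1_diffP; exact: (@ex_derive _ _ _ _ _ _ _ (flat_deriv k u)).
split=> // v.
have oT : open (setT : set R^o) by exact: openT.
have h := CkM oT (Ck_cst m setT (v : R)) (CkD oT (CkM oT (Ck_cst m setT c) (IH k.+2))
   (CkM oT (Ck_cst m setT (- k%:R)) (IH k.+1))).
apply: Ck_eq oT _ h => u _; rewrite deriveE //.
have -> : v = v *: (1 : R^o) by rewrite /GRing.scale /= mulr1.
rewrite linearZ /= -deriveE // (@derive_val _ _ _ _ _ _ _ (flat_deriv k u)).
by rewrite /GRing.scale /= mulr1 mulNr.
Qed.

End FlatFunction.

Section Bump.
Variables (R : realType) (q : nat).
Hypothesis q0 : (0 < q)%N.
Implicit Types t : R.

Let q1 : 1 <= q%:R :> R. Proof. by rewrite ler1n. Qed.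

(* The margin [4q]^-1 of the plateau, and the constant of the flat function: they make [theta] at
   least [1 - 2 / q] at distance two margins from the end points. *)
Definition margin : R := (4 * q%:R)^-1.
Definition steep : R := margin / q%:R.
Definition theta t : R := flat steep 0 (t - margin) * flat steep 0 (1 - margin - t).

Let margin_gt0 : 0 < margin. Proof. by have := q1; rewrite /margin => ?; rewrite invr_gt0; lra. Qed.
Let steep_gt0 : 0 < steep. Proof. by rewrite divr_gt0 // (lt_le_trans ltr01). Qed.

Lemma theta_ge0 t : 0 <= theta t.
Proof. by rewrite mulr_ge0 ?flat_ge0. Qed.

Lemma theta_le1 t : theta t <= 1.
Proof. by rewrite mulr_ile1 ?flat_ge0 // (flat0_le1 steep_gt0). Qed.

Lemma theta_eq0 t : (t <= margin) || (1 - margin <= t) -> theta t = 0.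
Proof.
by rewrite /theta /flat => /orP[h|h]; rewrite ?[X in if X then _ else _]ltNge;
  [rewrite (_ : t - margin <= 0) ?mul0r | rewrite [0 < 1 - margin - t]ltNge (_ : 1 - margin - t <= 0) ?mulr0];
  rewrite //; lra.
Qed.

Lemma theta_ge t : 2 * margin <= t <= 1 - 2 * margin -> 1 - 2 / q%:R <= theta t.
Proof.
move=> /andP[h1 h2].
have key u : margin <= u -> 1 - q%:R^-1 <= flat steep 0 u.
  move=> mu; have u0 : 0 < u by rewrite (lt_le_trans margin_gt0).
  apply: le_trans (flat0_ge steep u0); rewrite lerD2l lerN2.
  rewrite ler_pdivrMr // mulrC /steep ler_wpM2r // invr_ge0; lra.
have k1 := key (t - margin) ltac:(lra); have k2 := key (1 - margin - t) ltac:(lra).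
have /andP[i0 i1] : 0 <= (q%:R^-1 : R) <= 1.
  by rewrite invr_ge0 ler0n invf_le1 // ltr0n.
have p0 : 0 <= 1 - q%:R^-1 :> R by lra.
rewrite (le_trans _ (ler_pM p0 p0 k1 k2)) //.
by have := sqr_ge0 (q%:R^-1 : R); rewrite expr2; lra.
Qed.

Lemma Ck_theta m : Ck m setT (theta : R^o -> R^o).
Proof.
have oT : open (setT : set R^o) by exact: openT.
have h1 := Ck_comp_affine (L := idfun) (- margin : R^o) (fun x => cvg_id) (Ck_flat steep_gt0 m 0).
have nc : continuous (-%R : R^o -> R^o) by move=> x; exact: continuousN.
have h2 := Ck_comp_affine (L := -%R) (1 - margin : R^o) nc (Ck_flat steep_gt0 m 0).
apply: Ck_eq oT _ (CkM oT h1 h2) => t _.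
by rewrite /theta /= [- t + _]addrC.
Qed.

(** With [2 * q * m] points, each end interval of length [2 * margin] holds [m] of them, and both
    together contribute at most [1 / q]; elsewhere the defect is at most [2 / q]. *)
Lemma avg_theta (m : nat) : (0 < m)%N ->
  ((2 * q * m)%N%:R)^-1 * \sum_(j < 2 * q * m) (1 - theta (j%:R / (2 * q * m)%N%:R)) <= 3 / q%:R.
Proof.
move=> m0; set L := (2 * q * m)%N.
have L0 : (0 < L)%N by rewrite !muln_gt0 q0 m0.
have L1 : 0 < L%:R :> R by rewrite ltr0n.
have mL : (m <= L - m)%N by rewrite /L; nia.
rewrite mulrC ler_pdivrMr //.
rewrite -(big_mkord xpredT (fun j => 1 - theta (j%:R / L%:R))).
have mL' : (m <= L)%N by rewrite (leq_trans mL) ?leq_subr.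
rewrite (big_cat_nat (n := m)) //= (big_cat_nat (m := m) (n := L - m)) ?leq_subr //=.
have LE : L%:R = 2 * q%:R * m%:R :> R by rewrite /L !natrM.
have b1 t : 1 - theta t <= 1 by rewrite gerBl theta_ge0.
have s1 : \sum_(0 <= j < m) (1 - theta (j%:R / L%:R)) <= m%:R.
  by rewrite (le_trans (ler_sum _ (fun j _ => b1 _))) // sumr_const_nat subn0.
have s3 : \sum_(L - m <= j < L) (1 - theta (j%:R / L%:R)) <= m%:R.
  rewrite (le_trans (ler_sum _ (fun j _ => b1 _))) // sumr_const_nat.
  by rewrite subKn // (leq_trans mL) ?leq_subr.
have s2 : \sum_(m <= j < L - m) (1 - theta (j%:R / L%:R)) <= L%:R * (2 / q%:R).
  apply: (@le_trans _ _ (\sum_(m <= j < L - m) (2 / q%:R : R))).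
    rewrite big_nat_cond [leRHS]big_nat_cond; apply: ler_sum => j /andP[/andP[j1 j2] _].
    rewrite lerBlDr addrC -lerBlDr; apply: theta_ge.
    have -> : 2 * margin = m%:R / L%:R.
      by rewrite LE /margin; field; rewrite !pnatr_eq0 -!lt0n q0 m0.
    apply/andP; split; first by rewrite ler_wpM2r ?invr_ge0 // ler_nat.
    rewrite lerBrDr -mulrDl ler_pdivrMr // mul1r -natrD ler_nat; lia.
  rewrite sumr_const_nat -(mulr_natl (2 / q%:R)) ler_wpM2r // ?mulr_ge0 ?invr_ge0 //.
  by rewrite ler_nat; lia.
have -> : 3 / q%:R * L%:R = L%:R * (2 / q%:R) + 2 * m%:R :> R.
  by rewrite LE; field; rewrite pnatr_eq0 -lt0n.
lra.
Qed.

Definition rho n (g : 'rV[R]_n) : R := \prod_(i < n) theta (g 0 i).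

Lemma rho_itv n (g : 'rV[R]_n) : 0 <= rho g <= 1.
Proof.
apply/andP; split; first by apply: prodr_ge0 => i _; exact: theta_ge0.
by apply: prodr_ile1 => i _; rewrite theta_ge0 theta_le1.
Qed.

Lemma rho_eq0 n (g : 'rV[R]_n) i : (g 0 i <= margin) || (1 - margin <= g 0 i) -> rho g = 0.
Proof. by move=> h; rewrite /rho (bigD1 i) //= theta_eq0 ?mul0r. Qed.

Lemma Ck_rho n m : Ck m setT (@rho n : 'rV[R]_n -> R^o).
Proof.
have oT : open (setT : set 'rV[R]_n) by exact: openT.
suff h (s : seq 'I_n) : Ck m setT (fun g : 'rV[R]_n => \prod_(i <- s) theta (g 0 i) : R^o).
  exact: h.
elim: s => [|i s IH].
  by apply: Ck_eq oT _ (Ck_cst m setT (1 : R)) => g _; rewrite big_nil.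
have cc : continuous (coordl i : 'rV[R]_n -> R^o) by exact: linear_continuous_row.
have h := Ck_comp_affine (L := coordl i) (0 : R^o) cc (Ck_theta m).
by apply: Ck_eq oT _ (CkM oT h IH) => g _; rewrite big_cons /= addr0.
Qed.

Lemma avg_rho n (m : nat) : (0 < m)%N ->
  avg (2 * q * m) (fun g : 'rV[R]_n => (1 - rho g) ^+ 2) <= 3 * n%:R / q%:R.
Proof.
move=> m0; set L := (2 * q * m)%N.
have L0 : (0 < L)%N by rewrite !muln_gt0 q0 m0.
apply: (@le_trans _ _ (avg L (fun g : 'rV[R]_n => 1 - rho g))).
  apply: ler_avg => g; have /andP[h1 h2] := rho_itv g.
  by rewrite expr2 ler_piMr; lra.
elim: n => [|n IH]; first by rewrite avg0 /rho big_ord0 subrr mulr0 mul0r.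
rewrite avgS.
apply: (@le_trans _ _ (L%:R^-1 * \sum_(k < L) ((1 - theta (k%:R / L%:R)) + 3 * n%:R / q%:R))).
  rewrite ler_wpM2l ?invr_ge0 // ler_sum // => k _.
  apply: (@le_trans _ _ (avg L (fun y : 'rV[R]_n => (1 - theta (k%:R / L%:R)) + (1 - rho y)))).
    apply: ler_avg => y; rewrite /rho big_ord_recl rowc0.
    under eq_bigr do rewrite rowc_lift.
    rewrite -/(rho y); have /andP[h1 h2] := rho_itv y.
    have := theta_ge0 (k%:R / L%:R); have := theta_le1 (k%:R / L%:R).
    set tt := theta _; nra.
  by rewrite avgD avg_cst // lerD2l.
have h1 := avg_theta m0.
rewrite big_split /= mulrDr sumr_const card_ord -(mulr_natl (3 * n%:R / q%:R)) mulrA mulVf ?mul1r; last first.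
  by rewrite pnatr_eq0 -lt0n.
apply: le_trans (lerD h1 (lexx _)) _.
by rewrite -(natr1 n); lra.
Qed.

End Bump.

Lemma avg_cauchy_schwarz (R : realType) n K (f g : 'rV[R]_n -> R) :
  avg K (fun x => f x * g x) ^+ 2 <= avg K (fun x => f x ^+ 2) * avg K (fun x => g x ^+ 2).
Proof.
set B := avg K (fun x => f x * g x); set A := avg K _; set C := avg K _.
have C0 : 0 <= C by apply: avg_ge0 => x; exact: sqr_ge0.
have key s t : 0 <= s ^+ 2 * A - 2 * s * t * B + t ^+ 2 * C.
  have : 0 <= avg K (fun x => (s * f x - t * g x) ^+ 2) by apply: avg_ge0 => x; exact: sqr_ge0.
  rewrite (eq_avg _ (g := fun x => s ^+ 2 * f x ^+ 2 - 2 * s * t * (f x * g x) + t ^+ 2 * g x ^+ 2)).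
    by rewrite avgD avgB !avgZ.
  by move=> x; ring.
have [C1|C1] := eqVneq C 0.
  have [->|B0] := eqVneq B 0; first by rewrite C1 mulr0 expr0n.
  have := key 1 ((A + 1) / (2 * B)); rewrite C1 mulr0 addr0 expr1n mul1r mulr1.
  have -> : 2 * ((A + 1) / (2 * B)) * B = A + 1 by field.
  by lra.
have {}C0 : 0 < C by rewrite lt_def C1.
have := key C B; have -> : C ^+ 2 * A - 2 * C * B * B + B ^+ 2 * C = C * (A * C - B ^+ 2) by ring.
by rewrite pmulr_rge0 // subr_ge0.
Qed.

Lemma frac_uniq (R : realType) n (v g : 'rV[R]_n) : int_vector (v - g) ->
  (forall i, 0 <= g 0 i < 1) -> frac v = g.
Proof.
move=> /mxOverP vg hg; apply/rowP => i; rewrite mxE.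
have := vg 0 i; rewrite !mxE => /intrP[m e].
have -> : Num.floor (v 0 i) = m.
  apply: Num.Theory.floor_def; have /andP[g0 g1] := hg i.
  by rewrite intrD -e; apply/andP; split; [rewrite gerBl | rewrite -ltrBlDl opprB addrC subrK].
by rewrite -e; ring.
Qed.

Lemma int_vector_frac (R : realType) n (v : 'rV[R]_n) : int_vector (v - frac v).
Proof. by apply/mxOverP => i j; rewrite !mxE ord1 opprB addrC subrK intr_int. Qed.

Lemma grid_int (R : realType) n K (y : 'rV[R]_n) : y \in grid R n K -> int_vector (K%:R *: y).
Proof.
elim: n y => [|n IH] y; first by move=> _; apply/mxOverP => i [].
case/allpairsP => -[k z] /= [kK zg ->].
have K0 : K%:R != 0 :> R.
  by rewrite pnatr_eq0 -lt0n; move: kK; rewrite mem_iota => /andP[]; lia.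
apply/mxOverP => i j; rewrite ord1 mxE; have [l ->|->] := unliftP ord0 j.
  by rewrite rowc_lift; move/mxOverP: (IH _ zg) => /(_ 0 l); rewrite mxE.
by rewrite rowc0 mulrC divfK // natr_int.
Qed.

(** * The interpolated section: pairings and smoothness *)

Section Interpolation.
Variables (R : realType) (n r : nat) (E : clifford_bundle R n r) (a0 : R).
Variables (U : link_variables E a0) (h : R) (hS : transport_scale U h).
Variables (N q : nat) (N0 : (0 < N)%N) (q0 : (0 < q)%N).
Hypothesis Nh : 2 * N%:R^-1 < h.
Implicit Types u v w : section E.

Local Notation a := (N%:R^-1 : R).

Let N1 : 0 < N%:R :> R. Proof. by rewrite ltr0n. Qed.
Let a_gt0 : 0 < a. Proof. by rewrite invr_gt0. Qed.
Let h0 := scale_gt0 hS.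

(* [x] is the lattice point of its cell translated by [N^-1 *: cellpos x]. *)
Definition cellpos (x : torus R n) : 'rV[R]_n := frac (N%:R *: repr x).

Lemma cellposE (v g : 'rV[R]_n) : int_vector (N%:R *: v - g) ->
  (forall i, 0 <= g 0 i < 1) -> cellpos (tpt v) = g.
Proof.
move=> vg; apply: frac_uniq.
have : int_vector (repr (tpt v) - v) by apply/tpt_eq; rewrite /tpt reprK.
move=> /mxOverP rv; apply/mxOverP => i j; move/mxOverP: vg => /(_ i j).
have := rv i j; rewrite ord1 !mxE.
move: (fun_of_matrix (repr (tpt v)) 0 j) (v 0 j) (g 0 j) => x y z xy yz.
have -> : N%:R * x - z = N%:R * (x - y) + (N%:R * y - z) by ring.
by rewrite rpredD // rpredM // natr_int.
Qed.

Lemma cellpos_frac (v : 'rV[R]_n) : cellpos (tpt v) = frac (N%:R *: v).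
Proof. by apply: cellposE => [|i]; [exact: int_vector_frac | exact: frac_itv]. Qed.

Lemma cell_lt (g : 'rV[R]_n) : (forall i, 0 <= g 0 i < 1) -> `|a *: g| < h.
Proof.
move=> hg; rewrite normrZ gtr0_norm //; have := Nh; have := a_gt0.
have : `|g| <= 1 by apply: norm_row_le => // i; have /andP[? ?] := hg i; rewrite ger0_norm // ltW.
by move=> /(ler_wpM2l (ltW a_gt0)); lra.
Qed.

Definition sec u : section E :=
  fun x => (rho q (cellpos x))%:C *: Psh U (- (a *: cellpos x)) u x.

Lemma sec_is_linear : linear sec.
Proof.
move=> k u v; apply: functional_extensionality_dep => x.
rewrite /sec linearP; pose g := cellpos x.
rewrite -[LHS]/(_ *: (k *: Psh U (- (a *: g)) u x + Psh U (- (a *: g)) v x)).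
by rewrite scalerDr scalerA [_ * k]mulrC -scalerA.
Qed.

HB.instance Definition _ :=
  @GRing.isLinear.Build R[i] (section E) (section E) *:%R sec sec_is_linear.

Section Pairing.
Variables (L : nat) (L0 : (0 < L)%N).

(** Pulling back from position [g] to the lattice point undoes the transport in [sec]. *)
Lemma Psh_sec (g y : 'rV[R]_n) u : y \in grid R n N -> (forall i, 0 <= g 0 i < 1) ->
  Psh U (a *: g) (sec u) (tpt y) = (rho q g)%:C *: u (tpt y).
Proof.
move=> yN hg; have cg : cellpos (tpt y + tpt (a *: g)) = g.
  rewrite -tptD; apply: cellposE => //.
  by rewrite scalerDr scalerA mulfV ?gt_eqF // scale1r addrK; exact: grid_int.
rewrite /Psh /sec cg linearZ /=; congr (_ *: _).
by rewrite -[RHS]/(u (tpt y)) -{2}(PshK hS u (cell_lt hg)).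
Qed.

Lemma bK_sec w u : bK (N * L) w (sec u) =
  avg L (fun g => rho q g * bK N (Psh U (a *: g) w) u).
Proof.
rewrite -(avg_cell hS N0 L0 Nh); apply: eq_avg_grid => g gL.
have hg i : 0 <= g 0 i < 1 by exact: grid_itv gL.
rewrite /bK /tavg -avgZ; apply: eq_avg_grid => y yN /=.
by rewrite Psh_sec // (psdZr (rdP E _)).
Qed.

Lemma nbK_sec u : nb (bK (N * L)) (sec u) ^+ 2 =
  avg (n := n) L (fun g => rho q g ^+ 2) * nb (bK N) u ^+ 2.
Proof.
rewrite (sqr_nb (bK_psd _)) (sqr_nb (bK_psd _)) bK_sec mulrC -avgZ.
apply: eq_avg_grid => g gL; have hg i : 0 <= g 0 i < 1 by exact: grid_itv gL.
rewrite mulrC expr2 mulrA; congr (_ * _); rewrite mulrC /bK /tavg -avgZ.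
by apply: eq_avg_grid => y yN /=; rewrite Psh_sec // (psdZl (rdP E _)).
Qed.

(** Replacing the bump by 1 is paid by its L2 distance to 1, through Cauchy-Schwarz over the cell
    positions; neither [w] nor the bump is differentiated. *)
Lemma bK_sec_cell_mean w u :
  `|bK (N * L) w (sec u) - bK N (cell_mean U N L w) u| <=
  Num.sqrt (avg (n := n) L (fun g => (1 - rho q g) ^+ 2)) * nb (bK (N * L)) w * nb (bK N) u.
Proof.
rewrite bK_sec cell_meanE -avgB.
set b := bK N; have Pb : psd b := bK_psd N.
have sE : avg L (fun g => nb b (Psh U (a *: g) w) ^+ 2) = nb (bK (N * L)) w ^+ 2.
  rewrite (sqr_nb (bK_psd (N * L))) -(avg_cell hS N0 L0 Nh).
  by apply: eq_avg => g; rewrite (sqr_nb Pb).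
set e := avg L (fun g => (1 - rho q g) ^+ 2).
have e0 : 0 <= e by apply: avg_ge0 => g; exact: sqr_ge0.
apply: (@le_trans _ _ (avg L (fun g => (1 - rho q g) * nb b (Psh U (a *: g) w)) * nb b u)).
  rewrite (le_trans (ler_norm_avg _ _)) // mulrC -avgZ; apply: ler_avg => g.
  have /andP[r0 r1] := rho_itv q0 g.
  have -> : rho q g * b (Psh U (a *: g) w) u - b (Psh U (a *: g) w) u =
    - ((1 - rho q g) * b (Psh U (a *: g) w) u) by ring.
  rewrite normrN normrM ger0_norm ?subr_ge0 // mulrCA ler_wpM2l ?subr_ge0 //.
  by rewrite mulrC (psd_abs Pb).
have p0 : 0 <= avg L (fun g => (1 - rho q g) * nb b (Psh U (a *: g) w)).
  by apply: avg_ge0 => g; have /andP[r0 r1] := rho_itv q0 g; rewrite mulr_ge0 ?nb_ge0 ?subr_ge0.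
have p1 : 0 <= Num.sqrt e * nb (bK (N * L)) w by rewrite mulr_ge0 ?sqrtr_ge0 ?nb_ge0.
rewrite ler_wpM2r ?nb_ge0 // -(ler_pXn2r (ltn0Sn 1) p0 p1).
by rewrite [leRHS]exprMn sqr_sqrtr // -sE; exact: avg_cauchy_schwarz.
Qed.

End Pairing.

(** At a wall the bump vanishes nearby. Inside a cell the corner is constant near the point, and the
    section is a smooth scalar times the transport of a fixed vector. *)
Lemma smooth_sec u : smooth_section (sec u).
Proof.
apply: smooth_section_local => x0; pose g0 := frac (N%:R *: x0).
have hg0 i : 0 <= g0 0 i < 1 by exact: frac_itv.
have [c cx0] := cdom_cover E (tpt x0).
have near_coord e x i : `|x - x0| < e -> `|N%:R * x 0 i - N%:R * x0 0 i| < N%:R * e.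
  move=> xe; rewrite -mulrBr normrM gtr0_norm // ltr_pM2l //.
  by rewrite (le_lt_trans _ xe) //; have := coord_norm_le (x - x0) i; rewrite !mxE.
(* Positions lie in [[0, 1)], so a wall is a coordinate equal to 0; at nearby points this coordinate
   is close to 0 or, across the wall, close to 1. *)
have [[i /negP gi]|gpos] := pselect (exists i, ~ (0 < g0 0 i)).
  have m0 : 0 < @margin R q by rewrite invr_gt0 mulr_gt0 // ltr0n.
  have [e e0 he] := smallI (chart_nbhd cx0) (small_lt (divr_gt0 m0 N1)).
  have {he} [hc em] := he e e0 (lexx _).
  have gi0 : g0 0 i = 0.
    by apply/eqP; rewrite eq_le; have /andP[-> _] := hg0 i; rewrite andbT leNgt.
  exists c, (ball x0 e); split; [exact: ball_open|exact: ballxx| |move=> k].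
    by move=> x; rewrite -ball_normE /= distrC; exact: hc.
  apply: csmooth_eq (csmooth_cst _ 0); first exact: ball_open.
  move=> x; rewrite -ball_normE /= distrC => xe.
  suff r0 : rho q (cellpos (tpt x)) = 0 by rewrite /sec r0 scale0r linear0 mxE.
  apply: (@rho_eq0 _ _ _ _ i).
  rewrite cellpos_frac mxE; have := near_coord _ _ i xe.
  move: gi0; rewrite /g0 !mxE => /eqP; rewrite subr_eq0 => /eqP ->.
  move: em; rewrite ltr_pdivlMr // mulrC => em /lt_trans /(_ em).
  rewrite ltr_norml => /andP[l1 l2]; move: l1 l2.
  set f := Num.floor (N%:R * x0 0 i); set y := N%:R * x 0 i => l1 l2.
  have m1 : @margin R q <= 4^-1.
    by rewrite /margin lef_pV2 ?posrE ?mulr_gt0 ?ltr0n // ler_peMr // ler1n.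
  have [l|l] := leP f%:~R y.
    have -> : Num.floor y = f by apply: Num.Theory.floor_def; rewrite l intrD /=; lra.
    by apply/orP; left; lra.
  have -> : Num.floor y = f - 1.
    by apply: Num.Theory.floor_def; rewrite subrK l andbT intrB /=; lra.
  by apply/orP; right; rewrite intrB /=; lra.
have {}gpos i : 0 < g0 0 i by apply: contrapT => gi; apply: gpos; exists i.
(* The corner of the cell, common to all points near [x0]. *)
pose z := x0 - a *: g0.
have zE : z = a *: (N%:R *: x0 - g0).
  by rewrite scalerBr scalerA mulVf ?gt_eqF // scale1r.
have [d dz] := cdom_cover E (tpt z).
have cell_open : small (fun e => forall x, `|x - x0| < e -> forall i, 0 < (N%:R *: x - N%:R *: z) 0 i < 1).
  have g1 i : 0 < 1 - g0 0 i by rewrite subr_gt0; have /andP[] := hg0 i.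
  have := small_fin (fun i : 'I_n => smallI (small_lt (divr_gt0 (gpos i) N1))
    (small_lt (divr_gt0 (g1 i) N1))).
  apply: small_imp => e e0 he x xe i.
  have [] := he i; rewrite !ltr_pdivlMr // ![e * _]mulrC => l1 l2.
  have := near_coord _ _ i xe; rewrite ltr_norml => /andP[l3 l4].
  have -> : (N%:R *: x - N%:R *: z) 0 i = g0 0 i + (N%:R * x 0 i - N%:R * x0 0 i).
    rewrite zE scalerA mulfV ?gt_eqF // scale1r !mxE; ring.
  by apply/andP; split; lra.
have [e e0 he] := smallI (chart_nbhd cx0) cell_open.
have {he} [hc hcell] := he e e0 (lexx _).
have Bx x : ball x0 e x -> `|x - x0| < e by rewrite -ball_normE /= distrC.
have cellE x : ball x0 e x -> cellpos (tpt x) = N%:R *: x - N%:R *: z.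
  move=> /Bx /hcell hx; apply: cellposE; last by move=> i; have /andP[/ltW -> ->] := hx i.
  by rewrite opprB addrC subrK zE scalerA mulfV ?gt_eqF // scale1r; exact: int_vector_frac.
have ptE x : ball x0 e x -> tpt x + tpt (- (a *: cellpos (tpt x))) = tpt z.
  move=> xB; rewrite cellE // -tptD; congr (tpt _).
  by rewrite scalerBr !scalerA mulVf ?gt_eqF // !scale1r opprB addrC subrK.
exists c, (ball x0 e); split; [exact: ball_open|exact: ballxx| |move=> k].
  by move=> x /Bx; exact: hc.
have oB : open (ball x0 e) by exact: ball_open.
have rS : csmooth (ball x0 e) (fun x : 'rV[R]_n => (rho q (N%:R *: x - N%:R *: z))%:C).
  split=> m; last exact: Ck_cst.
  have cL : continuous ( *:%R N%:R : 'rV[R]_n -> 'rV[R]_n) by move=> x; exact: scaler_continuous.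
  have := Ck_comp_affine (L := *:%R N%:R) (- (N%:R *: z)) cL (Ck_rho _ q0 n m).
  by apply: Ck_sub.
pose A : 'rV[R[i]]_r := triv (v := E) d (tpt z) (u (tpt z)).
pose fz : {linear 'rV[R]_n -> 'rV[R]_n} := \0.
have cl : continuous (lpair idfun fz : 'rV[R]_n -> 'rV[R]_n * 'rV[R]_n).
  by apply: lpair_continuous; [move=> x; exact: cvg_id | exact: linear_continuous_row].
have lE x : lpair idfun fz x + (0, z) = (x, z).
  by rewrite /lpair /= -[LHS]/(x + 0, 0 + z) addr0 add0r.
pose Q := [set p : 'rV[R]_n * 'rV[R]_n | ball x0 e p.1 /\ p.2 = z].
have mS j l : csmooth (ball x0 e) (fun x => lmat U c d (x, z) j l).
  have qS : forall j l, csmooth Q (fun p => lmat U c d p j l).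
    apply: lmat_smooth => p [xB ->]; split=> //; first exact/hc/Bx.
    move: p.1 xB => x xB; case: hS => _ td _; have := td (tpt x) (- (a *: cellpos (tpt x))).
    by rewrite normrN ptE //; apply; apply: cell_lt => i; exact: frac_itv.
  have := csmooth_affine (0, z) cl (qS j l).
  have sub : ball x0 e `<=` (fun x : 'rV[R]_n => lpair idfun fz x + (0, z)) @^-1` Q.
    by move=> x xB; rewrite /preimage /= lE.
  by move=> /(csmooth_sub sub); apply: csmooth_eq => // x _; rewrite lE.
have AS := csmooth_mulmx (A := fun=> A) oB (fun i j => csmooth_cst _ (A i j)) mS 0 k.
apply: csmooth_eq oB _ (csmoothM oB rS AS) => x xB.
have -> : triv c (tpt x) (sec u (tpt x)) = (rho q (N%:R *: x - N%:R *: z))%:C *: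
    triv c (tpt x) (Psh U (- (a *: cellpos (tpt x))) u (tpt x)).
  by rewrite -cellE // -linearZ.
rewrite [in RHS]mxE; congr (_ * _).
rewrite lmatE /= /A (trivK dz).
by rewrite -[X in _ = triv c (tpt x) X 0 k]/((fun p => U (tpt x) p (u p)) (tpt x + tpt (- (a *: cellpos (tpt x))))) ptE.
Qed.

End Interpolation.

(** * The limit of fine lattices *)

Section SmoothLipschitz.
Variables (R : realType) (n r : nat) (E : clifford_bundle R n r) (a0 : R).
Variables (U : link_variables E a0) (h : R) (hS : transport_scale U h).
Hypothesis a0_gt0 : 0 < a0.
Variable w : section E.
Hypothesis sw : smooth_section w.

Let h0 := scale_gt0 hS.

Lemma Psh_step i : exists C, 0 < C /\ small (fun d => forall s x, `|s| < d ->
  hn ((Psh U (s *: delta_mx 0 i) w - w) x) <= C * `|s|).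
Proof.
have [e e0 he] := section_taylor U a0_gt0 i sw.
have [B B0 hB] := section_bounded (smooth_nabla_cont U a0_gt0 i sw).
exists (1 + B); split; first by rewrite addr_gt0.
apply: small_imp (small_lt e0) => d d0 de s x sd.
have se : `|s| < e by exact: lt_trans de.
rewrite -[(_ - w) x]/(transported U i w x s - w x).
rewrite -(subrK (s%:C *: nabla_cont U i w x) (_ - w x)).
rewrite /hn (le_trans (nbD (rdP E x) _ _)) // (nbZ (rdP E x)) mulrDl mul1r lerD //.
  rewrite (le_trans (he x s se)) // -real_normK ?num_real // expr2 mulrA ler_piMl //.
  by rewrite ler_pdivrMl // mulr1 ltW.
by rewrite mulrC ler_wpM2r //; exact: hB.
Qed.

(* Moving along one coordinate axis at a time; the holonomy is of second order. *)
Lemma Psh_near0 : exists2 C, 0 < C & small (fun d => forall z x, `|z| < d ->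
  hn ((Psh U z w - w) x) <= C * `|z|).
Proof.
have [B B0 hB] := section_bounded sw.
have [f fP] : exists f : 'I_n -> R, forall i, 0 < f i /\ small (fun d => forall s x, `|s| < d ->
  hn ((Psh U (s *: delta_mx 0 i) w - w) x) <= f i * `|s|).
  by exists (fun i => xget 0 [set C | 0 < C /\ small (fun d => forall s x, `|s| < d ->
     hn ((Psh U (s *: delta_mx 0 i) w - w) x) <= C * `|s|)]) => i; case: xgetP => [y _ //|];
     have [C hC] := Psh_step i; move=> /(_ C); case.
pose C0 := \sum_i f i.
have fC i : f i <= C0.
  rewrite /C0 (bigD1 i) //= lerDl sumr_ge0 // => j _; exact/ltW/(fP j).1.
have C00 : 0 <= C0 by apply: sumr_ge0 => j _; exact/ltW/(fP j).1.
have n1 : 0 < n%:R + 1 :> R by rewrite ltr_wpDl.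
exists ((n%:R + 1) * (C0 + B)); first by rewrite mulr_gt0 // ltr_wpDl.
have := smallI (small_fin (fun i => (fP i).2)) (small_lt (divr_gt0 h0 n1)).
apply: small_imp => d d0 [hd dh] z x zd; move: dh; rewrite ltr_pdivlMr // => dh.
pose Z (s : seq 'I_n) : 'rV[R]_n := \sum_(i <- s) z 0 i *: delta_mx 0 i.
have ne i : `|z 0 i *: delta_mx 0 i : 'rV[R]_n| <= `|z|.
  apply: norm_row_le => // j; rewrite !mxE normrM (le_trans (ler_piMr _ _)) ?coord_norm_le //.
  by case: (_ && _); rewrite ?normr0 ?normr1.
have nZ s : `|Z s| <= (size s)%:R * `|z|.
  elim: s => [|i s IH]; first by rewrite /Z big_nil normr0 mul0r.
  by rewrite /Z big_cons (le_trans (ler_normD _ _)) //= -(natr1 (size s)) mulrDl mul1r addrC lerD.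
have key s x' : (size s <= n)%N -> hn ((Psh U (Z s) w - w) x') <= (size s)%:R * (C0 + B) * `|z|.
  elim: s => [|i s IH] sn.
    by rewrite /Z big_nil Psh0 subrr mul0r mul0r /hn (nb0 (rdP E x')).
  pose y := Z s; pose e := z 0 i *: delta_mx 0 i : 'rV[R]_n.
  have zh : (n%:R + 1) * `|z| < h by rewrite (le_lt_trans _ dh) // mulrC ler_wpM2r // ltW.
  have lt1 s' : (size s' <= n)%N -> `|Z s'| < h.
    move=> s'n; rewrite (le_lt_trans (nZ s')) // (le_lt_trans _ zh) // ler_wpM2r //.
    by rewrite (le_trans (_ : _ <= n%:R)) ?ler_nat // lerDl.
  have yh : `|y| < h by apply: lt1; exact: ltnW.
  have eh : `|e| < h.
    by rewrite (le_lt_trans (ne i)) // (le_lt_trans _ zh) // ler_peMl // lerDr.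
  have yeh : `|y + e| < h by rewrite addrC; have := lt1 (i :: s) sn; rewrite /Z big_cons.
  have Ze : Z (i :: s) = y + e by rewrite addrC /Z big_cons.
  have -> : (Psh U (Z (i :: s)) w - w) x' = - ((Psh U y (Psh U e w) - Psh U (y + e) w) x') +
      Psh U y (Psh U e w - w) x' + (Psh U y w - w) x'.
    have e1 : Psh U y (Psh U e w - w) = Psh U y (Psh U e w) - Psh U y w by rewrite linearB.
    rewrite Ze e1; move: (Psh U y w) (Psh U (y + e) w) (Psh U y (Psh U e w)) => A1 A2 A3.
    rewrite -[LHS]/(A2 x' - w x') -[RHS]/(- (A3 x' - A2 x') + (A3 x' - A1 x') + (A1 x' - w x')).
    by move: (A1 x') (A2 x') (A3 x') (w x') => *; zmod.
  have b1 : hn ((Psh U y (Psh U e w) - Psh U (y + e) w) x') <= B * `|z|.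
    rewrite (le_trans (Psh_hol hS _ _ yh eh yeh)) // (hn_Psh hS) //.
    have hy : h^-1 * `|y| <= 1 by rewrite ler_pdivrMl // mulr1 ltW.
    have p0 : 0 <= h^-1 * `|y| by rewrite mulr_ge0 ?invr_ge0 ?(ltW h0).
    have := ler_pM (mulr_ge0 p0 (normr_ge0 e)) (hn_ge0 _) (ler_pM p0 (normr_ge0 e) hy (ne i)) (hB (x' + tpt (y + e))).
    by rewrite mul1r [`|z| * B]mulrC.
  have b2 : hn (Psh U y (Psh U e w - w) x') <= C0 * `|z|.
    rewrite (hn_Psh hS) // (le_trans ((hd i) _ _ _)) //.
      by rewrite (le_lt_trans (coord_norm_le _ _)).
    by rewrite ler_pM ?coord_norm_le //; exact/ltW/(fP i).1.
  have b3 := IH (ltnW sn); rewrite -/y in b3.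
  have n1' := nbD (rdP E x') (- (Psh U y (Psh U e w) - Psh U (y + e) w) x' + Psh U y (Psh U e w - w) x') ((Psh U y w - w) x').
  have n2 := nbD (rdP E x') (- (Psh U y (Psh U e w) - Psh U (y + e) w) x') (Psh U y (Psh U e w - w) x').
  rewrite (nbN (rdP E x')) in n2; rewrite -(natr1 (size s)).
  by move: b1 b2 b3 n1' n2; rewrite /hn; lra.
have zE : Z (enum 'I_n) = z by rewrite /Z big_enum -(row_sum_delta z).
have := key (enum 'I_n) x; rewrite zE size_enum_ord => /(_ (leqnn n)) /le_trans; apply.
by rewrite ler_wpM2r // ler_wpM2r ?addr_ge0 ?(ltW B0) // lerDl.
Qed.

(** Short displacements are covered by [Psh_near0], the others by the bound [2 * B = k * d] on a
    difference of isometric images, as [d <= |z|]. Moving the base point by [y] costs a holonomy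
    term. *)
Lemma Psh_lipschitz : exists2 C, 0 < C & forall y z x, `|y| < h -> `|z| < h -> `|y + z| < h ->
  hn ((Psh U (y + z) w - Psh U y w) x) <= C * `|z|.
Proof.
have [B B0 hB] := section_bounded sw; have [C C0 [d d0 hd]] := Psh_near0.
have {}hd := hd d d0 (lexx _); pose k := 2 * B / d.
have k0 : 0 < k by rewrite divr_gt0 ?mulr_gt0.
have kd : k * d = 2 * B by rewrite /k divfK // gt_eqF.
exists (B + (C + k)) => [|y z x yh zh yzh]; first by rewrite !addr_gt0.
have h1 x' : hn ((Psh U z w - w) x') <= (C + k) * `|z|.
  have [zd|dz] := ltP `|z| d.
    by rewrite (le_trans (hd z x' zd)) // ler_wpM2r // lerDl ltW.
  have : hn ((Psh U z w - w) x') <= 2 * B.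
    have := nbB (rdP E x') (Psh U z w x') (w x'); rewrite -!/(hn _) (hn_Psh hS) //.
    by have := hB x'; have := hB (x' + tpt z); rewrite /hn; lra.
  have := ler_wpM2l (ltW k0) dz; have := mulr_ge0 (ltW C0) (normr_ge0 z).
  by rewrite kd; lra.
have -> : (Psh U (y + z) w - Psh U y w) x = - ((Psh U y (Psh U z w) - Psh U (y + z) w) x) +
      Psh U y (Psh U z w - w) x.
  have e1 : Psh U y (Psh U z w - w) = Psh U y (Psh U z w) - Psh U y w by rewrite linearB.
  rewrite e1; move: (Psh U y w) (Psh U (y + z) w) (Psh U y (Psh U z w)) => A1 A2 A3.
  rewrite -[LHS]/(A2 x - A1 x) -[RHS]/(- (A3 x - A2 x) + (A3 x - A1 x)).
  by move: (A1 x) (A2 x) (A3 x) => *; zmod.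
rewrite /hn (le_trans (nbD (rdP E x) _ _)) // mulrDl lerD //; last by rewrite -/(hn _) (hn_Psh hS).
rewrite (nbN (rdP E x)) -/(hn _) (le_trans (Psh_hol hS _ _ yh zh yzh)) //.
rewrite (hn_Psh hS) //.
have hy : h^-1 * `|y| <= 1 by rewrite ler_pdivrMl // mulr1 ltW.
have p0 : 0 <= h^-1 * `|y| by rewrite mulr_ge0 ?invr_ge0 ?(ltW h0).
have := ler_pM (mulr_ge0 p0 (normr_ge0 z)) (hn_ge0 _) (ler_pM p0 (normr_ge0 z) hy (lexx _)) (hB (x + tpt (y + z))).
by rewrite mul1r [`|z| * B]mulrC.
Qed.

(** Transport is isometric, so norms at neighbouring points differ by no more than the transported
    section does; this is the continuity that the Riemann sums ask for. *)
Lemma unif_cont_sqr_norm : unif_cont (fun y => hn (w (tpt y)) ^+ 2).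
Proof.
have [B B0 hB] := section_bounded sw; have [C C0 hC] := Psh_lipschitz.
have lip x z : `|z| < h -> `|hn (w (x + tpt z)) - hn (w x)| <= C * `|z|.
  move=> zh; rewrite -(hn_Psh hS _ _ zh).
  have := hC 0 z x; rewrite normr0 add0r Psh0 => /(_ h0 zh zh); apply: le_trans.
  rewrite ler_norml lerBlDr lerNl opprB lerBlDr; apply/andP; split.
    by rewrite addrC -[X in _ <= _ + X](nbN (rdP E x)) opprB; exact: (nb_le_sub (rdP E x)).
  by rewrite addrC; exact: (nb_le_sub (rdP E x)).
move=> e e0; pose d := Num.min (h / 2) (e / (2 * B * C)).
have d0 : 0 < d by rewrite lt_min !divr_gt0 ?mulr_gt0.
exists d => // x y; rewrite le_min => /andP[xh xe].
have {}xh : `|x - y| < h by have := h0; lra.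
have := lip (tpt y) (x - y) xh; rewrite -tptD (addrC y) subrK => l.
rewrite subr_sqr normrM (le_trans (ler_pM _ _ l (_ : _ <= 2 * B))) //.
  rewrite ger0_norm ?addr_ge0 ?hn_ge0 // mulr2n mulrDl mul1r lerD //.
by move: xe; rewrite ler_pdivlMr ?mulr_gt0 //; lra.
Qed.

End SmoothLipschitz.

(** * Lattice operators approximate continuum operators *)

Section Limits.
Variables (R : realType) (n r : nat) (E : clifford_bundle R n r) (a0 : R).
Variables (U : link_variables E a0) (h : R) (hS : transport_scale U h).
Hypothesis a0_gt0 : 0 < a0.
Variables (H : L2_completion E) (ip : {dot H for @Num.conj R[i]}).
Hypothesis ip_norm : forall u : H, ip u u = `|u| ^+ 2.
Implicit Types u v w : section E.

Local Notation BH := (re_dot ip).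
Local Notation NH := (nb BH).
Local Notation em := (embed H).
Let PH : psd BH := re_dot_psd ip.

Lemma normHE (x : H) : `|x| = (NH x)%:C.
Proof.
have x0 := normr_ge0 x; have i0 := ger0_Im x0.
have e : `|x| = (complex.Re `|x|)%:C by apply: eq_ReIm.
have r0 : 0 <= complex.Re `|x| by move: x0; rewrite {1}e lecR.
have sq (z : R[i]) : complex.Im z = 0 -> complex.Re (z ^+ 2) = complex.Re z ^+ 2.
  by case: z => a b /= ->; rewrite !expr2 /= mul0r subr0.
by rewrite {1}e /nb /re_dot ip_norm sq // sqrtr_sqr ger0_norm.
Qed.

Lemma embed0 : em 0 = 0.
Proof.
have s0 : smooth_section (0 : section E) by exact: smooth_section0.
have := embed_linear H (-1) s0 s0.
by rewrite scaler0 addr0 scaleN1r addNr.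
Qed.

Lemma embedZ k v : smooth_section v -> em (k *: v) = k *: em v.
Proof.
move=> sv; have s0 : smooth_section (0 : section E) by exact: smooth_section0.
by have := embed_linear H k sv s0; rewrite embed0 !addr0.
Qed.

Lemma embedD v w : smooth_section v -> smooth_section w -> em (v + w) = em v + em w.
Proof. by move=> sv sw; have := embed_linear H 1 sv sw; rewrite !scale1r. Qed.

Lemma embedN v : smooth_section v -> em (- v) = - em v.
Proof. by move=> sv; rewrite -scaleN1r embedZ // scaleN1r. Qed.

Lemma embed_sum I (s : seq I) (F : I -> section E) : (forall i, smooth_section (F i)) ->
  em (\sum_(i <- s) F i) = \sum_(i <- s) em (F i).
Proof.
move=> sF; elim: s => [|i s IH]; first by rewrite !big_nil embed0.
by rewrite !big_cons embedD ?IH //; exact: smooth_section_sum.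
Qed.

Lemma NH_embed v : smooth_section v -> NH (em v) = L2norm v.
Proof.
move=> sv; have := embed_norm H sv; rewrite normHE => /(congr1 (@complex.Re R)).
by [].
Qed.

Lemma Nb_cvg v : smooth_section v -> (fun K => nb (bK (E := E) K) v ^+ 2) @ \oo --> NH (em v) ^+ 2.
Proof.
move=> sv; pose x := torus_integral (fun p => hn (v p) ^+ 2).
have h1 : (fun K => nb (bK (E := E) K) v ^+ 2) @ \oo --> (x : R^o).
  apply/cvgrPdist_le => e e0.
  have [K0 hK] := riemann_cvg (unif_cont_sqr_norm hS a0_gt0 sv) e0.
  near=> K; rewrite (sqr_nb (bK_psd K)).
  have -> : bK K v v = avg K (fun y => hn (v (tpt y)) ^+ 2).
    by apply: eq_avg => y /=; rewrite /hn (sqr_nb (rdP E _)).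
  by apply: hK; near: K; exact: nbhs_infty_gt.
have x0 : 0 <= x by apply: (cvgr_to_ge h1); near=> K; exact: sqr_ge0.
by rewrite NH_embed // /L2norm sqr_sqrtr.
Unshelve. all: by end_near. Qed.

(** By polarization from the convergence of norms, which is all that the completion provides. *)
Lemma bK_cvg v w : smooth_section v -> smooth_section w ->
  (fun K => bK (E := E) K v w) @ \oo --> BH (em v) (em w).
Proof.
move=> sv sw.
have pol (V : lmodType R[i]) (b : V -> V -> R) (pb : psd b) x y :
    4^-1 * (nb b (x + y) ^+ 2 - nb b (x - y) ^+ 2) = b x y.
  rewrite !(sqr_nb pb) !(psdDl pb, psdDr pb, psdNl pb, psdNr pb) (psdC pb y x); lra.
rewrite -(pol _ _ PH) -embedD // -(embedN sw) -embedD //; last exact: smooth_sectionN.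
have : (fun K => 4^-1 * (nb (bK (E := E) K) (v + w) ^+ 2 - nb (bK (E := E) K) (v - w) ^+ 2)) @ \oo
    --> 4^-1 * (NH (em (v + w)) ^+ 2 - NH (em (v - w)) ^+ 2).
  apply: cvgM; first exact: cvg_cst.
  by apply: cvgB; apply: Nb_cvg; [exact: smooth_sectionD | exact: smooth_sectionB].
by under eq_cvg do rewrite (pol _ _ (bK_psd _)).
Qed.

(** Convergence in seminorms that change with the mesh: a section depending on [K] is compared with
    a fixed one on the lattice of mesh [1/K]. *)
Definition approximates (a : nat -> section E) v := (fun K => nb (bK K) (a K - v)) @ \oo --> (0 : R).

Lemma approximates_le a v (c : nat -> R) :
  (\forall K \near \oo, nb (bK K) (a K - v) <= c K) -> c @ \oo --> (0 : R) -> approximates a v.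
Proof.
move=> hc c0; apply: (squeeze_cvgr _ (cvg_cst 0) c0).
by near=> K; rewrite nb_ge0 /=; near: K.
Unshelve. all: by end_near. Qed.

Lemma approximates_cst v : approximates (fun=> v) v.
Proof.
apply: (approximates_le (c := fun=> 0)); last exact: cvg_cst.
by near=> K; rewrite subrr (nb0 (bK_psd K)).
Unshelve. all: by end_near. Qed.

Lemma approximatesD a b v w : approximates a v -> approximates b w ->
  approximates (fun K => a K + b K) (v + w).
Proof.
move=> av bw; apply: (approximates_le (c := fun K => nb (bK K) (a K - v) + nb (bK K) (b K - w))).
  near=> K; rewrite (le_trans _ (nbD (bK_psd K) _ _)) //; apply: eq_le_ring.
  by congr (nb _ _); rewrite opprD addrACA.
by rewrite -[0 : R](addr0 (0 : R)); apply: cvgD.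
Unshelve. all: by end_near. Qed.

Lemma approximatesZ (k : R) a v : approximates a v ->
  approximates (fun K => k%:C *: a K) (k%:C *: v).
Proof.
move=> av; apply: (approximates_le (c := fun K => `|k| * nb (bK K) (a K - v))).
  by near=> K; rewrite -scalerBr (nbZ (bK_psd K)).
by rewrite -[0 : R](mulr0 `|k|); apply: cvgM => //; exact: cvg_cst.
Unshelve. all: by end_near. Qed.

Lemma approximatesN a v : approximates a v -> approximates (fun K => - a K) (- v).
Proof.
move=> av; apply: (approximates_le (c := fun K => nb (bK K) (a K - v))) => //.
by near=> K; rewrite -opprD (nbN (bK_psd K)).
Unshelve. all: by end_near. Qed.

Lemma approximates_sum I (s : seq I) (a : I -> nat -> section E) (v : I -> section E) :
  (forall i, approximates (a i) (v i)) ->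
  approximates (fun K => \sum_(i <- s) a i K) (\sum_(i <- s) v i).
Proof.
move=> av; elim: s => [|i s IH].
  by rewrite big_nil; under eq_fun do rewrite big_nil; exact: approximates_cst.
by rewrite big_cons; under eq_fun do rewrite big_cons; exact: approximatesD.
Qed.

Lemma approximates_cl i a v : approximates a v ->
  approximates (fun K => cl_sec i (a K)) (cl_sec i v).
Proof.
move=> av; apply: (approximates_le (c := fun K => nb (bK K) (a K - v))) => //.
by near=> K; rewrite -(nbK_cl K i (a K - v)) linearB.
Unshelve. all: by end_near. Qed.

Lemma approximates_nb a v : approximates a v -> smooth_section v ->
  (fun K => nb (bK K) (a K)) @ \oo --> NH (em v).
Proof.
move=> av sv.
have h1 : (fun K => nb (bK (E := E) K) v) @ \oo --> NH (em v).
  have e (V : lmodType R[i]) (b : V -> V -> R) x : Num.sqrt (nb b x ^+ 2) = nb b x.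
    by rewrite sqrtr_sqr ger0_norm // nb_ge0.
  rewrite -(e _ BH); under eq_cvg do rewrite -(e _ (bK _)).
  by apply: (cvg_comp _ _ (Nb_cvg sv)); exact: sqrt_continuous.
apply: (squeeze_cvgr (f := fun K => nb (bK K) v - nb (bK K) (a K - v))
  (h := fun K => nb (bK K) v + nb (bK K) (a K - v))).
- near=> K; apply/andP; split; last exact: (nb_le_sub (bK_psd K)).
  by rewrite lerBlDr (nbBC (bK_psd K)); exact: (nb_le_sub (bK_psd K)).
- by rewrite -[X in _ --> X]subr0; apply: cvgB.
- by rewrite -[X in _ --> X]addr0; apply: cvgD.
Unshelve. all: by end_near. Qed.

Lemma approximates_bK a b v w : approximates a v -> approximates b w ->
  smooth_section v -> smooth_section w ->
  (fun K => bK (E := E) K (a K) (b K)) @ \oo --> BH (em v) (em w).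
Proof.
move=> av bw sv sw.
pose c K := nb (bK K) (a K - v) * nb (bK K) (b K) + nb (bK K) v * nb (bK K) (b K - w).
have c0 : c @ \oo --> (0 : R).
  have z : 0 * NH (em w) + NH (em v) * 0 = 0 by rewrite mul0r mulr0 addr0.
  rewrite -[X in _ --> X]z; apply: cvgD; apply: cvgM => //; first exact: approximates_nb.
  exact: (approximates_nb (approximates_cst v)).
have h1 := bK_cvg sv sw.
apply: (squeeze_cvgr (f := fun K => bK K v w - c K) (h := fun K => bK K v w + c K)).
- near=> K; rewrite -ler_distl.
  have -> : bK K (a K) (b K) - bK K v w = bK K (a K - v) (b K) + bK K v (b K - w).
    have pb := bK_psd (E := E) K.
    by rewrite !(psdDl pb, psdDr pb, psdNl pb, psdNr pb); ring.
  by rewrite (le_trans (ler_normD _ _)) // lerD // (psd_abs (bK_psd K)).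
- by rewrite -[X in _ --> X]subr0; apply: cvgB.
- by rewrite -[X in _ --> X]addr0; apply: cvgD.
Unshelve. all: by end_near. Qed.

Lemma cvg_invn : (fun K : nat => K%:R^-1 : R) @ \oo --> (0 : R).
Proof. by rewrite -cvg_shiftS; exact: cvg_harmonic. Qed.

Lemma near_scale (c : R) : 0 < c -> \forall K \near \oo, (0 < K)%N /\ 2 * K%:R^-1 < c.
Proof.
move=> c0; near=> K; split; first by near: K; exact: nbhs_infty_gt.
rewrite mulrC -ltr_pdivlMr //; near: K.
have c2 : 0 < c / 2 by rewrite divr_gt0.
have /cvgr0Pnorm_lt/(_ _ c2) := cvg_invn; apply: filterS => K.
by rewrite ger0_norm // invr_ge0.
Unshelve. all: by end_near. Qed.

Lemma difference_quotient i v (sg : bool) : smooth_section v ->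
  let s K : R := (-1) ^+ sg * K%:R^-1 in
  approximates (fun K => K%:R%:C *: (Psh U (s K *: delta_mx 0 i) v - v))
               (((-1) ^+ sg)%:C *: nabla_cont U i v).
Proof.
move=> sv s; have [e e0 he] := section_taylor U a0_gt0 i sv.
apply: (approximates_le (c := fun K => e^-1 * K%:R^-1)); last first.
  by rewrite -[0 : R](mulr0 e^-1); apply: cvgM; [exact: cvg_cst | exact: cvg_invn].
near=> K; have [K0 Ke] : (0 < K)%N /\ 2 * K%:R^-1 < e by near: K; exact: near_scale.
have K1 : 0 < K%:R :> R by rewrite ltr0n.
have ns : `|s K| = K%:R^-1.
  by rewrite /s normrM normrX normrN1 expr1n mul1r ger0_norm // invr_ge0.
have iK : 0 < K%:R^-1 :> R by rewrite invr_gt0.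
apply: (nbK_le K0); first by rewrite mulr_ge0 ?invr_ge0 ?(ltW e0).
move=> x; have := he x (s K); rewrite ns => /(_ ltac:(lra)).
set D := _ - _ - _ => hD.
have -> : (K%:R%:C *: (Psh U (s K *: delta_mx 0 i) v - v) - ((-1) ^+ sg)%:C *: nabla_cont U i v) x
    = K%:R%:C *: D.
  rewrite /D [RHS]scalerBr [in RHS]scalerA -rmorphM /=.
  have -> : K%:R * s K = (-1) ^+ sg by rewrite /s mulrCA mulfV ?gt_eqF // mulr1.
  by [].
rewrite /hn (nbZ (rdP E x)) ger0_norm ?ler0n // -ler_pdivlMl // (le_trans hD) //.
by rewrite -real_normK ?num_real // ns expr2 mulrCA.
Unshelve. all: by end_near. Qed.

Lemma nablaK_approximates i v : smooth_section v ->
  approximates (fun K => nablaK U K i v) (nabla_cont U i v).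
Proof.
move=> sv; have := difference_quotient i false sv; rewrite /= expr0 scale1r.
by under eq_fun do rewrite mul1r.
Qed.

Lemma nablaK'_approximates i v : smooth_section v ->
  approximates (fun K => nablaK' U K i v) (- nabla_cont U i v).
Proof.
move=> sv; have := difference_quotient i true sv.
rewrite /= expr1 rmorphN1 scaleN1r.
by under eq_fun do rewrite mulN1r scaleNr.
Qed.

Lemma smooth_cl i v : smooth_section v -> smooth_section (cl_sec i v).
Proof. by move=> sv; apply: smooth_section_endo => //; exact: cl_smooth. Qed.

Lemma smooth_gam v : smooth_section v -> smooth_section (gam_sec v).
Proof. by move=> sv; apply: smooth_section_endo => //; exact: gam_smooth. Qed.

Lemma dirac_contE v : dirac_cont U v = \sum_(i < n) cl_sec i (nabla_cont U i v).
Proof.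
apply: functional_extensionality_dep => x; rewrite /dirac_cont.
have : forall s : seq 'I_n, \sum_(i <- s) cl E i x (nabla_cont U i v x) =
  (\sum_(i <- s) cl_sec i (nabla_cont U i v) : section E) x; last by apply.
by elim=> [|i s IH]; rewrite ?big_nil // !big_cons IH.
Qed.

Lemma smooth_dirac v : smooth_section v -> smooth_section (dirac_cont U v).
Proof.
move=> sv; rewrite dirac_contE; apply: smooth_section_sum => i.
by apply: smooth_cl; exact: smooth_nabla_cont.
Qed.

Lemma wilsonK_approximates v : smooth_section v ->
  approximates (fun K => wilsonK U K v) (dirac_cont U v).
Proof.
move=> sv; have a1 i := nablaK_approximates i sv; have a2 i := nablaK'_approximates i sv.
have h1 : approximates (fun K => \sum_(i < n) cl_sec i (2^-1%:C *: (nablaK U K i v - nablaK' U K i v)))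
    (dirac_cont U v).
  rewrite dirac_contE; apply: approximates_sum => i; apply: approximates_cl.
  have := approximatesZ 2^-1 (approximatesD (a1 i) (approximatesN (a2 i))).
  suff -> : 2^-1%:C *: (nabla_cont U i v - - nabla_cont U i v) = nabla_cont U i v by [].
  rewrite opprK scalerDr -scalerDl -rmorphD /=.
  by rewrite (_ : 2^-1 + 2^-1 = 1 :> R) ?scale1r //; lra.
have h2 : approximates (fun K => \sum_(i < n) 2^-1%:C *: (nablaK U K i v + nablaK' U K i v)) 0.
  have z : \sum_(i < n) 2^-1%:C *: (nabla_cont U i v - nabla_cont U i v) = 0.
    by rewrite big1 // => i _; rewrite subrr scaler0.
  rewrite -[X in approximates _ X]z.
  by apply: approximates_sum => i; apply: approximatesZ; exact: approximatesD.
by have := approximatesD h1 (approximatesN h2); rewrite subr0.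
Qed.

(** The lattice inequality has constants independent of the mesh and passes to the limit, where the
    Wilson term disappears. It is the Garding inequality of the Dirac operator. *)
Lemma continuum_elliptic v : smooth_section v ->
  \sum_(i < n) NH (em (nabla_cont U i v)) ^+ 2 <=
  NH (em (dirac_cont U v)) ^+ 2 + 8 * n%:R ^+ 2 * h^-1 * NH (em v) ^+ 2.
Proof.
move=> sv; have h0 := scale_gt0 hS.
have c2 (a : nat -> section E) w : approximates a w -> smooth_section w ->
    (fun K => nb (bK K) (a K) ^+ 2) @ \oo --> NH (em w) ^+ 2.
  by move=> aw sw; under eq_cvg do rewrite expr2; rewrite expr2; apply: cvgM; exact: approximates_nb.
have h1 : (fun K => \sum_(i < n) nb (bK K) (nablaK U K i v) ^+ 2) @ \oo -->
    \sum_(i < n) NH (em (nabla_cont U i v)) ^+ 2.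
  apply: cvg_big => [|i _]; first by move=> x; exact: add_continuous.
  by apply: c2; [exact: nablaK_approximates | exact: smooth_nabla_cont].
have h2 : (fun K => nb (bK K) (wilsonK U K v) ^+ 2 + 8 * n%:R ^+ 2 * h^-1 * nb (bK K) v ^+ 2) @ \oo -->
    NH (em (dirac_cont U v)) ^+ 2 + 8 * n%:R ^+ 2 * h^-1 * NH (em v) ^+ 2.
  apply: cvgD; first by apply: c2; [exact: wilsonK_approximates | exact: smooth_dirac].
  by apply: cvgM; [exact: cvg_cst | exact: Nb_cvg].
apply: (ler_cvg_to h1 h2); near=> K.
have [K0 Kh] : (0 < K)%N /\ 2 * K%:R^-1 < h by near: K; exact: near_scale.
by exact: (wilsonK_elliptic hS K0 Kh).
Unshelve. all: by end_near. Qed.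

Lemma cl_embed_adj i v w : smooth_section v -> smooth_section w ->
  BH (em (cl_sec i v)) (em w) = BH (em v) (em (cl_sec i w)).
Proof.
move=> sv sw; have := bK_cvg (smooth_cl i sv) sw.
under eq_cvg do rewrite cl_sec_adj.
by move=> /cvg_lim <- //; apply/cvg_lim => //; apply: bK_cvg => //; exact: smooth_cl.
Qed.

Lemma gam_embed_adj v w : smooth_section v -> smooth_section w ->
  BH (em (gam_sec v)) (em w) = BH (em v) (em (gam_sec w)).
Proof.
move=> sv sw; have := bK_cvg (smooth_gam sv) sw.
under eq_cvg do rewrite gam_sec_adj.
by move=> /cvg_lim <- //; apply/cvg_lim => //; apply: bK_cvg => //; exact: smooth_gam.
Qed.

(** Integration by parts as a limit: on each lattice the adjoint of [nablaK] is [nablaK'], which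
    converges to minus the covariant derivative, and [c i] is self-adjoint and commutes with
    transport. *)
Lemma dirac_antisym v : smooth_section v -> BH (em (dirac_cont U v)) (em v) = 0.
Proof.
move=> sv; have h0 := scale_gt0 hS; rewrite dirac_contE embed_sum; last first.
  by move=> i; apply: smooth_cl; exact: smooth_nabla_cont.
rewrite (psd_suml PH) big1 // => i _.
have sN : smooth_section (nabla_cont U i v) by exact: smooth_nabla_cont.
have c1 := approximates_bK (approximates_cl i (nablaK_approximates i sv))
  (approximates_cst v) (smooth_cl i sN) sv.
have c2 := approximates_bK (approximates_cst (cl_sec i v)) (nablaK'_approximates i sv)
  (smooth_cl i sv) (smooth_sectionN sN).
have e : BH (em (cl_sec i (nabla_cont U i v))) (em v) = BH (em (cl_sec i v)) (em (- nabla_cont U i v)).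
  have ee : \forall K \near \oo, bK K (cl_sec i (nablaK U K i v)) v = bK K (cl_sec i v) (nablaK' U K i v).
    near=> K; have [K0 Kh] : (0 < K)%N /\ 2 * K%:R^-1 < h by near: K; exact: near_scale.
    by rewrite (nablaK_cl hS K0 Kh) (nablaK_adj hS K0 Kh).
  apply/le_anti/andP; split; [apply: (ler_cvg_to c1 c2) | apply: (ler_cvg_to c2 c1)];
    by apply: filterS ee => K ->.
move: e; rewrite embedN // (psdNr PH) cl_embed_adj //.
rewrite (psdC PH (em (cl_sec i v))).
by move: (BH _ _) => x; lra.
Unshelve. all: by end_near. Qed.

End Limits.

Section Sequences.
Variable R : realType.
Implicit Types (f g : nat -> R) (l m c : R).

Lemma seq_cst c : (fun _ : nat => c) @ \oo --> c.
Proof. exact: cvg_cst. Qed.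

Lemma seqD f g l m : f @ \oo --> l -> g @ \oo --> m -> (fun K => f K + g K) @ \oo --> l + m.
Proof. exact: cvgD. Qed.

Lemma seqB f g l m : f @ \oo --> l -> g @ \oo --> m -> (fun K => f K - g K) @ \oo --> l - m.
Proof. exact: cvgB. Qed.

Lemma seqM f g l m : f @ \oo --> l -> g @ \oo --> m -> (fun K => f K * g K) @ \oo --> l * m.
Proof. exact: cvgM. Qed.

Lemma seqX2 f l : f @ \oo --> l -> (fun K => f K ^+ 2) @ \oo --> l ^+ 2.
Proof. by move=> fl; exact: (seqM fl fl). Qed.

Lemma seq_norm f l : f @ \oo --> l -> (fun K => `|f K|) @ \oo --> `|l|.
Proof. exact: cvg_norm. Qed.

Lemma seq_comp f l (k : nat -> nat) : k @ \oo --> \oo -> f @ \oo --> l ->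
  (fun j => f (k j)) @ \oo --> l.
Proof. by move=> kc fl; exact: (cvg_comp _ _ kc fl). Qed.

Lemma seq_le f g l m : f @ \oo --> l -> g @ \oo --> m ->
  (forall K, (0 < K)%N -> f K <= g K) -> l <= m.
Proof.
move=> fl gm fg; apply: (ler_cvg_to fl gm); near=> K; apply: fg.
by near: K; exact: nbhs_infty_gt.
Unshelve. all: by end_near. Qed.

Lemma seq_mul_oo (c : nat) : (0 < c)%N -> (fun K => c * K)%N @ \oo --> \oo.
Proof.
move=> c0; apply/cvgnyPge => A; near=> m.
have Am : (A <= m)%N by near: m; exact: nbhs_infty_ge.
by rewrite (leq_trans Am) // leq_pmull.
Unshelve. all: by end_near. Qed.

End Sequences.

Arguments seq_cst {R} c.

(** * Bounds, coercivity and intertwining for smooth sections *)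

Section Coupling.
Variables (R : realType) (n r : nat) (E : clifford_bundle R n r) (a0 : R).
Variables (U : link_variables E a0) (h : R) (hS : transport_scale U h).
Hypothesis a0_gt0 : 0 < a0.
Variables (H : L2_completion E) (ip : {dot H for @Num.conj R[i]}).
Hypothesis ip_norm : forall u : H, ip u u = `|u| ^+ 2.
Variables (N q : nat) (N0 : (0 < N)%N) (q0 : (0 < q)%N).
Hypotheses (Nh : 2 * N%:R^-1 < h) (N4 : N%:R^-1 <= 4^-1 :> R).
Hypothesis q_large : 3 * n%:R / q%:R <= N%:R^-1 ^+ 2 :> R.
Implicit Types u v w phi : section E.

Local Notation a := (N%:R^-1 : R).
Local Notation BH := (re_dot ip).
Local Notation NH := (nb BH).
Local Notation em := (embed H).
Local Notation b := (bK (E := E) N).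
Local Notation Nb := (nb b).
Local Notation grad i w := (em (nabla_cont U i w)).

Let PH : psd BH := re_dot_psd ip.
Let Pb : psd b := bK_psd N.
Let h0 := scale_gt0 hS.
Let N1 : 0 < N%:R :> R. Proof. by rewrite ltr0n. Qed.
Let a_gt0 : 0 < a. Proof. by rewrite invr_gt0. Qed.

Definition interp u : H := em (sec U N q u).

(** Refinements by multiples of [2 * q] align the plateau of the bump with the grid. *)
Let Lm m := (2 * q * m)%N.
Let Km m := (N * Lm m)%N.

Let Lm_gt0 m : (0 < m)%N -> (0 < Lm m)%N.
Proof. by move=> m0; rewrite !muln_gt0 q0 m0. Qed.

Let Lcvg : Lm @ \oo --> \oo.
Proof. by apply: seq_mul_oo; rewrite muln_gt0. Qed.

Let Kcvg : Km @ \oo --> \oo.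
Proof. exact: (cvg_comp _ _ Lcvg (seq_mul_oo N0)). Qed.

Lemma bump_defect m : (0 < m)%N ->
  Num.sqrt (avg (n := n) (Lm m) (fun g => (1 - rho q g) ^+ 2)) <= a.
Proof.
move=> m0; rewrite -[leRHS]ger0_norm ?(ltW a_gt0) // -sqrtr_sqr ler_wsqrtr //.
by rewrite (le_trans (avg_rho _ q0 _ m0)).
Qed.

Lemma sec_cl i u : cl_sec i (sec U N q u) = sec U N q (cl_sec i u).
Proof.
apply: functional_extensionality_dep => x; rewrite /sec {1}/cl_sec linearZ; congr (_ *: _).
rewrite -(Psh_cl hS) // normrN; apply: (cell_lt N0 Nh) => i'; exact: frac_itv.
Qed.

Lemma sec_gam u : gam_sec (sec U N q u) = sec U N q (gam_sec u).
Proof.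
apply: functional_extensionality_dep => x; rewrite /sec {1}/gam_sec linearZ; congr (_ *: _).
rewrite -(Psh_gam hS) // normrN; apply: (cell_lt N0 Nh) => i'; exact: frac_itv.
Qed.

Let ss u : smooth_section (sec U N q u) := smooth_sec hS N0 q0 Nh u.

Lemma interpD u v : interp (u + v) = interp u + interp v.
Proof. by rewrite /interp linearD (embedD H (ss u) (ss v)). Qed.

Lemma interpZ k u : interp (k *: u) = k *: interp u.
Proof. by rewrite /interp linearZ (embedZ H k (ss u)). Qed.

Lemma interp_sum I (s : seq I) (F : I -> section E) :
  interp (\sum_(i <- s) F i) = \sum_(i <- s) interp (F i).
Proof. by rewrite /interp linear_sum (embed_sum H _ (fun i => ss (F i))). Qed.

Lemma interp_norm_cvg u :
  (fun m => avg (n := n) (Lm m) (fun g => rho q g ^+ 2) * Nb u ^+ 2) @ \oo --> NH (interp u) ^+ 2.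
Proof.
have := seq_comp Kcvg (Nb_cvg hS a0_gt0 ip_norm (ss u)).
apply: cvg_trans; apply: near_eq_cvg; near=> m.
have m0 : (0 < m)%N by near: m; exact: nbhs_infty_gt.
by rewrite /= (nbK_sec hS q N0 Nh (Lm_gt0 m0)).
Unshelve. all: by end_near. Qed.

Lemma interp_le u : NH (interp u) <= Nb u.
Proof.
rewrite -(ler_pXn2r (ltn0Sn 1)) ?nnegrE ?nb_ge0 //.
apply: (seq_le (@interp_norm_cvg u) (seq_cst _)) => m m0.
rewrite ler_piMl ?sqr_ge0 // -[leRHS](avg_cst n (1 : R) (Lm_gt0 m0)).
apply: ler_avg => g; have /andP[r0 r1] := rho_itv q0 g; by rewrite expr_le1.
Qed.

(** The squared norm is multiplied by the mean of [rho ^+ 2 >= 1 - 2 * (1 - rho)], and [1 - rho] has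
    mean at most [a <= 1 / 4]. *)
Lemma interp_ge u : Nb u <= 2 * NH (interp u).
Proof.
rewrite -(ler_pXn2r (ltn0Sn 1)) ?nnegrE ?mulr_ge0 ?nb_ge0 // exprMn.
suff : 4^-1 * Nb u ^+ 2 <= NH (interp u) ^+ 2 by lra.
apply: (seq_le (seq_cst _) (@interp_norm_cvg u)) => m m0.
rewrite ler_wpM2r ?sqr_ge0 //.
have L0 := Lm_gt0 m0.
pose x : R := avg (n := n) (Lm m) (fun g => 1 - rho q g).
have xa : x <= a.
  rewrite (le_trans _ (bump_defect m0)) // -[leLHS]ger0_norm; last first.
    by apply: avg_ge0 => g; have /andP[_ r1] := rho_itv q0 g; rewrite subr_ge0.
  by rewrite -sqrtr_sqr ler_wsqrtr // sqr_avg_le.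
have : avg (Lm m) (fun g : 'rV[R]_n => 1 - 2 * (1 - rho q g)) <= avg (Lm m) (fun g : 'rV[R]_n => rho q g ^+ 2).
  by apply: ler_avg => g; have := sqr_ge0 (1 - rho q g); lra.
by rewrite avgB avgZ avg_cst // -/x; have := N4; lra.
Qed.

(** Of the summand 2, one unit comes from [weak_gradient] and one from exchanging cell means for
    pairings with [interp], which contain the bump. *)
Lemma weak_gradient_limit i w u : smooth_section w ->
  `|BH (grad i w) (interp u) - BH (em w) (interp (nablaK' U N i u))|
  <= a * (2 + 3 * h^-1) * (NH (grad i w) + NH (em w)) * (Nb u + Nb (nablaK' U N i u)).
Proof.
move=> sw; set u' := nablaK' U N i u.
have sN : smooth_section (nabla_cont U i w) := smooth_nabla_cont U a0_gt0 i sw.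
have aN := nablaK_approximates U a0_gt0 i sw.
have ac v : approximates (fun=> v) v := approximates_cst v.
have c1 := seq_comp Kcvg (approximates_bK hS a0_gt0 ip_norm aN (ac _) sN (ss u)).
have c2 := seq_comp Kcvg (bK_cvg hS a0_gt0 ip_norm sw (ss u')).
have c3 := seq_comp Kcvg (approximates_nb hS a0_gt0 ip_norm aN sN).
have c4 := seq_comp Kcvg (approximates_nb hS a0_gt0 ip_norm (ac w) sw).
have cl := seq_norm (seqB c1 c2).
have cr := seqM (seqM (seq_cst (a * (2 + 3 * h^-1))) (seqD c3 c4)) (seq_cst (Nb u + Nb u')).
apply: (seq_le cl cr) => m m0; set K := Km m.
have L0 := Lm_gt0 m0; have eta := bump_defect m0.
set D := nablaK U K i w.
have t1 := bK_sec_cell_mean hS N0 q0 Nh L0 D u.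
have t2 := bK_sec_cell_mean hS N0 q0 Nh L0 w u'.
have t3 := weak_gradient hS N0 L0 Nh i w u.
rewrite -!cell_meanE -/u' -/D in t3.
have e1 : Num.sqrt (avg (Lm m) (fun g : 'rV[R]_n => (1 - rho q g) ^+ 2)) * nb (bK K) D * Nb u <=
    a * nb (bK K) D * Nb u by rewrite !ler_wpM2r ?nb_ge0.
have e2 : Num.sqrt (avg (Lm m) (fun g : 'rV[R]_n => (1 - rho q g) ^+ 2)) * nb (bK K) w * Nb u' <=
    a * nb (bK K) w * Nb u' by rewrite !ler_wpM2r ?nb_ge0.
have := le_trans t1 e1; have := le_trans t2 e2; move: t3; rewrite -/K.
have := nb_ge0 (bK K) D; have := nb_ge0 (bK K) w; have := nb_ge0 b u; have := nb_ge0 b u'.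
move: (nb (bK K) D) (nb (bK K) w) (Nb u) (Nb u') => d w' x x' x'0 x0 w0 d0.
move: (bK K D _) (bK K w _) (b _ u) (b _ u') => T1 T2 S1 S2.
rewrite !ler_norml => /andP[l1 l2] /andP[l3 l4] /andP[l5 l6].
have p1 := mulr_ge0 (ltW a_gt0) (mulr_ge0 d0 x'0).
have p2 := mulr_ge0 (ltW a_gt0) (mulr_ge0 w0 x0).
by apply/andP; split; nra.
Qed.

(** In the proof of coercivity the test section is a cell mean and depends on [L], while its pairing
    with [interp] is a limit over meshes. So it is frozen while the mesh is refined further by [l],
    and this bounds the resulting change of the cell mean. *)
Lemma cell_mean_refine w : smooth_section w -> exists2 C, 0 <= C &
  forall L l, (0 < L)%N -> (0 < l)%N -> forall u,
  `|b (cell_mean U N (L * l) w) u - b (cell_mean U N L w) u| <= C * L%:R^-1 * Nb u.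
Proof.
move=> sw; have [C C0 hC] := Psh_lipschitz hS a0_gt0 sw.
exists (C * a) => [|L l L0 l0 u]; first by rewrite mulr_ge0 // ltW.
have iL : 0 < L%:R^-1 :> R by rewrite invr_gt0 ltr0n.
rewrite !cell_meanE avg_refine // -[X in _ - X](avg_cst n _ l0) -avgB.
rewrite (le_trans (ler_norm_avg _ _)) // -[leRHS](avg_cst n _ l0).
apply: ler_avg_grid => g gl; rewrite -avgB (le_trans (ler_norm_avg _ _)) // -[leRHS](avg_cst n _ L0).
apply: ler_avg_grid => x xL; rewrite -(psdBl Pb) (le_trans (psd_abs Pb _ _)) // ler_wpM2r ?nb_ge0 //.
have gn := grid_norm (N := N) N0 gl; have xn := grid_norm (N := N) N0 xL.
have gn' : `|a *: (L%:R^-1 *: g)| <= a * L%:R^-1.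
  rewrite !normrZ !gtr0_norm // mulrCA mulrC ler_wpM2r ?(ltW iL) //.
  by move: gn; rewrite normrZ gtr0_norm.
have L1 : L%:R^-1 <= 1 :> R by rewrite invf_le1 ?ltr0n // ler1n.
have aL : a * L%:R^-1 <= a by rewrite ler_piMr // ltW.
apply: (nbK_le N0) => [|y]; first by rewrite !mulr_ge0 // ltW.
rewrite scalerDr (le_trans (hC _ _ y _ _ _)) //; last by rewrite -mulrA ler_wpM2l // ltW.
- by have := Nh; have := a_gt0; lra.
- by have := Nh; have := a_gt0; lra.
- by rewrite (le_lt_trans (ler_normD _ _)) //; have := Nh; lra.
Qed.

(* The hypothesis bounds the adjoint of [interp] at [w], hence the cell means of [w]
   as the mesh of the fine lattice goes to 0. *)
Lemma interp_coercive w (beta : R) : smooth_section w -> 0 <= beta ->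
  (forall u, BH (em w) (interp u) <= beta * Nb u) ->
  NH (em w) ^+ 2 <= (beta + a * NH (em w)) ^+ 2 +
    4 ^+ n * \sum_(i < n) a ^+ 2 * (NH (grad i w) ^+ 2 + NH (em w) ^+ 2).
Proof.
move=> sw beta0 hb; have [C C0 hC] := cell_mean_refine sw.
have aN i := nablaK_approximates U a0_gt0 i sw.
have sN i : smooth_section (nabla_cont U i w) := smooth_nabla_cont U a0_gt0 i sw.
have nw := approximates_nb hS a0_gt0 ip_norm (approximates_cst w) sw.
have bound m : (0 < m)%N ->
    Nb (cell_mean U N (Lm m) w) <= beta + a * NH (em w) + C * (Lm m)%:R^-1.
  move=> m0; set L := Lm m; have L0 : (0 < L)%N := Lm_gt0 m0.
  set cm := cell_mean U N L w.
  have ncvg : (fun l => N * (L * l))%N @ \oo --> \oo.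
    by under eq_cvg do rewrite mulnA; apply: seq_mul_oo; rewrite muln_gt0 N0 L0.
  have c1 := seq_comp ncvg (bK_cvg hS a0_gt0 ip_norm sw (ss cm)).
  have c2 := seq_comp ncvg nw.
  have cr := seqD c1 (seqM (seqM (seq_cst a) c2) (seq_cst (Nb cm))).
  (* Duality: the cell mean is tested against itself, through its interpolation, and one factor
     [Nb cm] cancels afterwards. *)
  have key : Nb cm ^+ 2 - C * L%:R^-1 * Nb cm <=
      BH (em w) (interp cm) + a * NH (em w) * Nb cm.
    apply: (seq_le (seq_cst _) cr) => l l0.
    have Ll0 : (0 < L * l)%N by rewrite muln_gt0 L0 l0.
    have Le : (L * l = Lm (m * l))%N by rewrite /L /Lm mulnA.
    have ml0 : (0 < m * l)%N by rewrite muln_gt0 m0 l0.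
    have t1 := bK_sec_cell_mean hS N0 q0 Nh Ll0 w cm.
    have := bump_defect ml0; rewrite -Le => eta.
    have e1 := ler_wpM2r (nb_ge0 b cm) (ler_wpM2r (nb_ge0 (bK (N * (L * l))) w) eta).
    have := hC L l L0 l0 cm; rewrite -/cm -(sqr_nb Pb).
    have := le_trans t1 e1; rewrite !ler_norml => /andP[l1 l2] /andP[l3 l4]; lra.
  have [c0|c0] := eqVneq (Nb cm) 0.
    by rewrite c0 !addr_ge0 ?mulr_ge0 ?invr_ge0 ?nb_ge0 ?(ltW a_gt0).
  have cp : 0 < Nb cm by rewrite lt_def c0 nb_ge0.
  by rewrite -(ler_pM2r cp) -expr2; have := hb cm; move: key; lra.
have c2 (x : nat -> section E) v : approximates x v -> smooth_section v ->
    (fun m => nb (bK (Km m)) (x (Km m)) ^+ 2) @ \oo --> NH (em v) ^+ 2.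
  by move=> xv sv; apply: seqX2; exact: (seq_comp Kcvg (approximates_nb hS a0_gt0 ip_norm xv sv)).
have ci : (fun m => (Lm m)%:R^-1 : R) @ \oo --> (0 : R).
  exact: (seq_comp Lcvg (@cvg_invn R)).
have cr1 := seqX2 (seqD (seq_cst (beta + a * NH (em w))) (seqM (seq_cst C) ci)).
have cr2 : (fun m => 4 ^+ n * \sum_(i < n) a ^+ 2 *
      (nb (bK (Km m)) (nablaK U (Km m) i w) ^+ 2 + nb (bK (Km m)) w ^+ 2)) @ \oo -->
    4 ^+ n * \sum_(i < n) a ^+ 2 * (NH (grad i w) ^+ 2 + NH (em w) ^+ 2).
  apply: seqM; first exact: seq_cst.
  apply: cvg_big => [|i _]; first by move=> x; exact: add_continuous.
  apply: seqM; first exact: seq_cst.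
  by apply: seqD; [exact: (c2 _ _ (aN i)) | exact: (c2 _ _ (approximates_cst w))].
rewrite -[beta + _]addr0 -{1}(mulr0 C).
apply: (seq_le (c2 _ _ (approximates_cst w) sw) (seqD cr1 cr2)) => m m0.
rewrite (le_trans (cell_mean_lower_bound hS N0 (Lm_gt0 m0) Nh w)) // lerD2r.
by rewrite ler_pXn2r ?nnegrE ?nb_ge0 ?bound // (le_trans (nb_ge0 _ _) (bound m m0)).
Qed.

Lemma nablaK'_gam i u : gam_sec (nablaK' U N i u) = nablaK' U N i (gam_sec u).
Proof.
rewrite /nablaK' linearZ linearB /= (Psh_gam hS) // normrN.
exact: (unit_step_lt N0 Nh).
Qed.

(** Hence the Wilson term is [a / 2] times a lattice Laplacian. *)
Lemma nablaK_sum_laplace i u :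
  nablaK U N i u + nablaK' U N i u = - (a%:C *: nablaK' U N i (nablaK U N i u)).
Proof.
have lt := unit_step_lt N0 Nh i.
have e : Psh U (- unit_step R N i) (Psh U (unit_step R N i) u) = u.
  by rewrite -{2}(opprK (unit_step R N i)) (PshK hS) // normrN.
have aN : a%:C * N%:R%:C = 1 :> R[i] by rewrite -rmorphM /= mulVf ?gt_eqF.
have e2 : nablaK' U N i (nablaK U N i u) = N%:R%:C *: (N%:R%:C *:
    ((u - Psh U (- unit_step R N i) u) - (Psh U (unit_step R N i) u - u))).
  by rewrite /nablaK' /nablaK [Psh U _ (_ *: _)]linearZ /= [Psh U _ (_ - _)]linearB /= e -scalerBr.
rewrite e2 scalerA aN scale1r -scalerN /nablaK /nablaK' -scalerDr; congr (_ *: _).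
move: (Psh U (unit_step R N i) u) (Psh U (- unit_step R N i) u) => x y.
by move: u x y {e e2} => *; zmod.
Qed.

Lemma nb_nablaK'_le i u : Nb (nablaK' U N i u) <= 2 * N%:R * Nb u.
Proof.
rewrite /nablaK' (nbZ Pb) ger0_norm ?ler0n // [2 * _]mulrC -mulrA ler_wpM2l ?ler0n //.
rewrite (le_trans (nbB Pb _ _)) // (nbK_Psh hS) //; first lra.
  by rewrite normrN (unit_step_lt N0 Nh).
by rewrite scalerN; apply: int_vectorN; exact: unit_step_int.
Qed.

(** [weak_gradient_limit] yields differences [nablaK'], so the operator is written with these alone.
    The central difference is [- nablaK'] plus half of [nablaK + nablaK']; the latter is [a] times a
    second difference and joins the Wilson term in the last summand. The sign of the first summand
    comes from the anticommutation of [gamma] and [c i]. *)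
Lemma wilson_split phi : gam_sec (wilsonK U N phi) = \sum_(i < n)
  (nablaK' U N i (cl_sec i (gam_sec phi)) + nablaK' U N i
    (- ((a / 2)%:C *: gam_sec (cl_sec i (nablaK U N i phi) - nablaK U N i phi)))).
Proof.
rewrite /wilsonK -sumrB linear_sum; apply: eq_bigr => i _.
have half (V : lmodType R[i]) (x y : V) : x = 2^-1%:C *: (x - y) + 2^-1%:C *: (x + y).
  rewrite -scalerDr [x + y]addrC addrA subrK scalerDr -scalerDl -rmorphD /=.
  by rewrite (_ : 2^-1 + 2^-1 = 1 :> R) ?scale1r //; lra.
pose A := nablaK U N i phi; pose B := nablaK' U N i phi.
have e1 : nablaK' U N i (cl_sec i (gam_sec phi)) = - gam_sec (cl_sec i B).
  by rewrite -(nablaK'_cl hS N0 Nh) -nablaK'_gam gam_cl_sec opprK.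
have e2 : nablaK' U N i (- ((a / 2)%:C *: gam_sec (cl_sec i A - A))) =
   gam_sec (cl_sec i (2^-1%:C *: (A + B)) - 2^-1%:C *: (A + B)).
  have lN (k : R) x : nablaK' U N i (- (k%:C *: x)) = - (k%:C *: nablaK' U N i x).
    by rewrite /nablaK' linearN linearZ /= -opprD scalerN -scalerBr !scalerA mulrC.
  rewrite lN -nablaK'_gam.
  have -> : nablaK' U N i (cl_sec i A - A) = cl_sec i (nablaK' U N i A) - nablaK' U N i A.
    have lB x y : nablaK' U N i (x - y) = nablaK' U N i x - nablaK' U N i y.
      rewrite /nablaK' [Psh U _ (x - y)]linearB /= -[RHS]scalerBr; congr (_ *: _).
      by move: (Psh U _ x) (Psh U _ y) => *; move: x y => *; zmod.
    by rewrite lB (nablaK'_cl hS N0 Nh).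
  rewrite (nablaK_sum_laplace i phi) -/A.
  set C := nablaK' U N i A; set k := (a / 2)%:C.
  have l1 : 2^-1%:C *: (- (a%:C *: C)) = - (k *: C).
    by rewrite scalerN scalerA -rmorphM /= mulrC.
  have l2 : cl_sec i (- (k *: C)) = - (k *: cl_sec i C) by rewrite linearN linearZ.
  have l3 x : gam_sec (- (k *: x)) = - (k *: gam_sec x) by rewrite linearN linearZ.
  by rewrite l1 l2 -opprD -scalerBr l3.
rewrite e1 e2 -/A -/B.
have -> : - gam_sec (cl_sec i B) = gam_sec (cl_sec i (2^-1%:C *: (A - B)) - cl_sec i (2^-1%:C *: (A + B))).
  have -> : cl_sec i (2^-1%:C *: (A - B)) - cl_sec i (2^-1%:C *: (A + B)) = cl_sec i (- B).
    rewrite -linearB; congr (cl_sec i _); rewrite -scalerBr.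
    have -> : A - B - (A + B) = - (B + B) by move: A B {e1 e2} => *; zmod.
    rewrite scalerN scalerDr -scalerDl -rmorphD /=.
    by rewrite (_ : 2^-1 + 2^-1 = 1 :> R) ?scale1r //; lra.
  by rewrite !linearN.
have gD (x y : section E) : gam_sec x + gam_sec y = gam_sec (x + y) by rewrite linearD.
rewrite gD -[LHS]/(gam_sec (cl_sec i (2^-1%:C *: (A - B)) - 2^-1%:C *: (A + B))); congr gam_sec.
by move: (cl_sec i (2^-1%:C *: (A + B))) (2^-1%:C *: (A + B)) (cl_sec i _) => *; zmod.
Qed.

(** [gamma] and [c i] go to the test section, and [weak_gradient_limit] applies to both summands of
    [wilson_split]. The correction [chi] is [a] times a first difference of [phi]: in its own
    difference [a] compensates the inverse mesh, and its pairing with the gradient of [w] is of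
    order [a]. *)
Lemma coupling_bound w phi : smooth_section w ->
  `|BH (em (gam_sec (dirac_cont U w))) (interp phi) -
    BH (em w) (interp (gam_sec (wilsonK U N phi)))| <=
  a * (4 * (2 + 3 * h^-1) + 1) *
    \sum_(i < n) (NH (grad i w) + NH (em w)) * (Nb phi + Nb (nablaK U N i phi)).
Proof.
move=> sw; have sN i : smooth_section (nabla_cont U i w) := smooth_nabla_cont U a0_gt0 i sw.
have sc i : smooth_section (cl_sec i (nabla_cont U i w)) := smooth_cl i (sN i).
have -> : em (gam_sec (dirac_cont U w)) = \sum_(i < n) em (gam_sec (cl_sec i (nabla_cont U i w))).
  by rewrite dirac_contE linear_sum embed_sum // => i; exact: smooth_gam.
rewrite wilson_split interp_sum (psd_suml PH) (psd_sumr PH) -sumrB mulr_sumr.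
rewrite (le_trans (ler_norm_sum _ _ _)) //; apply: ler_sum => i _.
set chi := - ((a / 2)%:C *: _); set u := cl_sec i (gam_sec phi).
rewrite interpD (psdDr PH).
have -> : BH (em (gam_sec (cl_sec i (nabla_cont U i w)))) (interp phi) = BH (grad i w) (interp u).
  rewrite (gam_embed_adj hS a0_gt0 ip_norm) // (cl_embed_adj hS a0_gt0 ip_norm) ?sec_gam ?sec_cl //.
have t1 := weak_gradient_limit i u sw; have t2 := weak_gradient_limit i chi sw.
have nu : Nb u = Nb phi by rewrite nbK_cl nbK_gam.
have nu' : Nb (nablaK' U N i u) = Nb (nablaK U N i phi).
  by rewrite -(nablaK'_cl hS N0 Nh) -nablaK'_gam nbK_cl nbK_gam (nbK_nablaK' hS N0 Nh).
set A := NH (grad i w) in t1 t2 *; set B := NH (em w) in t1 t2 *.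
set p := Nb phi in nu *; set p' := Nb (nablaK U N i phi) in nu' *.
have nchi : Nb chi <= a * p'.
  rewrite /chi (nbN Pb) (nbZ Pb) gtr0_norm ?divr_gt0 // nbK_gam -mulrA ler_wpM2l ?(ltW a_gt0) //.
  have := nbB Pb (cl_sec i (nablaK U N i phi)) (nablaK U N i phi); rewrite nbK_cl -/p'; lra.
have nchi' : Nb (nablaK' U N i chi) <= 2 * p'.
  rewrite (le_trans (nb_nablaK'_le i chi)) // -mulrA ler_wpM2l // -ler_pdivlMl //.
have t3 : `|BH (grad i w) (interp chi)| <= A * (a * p').
  rewrite (le_trans (psd_abs PH _ _)) // ler_wpM2l ?nb_ge0 //.
  exact: le_trans (interp_le _) nchi.
rewrite nu nu' in t1.
set T1 := BH (grad i w) (interp u) in t1 *; set T2 := BH (em w) _ in t1 *.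
set T3 := BH (em w) _ in t2 *; set T4 := BH (grad i w) (interp chi) in t2 t3.
have A0 : 0 <= A := nb_ge0 _ _; have B0 : 0 <= B := nb_ge0 _ _.
have p0 : 0 <= p := nb_ge0 _ _; have p'0 : 0 <= p' := nb_ge0 _ _.
set k := 2 + 3 * h^-1 in t1 t2 *.
have k0 : 0 <= k by rewrite addr_ge0 // mulr_ge0 // invr_ge0 ltW.
have a1 : a <= 1 by have := N4; lra.
have t2' : a * k * (A + B) * (Nb chi + Nb (nablaK' U N i chi)) <= a * k * (A + B) * (3 * p').
  have kAB : 0 <= a * k * (A + B).
    by apply: mulr_ge0; [apply: mulr_ge0 => //; exact: ltW | exact: addr_ge0].
  by rewrite (ler_wpM2l kAB) //; have := ler_wpM2r p'0 a1; lra.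
have := le_trans t2 t2'.
have kAB : 0 <= a * k * (A + B).
  by apply: mulr_ge0; [apply: mulr_ge0 => //; exact: ltW | exact: addr_ge0].
have p1 := mulr_ge0 kAB p0.
have p2 := mulr_ge0 kAB p'0.
have p3 : 0 <= a * A * p by rewrite !mulr_ge0 ?(ltW a_gt0).
have p4 : 0 <= a * B * p by rewrite !mulr_ge0 ?(ltW a_gt0).
have p5 : 0 <= a * B * p' by rewrite !mulr_ge0 ?(ltW a_gt0).
move: t1 t3; rewrite !ler_norml => /andP[x1 x2] /andP[x3 x4] /andP[x5 x6].
have -> : a * (4 * k + 1) * ((A + B) * (p + p')) = 4 * (a * k * (A + B) * p) + 4 * (a * k * (A + B) * p')
   + a * A * p + A * (a * p') + a * B * p + a * B * p' by ring.
by apply/andP; split; move: p1 p2 p3 p4 p5 x1 x2 x3 x4 x5 x6; lra.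
Qed.

End Coupling.

(** * Extension to the completions *)

Section DenseContinuity.
Variable R : realType.

Lemma dense_ge0 (T : topologicalType) (S : set T) (g : T -> R) : dense S -> continuous g ->
  (forall x, S x -> 0 <= g x) -> forall x, 0 <= g x.
Proof.
move=> dS cg hS x; rewrite leNgt; apply/negP => gx.
have oO : open (g @^-1` [set y | y < 0]).
  by apply: open_comp => [y _|]; [exact: cg | exact: open_lt].
have [y [/= gy /hS]] := dS _ (ex_intro _ x gx) oO.
by rewrite leNgt gy.
Qed.

Lemma dense_eq0 (T : topologicalType) (S : set T) (g : T -> R) : dense S -> continuous g ->
  (forall x, S x -> g x = 0) -> forall x, g x = 0.
Proof.
move=> dS cg hS x; apply/le_anti/andP; split.
  rewrite -oppr_ge0; apply: (dense_ge0 (g := fun x => - g x) dS) => [y|y /hS ->].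
    by apply: cvgN; exact: cg.
  by rewrite oppr0.
by apply: (dense_ge0 dS cg) => y /hS ->.
Qed.

(** The norm of a complex space takes values in [R[i]], so its real part is used. *)
Lemma lip_continuous (X : normedModType R[i]) (g : X -> R) (C : R) : 0 <= C ->
  (forall x y, `|g x - g y| <= C * complex.Re `|x - y|) -> continuous g.
Proof.
move=> C0 hg x; apply/cvgrPdist_le => e e0.
have C1 : 0 < C + 1 by rewrite ltr_wpDl.
have d0 : 0 < (e / (C + 1))%:C :> R[i] by rewrite ltcR divr_gt0.
near=> y; have : `|x - y| < (e / (C + 1))%:C.
  near: y; apply/nbhs_ballP; exists (e / (C + 1))%:C => // y; by rewrite -ball_normE.
have xy0 := normr_ge0 (x - y); have xyE : `|x - y| = (complex.Re `|x - y|)%:C.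
  by apply: eq_ReIm => //=; exact: ger0_Im.
rewrite xyE ltcR ltr_pdivlMr // => /ltW h; rewrite (le_trans (hg x y)) // (le_trans _ h) //.
rewrite mulrC ler_wpM2l //; last by rewrite lerDl.
by move: xy0; rewrite xyE lecR.
Unshelve. all: by end_near. Qed.

Section RealFunctions.
Variables (T : topologicalType) (f g : T -> R).
Hypotheses (cf : continuous f) (cg : continuous g).

Lemma contD : continuous (fun x => f x + g x).
Proof. by move=> x; apply: cvgD; [exact: cf | exact: cg]. Qed.

Lemma contB : continuous (fun x => f x - g x).
Proof. by move=> x; apply: cvgB; [exact: cf | exact: cg]. Qed.

Lemma contM : continuous (fun x => f x * g x).
Proof. by move=> x; apply: cvgM; [exact: cf | exact: cg]. Qed.

Lemma cont_norm : continuous (fun x => `|f x|).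
Proof. by move=> x; apply: cvg_norm; exact: cf. Qed.

End RealFunctions.

Lemma contZ (T : topologicalType) (c : R) (f : T -> R) : continuous f -> continuous (fun x => c * f x).
Proof. by move=> cf; apply: contM => // x; exact: cvg_cst. Qed.

Lemma contX2 (T : topologicalType) (f : T -> R) : continuous f -> continuous (fun x => f x ^+ 2).
Proof. by move=> cf; exact: contM. Qed.

Lemma cont_comp (T T' : topologicalType) (f : T' -> R) (g : T -> T') :
  continuous g -> continuous f -> continuous (fun x => f (g x)).
Proof. by move=> cg cf x; exact: (continuous_comp (cg x) (cf (g x))). Qed.

End DenseContinuity.

Section EnergySpace.
Variables (R : realType) (n r : nat) (E : clifford_bundle R n r) (a0 : R).
Variables (U : link_variables E a0) (h : R) (hS : transport_scale U h).
Hypothesis a0_gt0 : 0 < a0.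
Variables (m0 : R) (H : L2_completion E) (H1 : L21_completion U m0).
Variable (ip : {dot H for @Num.conj R[i]}).
Hypothesis ip_norm : forall u : H, ip u u = `|u| ^+ 2.
Variable gH : {linear H -> H}.
Hypothesis gH_ext : is_extension (@gam_sec R n r E) (gH : H -> H).
Variable D : {linear H1 -> H}.
Hypothesis D_ext : is_extension (dirac_cont U) (D : H1 -> H).
Variable J : {linear H1 -> H}.
Hypothesis J_ext : is_extension id (J : H1 -> H).

Local Notation BH := (re_dot ip).
Local Notation NH := (nb BH).
Local Notation em := (embed H).
Let PH : psd BH := re_dot_psd ip.
Let h0 := scale_gt0 hS.

Let kappa := 8 * n%:R ^+ 2 * h^-1.
Let kappa_ge0 : 0 <= kappa.
Proof. by rewrite mulr_ge0 ?invr_ge0 ?(ltW h0) // mulr_ge0 // sqr_ge0. Qed.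

Let NHE x : complex.Re `|x| = NH x.
Proof. by rewrite (normHE ip_norm). Qed.

Let c_J : continuous J := J_ext.1.
Let c_D : continuous D := D_ext.1.
Let c_gH : continuous gH := gH_ext.1.

Let c_NH : continuous (fun x : H => NH x).
Proof.
apply: (lip_continuous (C := 1)) => // x y; rewrite NHE mul1r ler_norml lerBlDr lerNl opprB lerBlDr.
apply/andP; split; first by rewrite addrC (nbBC PH); exact: (nb_le_sub PH).
by rewrite addrC; exact: (nb_le_sub PH).
Qed.

Let c_BH y : continuous (fun x : H => BH x y).
Proof.
apply: (lip_continuous (C := NH y)) => [|x x']; first exact: nb_ge0.
by rewrite NHE -(psdBl PH) mulrC (psd_abs PH).
Qed.

Let c_BHr y : continuous (fun x : H => BH y x).
Proof. by have -> : (fun x => BH y x) = (fun x => BH x y) by apply/funext => x; exact: (psdC PH). Qed.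

Let polar x y : BH x y = 4^-1 * (NH (x + y) ^+ 2 - NH (x - y) ^+ 2).
Proof. rewrite !(sqr_nb PH) !(psdDl PH, psdDr PH, psdNl PH, psdNr PH) (psdC PH y x); lra. Qed.

Let dH := @embed_dense _ _ _ _ H.
Let dH1 := @embed_dense _ _ _ _ H1.

Lemma gH_adj x y : BH (gH x) y = BH x (gH y).
Proof.
apply/eqP; rewrite -subr_eq0; apply/eqP; move: x; apply: (dense_eq0 dH).
  have c1 : continuous (fun x => BH (gH x) y) := cont_comp c_gH (@c_BH y).
  exact: (contB c1 (@c_BH (gH y))).
move=> _ [v sv <-]; move: y; apply: (dense_eq0 dH).
  exact: (contB (@c_BHr (gH (em v))) (cont_comp c_gH (@c_BHr (em v)))).
by move=> _ [w sw <-]; rewrite !gH_ext.2 // (gam_embed_adj hS a0_gt0 ip_norm) // subrr.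
Qed.

Lemma gH_norm x : NH (gH x) = NH x.
Proof.
have e y : NH (gH y) ^+ 2 = NH y ^+ 2.
  apply/eqP; rewrite -subr_eq0; apply/eqP; move: y; apply: (dense_eq0 dH).
    by apply: contB; apply: contX2; [exact: (cont_comp c_gH c_NH) | exact: c_NH].
  move=> _ [v sv <-]; rewrite !(sqr_nb PH) gH_adj !gH_ext.2 ?gam_secK ?subrr //.
  exact: smooth_gam.
have := congr1 Num.sqrt (e x).
by rewrite !sqrtr_sqr !ger0_norm ?nb_ge0.
Qed.

Lemma dirac_orthogonal v : BH (D v) (J v) = 0.
Proof.
rewrite polar; move: v; apply: (dense_eq0 dH1).
  have cs : continuous (fun x => D x + J x).
    by move=> x; apply: cvgD; [exact: c_D | exact: c_J].
  have cd : continuous (fun x => D x - J x).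
    by move=> x; apply: cvgB; [exact: c_D | exact: c_J].
  apply: contZ; apply: contB; apply: contX2.
    exact: (cont_comp cs c_NH).
  exact: (cont_comp cd c_NH).
move=> _ [v sv <-]; rewrite D_ext.2 // J_ext.2 // -polar.
exact: (dirac_antisym hS a0_gt0 ip_norm).
Qed.

(** [kappa + 1] stands in for the square root of [kappa]. *)
Let le_of_sqr (x y z : R) : 0 <= y -> 0 <= z -> x ^+ 2 <= y ^+ 2 + kappa * z ^+ 2 -> x <= y + (kappa + 1) * z.
Proof.
move=> y0 z0 le; have k1 : 0 <= (kappa + 1) * z by rewrite mulr_ge0 // addr_ge0.
have [x0|x0] := leP x 0; first by rewrite (le_trans x0) // addr_ge0.
rewrite -(ler_pXn2r (ltn0Sn 1)) ?nnegrE ?addr_ge0 ?(ltW x0) // (le_trans le) // sqrrD.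
have p1 := mulr_ge0 y0 k1; have p2 := mulr_ge0 kappa_ge0 (sqr_ge0 z).
have p3 := mulr_ge0 kappa_ge0 p2; have p4 := sqr_ge0 z.
rewrite exprMn sqrrD expr1n; move: p1 p2 p3 p4; rewrite mulr2n; nra.
Qed.

(** In an abstract completion this needs ellipticity: it bounds the norm of [H1] by the graph norm
    of [D] on smooth sections, and density extends the bound. *)
Lemma energy_norm_eq0 v : J v = 0 -> D v = 0 -> v = 0.
Proof.
move=> Jv Dv; pose c : R := m0 ^- 2.
have c0 : 0 <= c by rewrite invr_ge0 sqr_ge0.
pose N1 (x : H1) := complex.Re `|x|.
have N1E x : `|x| = (N1 x)%:C.
  by apply: eq_ReIm => //=; apply: ger0_Im; exact: normr_ge0.
have N10 x : 0 <= N1 x by have := normr_ge0 x; rewrite N1E lecR.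
have c_N1 : continuous (N1 : H1 -> R).
  apply: (lip_continuous (C := 1)) => // x y; rewrite mul1r -/(N1 _).
  have := lerB_dist x y; have := lerB_dist y x; rewrite distrC !N1E -!rmorphB /= !lecR.
  by move=> l1 l2; rewrite ler_norml l2 andbT lerNl opprB.
have key x : 0 <= NH (J x) ^+ 2 + c * (NH (D x) ^+ 2 + kappa * NH (J x) ^+ 2) - N1 x ^+ 2.
  move: x; apply: (dense_ge0 dH1).
    have cJ2 : continuous (fun x => NH (J x) ^+ 2) by apply: contX2; exact: (cont_comp c_J c_NH).
    have cD2 : continuous (fun x => NH (D x) ^+ 2) by apply: contX2; exact: (cont_comp c_D c_NH).
    apply: contB; last exact: contX2.
    by apply: contD => //; apply: contZ; apply: contD => //; exact: contZ.
  move=> _ [w sw <-]; rewrite D_ext.2 // J_ext.2 // subr_ge0.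
  rewrite /N1 (embed_norm H1 sw) /= /L21norm sqr_sqrtr; last first.
    by rewrite addr_ge0 ?sqr_ge0 // mulr_ge0 // sumr_ge0 // => i _; exact: sqr_ge0.
  rewrite -(NH_embed ip_norm sw) lerD2l ler_wpM2l //.
  apply: le_trans (continuum_elliptic hS a0_gt0 ip_norm sw); apply: ler_sum => i _.
  rewrite -(NH_embed ip_norm) //; exact: smooth_nabla_cont.
have := key v; rewrite Jv Dv (nb0 PH) expr0n /= !mulr0 !addr0 !mulr0 => l0.
have l : N1 v ^+ 2 <= 0 by move: l0; lra.
apply/eqP; rewrite -normr_eq0 N1E.
have /eqP : N1 v ^+ 2 = 0 by apply/le_anti; rewrite l sqr_ge0.
by rewrite sqrf_eq0 => /eqP ->.
Qed.

Section Lattice.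
Variables (N q : nat) (N0 : (0 < N)%N) (q0 : (0 < q)%N).
Hypotheses (Nh : 2 * N%:R^-1 < h) (N4 : N%:R^-1 <= 4^-1 :> R).
Hypothesis q_large : 3 * n%:R / q%:R <= N%:R^-1 ^+ 2 :> R.
Implicit Types u w phi : section E.

Local Notation a := (N%:R^-1 : R).
Local Notation b := (bK (E := E) N).
Local Notation Nb := (nb b).
Let Pb : psd b := bK_psd N.
Local Notation f := (interp U H N q).
Let N1 : 0 < N%:R :> R. Proof. by rewrite ltr0n. Qed.
Let a_gt0 : 0 < a. Proof. by rewrite invr_gt0. Qed.

(** The constant of [coupling_bound], [n] directions, and a factor [kappa + 2] for each of the two
    graph norms that bound first derivatives. *)
Definition coupling_const : R := (4 * (2 + 3 * h^-1) + 1) * n%:R * (kappa + 2) ^+ 2.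
(** The 2 comes from expanding the square in [interp_coercive], the rest from its Poincare term
    after [continuum_elliptic]. *)
Definition coercive_const : R := 2 + 4 ^+ n * (1 + kappa + n%:R).

Lemma grad_le i w : smooth_section w ->
  NH (em (nabla_cont U i w)) <= NH (em (dirac_cont U w)) + (kappa + 1) * NH (em w).
Proof.
move=> sw; apply: le_of_sqr; rewrite ?nb_ge0 //.
apply: le_trans (continuum_elliptic hS a0_gt0 ip_norm sw).
by rewrite (bigD1 i) //= lerDl sumr_ge0 // => j _; exact: sqr_ge0.
Qed.

Lemma nablaK_le i phi : Nb (nablaK U N i phi) <= Nb (wilsonK U N phi) + (kappa + 1) * Nb phi.
Proof.
apply: le_of_sqr; rewrite ?nb_ge0 //; apply: le_trans (wilsonK_elliptic hS N0 Nh phi).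
by rewrite (bigD1 i) //= lerDl sumr_ge0 // => j _; exact: sqr_ge0.
Qed.

Lemma energy_coupling v phi :
  `|BH (gH (D v)) (f phi) - BH (J v) (f (gam_sec (wilsonK U N phi)))| <=
  a * coupling_const * (NH (D v) + NH (J v)) * (Nb phi + Nb (wilsonK U N phi)).
Proof.
rewrite -subr_ge0; move: v; apply: (dense_ge0 dH1).
  apply: contB.
    apply: contM => [|x]; last exact: cvg_cst.
    by apply: contZ; apply: contD; [exact: (cont_comp c_D c_NH) | exact: (cont_comp c_J c_NH)].
  apply: cont_norm; apply: contB; last exact: (cont_comp c_J (@c_BH _)).
  exact: (cont_comp c_D (cont_comp c_gH (@c_BH (f phi)))).
move=> _ [w sw <-]; rewrite D_ext.2 // J_ext.2 // gH_ext.2; last exact: smooth_dirac.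
rewrite subr_ge0 (le_trans (coupling_bound hS a0_gt0 ip_norm N0 q0 Nh N4 q_large phi sw)) //.
have x0 := nb_ge0 BH (em (dirac_cont U w)); have y0 := nb_ge0 BH (em w).
have p0 := nb_ge0 b phi; have z0 := nb_ge0 b (wilsonK U N phi).
set x := NH (em (dirac_cont U w)) in x0 *; set y := NH (em w) in y0 *.
set p := Nb phi in p0 *; set z := Nb (wilsonK U N phi) in z0 *.
have k0 : 0 <= kappa + 2 by rewrite addr_ge0.
have t i : (NH (em (nabla_cont U i w)) + y) * (p + Nb (nablaK U N i phi)) <=
    ((kappa + 2) * (x + y)) * ((kappa + 2) * (p + z)).
  have g1 := grad_le i sw; have g2 := nablaK_le i phi; rewrite -/x -/y in g1; rewrite -/p -/z in g2.
  apply: ler_pM; rewrite ?addr_ge0 ?nb_ge0 //.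
    by have := mulr_ge0 kappa_ge0 x0; move: g1 x0 y0; lra.
  by have := mulr_ge0 kappa_ge0 z0; move: g2 p0 z0; lra.
have := ler_sum (index_enum _) (fun i (_ : true) => t i).
rewrite [X in _ <= X -> _]sumr_const card_ord -(mulr_natl ((kappa + 2) * (x + y) * ((kappa + 2) * (p + z)))) => s.
have kk0 : 0 <= a * (4 * (2 + 3 * h^-1) + 1).
  by rewrite mulr_ge0 ?(ltW a_gt0) // addr_ge0 // mulr_ge0 // addr_ge0 // mulr_ge0 // invr_ge0 ltW.
rewrite (le_trans (ler_wpM2l kk0 s)) // /coupling_const; apply: eq_le_ring; ring.
Qed.

(** [G] stands for the adjoint and is given by its pairings only. It is nonexpansive because
    [interp] is, so the inequality is continuous in [v] and passes to the completion. *)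
Lemma energy_coercive (G : H -> section E) v :
  (forall x u, b (G x) u = BH x (f u)) ->
  NH (J v) ^+ 2 <= 2 * Nb (G (J v)) ^+ 2 + coercive_const * a ^+ 2 * (NH (D v) ^+ 2 + NH (J v) ^+ 2).
Proof.
move=> GE.
have G_lip x y : Nb (G x - G y) <= NH (x - y).
  have [->|g0] := eqVneq (Nb (G x - G y)) 0; first exact: nb_ge0.
  have gp : 0 < Nb (G x - G y) by rewrite lt_def g0 nb_ge0.
  rewrite -(ler_pM2r gp) -expr2 (sqr_nb Pb) (psdBl Pb) !GE -(psdBl PH).
  rewrite (le_trans (psd_le PH _ _)) // ler_wpM2l ?nb_ge0 //.
  exact: (interp_le hS a0_gt0 ip_norm).
have c_G : continuous (fun x => Nb (G x) : R).
  apply: (lip_continuous (C := 1)) => // x y; rewrite NHE mul1r.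
  have l1 := nb_le_sub Pb (G x) (G y); have l2 := nb_le_sub Pb (G y) (G x).
  rewrite (nbBC Pb (G y)) in l2; have l3 := G_lip x y.
  by rewrite ler_norml; apply/andP; split; lra.
rewrite -subr_ge0; move: v; apply: (dense_ge0 dH1).
  have cJ2 : continuous (fun x => NH (J x) ^+ 2) by apply: contX2; exact: (cont_comp c_J c_NH).
  have cD2 : continuous (fun x => NH (D x) ^+ 2) by apply: contX2; exact: (cont_comp c_D c_NH).
  apply: contB => //; apply: contD; last by apply: contZ; exact: contD.
  by apply: contZ; apply: contX2; exact: (cont_comp c_J c_G).
move=> _ [w sw <-]; rewrite D_ext.2 // J_ext.2 // subr_ge0.
have hb u : BH (em w) (f u) <= Nb (G (em w)) * Nb u by rewrite -GE; exact: (psd_le Pb).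
have := interp_coercive hS a0_gt0 ip_norm N0 q0 Nh q_large sw (nb_ge0 b _) hb.
rewrite -mulr_sumr big_split /= sumr_const card_ord -(mulr_natl (NH (em w) ^+ 2)).
have el := continuum_elliptic hS a0_gt0 ip_norm sw; rewrite -/kappa in el.
move=> le; rewrite (le_trans le) //.
set S := \sum_(i < n) _ in el *; set x := NH (em (dirac_cont U w)) in el *.
set y := NH (em w) in el *; set g := Nb _.
have f0 : 0 <= 4 ^+ n * a ^+ 2 by rewrite mulr_ge0 ?exprn_ge0 // ltW.
have l1 : 4 ^+ n * (a ^+ 2 * (S + n%:R * y ^+ 2)) <= 4 ^+ n * a ^+ 2 * ((1 + kappa + n%:R) * (x ^+ 2 + y ^+ 2)).
  rewrite mulrA ler_wpM2l //.
  have := mulr_ge0 kappa_ge0 (sqr_ge0 x); have := mulr_ge0 (ler0n R n) (sqr_ge0 x).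
  by have := sqr_ge0 y; move: el; lra.
have l2 : (g + a * y) ^+ 2 <= 2 * g ^+ 2 + 2 * (a ^+ 2 * (x ^+ 2 + y ^+ 2)).
  have := sqr_ge0 (g - a * y); have := mulr_ge0 (sqr_ge0 a) (sqr_ge0 x).
  by lra.
rewrite (le_trans (lerD l2 l1)) // /coercive_const; apply: eq_le_ring; ring.
Qed.

End Lattice.

End EnergySpace.

(** * Sections on the lattice *)

Section GridPoints.
Variables (R : realType) (n N : nat) (N0 : (0 < N)%N).
Implicit Types y : 'rV[R]_n.

Let N1 : 0 < N%:R :> R. Proof. by rewrite ltr0n. Qed.

Lemma uniq_grid m : uniq (grid R m N).
Proof.
elim: m => [|m IH] //=; apply: allpairs_uniq => //; first exact: iota_uniq.
move=> [k y] [k' y'] /allpairsP[[j z] /= [_ _ [-> ->]]] /allpairsP[[j' z'] /= [_ _ [-> ->]]] e.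
have e0 := congr1 (fun v : 'rV_m.+1 => v 0 ord0) e; rewrite !rowc0 in e0.
have ez : z = z'.
  apply/rowP => i; have := congr1 (fun v : 'rV_m.+1 => v 0 (lift ord0 i)) e.
  by rewrite !rowc_lift.
move: e0 => /(congr1 (fun s => s * N%:R)); rewrite !divfK ?gt_eqF // => /eqP.
by rewrite eqr_nat ez => /eqP ->.
Qed.

Lemma mem_grid m (y : 'rV[R]_m) : (forall i, 0 <= y 0 i < 1) -> int_vector (N%:R *: y) ->
  y \in grid R m N.
Proof.
elim: m y => [|m IH] y y01 yN; first by rewrite inE; apply/eqP/rowP => -[].
have /intrP[j jE] : N%:R * y 0 ord0 \is a Num.int by move/mxOverP: yN => /(_ 0 ord0); rewrite mxE.
have /andP[y0 y1] := y01 ord0.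
have j0 : 0 <= j by rewrite -(ler0z R) -jE mulr_ge0.
case: j j0 jE => // j _ jE.
have jN : (j < N)%N by rewrite -(ltr_nat R) -[X in X < _]jE -[X in _ < X]mulr1 ltr_pM2l.
rewrite (rowcP y) /=; apply/allpairsP; exists (j, \row_i y 0 (lift ord0 i)) => /=; split.
- by rewrite mem_iota.
- apply: IH => [i|]; first by rewrite mxE.
  apply/mxOverP => p i; rewrite !mxE; move/mxOverP: yN => /(_ 0 (lift ord0 i)).
  by rewrite mxE.
- by congr rowc; rewrite -[j%:R]/((Posz j)%:~R) -jE mulrC mulKf // gt_eqF.
Qed.

Lemma lattice_ptP (y : 'rV[R]_n) : int_vector (N%:R *: y) -> tpt y \in @lattice_pts R n N.
Proof.
move=> yN; apply/mem_set; exists (\row_i Num.floor (N%:R * y 0 i)) => //.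
congr (tpt _); apply/rowP => i; rewrite !mxE.
move/mxOverP: yN => /(_ 0 i); rewrite mxE => /intrP[j jE].
by rewrite jE intrKfloor -jE mulrA mulVf ?mul1r // gt_eqF.
Qed.

(** Made total by sending points off the lattice to the origin. *)
Definition grid_pt y : lattice R n N :=
  match pselect (tpt y \in @lattice_pts R n N) with
  | left p => SigSub p
  | right _ => SigSub (lattice_ptP (y := 0) (eq_ind_r (fun v => int_vector v) (rpred0 _) (scaler0 _ N%:R)))
  end.

Lemma val_grid_pt y : y \in grid R n N -> val (grid_pt y) = tpt y.
Proof.
move=> yN; rewrite /grid_pt; case: pselect => // np.
by case: np; apply: lattice_ptP; exact: grid_int.
Qed.

Lemma tpt_grid_inj y y' : y \in grid R n N -> y' \in grid R n N -> tpt y = tpt y' -> y = y'.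
Proof.
move=> yN yN' e; have fr z : z \in grid R n N -> frac z = z.
  move=> zN; apply: frac_uniq => [|i]; last exact: (grid_itv i zN).
  by rewrite subrr; exact: rpred0.
rewrite -(fr y' yN'); rewrite -{1}(fr y yN); apply: frac_uniq => [|i]; last exact: frac_itv.
rewrite (fr y' yN'); exact/tpt_eq.
Qed.

(** An enumeration without repetition, which turns the sum over a set in [lip] into the sum over the
    grid in [avg]. *)
Definition lattice_seq : seq (lattice R n N) := [seq grid_pt y | y <- grid R n N].

Lemma uniq_lattice_seq : uniq lattice_seq.
Proof.
rewrite map_inj_in_uniq ?uniq_grid // => y y' yN yN' /(congr1 val).
by rewrite !val_grid_pt //; exact: tpt_grid_inj.
Qed.

Lemma mem_lattice_seq z : z \in lattice_seq.
Proof.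
have /set_mem [k _ kz] := valP z.
pose v : 'rV[R]_n := N%:R^-1 *: map_mx intr k.
have vN : int_vector (N%:R *: frac v).
  have -> : N%:R *: frac v = N%:R *: v - N%:R *: (v - frac v).
    by rewrite -scalerBr opprB addrC subrK.
  apply: rpredB; first by rewrite scalerA mulfV ?gt_eqF // scale1r; apply/mxOverP => i j; rewrite mxE intr_int.
  apply/mxOverP => i j; rewrite mxE rpredM ?natr_int //.
  by move/mxOverP: (int_vector_frac v); apply.
have fN : frac v \in grid R n N by apply: mem_grid => // i; exact: frac_itv.
apply/mapP; exists (frac v) => //; apply: val_inj.
by rewrite val_grid_pt // tpt_frac -kz.
Qed.

End GridPoints.

(** * Restriction, extension by zero and adjoints *)

Section LatticeSections.
Variables (R : realType) (n r : nat) (E : clifford_bundle R n r) (a0 : R).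
Variables (U : link_variables E a0) (h : R) (hS : transport_scale U h).
Variables (N : nat) (N0 : (0 < N)%N).
Hypothesis Nh : 2 * N%:R^-1 < h.
Implicit Types (u v : section E) (phi psi : lsection E N).

Local Notation a := (N%:R^-1 : R).
Local Notation b := (bK (E := E) N).
Let Pb : psd b := bK_psd N.
Let N1 : 0 < N%:R :> R. Proof. by rewrite ltr0n. Qed.

Definition rst u : lsection E N := fun z => u (val z).

(** A discontinuous extension is harmless here: the form [bK N] and the interpolation [sec] read
    only lattice points. *)
Definition ext phi : section E := fun x =>
  match pselect (x \in @lattice_pts R n N) with
  | left p => phi (SigSub p)
  | right _ => 0
  end.

Lemma rst_ext phi : rst (ext phi) = phi.
Proof.
apply: functional_extensionality_dep => -[x xp]; rewrite /rst /ext /=.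
by case: pselect => // p; rewrite (bool_irrelevance p xp).
Qed.

Lemma ext_is_linear : linear ext.
Proof.
move=> k phi psi; apply: functional_extensionality_dep => x.
rewrite -[RHS]/(k *: ext phi x + ext psi x) /ext; case: pselect => //= _.
by rewrite scaler0 addr0.
Qed.

HB.instance Definition _ :=
  @GRing.isLinear.Build R[i] (lsection E N) (section E) *:%R ext ext_is_linear.

Lemma rst_is_linear : linear rst.
Proof. by []. Qed.

HB.instance Definition _ :=
  @GRing.isLinear.Build R[i] (section E) (lsection E N) *:%R rst rst_is_linear.

Lemma eq_rst u v : rst u = rst v -> forall y, y \in grid R n N -> u (tpt y) = v (tpt y).
Proof.
move=> uv y yN; have := congr1 (fun phi => phi (grid_pt N0 y)) uv; rewrite /rst.
by rewrite (val_grid_pt N0 yN).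
Qed.

Lemma bK_rst u u' v v' : rst u = rst u' -> rst v = rst v' -> b u v = b u' v'.
Proof.
by move=> uu vv; apply: eq_avg_grid => y yN /=; rewrite (eq_rst uu yN) (eq_rst vv yN).
Qed.

Lemma lipE phi psi : lip phi psi = (a ^+ n)%:C *
  \sum_(z <- lattice_seq R n N0) herm E (val z) (phi z) (psi z).
Proof.
rewrite /lip; congr (_ * _); apply/esym; rewrite fsbig_seq ?uniq_lattice_seq //.
apply: eq_fsbigl; apply/seteqP; split=> z //= _; exact: mem_lattice_seq.
Qed.

Lemma Re_lip phi psi : complex.Re (lip phi psi) = b (ext phi) (ext psi).
Proof.
rewrite lipE ReZ Re_sum /lattice_seq big_map exprVn; congr (_ * _).
rewrite big_seq [RHS]big_seq; apply: eq_bigr => y yN /=.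
rewrite -{1}(rst_ext phi) -{1}(rst_ext psi) /rst.
rewrite -[LHS]/((fun q => complex.Re (herm E q (ext phi q) (ext psi q))) (val (grid_pt N0 y))).
by rewrite (val_grid_pt N0 yN).
Qed.

Lemma lipZl k phi psi : lip (k *: phi) psi = k * lip phi psi.
Proof.
rewrite !lipE [RHS]mulrCA; congr (_ * _); rewrite mulr_sumr; apply: eq_bigr => z _.
by rewrite -[(k *: phi) z]/(k *: phi z) dotZl.
Qed.

(** The scalars 1 and [i] recover a complex number from real parts, so the real form [bK N] is
    enough to identify an adjoint. *)
Lemma lip_eq phi psi phi' psi' : 
  (forall k, complex.Re (lip (k *: phi) psi) = complex.Re (lip (k *: phi') psi')) ->
  lip phi psi = lip phi' psi'.
Proof.
move=> e; have e1 := e 1; have ei := e 'i; rewrite !lipZl !mul1r in e1 ei *.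
move: ei e1; case: (lip phi psi) => x y; case: (lip phi' psi') => x' y' /=.
by rewrite !mul0r !mul1r !sub0r => /oppr_inj -> ->.
Qed.

Lemma Nb_eq0 u : nb b u = 0 -> rst u = 0.
Proof.
move=> u0; have bu : b u u = 0 by rewrite -(sqr_nb Pb) u0 expr0n.
have : \sum_(y <- grid R n N) rd (tpt y) (u (tpt y)) (u (tpt y)) = 0.
  move: bu; rewrite /bK /tavg /avg => /eqP; rewrite mulf_eq0 invr_eq0 expf_eq0 gt_eqF // andbF /=.
  by move/eqP.
move=> /eqP; rewrite psumr_eq0 => [/allP h0|y _]; last exact: (psd_ge0 (rdP E _)).
apply: functional_extensionality_dep => z; suff : u (val z) = 0 by [].
have /mapP[y yN ->] := mem_lattice_seq N0 z.
rewrite -[_ = _]/((fun q => u q = 0) (val (grid_pt N0 y))) (val_grid_pt N0 yN).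
by have /eqP := h0 y yN; exact: re_dot_eq0.
Qed.

(** [adjoint] is a choice with default 0; definiteness of [lip] on lattice sections leaves only one
    candidate. *)
Lemma adjoint_unique (X : lmodType R[i]) (ipX : X -> X -> R[i]) (F : lsection E N -> X) y w :
  (forall phi, ipX (F phi) y = lip phi w) -> adjoint (@lip R n r E N) ipX F y = w.
Proof.
move=> hw; rewrite /adjoint; case: xgetP => [w' _ /= hw'|/(_ w)]; last by case.
have e phi : b (ext phi) (ext w') = b (ext phi) (ext w) by rewrite -!Re_lip -hw' hw.
have l : ext (w' - w) = ext w' - ext w by rewrite linearB.
have : nb b (ext (w' - w)) = 0.
  by rewrite /nb {2}l (psdBr Pb) !e subrr sqrtr0.
by move=> /Nb_eq0; rewrite rst_ext => /eqP; rewrite subr_eq0 => /eqP.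
Qed.

Lemma nabla_latE i phi : nabla_lat U i phi = rst (nablaK U N i (ext phi)).
Proof.
apply: functional_extensionality_dep => z.
rewrite /nabla_lat invrK -[LHS]/(N%:R%:C *: (U (val z) (val (lstep i z)) (phi (lstep i z)) - phi z)).
by rewrite -{1 2}(rst_ext phi).
Qed.

Lemma nabla_lat_adjE i phi : nabla_lat_adj U i phi = rst (nablaK' U N i (ext phi)).
Proof.
apply: adjoint_unique => psi.
have e phi1 : complex.Re (lip (nabla_lat U i phi1) phi) =
    complex.Re (lip phi1 (rst (nablaK' U N i (ext phi)))).
  rewrite !Re_lip nabla_latE (bK_rst (u' := nablaK U N i (ext phi1)) (v' := ext phi)) ?rst_ext //.
  by rewrite (nablaK_adj hS N0 Nh); apply: bK_rst; rewrite ?rst_ext.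
apply: lip_eq => k; rewrite -e; congr (complex.Re (lip _ _)).
have UZ : Ulat U i (k *: psi) = k *: Ulat U i psi.
  by apply: functional_extensionality_dep => z; rewrite /Ulat -[RHS]/(k *: _) -linearZ.
by rewrite /nabla_lat UZ -scalerBr !scalerA mulrC.
Qed.

Lemma wilson_diracE phi : wilson_dirac U phi = rst (wilsonK U N (ext phi)).
Proof.
have half : 2^-1 = (2^-1)%:C :> R[i] by rewrite fmorphV rmorph_nat.
rewrite /wilson_dirac /dirac_lat /wilson_term /wilsonK -[RHS]/(rst _ - rst _) !linear_sum.
by congr (_ + _); apply: eq_bigr => i _ /=; rewrite nabla_latE nabla_lat_adjE half.
Qed.

Section Riesz.
Variables (H : lmodType R[i]) (ip : {dot H for @Num.conj R[i]}).
Variables (f : {linear lsection E N -> H}) (x : H).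

(** Fibers at different points are different types, so the value is carried along a proof that the
    points are equal. *)
Definition delta_section (z : lattice R n N) (u : E (val z)) : lsection E N := fun z' =>
  match pselect (z = z') with
  | left e => eq_rect z (fun z => E (val z)) u z' e
  | right _ => 0
  end.

Lemma delta_section_same z (u : E (val z)) : @delta_section z u z = u.
Proof.
rewrite /delta_section; case: pselect => // e.
by rewrite (Prop_irrelevance e erefl).
Qed.

Lemma delta_section_neq z (u : E (val z)) z' : z <> z' -> @delta_section z u z' = 0.
Proof. by rewrite /delta_section; case: pselect. Qed.

Lemma delta_section_is_linear z : linear (@delta_section z).
Proof.
move=> k u v; apply: functional_extensionality_dep => z'.
rewrite -[RHS]/(k *: delta_section u z' + delta_section v z').
have [<-|nz] := pselect (z = z'); first by rewrite !delta_section_same.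
by rewrite !delta_section_neq // scaler0 addr0.
Qed.

HB.instance Definition _ z :=
  @GRing.isLinear.Build R[i] (E (val z)) (lsection E N) *:%R (@delta_section z)
    (@delta_section_is_linear z).

Lemma delta_section_sum phi : phi = \sum_(z <- lattice_seq R n N0) delta_section (phi z).
Proof.
apply: functional_extensionality_dep => z'.
have e (s : seq (lattice R n N)) : (\sum_(z <- s) delta_section (phi z) : lsection E N) z' =
    \sum_(z <- s) delta_section (phi z) z'.
  by elim: s => [|z s IH]; rewrite ?big_nil // !big_cons -IH.
rewrite e (bigD1_seq z') ?uniq_lattice_seq ?mem_lattice_seq //= delta_section_same.
by rewrite big1 ?addr0 // => z /eqP zz; rewrite delta_section_neq.
Qed.

Definition point_functional z (u : E (val z)) : R[i] := ip (f (delta_section u)) x.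

Lemma point_functional_is_scalar z : scalar (@point_functional z).
Proof. by move=> k u v; rewrite /point_functional !linearP dotDl dotZl. Qed.

HB.instance Definition _ z :=
  @GRing.isLinear.Build R[i] (E (val z)) R[i] *%R (@point_functional z)
    (@point_functional_is_scalar z).

(** Existence of the adjoint: a lattice section is a finite sum of sections supported at one point,
    and a Riesz vector is found in each fiber. *)
Lemma lattice_riesz phi :
  ip (f phi) x = lip phi (adjoint (@lip R n r E N) ip f x).
Proof.
have pt z : exists w, forall u : E (val z), point_functional u = herm E (val z) u w.
  have [c cz] := cdom_cover E (val z).
  have [w hw] := finite_riesz (herm E (val z)) (trivK cz) (trivVK cz) (@point_functional z).
  by exists w.
(* The factor [N ^ n] undoes the weight [a ^ n] of [lip]. *)
pose w : lsection E N := fun z => (N%:R ^+ n)%:C *: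
  xget 0 [set w | forall u : E (val z), point_functional u = herm E (val z) u w].
have wE psi : ip (f psi) x = lip psi w.
  rewrite lipE {1}(delta_section_sum psi) linear_sum dot_suml mulr_sumr; apply: eq_bigr => z _.
  rewrite /w dotZr mulrA; case: xgetP => [y _ /= hy|]; last by have [y hy] := pt z; move=> /(_ y).
  rewrite -hy /point_functional.
  have -> : Num.conj (N%:R ^+ n)%:C = (N%:R ^+ n)%:C :> R[i] by apply: eq_ReIm; rewrite ?ReJ ?ImJ /= ?oppr0.
  by rewrite -rmorphM /= exprVn mulVf ?mul1r // expf_neq0 // gt_eqF.
by rewrite (adjoint_unique wE) wE.
Qed.

End Riesz.

End LatticeSections.

(** * The combined kernel *)

Section RealInequalities.
Variable R : realType.
Implicit Types t M a x y z d al be : R.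

(** The letters are [x = |phi|], [z = |D_W phi|], [y = |v|], [d = |D v|], [al = |f phi|], and [be]
    for the norm of the adjoint of [f] at [v]; [K1] is the coercivity and [K2] the coupling
    constant. Multiples of [al + be] bound all of [x, y, z, d], so the last hypothesis bounds
    [al^2 + be^2] by half of itself. *)
Lemma unit_coupling_vanishes K1 K2 M a x y z d al be :
  0 <= K2 -> 0 <= M -> 0 < a -> K1 * a ^+ 2 <= 2^-1 -> 16 * (1 + M) * K2 * a <= 1 ->
  0 <= x -> 0 <= y -> 0 <= z -> 0 <= d -> 0 <= al -> 0 <= be -> 
  x <= 2 * al -> d <= al -> z <= M * x + be ->
  y ^+ 2 <= 2 * be ^+ 2 + K1 * a ^+ 2 * (d ^+ 2 + y ^+ 2) ->
  al ^+ 2 + be ^+ 2 <= a * K2 * (d + y) * (x + z) ->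
  [/\ x = 0, y = 0 & d = 0].
Proof.
move=> K20 M0 a0 s1 s2 x0 y0 z0 d0 al0 be0 xal dal zx hy hS.
have y2 : y <= 2 * be + al.
  rewrite -(ler_pXn2r (ltn0Sn 1)) ?nnegrE ?addr_ge0 ?mulr_ge0 //.
  have d2 : d ^+ 2 <= al ^+ 2 by rewrite ler_pXn2r ?nnegrE.
  have p : 0 <= d ^+ 2 + y ^+ 2 by rewrite addr_ge0 ?sqr_ge0.
  have := ler_wpM2r p s1; have := mulr_ge0 al0 be0; rewrite sqrrD exprMn; nra.
have aK : 0 <= a * K2 by rewrite mulr_ge0 // ltW.
have l1 : a * K2 * (d + y) * (x + z) <= a * K2 * (2 * (al + be)) * (2 * (1 + M) * (al + be)).
  have g1 : d + y <= 2 * (al + be) by lra.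
  have g2 : x + z <= 2 * (1 + M) * (al + be).
    have := ler_wpM2l M0 xal; have := mulr_ge0 M0 be0; lra.
  exact: ler_pM (mulr_ge0 aK (addr_ge0 d0 y0)) (addr_ge0 x0 z0) (ler_wpM2l aK g1) g2.
have l2 : a * K2 * (2 * (al + be)) * (2 * (1 + M) * (al + be)) <= 2^-1 * (al ^+ 2 + be ^+ 2).
  have e : a * K2 * (2 * (al + be)) * (2 * (1 + M) * (al + be)) =
    (16 * (1 + M) * K2 * a) * (4^-1 * (al + be) ^+ 2) by field.
  rewrite e; have p : 0 <= 4^-1 * (al + be) ^+ 2 by rewrite mulr_ge0 ?sqr_ge0.
  have := ler_wpM2r p s2; have := sqr_ge0 (al - be); lra.
have S0 : al ^+ 2 + be ^+ 2 <= 0 by lra.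
have al00 : al = 0.
  by apply/eqP; rewrite -sqrf_eq0; apply/eqP/le_anti; have := sqr_ge0 be; have := sqr_ge0 al; lra.
have be00 : be = 0.
  by apply/eqP; rewrite -sqrf_eq0; apply/eqP/le_anti; have := sqr_ge0 be; have := sqr_ge0 al; lra.
by split; apply/le_anti; move: xal y2 dal; rewrite al00 be00 => *; apply/andP; split; lra.
Qed.

(** Same letters, with [K3] from the ellipticity of the Wilson operator. The mass bounds [y] and [d]
    by multiples of [t * al], and [x] and [z] by multiples of [t * be], so the right hand side of
    the last hypothesis carries [t ^+ 2] and is at most half of the left one, uniformly down to
    [t = 0]. *)
Lemma boundary_coupling_vanishes K2 K3 M a t x y z d al be :
  0 <= K2 -> 0 <= K3 -> 0 < M -> 0 < a -> 0 <= t <= 1 ->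
  K3 * (M ^+ 2 + 1) * a <= M / 4 -> K3 * M * a <= 1 -> K2 * (1 + M^-1) * (3 + 2 * M^-1) * a <= 1 ->
  0 <= x -> 0 <= y -> 0 <= z -> 0 <= d -> 0 <= al -> 0 <= be -> 
  d <= t * al -> M * y <= t * al -> z <= M * x + t * be ->
  M * x ^+ 2 <= t * be * x + a / 2 * (K3 * (z ^+ 2 + x ^+ 2)) ->
  t * (al ^+ 2 + be ^+ 2) <= a * K2 * (d + y) * (x + z) ->
  [/\ x = 0, y = 0 & d = 0].
Proof.
move=> K20 K30 M0 a0 /andP[t0 t1] s1 s2 s3 x0 y0 z0 d0 al0 be0 dt yt zx hx hS.
have M00 : 0 <= M by exact: ltW.
set B := t * be in zx hx *; have B0 : 0 <= B by rewrite mulr_ge0.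
have iM : 0 < M^-1 by rewrite invr_gt0.
have aK3 : 0 <= a * K3 by rewrite mulr_ge0 // ltW.
(* The gap on the lattice side: [s1] and [s2] absorb the terms with [K3] into the mass term and into
   [B]. *)
have xB : M * x <= 2 * B.
  have z2 : z ^+ 2 <= 2 * (M ^+ 2 * x ^+ 2) + 2 * B ^+ 2.
    have : z ^+ 2 <= (M * x + B) ^+ 2 by rewrite ler_pXn2r ?nnegrE ?addr_ge0 ?mulr_ge0.
    have := sqr_ge0 (M * x - B); rewrite !sqrrD exprMn; lra.
  rewrite -(ler_pXn2r (ltn0Sn 1)) ?nnegrE ?mulr_ge0 //.
  have l1 := ler_wpM2l aK3 z2.
  have l2 := ler_wpM2r (sqr_ge0 x) s1.
  have l3 : M * x ^+ 2 <= B * x + M / 4 * x ^+ 2 + a * K3 * B ^+ 2.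
    have := mulr_ge0 aK3 (sqr_ge0 x); lra.
  have l4 := ler_wpM2l M00 l3.
  have l5 := ler_wpM2r (sqr_ge0 B) s2.
  have := sqr_ge0 (M * x - 2 * B); lra.
have xB' : x <= 2 * M^-1 * B.
  by rewrite -(ler_pM2l M0) (le_trans xB) //; apply: eq_le_ring; field; rewrite gt_eqF.
have yal : y <= M^-1 * (t * al) by rewrite ler_pdivlMl.
have tal0 : 0 <= t * al by rewrite mulr_ge0.
have aK : 0 <= a * K2 by rewrite mulr_ge0 // ltW.
have l1 : a * K2 * (d + y) * (x + z) <= a * K2 * ((1 + M^-1) * (t * al)) * ((3 + 2 * M^-1) * B).
  have g1 : d + y <= (1 + M^-1) * (t * al) by lra.
  have g2 : x + z <= (3 + 2 * M^-1) * B by lra.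
  exact: ler_pM (mulr_ge0 aK (addr_ge0 d0 y0)) (addr_ge0 x0 z0) (ler_wpM2l aK g1) g2.
have l2 : a * K2 * ((1 + M^-1) * (t * al)) * ((3 + 2 * M^-1) * B) <= 2^-1 * (t * (al ^+ 2 + be ^+ 2)).
  have e : a * K2 * ((1 + M^-1) * (t * al)) * ((3 + 2 * M^-1) * B) =
    (K2 * (1 + M^-1) * (3 + 2 * M^-1) * a) * (t * (t * (al * be))) by rewrite /B; ring.
  have p : 0 <= al * be by rewrite mulr_ge0.
  have tp : 0 <= t * (t * (al * be)) by rewrite !mulr_ge0.
  rewrite e (le_trans (ler_wpM2r tp s3)) // mul1r.
  have k1 : t * (al * be) <= 2^-1 * (al ^+ 2 + be ^+ 2).
    by have := ler_wpM2r p t1; have := sqr_ge0 (al - be); lra.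
  by have := ler_wpM2l t0 k1; lra.
have S0 : t * (al ^+ 2 + be ^+ 2) <= 0 by lra.
(* Since [t] may be 0, only the products [t * al] and [t * be] are shown to vanish; the bounds on
   [x], [y] and [d] contain nothing else. *)
have tz w : 0 <= w -> w ^+ 2 <= al ^+ 2 + be ^+ 2 -> t * w = 0.
  move=> w0 wS; apply/eqP; rewrite -sqrf_eq0; apply/eqP/le_anti; rewrite sqr_ge0 andbT.
  have q1 := ler_wpM2l t0 wS; have q2 := mulr_ge0 t0 (sqr_ge0 w).
  have := ler_wpM2r q2 t1; rewrite exprMn expr2; nra.
have ta : t * al = 0 by apply: tz => //; rewrite lerDl sqr_ge0.
have tb : B = 0 by apply: tz => //; rewrite lerDr sqr_ge0.
by split; apply/le_anti; move: dt yal xB'; rewrite ta tb => *; apply/andP; split; lra.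
Qed.

End RealInequalities.

(** * Consequences of the kernel equations *)

Section CombinedKernel.
Variables (R : realType) (n r : nat) (E : clifford_bundle R n r) (a0 : R).
Variables (U : link_variables E a0) (h : R) (hS : transport_scale U h).
Hypothesis a0_gt0 : 0 < a0.
Variables (m0 : R) (H : L2_completion E) (H1 : L21_completion U m0).
Variable (ip : {dot H for @Num.conj R[i]}).
Hypothesis ip_norm : forall u : H, ip u u = `|u| ^+ 2.
Variable gH : {linear H -> H}.
Hypothesis gH_ext : is_extension (@gam_sec R n r E) (gH : H -> H).
Variable D : {linear H1 -> H}.
Hypothesis D_ext : is_extension (dirac_cont U) (D : H1 -> H).
Variable J : {linear H1 -> H}.
Hypothesis J_ext : is_extension id (J : H1 -> H).
Variables (N q : nat) (N0 : (0 < N)%N) (q0 : (0 < q)%N).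
Hypotheses (Nh : 2 * N%:R^-1 < h) (N4 : N%:R^-1 <= 4^-1 :> R).
Hypothesis q_large : 3 * n%:R / q%:R <= N%:R^-1 ^+ 2 :> R.
Implicit Types u : section E.

Local Notation a := (N%:R^-1 : R).
Local Notation rstN := (@rst R n r E N).
Local Notation BH := (re_dot ip).
Local Notation NH := (nb BH).
Local Notation b := (bK (E := E) N).
Local Notation Nb := (nb b).
Let PH : psd BH := re_dot_psd ip.
Let Pb : psd b := bK_psd N.
Let N1 : 0 < N%:R :> R. Proof. by rewrite ltr0n. Qed.
Let a_gt0 : 0 < a. Proof. by rewrite invr_gt0. Qed.

Definition interp_lat (phi : lsection E N) : H := interp U H N q (ext phi).

Lemma interp_lat_is_linear : linear interp_lat.
Proof.
move=> k phi psi; rewrite /interp_lat linearP.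
by rewrite (interpD hS H N0 q0 Nh) (interpZ hS H N0 q0 Nh).
Qed.

HB.instance Definition _ :=
  @GRing.isLinear.Build R[i] (lsection E N) H *:%R interp_lat interp_lat_is_linear.

Definition interpolation : {linear lsection E N -> H} := interp_lat.

Lemma sec_ext_rst u : sec U N q (ext (rstN u)) = sec U N q u.
Proof.
apply: functional_extensionality_dep => x; rewrite /sec; congr (_ *: _); rewrite /Psh.
suff -> : ext (rstN u) (x + tpt (- (a *: cellpos N x))) = u (x + tpt (- (a *: cellpos N x))) by [].
have xN : x + tpt (- (a *: cellpos N x)) \in @lattice_pts R n N.
  have [v ->] := tpt_surj x; rewrite cellpos_frac -tptD; apply: (lattice_ptP N0).
  rewrite scalerDr scalerN scalerA mulfV ?gt_eqF // scale1r; exact: int_vector_frac.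
by rewrite /ext; case: pselect.
Qed.

Definition coadjoint (x : H) : section E := ext (adjoint (@lip R n r E N) ip interp_lat x).

Lemma coadjointE x u : b (coadjoint x) u = BH x (interp U H N q u).
Proof.
rewrite (psdC Pb) (bK_rst N0 (u' := ext (rstN u)) (v' := coadjoint x)) ?rst_ext //.
rewrite -(Re_lip N0) -(lattice_riesz N0 ip interpolation x) -[interpolation _]/(interp_lat _).
by rewrite /interp_lat /interp sec_ext_rst -/(re_dot _ _ _) (psdC PH).
Qed.

(** The part with central differences is antisymmetric and drops out; the Wilson term is [a / 2]
    times a lattice Laplacian. *)
Lemma wilson_dissipation u :
  b (wilsonK U N u) u = a / 2 * \sum_(i < n) Nb (nablaK U N i u) ^+ 2.
Proof.
rewrite /wilsonK (psdBl Pb) !(psd_suml Pb) mulr_sumr.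
rewrite big1 => [|i _]; last first.
  have e : cl_sec i (2^-1%:C *: (nablaK U N i u - nablaK' U N i u)) =
    2^-1%:C *: (cl_sec i (nablaK U N i u) - cl_sec i (nablaK' U N i u)).
    by rewrite linearZ linearB.
  have e1 : b (cl_sec i (nablaK U N i u)) u = b (cl_sec i u) (nablaK' U N i u).
    by rewrite (nablaK_cl hS N0 Nh) (nablaK_adj hS N0 Nh).
  have e2 : b (cl_sec i (nablaK' U N i u)) u = b (cl_sec i u) (nablaK' U N i u).
    by rewrite cl_sec_adj (psdC Pb).
  by rewrite e (psdZl Pb) (psdBl Pb) e1 e2 subrr mulr0.
rewrite sub0r -sumrN; apply: eq_bigr => i _.
rewrite (psdZl Pb) (nablaK_sum_laplace hS N0 Nh) (psdNl Pb) (psdZl Pb) (psdC Pb).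
rewrite -(nablaK_adj hS N0 Nh) (sqr_nb Pb).
by rewrite mulrN opprK mulrA [2^-1 * _]mulrC.
Qed.

Variables (m t : R) (phi : lsection E N) (v : H1).
Hypothesis t0 : 0 <= t.
Hypothesis ker : Hcom U ip gH D J interpolation m t (phi, v) = 0.

Let Phi := ext phi.
Let G := coadjoint (J v).
Let f := interp U H N q.

Let ker_lat : rstN (gam_sec (wilsonK U N Phi + m%:C *: Phi)) = rstN (t%:C *: G).
Proof.
have := congr1 fst ker; rewrite /Hcom /= => /eqP; rewrite addrC subr_eq0 => /eqP e.
rewrite -[RHS]/(t%:C *: rstN G) /G /coadjoint rst_ext e (wilson_diracE hS N0 Nh).
by rewrite -{2}(rst_ext phi).
Qed.

Let ker_cont : gH (D v + m%:C *: J v) = - (t%:C *: f Phi).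
Proof.
have := congr1 snd ker; rewrite /Hcom /= => /eqP; rewrite addrC addr_eq0 => /eqP.
by [].
Qed.

Let ker_b u : b (gam_sec (wilsonK U N Phi + m%:C *: Phi)) u = t * b G u.
Proof. by rewrite (bK_rst N0 ker_lat (erefl (rstN u))) (psdZl Pb). Qed.

(** The lower equation in norm: [gamma] is isometric and [D v] is orthogonal to [J v], so the mass
    enters as in Pythagoras. *)
Lemma kernel_energy : NH (D v) ^+ 2 + m ^+ 2 * NH (J v) ^+ 2 = t ^+ 2 * NH (f Phi) ^+ 2.
Proof.
have := congr1 (fun x => NH x ^+ 2) ker_cont.
rewrite (gH_norm hS a0_gt0 ip_norm gH_ext) (nbN PH) (nbZ PH) exprMn real_normK ?num_real // => <-.
have o := dirac_orthogonal hS a0_gt0 ip_norm D_ext J_ext v.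
rewrite !(sqr_nb PH) !(psdDl PH, psdDr PH) !(psdZl PH, psdZr PH) (psdC PH (J v)) o.
by ring.
Qed.

Lemma kernel_wilson : Nb (wilsonK U N Phi) <= `|m| * Nb Phi + t * Nb G.
Proof.
have e : Nb (wilsonK U N Phi + m%:C *: Phi) = t * Nb G.
  rewrite -(nbK_gam N (_ + _)) /nb (bK_rst N0 ker_lat ker_lat) -/(nb _ _) (nbZ Pb) ger0_norm //.
rewrite -(nbZ Pb) -e -{1}(addrK (m%:C *: Phi) (wilsonK U N Phi)) addrC.
by rewrite (le_trans (nbD Pb _ _)) // (nbN Pb).
Qed.

Lemma kernel_coupling : t * (NH (f Phi) ^+ 2 + Nb G ^+ 2) <=
  a * coupling_const n h * (NH (D v) + NH (J v)) * (Nb Phi + Nb (wilsonK U N Phi)).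
Proof.
have := energy_coupling hS a0_gt0 ip_norm gH_ext D_ext J_ext N0 q0 Nh N4 q_large v Phi.
apply: le_trans; rewrite -/f.
have e1 : t * NH (f Phi) ^+ 2 = - BH (gH (D v)) (f Phi) - m * BH (J v) (f (gam_sec Phi)).
  have g2 : gH (f Phi) = f (gam_sec Phi).
    rewrite /f /interp gH_ext.2; last exact: (smooth_sec hS N0 q0 Nh).
    by rewrite (sec_gam hS q N0 Nh).
  have := congr1 (fun x => BH x (f Phi)) ker_cont.
  rewrite linearD linearZ /= (psdDl PH) (psdZl PH) (psdNl PH) (psdZl PH) (sqr_nb PH).
  rewrite (gH_adj hS a0_gt0 ip_norm gH_ext (J v)) g2; lra.
have e2 : t * Nb G ^+ 2 = BH (J v) (f (gam_sec (wilsonK U N Phi))) + m * BH (J v) (f (gam_sec Phi)).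
  rewrite (sqr_nb Pb) -ker_b linearD linearZ /= (psdDl Pb) (psdZl Pb).
  by rewrite !(psdC Pb _ G) !coadjointE.
rewrite mulrDr e1 e2.
set A := BH (gH _) _; set B := BH _ (f (gam_sec (wilsonK _ _ _))).
by have := ler_norm (- (A - B)); rewrite normrN; lra.
Qed.

(** The upper equation is paired with [gamma phi]. For [m = M] the dissipation of the Wilson term
    has the sign of the mass and may be dropped; for [m = - M] it opposes the mass, but ellipticity
    bounds it by [a] times squared graph norms. *)
Lemma kernel_gap M : m = - M \/ m = M -> 0 <= M ->
  M * Nb Phi ^+ 2 <= t * Nb G * Nb Phi +
    a / 2 * ((1 + 8 * n%:R ^+ 2 * h^-1) * (Nb (wilsonK U N Phi) ^+ 2 + Nb Phi ^+ 2)).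
Proof.
move=> mM M0.
have e : a / 2 * (\sum_(i < n) Nb (nablaK U N i Phi) ^+ 2) + m * Nb Phi ^+ 2 = t * b G (gam_sec Phi).
  have e0 u : b (gam_sec u) (gam_sec Phi) = b u Phi by rewrite gam_sec_adj gam_secK.
  by rewrite -ker_b e0 (psdDl Pb) wilson_dissipation (psdZl Pb) (sqr_nb Pb).
have l : `|t * b G (gam_sec Phi)| <= t * Nb G * Nb Phi.
  rewrite normrM ger0_norm // -mulrA ler_wpM2l // (le_trans (psd_abs Pb _ _)) //.
  by rewrite nbK_gam.
have el := wilsonK_elliptic hS N0 Nh Phi.
set S := \sum_(i < n) _ in e el.
have S0 : 0 <= S by apply: sumr_ge0 => i _; exact: sqr_ge0.
set k := 8 * n%:R ^+ 2 * h^-1 in el *.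
have k0 : 0 <= k by rewrite !mulr_ge0 ?sqr_ge0 ?invr_ge0 ?(ltW (scale_gt0 hS)).
set z := Nb (wilsonK U N Phi) in el *; set x := Nb Phi in e el l *.
have a2 : 0 <= a / 2 by rewrite divr_ge0 // ltW.
have l2 : a / 2 * S <= a / 2 * ((1 + k) * (z ^+ 2 + x ^+ 2)).
  rewrite ler_wpM2l // (le_trans el) //.
  have := mulr_ge0 k0 (sqr_ge0 z); have := sqr_ge0 x; lra.
move: l; rewrite -e ler_norml => /andP[l3 l4].
have aS := mulr_ge0 a2 S0.
by case: mM => mE; rewrite mE in l3 l4; lra.
Qed.

Lemma kernel_eq0 : Nb Phi = 0 -> NH (J v) = 0 -> NH (D v) = 0 -> (phi, v) = 0.
Proof.
move=> /(Nb_eq0 N0); rewrite rst_ext => -> /nb_re_dot_eq0 Jv /nb_re_dot_eq0 Dv.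
by rewrite (energy_norm_eq0 hS a0_gt0 ip_norm D_ext J_ext Jv Dv).
Qed.

Let f_ge : Nb Phi <= 2 * NH (f Phi) := interp_ge hS a0_gt0 ip_norm N0 q0 Nh N4 q_large Phi.

Let gap_const_ge0 : 0 <= 8 * n%:R ^+ 2 * h^-1.
Proof. by rewrite !mulr_ge0 ?sqr_ge0 ?invr_ge0 ?(ltW (scale_gt0 hS)). Qed.

Lemma coupling_const_ge0 : 0 <= coupling_const n h.
Proof.
have ih : 0 <= h^-1 by rewrite invr_ge0 ltW // (scale_gt0 hS).
by rewrite /coupling_const mulr_ge0 ?sqr_ge0 // mulr_ge0 //; lra.
Qed.

Let dirac_le : NH (D v) <= t * NH (f Phi).
Proof.
rewrite -(ler_pXn2r (ltn0Sn 1)) ?nnegrE ?mulr_ge0 ?nb_ge0 // exprMn -kernel_energy lerDl.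
by rewrite mulr_ge0 ?sqr_ge0.
Qed.

Lemma unit_kernel M : t = 1 -> 0 <= M -> `|m| <= M ->
  coercive_const n h * a ^+ 2 <= 2^-1 -> 16 * (1 + M) * coupling_const n h * a <= 1 -> (phi, v) = 0.
Proof.
move=> t1 M0 mM s1 s2.
have hd := dirac_le; have hz := kernel_wilson; have hc := kernel_coupling.
have hy := energy_coercive hS a0_gt0 ip_norm D_ext J_ext N0 q0 Nh q_large v coadjointE.
rewrite t1 !mul1r -/G in hd hz hc hy.
have hz' : Nb (wilsonK U N Phi) <= M * Nb Phi + Nb G.
  by rewrite (le_trans hz) // lerD2r ler_wpM2r ?nb_ge0.
have [x0 y0 d0] := unit_coupling_vanishes coupling_const_ge0 M0 a_gt0 s1 s2
  (nb_ge0 b Phi) (nb_ge0 BH (J v)) (nb_ge0 b (wilsonK U N Phi)) (nb_ge0 BH (D v))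
  (nb_ge0 BH (f Phi)) (nb_ge0 b G) f_ge hd hz' hy hc.
exact: kernel_eq0.
Qed.

Lemma boundary_kernel M (K3 := 1 + 8 * n%:R ^+ 2 * h^-1) : t <= 1 -> 0 < M -> m = - M \/ m = M ->
  K3 * (M ^+ 2 + 1) * a <= M / 4 -> K3 * M * a <= 1 ->
  coupling_const n h * (1 + M^-1) * (3 + 2 * M^-1) * a <= 1 -> (phi, v) = 0.
Proof.
move=> t1 M0 mM s1 s2 s3; have M00 := ltW M0.
have nm : `|m| = M by case: mM => ->; rewrite ?normrN ger0_norm.
have m2 : m ^+ 2 = M ^+ 2 by rewrite -nm real_normK ?num_real.
have hz := kernel_wilson; have hg := kernel_gap mM M00; rewrite nm in hz.
have hy : M * NH (J v) <= t * NH (f Phi).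
  rewrite -(ler_pXn2r (ltn0Sn 1)) ?nnegrE ?mulr_ge0 ?nb_ge0 // !exprMn -kernel_energy m2.
  by rewrite lerDr sqr_ge0.
have K30 : 0 <= K3 by rewrite addr_ge0.
have t01 : 0 <= t <= 1 by rewrite t0.
have [x0 y0 d0] := boundary_coupling_vanishes coupling_const_ge0 K30 M0 a_gt0 t01 s1 s2 s3
  (nb_ge0 b Phi) (nb_ge0 BH (J v)) (nb_ge0 b (wilsonK U N Phi)) (nb_ge0 BH (D v))
  (nb_ge0 BH (f Phi)) (nb_ge0 b G) dirac_le hy hz hg kernel_coupling.
exact: kernel_eq0.
Qed.

End CombinedKernel.

Lemma small_mul_le (R : realType) (K c : R) : 0 < c -> small (fun e => K * e <= c).
Proof.
move=> c0; have K0 : 0 < `|K| + 1 by rewrite ltr_wpDl.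
apply: small_imp (small_lt (divr_gt0 c0 K0)) => e e0; rewrite ltr_pdivlMr // => /ltW.
apply: le_trans; rewrite mulrC ler_wpM2l ?(ltW e0) // (le_trans (ler_norm K)) //.
by rewrite lerDl.
Qed.

Theorem theorem3p6 (R : realType) (n r : nat) (n_gt0 : (0 < n)%N)
    (E : clifford_bundle R n r)
    (a0 : R) (a0_gt0 : 0 < a0) (a0_lt : a0 < 2^-1)
    (U : link_variables E a0)
    (m0 : R) (m0_neq0 : m0 != 0)
    (H : L2_completion E) (H1 : L21_completion U m0)
    (ip : {dot H for @Num.conj R[i]})
    (ip_norm : forall u : H, ip u u = `|u| ^+ 2)
    (gH : {linear H -> H})
    (gH_ext : is_extension (@gam_sec R n r E) (gH : H -> H))
    (D : {linear H1 -> H})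
    (D_ext : is_extension (dirac_cont U) (D : H1 -> H))
    (J : {linear H1 -> H})
    (J_ext : is_extension id (J : H1 -> H))
    (M : R) (M_gt0 : 0 < M) :
  exists2 a1 : R, 0 < a1 < a0 &
  forall N : nat, (0 < N)%N -> N%:R^-1 <= a1 ->
  exists f : {linear lsection E N -> H},
    (forall m : R, - M <= m <= M ->
       trivial_kernel (Hcom U ip gH D J f m 1)) /\
    (forall m : R, m = - M \/ m = M -> forall t : R, 0 <= t <= 1 ->
       trivial_kernel (Hcom U ip gH D J f m t)).
Proof.
have [h hS] := transport_scale_exists U a0_gt0; have h0 := scale_gt0 hS.
pose K1 : R := coercive_const n h; pose K2 : R := coupling_const n h.
pose K3 : R := 1 + 8 * n%:R ^+ 2 * h^-1.
have h2 : 0 < h / 2 by rewrite divr_gt0.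
have M4 : 0 < M / 4 by rewrite divr_gt0.
have i1 : 0 < 1 :> R by [].
have i2 : 0 < 2^-1 :> R by rewrite invr_gt0.
have i4 : 0 < 4^-1 :> R by rewrite invr_gt0.
(* All smallness conditions are collected here; they involve [M] and the geometry, so [a1] serves
   every [m] and [t]. *)
have [a1 a10 ha] := smallI (smallI (small_lt a0_gt0) (small_lt h2))
  (smallI (smallI (small_lt i4) (small_mul_le K1 i2))
  (smallI (smallI (small_mul_le (16 * (1 + M) * K2) i1) (small_mul_le (K3 * (M ^+ 2 + 1)) M4))
  (smallI (small_mul_le (K3 * M) i1) (small_mul_le (K2 * (1 + M^-1) * (3 + 2 * M^-1)) i1)))).
exists a1; first by rewrite a10; have [[]] := ha a1 a10 (lexx _).
move=> N N0 Na; have a_gt0 : 0 < N%:R^-1 :> R by rewrite invr_gt0 ltr0n.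
have [[_ ah] [[a4 s1] [[s2 s3] [s4 s5]]]] := ha _ a_gt0 Na.
have Nh : 2 * N%:R^-1 < h by lra.
have N4 : N%:R^-1 <= 4^-1 :> R by exact: ltW.
(* With [q >= 3 n N^2] the mean square defect of the bump is at most [a ^+ 2]; the successor makes
   [q] visibly positive. *)
pose q := (3 * n * N ^ 2).+1; have q0 : (0 < q)%N by [].
have q_large : 3 * n%:R / q%:R <= N%:R^-1 ^+ 2 :> R.
  rewrite ler_pdivrMr ?ltr0n // exprVn ler_pdivlMl ?exprn_gt0 ?ltr0n //.
  by rewrite -natrX -!natrM ler_nat mulnC leqW.
have K10 : 0 <= K1.
  rewrite /K1 /coercive_const addr_ge0 // mulr_ge0 ?exprn_ge0 // !addr_ge0 //.
  by rewrite !mulr_ge0 ?sqr_ge0 // invr_ge0 ltW.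
have s1' : K1 * N%:R^-1 ^+ 2 <= 2^-1.
  by rewrite (le_trans _ s1) // ler_wpM2l // expr2 ler_piMr ?(ltW a_gt0) //; lra.
exists (interpolation hS H N0 q0 Nh); split.
  move=> m mM [phi v] ker; have mM' : `|m| <= M by rewrite ler_norml.
  have e := unit_kernel a0_gt0 ip_norm gH_ext D_ext J_ext N4 q_large ler01 ker erefl (ltW M_gt0) mM' s1' s2.
  exact: e.
move=> m mM t /andP[t0 t1] [phi v] ker.
exact: (boundary_kernel a0_gt0 ip_norm gH_ext D_ext J_ext N4 q_large t0 ker t1 M_gt0 mM).
Qed.
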